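(* Let $\sigma\equiv\sigma_0>0$ be constant on $D$. Let $\gamma_1\ge1$, $\gamma_2\ge1$, $Q_1^{1/2}\in HS(L^2(D),H^{\gamma_1}(D))$, $Q_2^{1/2}\in HS(L^2(D),H_0^{\gamma_2}(D))$, and $u_0\in L^2(\Omega,\mathbb{H})$. Then for the discontinuous Galerkin full discretization described in the context: (i) For sufficiently small $\Delta t>0$, the numerical solution $\{u_h^n\}_{n\in\mathbb{N}}$ has a unique invariant measure $\pi^{\Delta t,h}\in\mathcal P_2(\mathbb{H})$. Thus $\{u_h^n\}_{n\in\mathbb{N}}$ is ergodic. Moreover, $\{u_h^n\}_{n\in\mathbb{N}}$ is exponentially mixing. (ii) For any distribution $\pi\in\mathcal P_2(\mathbb{H})$ and all $n\in\mathbb{N}$, $$\mathcal W_2\big((P_h^n)^*\pi,\pi^{\Delta t,h}\big)\le e^{-\sigma_0t_n}\,\mathcal W_2(\pi,\pi^{\Delta t,h}).$$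
   Context: $D=(x_L,x_R)\times(y_L,y_R)\times(z_L,z_R)\subset\mathbb{R}^3$ is a cuboid; $\mathbb{H}:=L^2(D)^3\times L^2(D)^3$; $H^k(D)=W^{k,2}(D)$; $\lambda_1\in\mathbb{R}$, $\boldsymbol\lambda_2\in\mathbb{R}^3$, $\widetilde{\boldsymbol\lambda}_2=(\boldsymbol\lambda_2^\top,\boldsymbol\lambda_2^\top)^\top\in\mathbb{R}^6$; $J(\mathbf E,\mathbf H)=(-\mathbf H,\mathbf E)$. Noise: $W_1,W_2$ are independent $Q_1$- resp. $Q_2$-Wiener processes on a filtered probability space $(\Omega,\mathcal F,\{\mathcal F_t\}_{t\ge0},\mathbb P)$, $W_i(t)=\sum_{k\ge1}\sqrt{\eta_k^{(i)}}q_k\beta_k^{(i)}(t)$, where $\{q_k\}$ is an orthonormal basis of $L^2(D)$, $Q_iq_k=\eta_k^{(i)}q_k$ with $\eta_k^{(i)}\ge0$, and $\beta_k^{(i)}$ are independent Brownian motions. $HS(U,H)$ denotes the Hilbert–Schmidt operators from $U$ to $H$. With $t_n=n\Delta t$: $\Delta W_2^n=W_2(t_{n+1})-W_2(t_n)$, and $\Delta\overline W_1^n=\sqrt{\Delta t}\sum_{i\ge1}\zeta_i^{(1),n}Q_1^{1/2}q_i$ with $\zeta_i^{(1),n}=\max(-A_{\Delta t},\min(\xi_i^{(1),n},A_{\Delta t}))$, $\xi_i^{(1),n}=(\beta_i^{(1)}(t_{n+1})-\beta_i^{(1)}(t_n))/\sqrt{\Delta t}$, $A_{\Delta t}=\sqrt{2b|\ln\Delta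 t|}$, $b\ge4$ fixed. Mesh and dG space: $\mathcal T_h=\{K\}$ is a simplicial, shape- and contact-regular mesh of $D$, $h$ the maximal element diameter. $\mathbb{H}_h:=\{v_h\in L^2(D):v_h|_K\in\mathbb{P}_1(K)\ \forall K\}^6$ (piecewise polynomials of degree at most $1$), and $\pi_h:\mathbb{H}\to\mathbb{H}_h$ is the $L^2$-orthogonal projection. $\mathcal G_h^{\rm int},\mathcal G_h^{\rm ext}$ are the sets of interior/exterior faces. Each interior face $F$ has a fixed unit normal $\mathbf n_F$ pointing from $K$ to $K_F$, and $[[v_h]]_F:=(v_{K_F})|_F-(v_K)|_F$ with $v_K=v|_K$; on exterior faces $\mathbf n_F$ is the outward normal. Discrete Maxwell operator $M_h:\mathbb{H}_h\to\mathbb{H}_h$: for $u_h=(\mathbf E_h,\mathbf H_h)$, $v_h=(\psi_h,\phi_h)\in\mathbb{H}_h$, $$\begin{aligned}\langle M_hu_h,v_h\rangle_{\mathbb{H}}:=&\sum_{K}\big(\langle\nabla\times\mathbf H_h,\psi_h\rangle_{L^2(K)^3}-\langle\nabla\times\mathbf E_h,\phi_h\rangle_{L^2(K)^3}\big)\\&+\tfrac12\sum_{F\in\mathcal G_h^{\rm int}}\big(\langle\mathbf n_F\times[[\mathbf H_h]]_F,\psi_K+\psi_{K_F}\rangle_{L^2(F)^3}-\langle\mathbf n_F\times[[\mathbf E_h]]_F,\phi_K+\phi_{K_F}\rangle_{L^2(F)^3}\\&\qquad-\langle\mathbf n_F\times[[\mathbf E_h]]_F,\mathbf n_F\times[[\psi_h]]_F\rangle_{L^2(F)^3}-\langle\mathbf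 n_F\times[[\mathbf H_h]]_F,\mathbf n_F\times[[\phi_h]]_F\rangle_{L^2(F)^3}\big)\\&+\sum_{F\in\mathcal G_h^{\rm ext}}\big(\langle\mathbf n_F\times\mathbf E_h,\phi_h\rangle_{L^2(F)^3}-\langle\mathbf n_F\times\mathbf E_h,\mathbf n_F\times\psi_h\rangle_{L^2(F)^3}\big).\end{aligned}$$ dG full discretization: $u_h^0=\pi_hu_0$ and, for $n\in\mathbb{N}$, $$u_h^{n+1}-e^{-\sigma_0\Delta t}u_h^n=\tfrac{\Delta t}{2}\big(M_hu_h^{n+1}+e^{-\sigma_0\Delta t}M_hu_h^n\big)+\tfrac{\lambda_1}{2}\pi_h\big[J(u_h^{n+1}+e^{-\sigma_0\Delta t}u_h^n)\Delta\overline W_1^n\big]+\pi_h(\widetilde{\boldsymbol\lambda}_2\Delta W_2^n).$$ $P_h^n\varphi(x):=\mathbb{E}[\varphi(u_h^n)]$ for the scheme started from $u_h^0=\pi_hx$, $x\in\mathbb{H}$, is the Markov transition semigroup and $(P_h^n)^*$ its transpose acting on probability measures. $\mathcal P_2(\mathbb{H})$ is the set of Borel probability measures on $\mathbb{H}$ with finite second moment; $\mathcal W_2$ is the $L^2$-Wasserstein distance for the norm of $\mathbb{H}$; $\pi(\varphi):=\int\varphi\,d\pi$. Invariance: $\pi(P_h^n\varphi)=\pi(\varphi)$ for all bounded Borel $\varphi$ and $n\in\mathbb{N}$. Ergodicity: $\lim_{N\to\infty}\frac1N\sum_{n=0}^{N-1}P_h^n\varphi=\pi(\varphi)$ in $L^2(\mathbb{H},\pi)$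 for all $\varphi\in L^2(\mathbb{H},\pi)$. Exponential mixing: there exist $\rho>0$ and a positive function $C(\cdot)$ such that $|P_h^n\varphi(x)-\pi(\varphi)|\le C(x)L_\varphi e^{-\rho t_n}$ for every bounded Lipschitz $\varphi$ with Lipschitz constant $L_\varphi$, all $n$ and all $x$. *)

(* Defs.v *)
From HB Require Import structures.
From mathcomp Require Import all_boot all_order all_algebra.
From mathcomp Require Import all_classical all_reals all_analysis.
Set Implicit Arguments. Unset Strict Implicit. Unset Printing Implicit Defensive.
Import Order.TTheory GRing.Theory Num.Theory numFieldNormedType.Exports.
Local Open Scope classical_set_scope.
Local Open Scope ring_scope.

(* The library's [LspaceType] carries no vector space structure, so L^2 is built
   here as the quotient of the square-integrable functions [LfunType] by
   almost everywhere equality. *)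
Section L2_space.
Context {d : measure_display} {T : measurableType d} {R : realType}.
Variable mu : {measure set T -> \bar R}.

Definition L2fun := LfunType mu (lee1n 2 : (1 <= 2%:R%:E :> \bar R)%E).

HB.instance Definition _ := GRing.Lmodule.on L2fun.

Definition L2_rel (f g : L2fun) : bool :=
  `[< (f : T -> R) = (g : T -> R) %[ae mu] >].

Lemma L2_relP (f g : L2fun) :
  reflect ((f : T -> R) = (g : T -> R) %[ae mu]) (L2_rel f g).
Proof. exact: asboolP. Qed.

Lemma L2_rel_refl : reflexive L2_rel.
Proof. by move=> f; apply/L2_relP/nearW. Qed.

Lemma L2_rel_sym : symmetric L2_rel.
Proof. by move=> f g; apply/L2_relP/L2_relP; exact: ae_eq_sym. Qed.

Lemma L2_rel_trans : transitive L2_rel.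
Proof.
by move=> f g h /L2_relP gf /L2_relP fh; apply/L2_relP/(ae_eq_trans gf fh).
Qed.

Canonical L2_equiv := EquivRel L2_rel L2_rel_refl L2_rel_sym L2_rel_trans.

Definition L2 : Type := {eq_quot L2_rel}%qT.
HB.instance Definition _ := Choice.on L2.
HB.instance Definition _ := EqQuotient.on L2.

Definition L2_class (f : L2fun) : L2 := (\pi_L2 f)%qT.
Definition L2_repr (f : L2) : L2fun := repr f.

Lemma L2_reprK : cancel L2_repr L2_class.
Proof. exact: reprK. Qed.

Lemma L2_classP (f g : L2fun) : L2_class f = L2_class g <->
  (f : T -> R) = (g : T -> R) %[ae mu].
Proof. by split=> [/eqmodP/L2_relP|/L2_relP/eqmodP]. Qed.

Lemma L2_classK (f : L2fun) :
  (L2_repr (L2_class f) : T -> R) = (f : T -> R) %[ae mu].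
Proof. by apply/L2_classP; rewrite L2_reprK. Qed.

Definition L2_add (f g : L2) : L2 := L2_class (L2_repr f + L2_repr g).
Definition L2_opp (f : L2) : L2 := L2_class (- L2_repr f).
Definition L2_scale (a : R) (f : L2) : L2 := L2_class (a *: L2_repr f).

Lemma L2_addE (f g : L2fun) : L2_add (L2_class f) (L2_class g) = L2_class (f + g).
Proof.
apply/L2_classP; apply: filterS2 (L2_classK f) (L2_classK g) => x /(_ I) fx /(_ I) gx _.
by rewrite -[LHS]/(L2_repr (L2_class f) x + L2_repr (L2_class g) x) fx gx.
Qed.

Lemma L2_oppE (f : L2fun) : L2_opp (L2_class f) = L2_class (- f).
Proof.
apply/L2_classP; apply: filterS (L2_classK f) => x /(_ I) fx _.
by rewrite -[LHS]/(- L2_repr (L2_class f) x) fx.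
Qed.

Lemma L2_scaleE a (f : L2fun) : L2_scale a (L2_class f) = L2_class (a *: f).
Proof.
apply/L2_classP; apply: filterS (L2_classK f) => x /(_ I) fx _.
by rewrite -[LHS]/(a * L2_repr (L2_class f) x) fx.
Qed.

Lemma L2_ind (Q : L2 -> Prop) : (forall f, Q (L2_class f)) -> forall f, Q f.
Proof. by move=> Qc f; rewrite -[f]L2_reprK. Qed.

Lemma L2_addA : associative L2_add.
Proof.
by elim/L2_ind=> f; elim/L2_ind=> g; elim/L2_ind=> h; rewrite !L2_addE addrA.
Qed.

Lemma L2_addC : commutative L2_add.
Proof. by elim/L2_ind=> f; elim/L2_ind=> g; rewrite !L2_addE addrC. Qed.

Lemma L2_add0 : left_id (L2_class 0) L2_add.
Proof. by elim/L2_ind=> f; rewrite L2_addE add0r. Qed.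

Lemma L2_addN : left_inverse (L2_class 0) L2_opp L2_add.
Proof. by elim/L2_ind=> f; rewrite L2_oppE L2_addE addNr. Qed.

HB.instance Definition _ :=
  GRing.isZmodule.Build L2 L2_addA L2_addC L2_add0 L2_addN.

Lemma L2_scaleA a b (f : L2) : L2_scale a (L2_scale b f) = L2_scale (a * b) f.
Proof. by elim/L2_ind: f => f; rewrite !L2_scaleE scalerA. Qed.

Lemma L2_scale1 : left_id 1 L2_scale.
Proof. by elim/L2_ind=> f; rewrite L2_scaleE scale1r. Qed.

Lemma L2_scaleDr : right_distributive L2_scale +%R.
Proof.
move=> a; elim/L2_ind=> f; elim/L2_ind=> g.
by rewrite -![_ + _]/(L2_add _ _) L2_addE !L2_scaleE L2_addE scalerDr.
Qed.

Lemma L2_scaleDl (f : L2) : {morph L2_scale^~ f : a b / a + b}.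
Proof.
elim/L2_ind: f => f a b.
by rewrite !L2_scaleE -[RHS]/(L2_add _ _) L2_addE scalerDl.
Qed.

HB.instance Definition _ := GRing.Zmodule_isLmodule.Build R L2
  L2_scaleA L2_scale1 L2_scaleDr L2_scaleDl.

HB.instance Definition _ := isPointed.Build L2 0.

(* The class of f; 0 when f is not a measurable square-integrable function. *)
Definition toL2 (f : T -> R) : L2 :=
  if pselect (f \in Lfun mu 2%:R%:E) is left fL2
  then L2_class (Lfun_Sub (lee1n 2 : (1 <= 2%:R%:E :> \bar R)%E) fL2) else 0.

Definition ipL2 (f g : L2) : R := (\int[mu]_x (L2_repr f x * L2_repr g x))%R.

Definition normL2 (f : L2) : R := Num.sqrt (ipL2 f f).
(* Sums and limits of L^2 elements; the limit is 0 if the series diverges. *)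
Definition sumL2 (a : nat -> L2) : L2 :=
  xget 0 [set l | (fun N => normL2 (\sum_(k < N) a k - l)) @ \oo --> (0 : R)].

Definition mulL2 (f g : L2) : L2 := toL2 (fun x => L2_repr f x * L2_repr g x).

Definition orthonormal_basis (e : nat -> L2) : Prop :=
  (forall j k, ipL2 (e j) (e k) = (j == k)%:R) /\
  forall f, (fun N => normL2 (\sum_(k < N) ipL2 f (e k) *: e k - f)) @ \oo
    --> (0 : R).

(* S = Q^{1/2}; a symmetric operator defined on all of L^2 is bounded. *)
Definition nonneg_sqrt (Q S : L2 -> L2) : Prop :=
  [/\ linear S, (forall f g, ipL2 (S f) g = ipL2 f (S g)),
      (forall f, 0 <= ipL2 (S f) f) & (forall f, S (S f) = Q f)].

(* Hilbert-Schmidt operators from L^2 to a subspace V of L^2 whose squared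
   norm is nsq; the condition does not depend on the orthonormal basis e. *)
Definition hilbert_schmidt (e : nat -> L2) (V : set L2) (nsq : L2 -> \bar R)
    (S : L2 -> L2) : Prop :=
  [/\ linear S, (forall f, V (S f)),
      (exists C : R, forall f, (nsq (S f) <= (C * ipL2 f f)%:E)%E) &
      (\sum_(0 <= k <oo) nsq (S (e k)) < +oo)%E].

End L2_space.

Definition norm_open {R : realType} {V : lmodType R} (nrm : V -> R) :
    set (set V) :=
  [set U | forall x, U x -> exists2 e, 0 < e & forall y, nrm (y - x) < e -> U y].

Definition borelL2 {d} {T : measurableType d} {R : realType}
    (mu : {measure set T -> \bar R}) :=
  g_sigma_algebraType (norm_open (@normL2 d T R mu)).

Section space.
Variable R : realType.
Local Notation mR := (measurableTypeR R).

Definition R3 : Type := (R * R * R)%type.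
HB.instance Definition _ := NormedModule.on R3.
HB.instance Definition _ := Measurable.copy R3 (mR * mR * mR)%type.

Definition leb2 : {measure set (mR * mR) -> \bar R} :=
  (@lebesgue_measure R \x @lebesgue_measure R)%E.
Definition leb3_prod : {measure set (mR * mR * mR) -> \bar R} :=
  ((@lebesgue_measure R \x @lebesgue_measure R) \x @lebesgue_measure R)%E.
Definition leb3 : {measure set R3 -> \bar R} := leb3_prod.

Definition coord3 (x : R3) (i : 'I_3) : R :=
  match val i with 0 => x.1.1 | 1 => x.1.2 | _ => x.2 end.

Definition vec (f : 'I_3 -> R) : R3 := (f 0, f 1, f 2%:R).

Definition evec (i : 'I_3) : R3 := vec (fun j => (j == i)%:R).

Definition dot (u v : R3) : R := \sum_i coord3 u i * coord3 v i.

Definition enorm (u : R3) : R := Num.sqrt (dot u u).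

(* Indices are added modulo 3 in the ring 'I_3. *)
Definition cross (u v : R3) : R3 :=
  vec (fun i => coord3 u (i + 1) * coord3 v (i + 2%:R)
              - coord3 u (i + 2%:R) * coord3 v (i + 1)).

Definition partial (i : 'I_3) (f : R3 -> R) : R3 -> R :=
  fun x => 'D_(evec i) f x.

Definition curl (F : R3 -> R3) (x : R3) : R3 :=
  vec (fun i => partial (i + 1) (fun y => coord3 (F y) (i + 2%:R)) x
              - partial (i + 2%:R) (fun y => coord3 (F y) (i + 1)) x).

Definition cuboid (lo hi : R3) : set R3 :=
  ([set` `]lo.1.1, hi.1.1[] `*` [set` `]lo.1.2, hi.1.2[])
    `*` [set` `]lo.2, hi.2[].

Definition closed_cuboid (lo hi : R3) : set R3 :=
  [set x | forall i, coord3 lo i <= coord3 x i <= coord3 hi i].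

Lemma measurable_cuboid lo hi : measurable (cuboid lo hi : set R3).
Proof.
apply: measurableX; last exact: measurable_itv.
by apply: measurableX; exact: measurable_itv.
Qed.

(* Lebesgue measure on D = (x_L, x_R) x (y_L, y_R) x (z_L, z_R), where
   lo = (x_L, y_L, z_L) and hi = (x_R, y_R, z_R). *)
Definition muD (lo hi : R3) : {measure set R3 -> \bar R} :=
  mrestr leb3 (measurable_cuboid lo hi).

End space.

Section sobolev.
Context {R : realType} (lo hi : R3 R).
Local Notation L2D := (L2 (muD lo hi)).

Definition smooth (phi : R3 R -> R) : Prop :=
  forall s : seq 'I_3,
    let psi := foldr (@partial R) phi s in
    continuous psi /\ forall x i, derivable psi x (evec R i).

Definition test_function (phi : R3 R -> R) : Prop :=
  smooth phi /\ exists K : set (R3 R),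
    [/\ compact K, K `<=` cuboid lo hi & forall x, ~ K x -> phi x = 0].

Definition mpartial (a : 'I_3 -> nat) (phi : R3 R -> R) : R3 R -> R :=
  iter (a 0) (@partial R 0)
    (iter (a 1) (@partial R 1) (iter (a 2%:R) (@partial R 2%:R) phi)).

Definition weak_derivative (a : 'I_3 -> nat) (f g : L2D) : Prop :=
  forall phi, test_function phi ->
    (\int[muD lo hi]_x (L2_repr f x * mpartial a phi x))%R =
    (-1) ^+ (\sum_i a i)%N * (\int[muD lo hi]_x (L2_repr g x * phi x))%R.

Definition gagliardo_sq (theta : R) (g : L2D) : \bar R :=
  (\int[muD lo hi]_x \int[muD lo hi]_y
    ((L2_repr g x - L2_repr g y) ^+ 2 / enorm (x - y) `^ (3 + 2 * theta))%:E)%E.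

(* Squared norm of W^{s,2}(D), s >= 0 real (Sobolev-Slobodeckij when s is not
   an integer).  Weak derivatives are unique, so the infimum ranges over at most
   one value; it is +oo when f lacks a weak derivative of order <= s in L^2(D). *)
Definition sobolev_sq (s : R) (f : L2D) : \bar R :=
  let m := Num.truncn s in
  ereal_inf [set N : \bar R | exists df : {ffun 'I_3 -> 'I_m.+1} -> L2D,
    [/\ df [ffun=> ord0] = f,
        (forall a : {ffun 'I_3 -> 'I_m.+1}, (\sum_i a i <= m)%N ->
           weak_derivative (fun i => a i) f (df a))
      & N = (\sum_(a : {ffun 'I_3 -> 'I_m.+1} | (\sum_i a i <= m)%N) (ipL2 (df a) (df a))%:E
            + if s == m%:R then 0
              else \sum_(a : {ffun 'I_3 -> 'I_m.+1} | (\sum_i a i == m)%N)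
                     gagliardo_sq (s - m%:R) (df a))%E]].

Definition sobolev (s : R) : set L2D := [set f | (sobolev_sq s f < +oo)%E].

(* Closure of C_c^infinity(D) in H^s(D). *)
Definition sobolev0 (s : R) : set L2D :=
  [set f | forall e : R, 0 < e -> exists2 phi, test_function phi &
     (sobolev_sq s (f - toL2 (muD lo hi) phi)%R < e%:E)%E].

End sobolev.

Section noise.
Context {d : measure_display} {Omega : measurableType d} {R : realType}.
Variable P : probability Omega R.

Definition filtration (Ft : R -> set (set Omega)) : Prop :=
  (forall t : R, 0 <= t -> sigma_algebra setT (Ft t) /\ Ft t `<=` measurable) /\
  (forall s t, 0 <= s <= t -> Ft s `<=` Ft t).

(* s < t below: [normal_prob m 0] is not a Dirac mass. *)
Definition brownian_motion (Ft : R -> set (set Omega))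
    (beta : R -> Omega -> R) : Prop :=
  [/\ (forall t : R, 0 <= t -> forall B : set R, measurable B ->
         Ft t (beta t @^-1` B)),
      (\forall w \ae P, beta 0 w = 0),
      (\forall w \ae P, {within `[0, +oo[, continuous (fun t => beta t w)}),
      (forall s t : R, 0 <= s -> s < t -> forall B : set R, measurable B ->
         P ((fun w => beta t w - beta s w) @^-1` B)
           = normal_prob 0 (Num.sqrt (t - s)) B)
    & (forall s t : R, 0 <= s -> s < t -> forall (A : set Omega) (B : set R),
         Ft s A -> measurable B ->
         P (A `&` (fun w => beta t w - beta s w) @^-1` B)
           = (P A * P ((fun w => beta t w - beta s w)%R @^-1` B))%E)].

Definition sigma_process (X : R -> Omega -> R) : set (set Omega) :=
  <<s [set A | exists t (B : set R),
         [/\ 0 <= t, measurable B & A = X t @^-1` B]] >>.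

Definition independent_processes {I : eqType} (X : I -> R -> Omega -> R) : Prop :=
  forall (s : seq I) (A : I -> set Omega), uniq s ->
    (forall i, i \in s -> sigma_process (X i) (A i)) ->
    fine (P (\big[setI/setT]_(i <- s) A i)) = \prod_(i <- s) fine (P (A i)).

Definition noise_family (beta1 beta2 : nat -> R -> Omega -> R)
    (j : nat + nat) : R -> Omega -> R :=
  match j with inl k => beta1 k | inr k => beta2 k end.

Section L2_noise.
Context {d' : measure_display} {T : measurableType d'}.
Variable mu : {measure set T -> \bar R}.

(* W(t) = sum_k sqrt(eta_k) beta_k(t) q_k, the series converging in
   L^2(Omega; L^2). *)
Definition Q_wiener (eta : nat -> R) (q : nat -> L2 mu)
    (beta : nat -> R -> Omega -> R) (W : R -> Omega -> L2 mu) : Prop :=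
  forall t, 0 <= t ->
    measurable_fun setT (W t : Omega -> borelL2 mu) /\
    (fun N => \int[P]_w (normL2 (\sum_(k < N)
        (Num.sqrt (eta k) * beta k t w) *: q k - W t w) ^+ 2)%:E)%E @ \oo --> 0%E.

Definition truncated_increment (b dt : R) (q : nat -> L2 mu)
    (S : L2 mu -> L2 mu) (beta : nat -> R -> Omega -> R) (n : nat) (w : Omega) :
    L2 mu :=
  let A := Num.sqrt (2 * b * `|ln dt|) in
  let xi i := (beta i (n.+1%:R * dt) w - beta i (n%:R * dt) w) / Num.sqrt dt in
  let zeta i := Num.max (- A) (Num.min (xi i) A) in
  Num.sqrt dt *: sumL2 (fun i => zeta i *: S (q i)).

Definition increment (dt : R) (W : R -> Omega -> L2 mu) (n : nat) (w : Omega) :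
    L2 mu :=
  W (n.+1%:R * dt) w - W (n%:R * dt) w.

End L2_noise.
End noise.

Section mesh.
Context {R : realType}.
Implicit Types v : 'I_4 -> R3 R.

Definition hull v (I : {set 'I_4}) : set (R3 R) :=
  [set x | exists c : 'I_4 -> R,
    [/\ forall i, 0 <= c i, forall i, i \notin I -> c i = 0,
        \sum_i c i = 1 & x = \sum_i c i *: v i]].

Definition simplex v : set (R3 R) := hull v [set: 'I_4].

Definition open_simplex v : set (R3 R) :=
  [set x | exists c : 'I_4 -> R,
    [/\ forall i, 0 < c i, \sum_i c i = 1 & x = \sum_i c i *: v i]].

Definition simplex_boundary v : set (R3 R) := simplex v `\` open_simplex v.

Definition diameter v : R :=
  sup [set enorm (x - y) | x in simplex v & y in simplex v].

Definition inradius v : R :=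
  sup [set r | exists x, forall y, enorm (y - x) <= r -> simplex v y].

Definition affinely_independent v : Prop :=
  forall c : 'I_4 -> R, \sum_i c i = 0 -> \sum_i c i *: v i = 0 ->
    forall i, c i = 0.

(* Hanging nodes are allowed; see [matching]. *)
Record simplicial_mesh (lo hi : R3 R) := SimplicialMesh {
  elt : finType;
  vtx : elt -> 'I_4 -> R3 R;
  _ : forall K, affinely_independent (vtx K);
  _ : forall K L, K != L ->
        open_simplex (vtx K) `&` open_simplex (vtx L) = set0;
  _ : \bigcup_K simplex (vtx K) = closed_cuboid lo hi }.

Variables lo hi : R3 R.
Implicit Types Th Sh : simplicial_mesh lo hi.

Definition matching Th : Prop :=
  forall K L : elt Th, K != L -> exists I : {set 'I_4},
    simplex_boundary (vtx K) `&` simplex_boundary (vtx L) = hull (vtx K) I.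

(* Di Pietro and Ern: there is a matching simplicial submesh which is
   shape-regular with parameter r1 and contact-regular with parameter r2. *)
Definition regular_mesh (r1 r2 : R) Th : Prop :=
  exists Sh, [/\ matching Sh,
    (forall S : elt Sh, exists K : elt Th, simplex (vtx S) `<=` simplex (vtx K)),
    (forall S : elt Sh, r1 * diameter (vtx S) <= inradius (vtx S)) &
    (forall (K : elt Th) (S : elt Sh), simplex (vtx S) `<=` simplex (vtx K) ->
       r2 * diameter (vtx K) <= diameter (vtx S))].

(* Planar sets are charted by an orthonormal frame (t1, t2, n) at a base point;
   surface integrals are then Lebesgue integrals over R^2 and do not depend on
   the chart. *)
Record frame := Frame { fpt : R3 R; ft1 : R3 R; ft2 : R3 R; fn : R3 R }.
HB.instance Definition _ := gen_eqMixin frame.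
HB.instance Definition _ := gen_choiceMixin frame.

Definition orthonormal_frame (fr : frame) : Prop :=
  [/\ dot (ft1 fr) (ft1 fr) = 1, dot (ft2 fr) (ft2 fr) = 1 &
      dot (fn fr) (fn fr) = 1] /\
  [/\ dot (ft1 fr) (ft2 fr) = 0, dot (ft1 fr) (fn fr) = 0 &
      dot (ft2 fr) (fn fr) = 0].

Definition chart (fr : frame) (z : measurableTypeR R * measurableTypeR R) : R3 R :=
  fpt fr + (z.1 : R) *: ft1 fr + (z.2 : R) *: ft2 fr.

Definition area (fr : frame) (F : set (R3 R)) : \bar R :=
  leb2 R (chart fr @^-1` F).

Definition surface_integral (fr : frame) (F : set (R3 R)) (g : R3 R -> R) : R :=
  (\int[leb2 R]_(z in chart fr @^-1` F) g (chart fr z))%R.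

Section faces.
Variable Th : simplicial_mesh lo hi.
Implicit Types K L : elt Th.

Definition common_face K L : set (R3 R) :=
  simplex_boundary (vtx K) `&` simplex_boundary (vtx L).

(* fr charts the plane of the common face, with normal pointing from K to L. *)
Definition face_frame K L (fr : frame) : Prop :=
  [/\ orthonormal_frame fr,
      (forall x, common_face K L x -> dot (x - fpt fr) (fn fr) = 0),
      (forall x, simplex (vtx K) x -> dot (x - fpt fr) (fn fr) <= 0) &
      (forall x, simplex (vtx L) x -> 0 <= dot (x - fpt fr) (fn fr))].

Definition interior_face K L : Prop :=
  exists2 fr, face_frame K L fr & (0 < area fr (common_face K L))%E.

Definition frame_of K L : frame := xget (Frame 0 0 0 0) (face_frame K L).

(* An interior face is an unordered pair of elements; ori selects the order
   (K, K_F), i.e. the direction of the fixed normal n_F. *)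
Definition orientation (ori : rel (elt Th)) : Prop :=
  forall K L, K != L -> ori K L != ori L K.

(* Exterior faces: the part of the boundary of K in the side x_i = lo_i
   (s = false) or x_i = hi_i (s = true) of D, with outward normal. *)
Definition side_coord (i : 'I_3) (s : bool) : R :=
  if s then coord3 hi i else coord3 lo i.

Definition side_frame (i : 'I_3) (s : bool) : frame :=
  Frame (side_coord i s *: evec R i) (evec R (i + 1)) (evec R (i + 2%:R))
    ((-1) ^+ (~~ s) *: evec R i).

Definition exterior_face K (i : 'I_3) (s : bool) : set (R3 R) :=
  simplex (vtx K) `&` [set x | coord3 x i = side_coord i s].

End faces.
End mesh.

Section energy_space.
Context {R : realType} (lo hi : R3 R).
Local Notation L2D := (L2 (muD lo hi)).

(* L^2(D)^3 x L^2(D)^3 *)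
Definition HH : Type := ({ffun 'I_3 -> L2D} * {ffun 'I_3 -> L2D})%type.
HB.instance Definition _ := GRing.Lmodule.on HH.
HB.instance Definition _ := isPointed.Build HH 0.

Definition ipH (u v : HH) : R :=
  \sum_i ipL2 (u.1 i) (v.1 i) + \sum_i ipL2 (u.2 i) (v.2 i).

Definition normH (u : HH) : R := Num.sqrt (ipH u u).

Definition borelH := g_sigma_algebraType (norm_open normH).

Definition Jop (u : HH) : HH := (- u.2, u.1).

Definition mulH (u : HH) (g : L2D) : HH :=
  ([ffun i => mulL2 (u.1 i) g], [ffun i => mulL2 (u.2 i) g]).

(* (lam2, lam2) g *)
Definition tildeH (lam2 : R3 R) (g : L2D) : HH :=
  ([ffun i => coord3 lam2 i *: g], [ffun i => coord3 lam2 i *: g]).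

End energy_space.

Section dG.
Context {R : realType} {lo hi : R3 R}.
Variables (Th : simplicial_mesh lo hi) (ori : rel (elt Th)).
Local Notation L2D := (L2 (muD lo hi)).
Local Notation HH := (HH lo hi).

(* The affine function c + g . x is coded by (c, g). *)
Definition P1 : Type := (R * R3 R)%type.
HB.instance Definition _ := GRing.Lmodule.on P1.

Definition P1_eval (p : P1) (x : R3 R) : R := p.1 + dot p.2 x.

(* A broken polynomial is the family of its restrictions to the elements. *)
Definition broken : Type := {ffun elt Th -> P1}.
HB.instance Definition _ := GRing.Lmodule.on broken.

Definition broken_fun (p : broken) (x : R3 R) : R :=
  \sum_K \1_(open_simplex (vtx K)) x * P1_eval (p K) x.

Definition Hh : Type := ({ffun 'I_3 -> broken} * {ffun 'I_3 -> broken})%type.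
HB.instance Definition _ := GRing.Lmodule.on Hh.

Definition embH (u : Hh) : HH :=
  ([ffun i => toL2 (muD lo hi) (broken_fun (u.1 i))],
   [ffun i => toL2 (muD lo hi) (broken_fun (u.2 i))]).

Definition on_elt (v : {ffun 'I_3 -> broken}) (K : elt Th) (x : R3 R) : R3 R :=
  vec (fun i => P1_eval (v i K) x).

Definition pih (f : HH) : Hh :=
  xget 0 [set w | forall v, ipH (f - embH w) (embH v) = 0].

Definition maxwell_form (u v : Hh) : R :=
  let E := on_elt u.1 in let H := on_elt u.2 in
  let psi := on_elt v.1 in let phi := on_elt v.2 in
  \sum_K ((\int[leb3 R]_(x in simplex (vtx K)) dot (curl (H K) x) (psi K x))%R
        - (\int[leb3 R]_(x in simplex (vtx K)) dot (curl (E K) x) (phi K x))%R)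
  + 2^-1 * \sum_(F : elt Th * elt Th | ori F.1 F.2 && `[< interior_face F.1 F.2 >])
      (let K := F.1 in let L := F.2 in
       let fr := frame_of K L in
       let nx := cross (fn fr) in
       let jump (G : elt Th -> R3 R -> R3 R) x := G L x - G K x in
       let int := surface_integral fr (common_face K L) in
         int (fun x => dot (nx (jump H x)) (psi K x + psi L x))
       - int (fun x => dot (nx (jump E x)) (phi K x + phi L x))
       - int (fun x => dot (nx (jump E x)) (nx (jump psi x)))
       - int (fun x => dot (nx (jump H x)) (nx (jump phi x))))
  + \sum_K \sum_(i < 3) \sum_(s : bool)
      (let fr := side_frame lo hi i s in
       let nx := cross (fn fr) in
       let int := surface_integral fr (exterior_face K i s) in
         int (fun x => dot (nx (E K x)) (phi K x))
       - int (fun x => dot (nx (E K x)) (nx (psi K x)))).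

Definition Mh (u : Hh) : Hh :=
  xget 0 [set w | forall v, ipH (embH w) (embH v) = maxwell_form u v].

Section scheme.
Context {d : measure_display} {Omega : measurableType d}.
Variables (sigma0 lam1 : R) (lam2 : R3 R) (dt : R).
Variables dW1 dW2 : nat -> Omega -> L2D.

Definition dG_scheme (u0 : Omega -> HH) (u : nat -> Omega -> Hh) : Prop :=
  (forall w, u 0%N w = pih (u0 w)) /\
  forall n w,
    let r := expR (- sigma0 * dt) in
    u n.+1 w - r *: u n w =
      (dt / 2) *: (Mh (u n.+1 w) + r *: Mh (u n w))
      + (lam1 / 2) *: pih (mulH (Jop (embH (u n.+1 w + r *: u n w))) (dW1 n w))
      + pih (tildeH lam2 (dW2 n w)).

(* The implicit scheme has exactly one solution. *)
Definition dG_solution (u0 : Omega -> HH) : nat -> Omega -> Hh :=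
  xget (fun _ _ => 0) (dG_scheme u0).

(* P_h^n phi (x) = E[phi(u_h^n)] with u_h^0 = pi_h x. *)
Definition transition (P : probability Omega R) (n : nat)
    (phi : borelH lo hi -> R) (x : HH) : R :=
  (\int[P]_w phi (embH (dG_solution (fun=> x) n w)))%R.

End scheme.
End dG.

Section ergodicity.
Context {R : realType} {lo hi : R3 R}.
Local Notation H := (borelH lo hi).
Implicit Types (Ph : nat -> (H -> R) -> H -> R) (pi : probability H R).

Definition finite_second_moment pi : Prop :=
  (\int[pi]_x (normH x ^+ 2)%:E < +oo)%E.

Definition invariant_measure Ph pi : Prop :=
  forall (n : nat) (phi : H -> R), measurable_fun setT phi ->
    (exists C, forall x, `|phi x| <= C) ->
    (\int[pi]_x Ph n phi x)%R = (\int[pi]_x phi x)%R.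

Definition ergodic_measure Ph pi : Prop :=
  forall phi : H -> R, measurable_fun setT phi ->
    (\int[pi]_x (phi x ^+ 2)%:E < +oo)%E ->
    (fun N : nat => \int[pi]_x ((N%:R^-1 * \sum_(n < N) Ph n phi x
        - (\int[pi]_y phi y)%R) ^+ 2)%:E)%E @ \oo --> 0%E.

Definition exponentially_mixing Ph (dt : R) pi : Prop :=
  exists2 rho : R, 0 < rho & exists2 C : H -> R, (forall x, 0 < C x) &
    forall (phi : H -> R) (L : R),
      (exists B, forall x, `|phi x| <= B) ->
      (forall x y, `|phi x - phi y| <= L * normH (x - y)) ->
      forall n x, `|Ph n phi x - (\int[pi]_y phi y)%R|
                  <= C x * L * expR (- rho * (n%:R * dt)).

(* The transpose (P_h^n)^* pi. *)
Definition transpose Ph (n : nat) pi (A : set H) : \bar R :=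
  (\int[pi]_x (Ph n \1_A x)%:E)%E.

Definition coupling (mu nu : set H -> \bar R)
    (gam : probability (H * H)%type R) : Prop :=
  forall A : set H, measurable A ->
    gam (A `*` setT) = mu A /\ gam (setT `*` A) = nu A.

Definition wasserstein2 (mu nu : set H -> \bar R) : \bar R :=
  (ereal_inf [set c | exists2 gam : probability (H * H)%type R,
     coupling mu nu gam & c = \int[gam]_z (normH (z.1 - z.2) ^+ 2)%:E]
   `^ 2^-1)%E.

End ergodicity.

(* Main.v *)
Require Import Defs.
From HB Require Import structures.
From mathcomp Require Import all_boot all_order all_algebra.
From mathcomp Require Import all_classical all_reals all_analysis.
From mathcomp Require Import measurable_realfun ring lra.
Set Implicit Arguments. Unset Strict Implicit. Unset Printing Implicit Defensive.
Import Order.TTheory GRing.Theory Num.Theory numFieldNormedType.Exports HBNNSimple.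
Local Open Scope classical_set_scope.
Local Open Scope ring_scope.

(* Almost every line parallel to a coordinate axis cuts the simplices of the mesh into
   intervals tiling its chord of the cuboid.  The fundamental theorem of calculus on these
   intervals telescopes into jumps over interior faces and traces on exterior faces, which
   is integration by parts over the mesh.  With it <M_h u, u> reduces to minus a sum of
   squares of tangential jumps and traces, so M_h is dissipative; the multiplicative noise
   u |-> pi_h (J u g) is skew.  Testing the difference of two implicit steps with
   p + r s, where p and s are the new and old differences and r = e^{-sigma_0 dt}, then
   gives |p| <= r |s| for every noise and every dt > 0: each step is, pathwise, a strict
   contraction, which in finite dimension also yields its unique solvability.

   Composing the random steps in reversed order (backward iteration) gives a sequence
   that converges almost surely, and reversing finitely many independent, identically
   distributed increments does not change their joint law, so the law of the limit is
   invariant.  Contraction carries over to bounded Lipschitz observables and to couplings;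
   this gives uniqueness, mixing and the Wasserstein bound, and ergodicity because bounded
   Lipschitz functions are dense in L^2(pi). *)

(** * Integrals, inner products and the space L^2 *)

(** The mesh may have hanging nodes, so a common face need not be a whole facet of either element,
    and boundary integrals of single elements do not pair up facet by facet. Almost every line meets
    only the interiors of facets, and on it the problem is one-dimensional. If two elements meet on
    such a line, their facets lie in one plane, for otherwise some direction would enter both open
    simplices.

    Backward iteration puts the newest noise innermost, where all earlier contractions damp it; the
    iterates are then almost surely Cauchy, although the chain itself does not converge pathwise.
    This requires the reversed noise to have the same joint law. The noise is accessible only
    through scalar Brownian motions: its first component is a series that converges for every
    sample, because the truncated coefficients are bounded, while the second is only a mean-square
    limit. Laws are therefore compared for finitely many modes and time steps, where rectangles
    suffice, and the limit is taken along an almost surely convergent subsequence. *)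

Section real_integral.
Context d (T : measurableType d) (R : realType) (mu : {measure set T -> \bar R}).

Lemma ae_eq_Rintegral (f g : T -> R) :
  measurable_fun [set: T] (f : T -> measurableTypeR R) ->
  measurable_fun [set: T] (g : T -> measurableTypeR R) ->
  (\forall x \ae mu, f x = g x) -> (\int[mu]_x f x = \int[mu]_x g x)%R.
Proof.
move=> mf mg fg; congr fine; apply: ae_eq_integral => //.
- exact: measurableT_comp.
- exact: measurableT_comp.
- by apply: (@filterS _ (almost_everywhere mu) _ _ _ _ fg) => x -> _.
Qed.

Lemma integrable_sum_fun (I : Type) (r : seq I) (D : set T) (f : I -> T -> R) :
  measurable D -> (forall i, mu.-integrable D (EFin \o f i)) ->
  mu.-integrable D (EFin \o (fun x => \sum_(i <- r) f i x)).
Proof.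
move=> mD fi; elim: r => [|i r IH].
  rewrite (_ : _ \o _ = cst 0%E); first exact: integrable0.
  by apply/funext => x /=; rewrite big_nil.
rewrite (_ : _ \o _ = (EFin \o f i) \+ (EFin \o (fun x => \sum_(i <- r) f i x))).
  exact: integrableD.
by apply/funext => x /=; rewrite big_cons.
Qed.

Lemma Rintegral_sum (I : Type) (r : seq I) (D : set T) (f : I -> T -> R) :
  measurable D -> (forall i, mu.-integrable D (EFin \o f i)) ->
  (\int[mu]_(x in D) (\sum_(i <- r) f i x) = \sum_(i <- r) \int[mu]_(x in D) f i x)%R.
Proof.
move=> mD fi; elim: r => [|i r IH].
  by rewrite big_nil; under eq_Rintegral do rewrite big_nil; rewrite Rintegral_cst // mul0r.
rewrite big_cons -IH -RintegralD //; last exact: integrable_sum_fun.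
by apply: eq_Rintegral => x _; rewrite big_cons.
Qed.

Lemma integrableD_EFin (D : set T) (f g : T -> R) : measurable D ->
  mu.-integrable D (EFin \o f) -> mu.-integrable D (EFin \o g) ->
  mu.-integrable D (EFin \o (fun x => f x + g x)).
Proof. by move=> mD fi gi; apply: (integrableD mD fi gi). Qed.

Lemma integrableB_EFin (D : set T) (f g : T -> R) : measurable D ->
  mu.-integrable D (EFin \o f) -> mu.-integrable D (EFin \o g) ->
  mu.-integrable D (EFin \o (fun x => f x - g x)).
Proof. by move=> mD fi gi; apply: (integrableB mD fi gi). Qed.

Lemma integrableZ_EFin (D : set T) (c : R) (f : T -> R) : measurable D ->
  mu.-integrable D (EFin \o f) -> mu.-integrable D (EFin \o (fun x => c * f x)).
Proof. by move=> mD fi; apply: (integrableZl mD _ fi). Qed.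

Lemma dominated_cvg_EFin (f_ : nat -> T -> R) (f g : T -> R) :
  (forall n, measurable_fun [set: T] (f_ n : T -> measurableTypeR R)) ->
  measurable_fun [set: T] (f : T -> measurableTypeR R) ->
  (\forall x \ae mu, f_ ^~ x @ \oo --> f x) ->
  mu.-integrable setT (EFin \o g) -> (forall n x, `|f_ n x| <= g x) ->
  (fun n => \int[mu]_x (f_ n x)%:E)%E @ \oo --> (\int[mu]_x (f x)%:E)%E.
Proof.
move=> mf_ mf ff ig fg.
have [] // := @dominated_convergence _ _ _ mu setT measurableT
  (fun n x => (f_ n x)%:E) (fun x => (f x)%:E) (EFin \o g).
- by move=> n; apply/measurable_EFinP; exact: mf_.
- exact/measurable_EFinP.
- by apply: filterS ff => x fx _; apply/fine_cvgP; split; [exact: nearW|exact: fx].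
- by apply: nearW => x n _; rewrite /= lee_fin; exact: fg.
Qed.

Lemma dominated_cvg_Rintegral (f_ : nat -> T -> R) (f g : T -> R) :
  (forall n, measurable_fun [set: T] (f_ n : T -> measurableTypeR R)) ->
  measurable_fun [set: T] (f : T -> measurableTypeR R) ->
  (\forall x \ae mu, f_ ^~ x @ \oo --> f x) ->
  mu.-integrable setT (EFin \o g) -> (forall n x, `|f_ n x| <= g x) ->
  (fun n => \int[mu]_x f_ n x)%R @ \oo --> (\int[mu]_x f x)%R.
Proof.
move=> mf_ mf ff ig fg.
have fi (h : T -> R) : measurable_fun [set: T] (h : T -> measurableTypeR R) ->
    (\forall x \ae mu, `|h x| <= g x) -> mu.-integrable setT (EFin \o h).
  move=> mh hg; apply/integrableP; split; first exact/measurable_EFinP.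
  have [_] := integrableP _ _ _ ig; apply: le_lt_trans.
  apply: ae_ge0_le_integral => //.
  - by apply: measurableT_comp => //; exact/measurable_EFinP.
  - by apply: measurableT_comp => //; have [] := integrableP _ _ _ ig.
  - apply: filterS hg => x hx _ /=; rewrite lee_fin; apply: le_trans hx (ler_norm _).
apply: fine_cvg; rewrite fineK; first exact: dominated_cvg_EFin ff ig fg.
apply: integrable_fin_num => //; apply: fi => //; apply: filterS ff => x fx.
by apply: (cvgr_to_le (cvg_norm fx)); exact: nearW.
Qed.

End real_integral.

Section pushforward_measure.
Context d d' (T1 : measurableType d) (T2 : measurableType d') (R : realType).
Variables (m : {measure set T1 -> \bar R}) (f : T1 -> T2).
Hypothesis mf : measurable_fun [set: T1] f.

(** The measurability witness is part of the term, so the pushforward is a bundled measure and can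
    be integrated against directly. *)
Definition push : {measure set T2 -> \bar R}.
Proof. refine (pushforward m f : {measure set T2 -> \bar R}); exact: mf. Defined.

Lemma pushE A : push A = m (f @^-1` A).
Proof. by []. Qed.

Lemma ge0_integral_push (g : T2 -> \bar R) : measurable_fun setT g ->
  (forall x, 0 <= g x)%E -> (\int[push]_y g y = \int[m]_x g (f x))%E.
Proof.
move=> mg g0.
by rewrite (ge0_integral_pushforward mf m measurableT mg) // preimage_setT.
Qed.

Lemma integral_push (g : T2 -> \bar R) : measurable_fun setT g ->
  (\int[push]_y g y = \int[m]_x g (f x))%E.
Proof.
move=> mg; rewrite integralE [RHS]integralE.
rewrite ge0_integral_push //; last exact: measurable_funepos.
rewrite ge0_integral_push //; last exact: measurable_funeneg.
by congr (_ - _)%E; apply: eq_integral => x _; rewrite ?funeposE ?funenegE.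
Qed.

End pushforward_measure.

(** * Inner products, seminorms and sequential convergence *)

Section inner_products.
Context {R : realType} {V : lmodType R}.
Implicit Types (ip : V -> V -> R) (u v w : V) (a : R).

Definition inner_product ip : Prop :=
  [/\ forall u v, ip u v = ip v u, forall u v w, ip (u + v) w = ip u w + ip v w,
      forall a u v, ip (a *: u) v = a * ip u v & forall u, 0 <= ip u u].

Definition seminorm (nrm : V -> R) : Prop :=
  (forall u v, nrm (u + v) <= nrm u + nrm v) /\
  (forall a u, nrm (a *: u) = `|a| * nrm u).

Section inner_product_theory.
Variable ip : V -> V -> R.
Hypothesis ipP : inner_product ip.
Let nrm u := Num.sqrt (ip u u).

Lemma ipC u v : ip u v = ip v u. Proof. by case: ipP. Qed.
Lemma ipDl u v w : ip (u + v) w = ip u w + ip v w. Proof. by case: ipP. Qed.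
Lemma ipZl a u v : ip (a *: u) v = a * ip u v. Proof. by case: ipP. Qed.
Lemma ip_ge0 u : 0 <= ip u u. Proof. by case: ipP. Qed.
Lemma ipDr u v w : ip u (v + w) = ip u v + ip u w.
Proof. by rewrite ipC ipDl 2![ip _ u]ipC. Qed.
Lemma ipZr a u v : ip u (a *: v) = a * ip u v.
Proof. by rewrite ipC ipZl ipC. Qed.
Lemma ipNl u v : ip (- u) v = - ip u v.
Proof. by rewrite -scaleN1r ipZl mulN1r. Qed.
Lemma ipNr u v : ip u (- v) = - ip u v.
Proof. by rewrite ipC ipNl ipC. Qed.
Lemma ipBl u v w : ip (u - v) w = ip u w - ip v w.
Proof. by rewrite ipDl ipNl. Qed.
Lemma ipBr u v w : ip u (v - w) = ip u v - ip u w.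
Proof. by rewrite ipDr ipNr. Qed.
Lemma ip0l v : ip 0 v = 0.
Proof. by rewrite -(scale0r 0) ipZl mul0r. Qed.
Lemma ipL a u v w : ip (a *: u + v) w = a * ip u w + ip v w.
Proof. by rewrite ipDl ipZl. Qed.
Lemma ip_suml (I : Type) (r : seq I) (Q : pred I) (F : I -> V) v :
  ip (\sum_(i <- r | Q i) F i) v = \sum_(i <- r | Q i) ip (F i) v.
Proof.
by elim/big_ind2: _ => [|x x' y y' <- <-|]; rewrite ?ip0l ?ipDl.
Qed.
Lemma ip_sumr (I : Type) (r : seq I) (Q : pred I) (F : I -> V) v :
  ip v (\sum_(i <- r | Q i) F i) = \sum_(i <- r | Q i) ip v (F i).
Proof. by rewrite ipC ip_suml; under eq_bigr do rewrite ipC. Qed.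

Lemma cauchy_schwarz u v : `|ip u v| <= nrm u * nrm v.
Proof.
have sqr : ip u v ^+ 2 <= ip u u * ip v v.
  have key t : 0 <= ip u u - 2 * t * ip u v + t ^+ 2 * ip v v.
    have := ip_ge0 (u - t *: v).
    by rewrite ipBl !ipBr !ipZl !ipZr [ip v u]ipC; rewrite (_ : _ - _ = ip u u - 2 * t * ip u v + t ^+ 2 * ip v v) //; ring.
  have [v0|v0] := eqVneq (ip v v) 0.
    rewrite v0 mulr0; have [->|uv0] := eqVneq (ip u v) 0; first by rewrite expr0n.
    (* With [ip v v = 0] the quadratic polynomial degenerates to a linear one, and this t makes it
       equal to -1. *)
    have := key ((ip u u + 1) / (2 * ip u v)).
    rewrite v0 mulr0 addr0.
    have -> : 2 * ((ip u u + 1) / (2 * ip u v)) * ip u v = ip u u + 1 by field; rewrite uv0.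
    by rewrite opprD addrA subrr sub0r oppr_ge0 ler10.
  have vgt0 : 0 < ip v v by rewrite lt_def v0 ip_ge0.
  have := key (ip u v / ip v v).
  have -> : ip u u - 2 * (ip u v / ip v v) * ip u v + (ip u v / ip v v) ^+ 2 * ip v v
    = (ip u u * ip v v - ip u v ^+ 2) / ip v v by field.
  by rewrite pmulr_lge0 ?invr_gt0 // subr_ge0.
by rewrite /nrm -sqrtrM ?ip_ge0 // -sqrtr_sqr ler_wsqrtr.
Qed.

Lemma sqr_pnorm u : nrm u ^+ 2 = ip u u.
Proof. by rewrite sqr_sqrtr // ip_ge0. Qed.

Lemma ip_seminorm : seminorm nrm.
Proof.
split=> [u v|a u]; last first.
  by rewrite /nrm ipZl ipZr mulrA -expr2 sqrtrM ?sqr_ge0 // sqrtr_sqr.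
rewrite -(@ler_pXn2r _ 2) ?nnegrE ?addr_ge0 ?sqrtr_ge0 //.
rewrite sqrrD !sqr_pnorm ipDl !ipDr [ip v u]ipC.
have := le_trans (ler_norm _) (cauchy_schwarz u v); lra.
Qed.

End inner_product_theory.

Section seminorm_theory.
Variable nrm : V -> R.
Hypothesis nrmP : seminorm nrm.

Lemma semiD u v : nrm (u + v) <= nrm u + nrm v. Proof. by case: nrmP. Qed.
Lemma semiZ a u : nrm (a *: u) = `|a| * nrm u. Proof. by case: nrmP. Qed.
Lemma semi0 : nrm 0 = 0. Proof. by rewrite -(scale0r 0) semiZ normr0 mul0r. Qed.
Lemma semiN u : nrm (- u) = nrm u. Proof. by rewrite -scaleN1r semiZ normrN1 mul1r. Qed.
Lemma semiBC u v : nrm (u - v) = nrm (v - u). Proof. by rewrite -semiN opprB. Qed.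
Lemma semi_ge0 u : 0 <= nrm u.
Proof. by have := semiD u (- u); rewrite subrr semi0 semiN; lra. Qed.
Lemma semiB u v : nrm (u - v) <= nrm u + nrm v.
Proof. by rewrite -(semiN v) semiD. Qed.
Lemma semi_triangle v u w : nrm (u - w) <= nrm (u - v) + nrm (v - w).
Proof. by rewrite -{1}(subrK v u) -addrA semiD. Qed.
Lemma semi_dist u v : `|nrm u - nrm v| <= nrm (u - v).
Proof.
have h1 := semiD (u - v) v; have h2 := semiD (v - u) u.
rewrite !subrK [nrm (v - u)]semiBC in h1 h2.
by rewrite ler_norml; apply/andP; split; lra.
Qed.
Lemma semi_sum (I : Type) (r : seq I) (Q : pred I) (F : I -> V) :
  nrm (\sum_(i <- r | Q i) F i) <= \sum_(i <- r | Q i) nrm (F i).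
Proof.
elim/big_rec2: _ => [|i x y _ h]; first by rewrite semi0.
by apply: le_trans (semiD _ _) _; rewrite lerD2l.
Qed.

(** The spaces carry no topological structure, so convergence is expressed by the scalar sequence of
    distances. *)
Definition ncvg (f : nat -> V) (l : V) : Prop := (fun N => nrm (f N - l)) @ \oo --> (0 : R).

Lemma cvg0_le (a c : nat -> R) : (forall n, 0 <= a n <= c n) ->
  c @ \oo --> (0 : R) -> a @ \oo --> (0 : R).
Proof.
move=> ac c0; apply: (squeeze_cvgr _ (cvg_cst 0) c0).
by apply: nearW => n; exact: ac.
Qed.

Lemma ncvgD f g l m : ncvg f l -> ncvg g m -> ncvg (fun n => f n + g n) (l + m).
Proof.
move=> fl gm; apply: (cvg0_le (c := fun n => nrm (f n - l) + nrm (g n - m))).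
  by move=> n; rewrite semi_ge0 opprD addrACA semiD.
by rewrite -[X in _ --> X]addr0; exact: cvgD.
Qed.

Lemma ncvgZ a f l : ncvg f l -> ncvg (fun n => a *: f n) (a *: l).
Proof.
move=> fl; apply: (cvg0_le (c := fun n => `|a| * nrm (f n - l))).
  by move=> n; rewrite semi_ge0 -scalerBr semiZ lexx.
by rewrite -[0 in X in _ --> X](mulr0 `|a|); apply: cvgM => //; exact: cvg_cst.
Qed.

Lemma cvg_dist_le (a c : nat -> R) l : (forall n, `|a n - l| <= c n) ->
  c @ \oo --> (0 : R) -> a @ \oo --> l.
Proof.
move=> ac c0; rewrite -[l]add0r; have -> : a = (fun n => (a n - l) + l).
  by apply/funext => n; rewrite subrK.
apply: cvgD; last exact: cvg_cst.
apply: norm_cvg0; apply: (cvg0_le (c := c)) => // n; rewrite normr_ge0; exact: ac.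
Qed.

Lemma ncvg_nrm f l : ncvg f l -> (fun n => nrm (f n)) @ \oo --> nrm l.
Proof. by move=> fl; apply: (cvg_dist_le _ fl) => n; exact: semi_dist. Qed.

Lemma ncvg_cst l : ncvg (fun=> l) l.
Proof. by rewrite /ncvg; under eq_fun do rewrite subrr semi0; exact: cvg_cst. Qed.

Lemma cvg0_ex (a : nat -> R) e : a @ \oo --> (0 : R) -> 0 < e ->
  exists N, forall n, (N <= n)%N -> a n < e.
Proof.
move=> a0 e0; have [N _ h] : \forall n \near \oo, a n < e by apply: (cvgr_lt 0 a0).
by exists N => n Nn; exact: h.
Qed.

End seminorm_theory.
End inner_products.

Lemma cvg_expr0 (R : realType) (th : R) : 0 <= th < 1 -> (fun k => th ^+ k) @ \oo --> (0 : R).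
Proof.
move=> /andP[th0 th1]; have -> : (fun k => th ^+ k) = geometric 1 th.
  by apply/funext => k; rewrite /= mul1r.
by apply: cvg_geometric; rewrite ger0_norm.
Qed.

Lemma cvg_bigsum (R : realType) (I : Type) (r : seq I) (F : nat -> I -> R) (l : I -> R) :
  (forall i, F ^~ i @ \oo --> l i) ->
  (fun n => \sum_(i <- r) F n i) @ \oo --> \sum_(i <- r) l i.
Proof.
move=> Fl; elim: r => [|i r IH].
  by rewrite big_nil; under eq_fun do rewrite big_nil; exact: cvg_cst.
by rewrite big_cons; under eq_fun do rewrite big_cons; exact: cvgD.
Qed.

Lemma ler_dist_le (R : realType) (a b c : R) : a <= b + c -> b <= a + c -> `|a - b| <= c.
Proof. by move=> h1 h2; rewrite ler_norml; apply/andP; split; lra. Qed.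

Lemma min1_contraction (R : realType) (a b : R) : `|Num.min 1 a - Num.min 1 b| <= `|a - b|.
Proof.
apply: ler_dist_le; rewrite /Num.min; case: ifPn; case: ifPn => //; rewrite -?leNgt => h1 h2;
  have := ler_norm (a - b); have := ler_norm (b - a); rewrite [`|b - a|]distrC => h3 h4;
  have := normr_ge0 (a - b) => h5; lra.
Qed.

Lemma indicator_dist_le1 (R : realType) (b : bool) (a : R) : 0 <= a <= 1 -> `|b%:R - a| <= 1.
Proof. by move=> /andP[? ?]; apply: ler_dist_le; case: b => /=; lra. Qed.

Section L2_theory.
Context {d : measure_display} {T : measurableType d} {R : realType}.
Variable mu : {measure set T -> \bar R}.
Local Notation mR := (measurableTypeR R).
Local Notation L2 := (L2 mu).
Implicit Types f g h : L2.

Lemma L2_Lfun f : (L2_repr f : T -> R) \in Lfun mu 2%:R%:E.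
Proof. exact: LfunP. Qed.

Lemma measurable_repr f : measurable_fun [set: T] (L2_repr f : T -> mR).
Proof. by have := L2_Lfun f => /andP[] /[!inE]. Qed.

Lemma Lfun2P (f : T -> R) : measurable_fun [set: T] (f : T -> mR) ->
  (\int[mu]_x (f x ^+ 2)%:E < +oo)%E -> f \in Lfun mu 2%:R%:E.
Proof.
move=> mf f2; apply/andP; split; rewrite inE //=.
rewrite /finite_norm unlock; apply: poweR_lty.
rewrite (eq_integral (fun x => (f x ^+ 2)%:E)) // => x _ /=.
by rewrite powR_mulrn // real_normK // num_real.
Qed.

Let p1 := lee1n 2 : (1 <= 2%:R%:E :> \bar R)%E.

Lemma Lfun2D (f g : T -> R) : f \in Lfun mu 2%:R%:E -> g \in Lfun mu 2%:R%:E ->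
  (fun x => f x + g x) \in Lfun mu 2%:R%:E.
Proof. by move=> f2 g2; exact: (LfunP (Lfun_Sub p1 f2 + Lfun_Sub p1 g2)). Qed.

Lemma toL2K (f : T -> R) : f \in Lfun mu 2%:R%:E ->
  (L2_repr (toL2 mu f) : T -> R) = f %[ae mu].
Proof. by move=> f2; rewrite /toL2; case: pselect => // fL; exact: L2_classK. Qed.

Lemma eq_L2 f g : (L2_repr f : T -> R) = (L2_repr g : T -> R) %[ae mu] -> f = g.
Proof. by move=> fg; rewrite -(L2_reprK f) -(L2_reprK g); apply/L2_classP. Qed.

Lemma L2_reprD f g : (L2_repr (f + g) : T -> R) = (fun x => L2_repr f x + L2_repr g x) %[ae mu].
Proof. exact: L2_classK. Qed.

Lemma L2_reprZ a f : (L2_repr (a *: f) : T -> R) = (fun x => a * L2_repr f x) %[ae mu].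
Proof. exact: L2_classK. Qed.

Lemma integrable_mul2 (f g : T -> R) : f \in Lfun mu 2%:R%:E -> g \in Lfun mu 2%:R%:E ->
  mu.-integrable setT (EFin \o (fun x => f x * g x)).
Proof. by move=> f2 g2; apply/Lfun1_integrable; exact: (Lfun2_mul_Lfun1 f2 g2). Qed.

Lemma ipL2_ae f g (f' g' : T -> R) :
  measurable_fun [set: T] (f' : T -> mR) -> measurable_fun [set: T] (g' : T -> mR) ->
  (L2_repr f : T -> R) = f' %[ae mu] -> (L2_repr g : T -> R) = g' %[ae mu] ->
  ipL2 f g = (\int[mu]_x (f' x * g' x))%R.
Proof.
move=> mf mg ff gg; apply: ae_eq_Rintegral.
- by apply: measurable_funM; exact: measurable_repr.
- exact: measurable_funM.
by apply: filterS2 ff gg => x /(_ I) -> /(_ I) ->.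
Qed.

Lemma ipL2_toL2 (f g : T -> R) : f \in Lfun mu 2%:R%:E -> g \in Lfun mu 2%:R%:E ->
  ipL2 (toL2 mu f) (toL2 mu g) = (\int[mu]_x (f x * g x))%R.
Proof.
move=> f2 g2; apply: ipL2_ae; try exact: toL2K.
- by have := f2 => /andP[] /[!inE].
- by have := g2 => /andP[] /[!inE].
Qed.

Lemma ipL2P : inner_product (@ipL2 d T R mu).
Proof.
split=> [f g|f g h|a f g|f].
- by apply: eq_Rintegral => x _; rewrite mulrC.
- rewrite -RintegralD //; try (apply: integrable_mul2; exact: L2_Lfun).
  under [RHS]eq_Rintegral do rewrite -mulrDl.
  apply: ipL2_ae; [| |exact: L2_reprD|exact: nearW]; last exact: measurable_repr.
  by apply: measurable_funD; exact: measurable_repr.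
- rewrite -RintegralZl //; last by apply: integrable_mul2; exact: L2_Lfun.
  under [RHS]eq_Rintegral do rewrite mulrA.
  apply: ipL2_ae; [| |exact: L2_reprZ|exact: nearW]; last exact: measurable_repr.
  by apply: measurable_funM => //; exact: measurable_repr.
- by apply: Rintegral_ge0 => x _; rewrite -expr2 sqr_ge0.
Qed.

Lemma normL2P : seminorm (@normL2 d T R mu).
Proof. exact: ip_seminorm ipL2P. Qed.

Lemma EFin_ipL2 f : ((ipL2 f f)%:E = \int[mu]_x (L2_repr f x ^+ 2)%:E)%E.
Proof.
rewrite /ipL2 /Rintegral fineK; last first.
  by apply: integrable_fin_num => //; apply: integrable_mul2; exact: L2_Lfun.
by apply: eq_integral => x _; rewrite expr2.
Qed.

Lemma normL2_eq0 f : normL2 f = 0 -> f = 0.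
Proof.
move=> /eqP; rewrite sqrtr_eq0 => f0.
have {}f0 : ipL2 f f = 0 by apply/eqP; rewrite eq_le f0 (ip_ge0 ipL2P).
have := EFin_ipL2 f; rewrite f0 => /esym.
under eq_integral do rewrite -[(_ ^+ 2)%:E]gee0_abs ?lee_fin ?sqr_ge0 //.
have m2 : measurable_fun [set: T] (fun x => (L2_repr f x ^+ 2)%:E).
  by apply/measurable_EFinP; apply: measurable_funX; exact: measurable_repr.
move=> /(ae_eq_integral_abs mu measurableT m2) e0.
apply: eq_L2; apply: (ae_eq_trans (g := fun=> 0)); last exact/ae_eq_sym/L2_classK.
apply: filterS e0 => x /(_ I) /eqP; rewrite eqe sqrf_eq0 => /eqP -> //.
Qed.

End L2_theory.

(** * Cauchy sequences and completeness of the energy space *)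

Section geometric_increments.
Context {R : realType} {V : lmodType R} (nrm : V -> R).
Hypothesis nrmP : seminorm nrm.

Definition ncauchy (f : nat -> V) : Prop := forall e, 0 < e ->
  exists N, forall m n, (N <= m)%N -> (N <= n)%N -> nrm (f m - f n) < e.

Lemma geometric_increments (f : nat -> V) C th : 0 <= th < 1 ->
  (forall k, nrm (f k.+1 - f k) <= C * th ^+ k) ->
  forall m n, (n <= m)%N -> nrm (f m - f n) <= C * th ^+ n / (1 - th).
Proof.
move=> /andP[th0 th1] h m n /subnKC <-.
have th1' : 0 < 1 - th by rewrite subr_gt0.
have C0 : 0 <= C by have := h 0; rewrite expr0 mulr1; apply: le_trans; exact: semi_ge0.
(* The induction on m - n closes with the exact partial geometric sum, not with its limit. *)
suff : nrm (f (n + (m - n))%N - f n) <= C * (th ^+ n - th ^+ (n + (m - n))) / (1 - th).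
  move=> /le_trans; apply; rewrite ler_pM2r ?invr_gt0 // ler_wpM2l //.
  by rewrite gerBl exprn_ge0.
elim: (m - n)%N => [|k IH]; first by rewrite addn0 !subrr semi0 // mulr0 mul0r.
rewrite addnS; apply: le_trans (semi_triangle nrmP (f (n + k)%N) _ _) _.
apply: le_trans (lerD (h _) IH) _; rewrite le_eqVlt; apply/orP; left; apply/eqP.
by rewrite exprS; field; rewrite subr_eq0 eq_sym lt_eqF.
Qed.

Lemma geometric_cauchy (f : nat -> V) C th : 0 <= th < 1 ->
  (forall k, nrm (f k.+1 - f k) <= C * th ^+ k) -> ncauchy f.
Proof.
move=> th01 h e e0; have [th0 th1] := andP th01.
have g0 : (fun n => C / (1 - th) * th ^+ n) @ \oo --> (0 : R).
  by apply: (@cvg_geometric _ _ th); rewrite ger0_norm.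
have [N hN] := cvg0_ex g0 e0; exists N => m n Nm Nn.
wlog nm : m n Nm Nn / (n <= m)%N => [hw|].
  by have [/hw|/ltnW/hw] := leqP n m; [exact|rewrite semiBC //; exact].
apply: le_lt_trans (geometric_increments th01 h nm) _.
by rewrite mulrAC; exact: hN.
Qed.

(** The rapidly converging subsequence of the Riesz-Fischer argument. The running maximum in [phi]
    makes it monotone, and the term j inside it keeps [phi k] above k. *)
Lemma ncauchy_subseq (f : nat -> V) : ncauchy f -> forall e : nat -> R,
  (forall k, 0 < e k) -> exists phi : nat -> nat,
  [/\ forall k, (k <= phi k)%N, forall k, (phi k <= phi k.+1)%N &
      forall k m, (phi k <= m)%N -> nrm (f m - f (phi k)) < e k].
Proof.
move=> fc e e0; have [N hN] := choice (fun k => fc _ (e0 k)).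
pose phi k := (\max_(j < k.+1) maxn j (N j))%N.
have geN k : (maxn k (N k) <= phi k)%N.
  by rewrite /phi big_ord_recr /=; exact: leq_maxr.
exists phi; split=> [k|k|k m km].
- by apply: leq_trans (geN k); exact: leq_maxl.
- by rewrite [phi k.+1]big_ord_recr /=; exact: leq_maxl.
have Nk : (N k <= phi k)%N by apply: leq_trans (geN k); exact: leq_maxr.
by apply: hN => //; exact: leq_trans km.
Qed.

Lemma ncauchy_cvg (f : nat -> V) l phi : ncauchy f -> (forall k, (k <= phi k)%N) ->
  ncvg nrm (f \o phi) l -> ncvg nrm f l.
Proof.
move=> fc kphi fl; apply/cvgrPdist_lt => e e0.
have e2 : 0 < e / 2 by rewrite divr_gt0.
have [N1 h1] := fc _ e2; have [N2 h2] := cvg0_ex fl e2.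
exists N1 => // n /= N1n; rewrite sub0r normrN ger0_norm ?semi_ge0 //.
apply: le_lt_trans (semi_triangle nrmP (f (phi (maxn N1 N2))) _ _) _.
rewrite [e]splitr; apply: ltrD; last by apply: h2; exact: leq_maxr.
by apply: h1 => //; apply: leq_trans (kphi _); exact: leq_maxl.
Qed.

End geometric_increments.

Section measure_convergence.
Context {d : measure_display} {T : measurableType d} {R : realType}.
Variable mu : {measure set T -> \bar R}.
Local Notation mR := (measurableTypeR R).

Lemma real_seminorm : @seminorm R R^o Num.norm.
Proof. by split=> [u v|a u]; [exact: ler_normD|exact: normrM]. Qed.

Lemma real_ncauchy_cvg (a : nat -> R) : @ncauchy R R^o Num.norm a -> exists l : R, a @ \oo --> l.
Proof.
move=> ac; suff : cvg (a @ \oo) by exists (lim (a @ \oo)).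
apply: cauchy_cvg; apply/cauchy_exP => e e0; have [N hN] := ac _ e0.
by exists (a N), N => // n /= Nn; rewrite /ball /=; exact: hN.
Qed.

Lemma nneseries_le (u : nat -> \bar R) c : (forall k, 0 <= u k)%E ->
  (forall n, \sum_(0 <= k < n) u k <= c)%E -> (\sum_(0 <= k <oo) u k <= c)%E.
Proof.
move=> u0 uc; apply: lime_le; last exact: nearW.
by apply: is_cvg_nneseries => k _ _.
Qed.

Lemma nneseries_ge_term (u : nat -> \bar R) n : (forall k, 0 <= u k)%E ->
  (u n <= \sum_(0 <= k <oo) u k)%E.
Proof.
move=> u0; apply: le_trans (nneseries_lim_ge n.+1 _) => //.
by rewrite big_nat_recr //= leeDr // sume_ge0.
Qed.

Lemma fatou_le (g_ : nat -> T -> R) (g : T -> R) (c : \bar R) :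
  (forall n, measurable_fun [set: T] (g_ n : T -> mR)) -> (forall n x, 0 <= g_ n x) ->
  (forall x, g_ ^~ x @ \oo --> g x) ->
  (\forall n \near \oo, (\int[mu]_x (g_ n x)%:E <= c)%E) ->
  (\int[mu]_x (g x)%:E <= c)%E.
Proof.
move=> mg g0 gg gc.
have := @fatou _ _ _ mu setT measurableT (fun n x => (g_ n x)%:E).
have -> : (fun x => limn_einf ((fun n x => (g_ n x)%:E)^~ x)) = (fun x => (g x)%:E).
  apply/funext => x; have /cvg_limn_einf_sup[-> _] // : (fun n => (g_ n x)%:E) @ \oo --> (g x)%:E.
  by apply/fine_cvgP; split; [exact: nearW|exact: gg].
move=> h; apply: le_trans (h _ _) _; rewrite ?lee_fin //.
- by move=> n; apply/measurable_EFinP; exact: mg.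
- by move=> n x _; rewrite lee_fin.
- rewrite limn_einf_lim; apply: lime_le; first exact: is_cvg_einfs.
  apply: filterS gc => n; apply: le_trans.
  by apply: ereal_inf_lbound; exists n => /=.
Qed.

(** A quantitative Borel-Cantelli argument: the series of th^-k g_k has integral at most M / (1 -
    rho), so it is finite almost everywhere and bounds each of its terms. The decay is split in two:
    rho pays for summability, th survives as the pointwise rate. *)
Lemma ae_geometric_bound (g : nat -> T -> R) (M rho th : R) :
  (forall k, measurable_fun [set: T] (g k : T -> mR)) -> (forall k x, 0 <= g k x) ->
  0 < th -> 0 <= rho < 1 ->
  (forall k, (\int[mu]_x (g k x)%:E <= (M * rho ^+ k * th ^+ k)%:E)%E) ->
  \forall x \ae mu, exists C, forall k, g k x <= C * th ^+ k.
Proof.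
move=> mg g0 th0 /andP[rho0 rho1] gM.
pose F k x := (th ^- k * g k x)%:E.
have F0 k x : (0 <= F k x)%E by rewrite lee_fin mulr_ge0 // invr_ge0 exprn_ge0 // ltW.
have mF k : measurable_fun [set: T] (F k) by apply/measurable_EFinP; apply: measurable_funM => //; exact: mg.
have mS : measurable_fun [set: T] (fun x => \sum_(0 <= k <oo) F k x)%E.
  exact: ge0_emeasurable_sum.
have S0 x : (0 <= \sum_(0 <= k <oo) F k x)%E by exact: nneseries_ge0.
have iS : (\int[mu]_x (\sum_(0 <= k <oo) F k x) < +oo)%E.
  rewrite integral_nneseries //.
  apply: le_lt_trans (_ : (\sum_(0 <= k <oo) (M * rho ^+ k)%:E < +oo)%E).
    apply: lee_nneseries => k _; first by move=> _; exact: integral_ge0.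
    rewrite /F; under eq_integral do rewrite EFinM.
    rewrite ge0_integralZl_EFin //; last 3 first.
    - by move=> x _; rewrite lee_fin.
    - by apply/measurable_EFinP; exact: mg.
    - by rewrite invr_ge0 exprn_ge0 // ltW.
    have e : M * rho ^+ k = th ^- k * (M * rho ^+ k * th ^+ k).
      by rewrite mulrCA mulVf ?mulr1 // expf_neq0 // gt_eqF.
    by rewrite e EFinM; apply: lee_wpmul2l; rewrite ?lee_fin ?invr_ge0 ?exprn_ge0 // ltW.
  apply: le_lt_trans (ltry (M / (1 - rho))).
  have M0 : 0 <= M.
    have := gM 0%N; rewrite !expr0 !mulr1 -lee_fin; apply: le_trans.
    by apply: integral_ge0 => x _; rewrite lee_fin.
  apply: nneseries_le => [k|n]; first by rewrite lee_fin mulr_ge0 // exprn_ge0.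
  rewrite sumEFin lee_fin -mulr_sumr ler_wpM2l // big_mkord.
  have r1 : 0 < 1 - rho by rewrite subr_gt0.
  rewrite -(@ler_pM2l _ (1 - rho)) // mulfV ?gt_eqF //.
  by rewrite -[1 - rho]opprB mulNr -subrX1 opprB gerBl exprn_ge0.
have /integrable_ae : mu.-integrable setT (fun x => \sum_(0 <= k <oo) F k x)%E.
  by apply/integrableP; split => //; under eq_integral do rewrite gee0_abs //.
move=> /(_ measurableT); apply: filterS => x /(_ I) fS.
exists (fine (\sum_(0 <= k <oo) F k x)%E) => k.
rewrite -ler_pdivrMr ?exprn_gt0 // mulrC -lee_fin fineK //.
exact: (nneseries_ge_term (u := fun k => F k x)).
Qed.

End measure_convergence.

Section L2_completeness.
Context {d : measure_display} {T : measurableType d} {R : realType}.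
Variable mu : {measure set T -> \bar R}.
Local Notation mR := (measurableTypeR R).
Local Notation L2 := (L2 mu).

Lemma EFin_sqr_normL2 (f : L2) (g : T -> R) : measurable_fun [set: T] (g : T -> mR) ->
  (L2_repr f : T -> R) = g %[ae mu] ->
  ((normL2 f ^+ 2)%:E = \int[mu]_x (g x ^+ 2)%:E)%E.
Proof.
move=> mg fg; rewrite (sqr_pnorm (ipL2P mu)) EFin_ipL2.
apply: ae_eq_integral => //.
- by apply/measurable_EFinP; apply: measurable_funX; exact: measurable_repr.
- by apply/measurable_EFinP; exact: measurable_funX.
by apply: filterS fg => x /(_ I) -> _.
Qed.

Lemma L2_reprB (f g : L2) :
  (L2_repr (f - g) : T -> R) = (fun x => L2_repr f x - L2_repr g x) %[ae mu].
Proof.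
apply: (ae_eq_trans (L2_reprD _ _)); rewrite -scaleN1r.
by apply: filterS (L2_reprZ (-1) g) => x /(_ I) -> _; rewrite mulN1r.
Qed.

(** Riesz-Fischer. A rapidly converging subsequence converges almost everywhere, Fatou's lemma turns
    the pointwise limit into an L^2 limit, and the Cauchy property carries it to the whole
    sequence. *)
Lemma L2_complete (f : nat -> L2) : ncauchy (@normL2 d T R mu) f ->
  exists l, ncvg (@normL2 d T R mu) f l.
Proof.
move=> fc; have q0 k : 0 < 4^-1 ^+ k :> R by rewrite exprn_gt0 // invr_gt0.
have [phi [kphi incphi hphi]] := ncauchy_subseq fc q0.
pose v k : T -> R := L2_repr (f (phi k)).
have mv k : measurable_fun [set: T] (v k : T -> mR) by exact: measurable_repr.
have vB k m (g : T -> R) : measurable_fun [set: T] (g : T -> mR) ->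
    (fun x => v k x - v m x) = g %[ae mu] ->
    (\int[mu]_x (g x ^+ 2)%:E = (normL2 (f (phi k) - f (phi m)) ^+ 2)%:E)%E.
  by move=> mg h; rewrite (EFin_sqr_normL2 mg) //; exact: ae_eq_trans (L2_reprB _ _) h.
(* The squared increments have integral at most 4^-k * 4^-k; one factor is spent on summability, the
   other bounds the squared increments pointwise, hence the increments by a multiple of 2^-k. *)
have [N [mN N0 sN]] : \forall x \ae mu, exists C, forall k, (v k.+1 x - v k x) ^+ 2 <= C * 4^-1 ^+ k.
  apply: (ae_geometric_bound (M := 1) (rho := 4^-1)) => //.
  - by move=> k; apply: measurable_funX; exact: measurable_funB.
  - by move=> k x; exact: sqr_ge0.
  - by rewrite invr_ge0 invf_lt1 // ler0n ltr1n.
  move=> k; rewrite (vB k.+1 k (fun x => v k.+1 x - v k x)); [|exact: measurable_funB|exact: nearW].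
  rewrite lee_fin mul1r -expr2 ler_pXn2r ?nnegrE ?(ltW (q0 k)) ?sqrtr_ge0 //.
  by apply: ltW; exact: hphi.
(* Setting the sequence to 0 on the exceptional null set makes it converge everywhere, so that its
   limit is measurable. *)
pose w k x := \1_(~` N) x * v k x.
have mw k : measurable_fun [set: T] (w k : T -> mR).
  by apply: measurable_funM => //; apply/measurable_indicP; exact: measurableC.
have wv k : v k = w k %[ae mu].
  exists N; split=> // x; apply: contra_notP => Nx _.
  by rewrite /w indicE mem_set // mul1r.
have /choice[l wl] : forall x, exists y : R, w ^~ x @ \oo --> y.
  move=> x; have [Nx|Nx] := pselect (N x).
    exists 0; rewrite (_ : w^~ x = fun=> 0); first exact: cvg_cst.
    by apply/funext => k; rewrite /w indicE memNset ?mul0r //; exact.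
  have [C hC] : exists C, forall k, (v k.+1 x - v k x) ^+ 2 <= C * 4^-1 ^+ k.
    by apply: contrapT => h; apply: Nx; exact: sN.
  have -> : w^~ x = v^~ x by apply/funext => k; rewrite /w indicE mem_set ?mul1r.
  apply/real_ncauchy_cvg/(geometric_cauchy real_seminorm (C := Num.sqrt C) (th := 2^-1)).
    by rewrite invr_ge0 invf_lt1 // ler0n ltr1n.
  move=> k; rewrite -sqrtr_sqr; apply: le_trans (ler_wsqrtr (hC k)) _.
  have C0 : 0 <= C by have := hC 0%N; rewrite mulr1; apply: le_trans; exact: sqr_ge0.
  have -> : 4^-1 = 2^-1 ^+ 2 :> R by field.
  by rewrite exprAC sqrtrM // sqrtr_sqr ger0_norm // exprn_ge0 // invr_ge0.
have ml : measurable_fun [set: T] (l : T -> mR).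
  by apply: (measurable_fun_cvg mw) => x _; exact: wl.
have bound k : (\int[mu]_x ((l x - w k x) ^+ 2)%:E <= (4^-1 ^+ k ^+ 2)%:E)%E.
  apply: (fatou_le (g_ := fun m x => (w m x - w k x) ^+ 2)).
  - by move=> m; apply: measurable_funX; apply: measurable_funB => //; exact: mw.
  - by move=> m x; exact: sqr_ge0.
  - move=> x; have h : (fun m => w m x - w k x) @ \oo --> l x - w k x.
      by apply: cvgB; [exact: wl|exact: cvg_cst].
    exact: (cvgM h h).
  exists k => // m /= km; rewrite (vB m k); [|by apply: measurable_funB; exact: mw|].
    rewrite lee_fin ler_pXn2r ?nnegrE ?(ltW (q0 k)) ?sqrtr_ge0 //.
    apply: ltW; apply: hphi; elim: m km => [|m IH]; first by rewrite leqn0 => /eqP ->.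
    by rewrite leq_eqVlt => /predU1P[->//|/IH/leq_trans]; apply.
  by apply: filterS2 (wv m) (wv k) => x /(_ I) -> /(_ I) ->.
have l2 : l \in Lfun mu 2%:R%:E.
  have lw : (fun x => l x - w 0%N x) \in Lfun mu 2%:R%:E.
    apply: Lfun2P; first by apply: measurable_funB => //; exact: mw.
    by apply: le_lt_trans (bound 0%N) _; rewrite ltry.
  have w2 : w 0%N \in Lfun mu 2%:R%:E.
    apply: Lfun2P; first exact: mw.
    rewrite -(EFin_sqr_normL2 (mw 0%N) (wv 0%N)); exact: ltry.
  have -> : l = (fun x => l x - w 0%N x) \+ w 0%N by apply/funext => x /=; rewrite subrK.
  exact: Lfun2D.
exists (toL2 mu l); apply: (ncauchy_cvg (normL2P mu) fc kphi).
apply: (cvg0_le (c := fun k => 4^-1 ^+ k)); last first.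
  by apply: cvg_expr0; rewrite invr_ge0 invf_lt1 // ler0n ltr1n.
move=> k; rewrite sqrtr_ge0 /=.
rewrite -(@ler_pXn2r _ 2) ?nnegrE ?(ltW (q0 k)) ?sqrtr_ge0 // -lee_fin.
rewrite (@EFin_sqr_normL2 _ (fun x => w k x - l x)); last 2 first.
- by apply: measurable_funB => //; exact: mw.
- apply: (ae_eq_trans (L2_reprB _ _)).
  by apply: filterS2 (wv k) (toL2K l2) => x /(_ I) h /(_ I) -> _; rewrite -h.
under eq_integral do rewrite -sqrrN opprB; exact: bound.
Qed.

End L2_completeness.

Section energy_space_theory.
Context {R : realType} (lo hi : R3 R).
Local Notation L2D := (L2 (muD lo hi)).
Local Notation HH := (HH lo hi).
Local Notation normH := (@normH R lo hi).
Local Notation ipH := (@ipH R lo hi).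
Implicit Types u v w : HH.

Lemma HH1D u v i : (u + v).1 i = u.1 i + v.1 i.
Proof. by rewrite -[LHS]/((u.1 + v.1) i) ffunE. Qed.
Lemma HH2D u v i : (u + v).2 i = u.2 i + v.2 i.
Proof. by rewrite -[LHS]/((u.2 + v.2) i) ffunE. Qed.
Lemma HH1Z a u i : (a *: u).1 i = a *: u.1 i.
Proof. by rewrite -[LHS]/((a *: u.1) i) ffunE. Qed.
Lemma HH2Z a u i : (a *: u).2 i = a *: u.2 i.
Proof. by rewrite -[LHS]/((a *: u.2) i) ffunE. Qed.
Lemma HH1B u v i : (u - v).1 i = u.1 i - v.1 i.
Proof. by rewrite HH1D -scaleN1r HH1Z scaleN1r. Qed.
Lemma HH2B u v i : (u - v).2 i = u.2 i - v.2 i.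
Proof. by rewrite HH2D -scaleN1r HH2Z scaleN1r. Qed.

Lemma ipHP : inner_product ipH.
Proof.
have ipP := ipL2P (muD lo hi).
split=> [u v|u v w|a u v|u]; rewrite /Defs.ipH.
- by congr (_ + _); apply: eq_bigr => i _; rewrite (ipC ipP).
- under eq_bigr do rewrite HH1D (ipDl ipP); rewrite big_split.
  under [X in _ + X]eq_bigr do rewrite HH2D (ipDl ipP); rewrite big_split.
  exact: addrACA.
- rewrite mulrDr !mulr_sumr.
  by congr (_ + _); apply: eq_bigr => i _; rewrite ?HH1Z ?HH2Z (ipZl ipP).
- by rewrite addr_ge0 // sumr_ge0 // => i _; exact: (ip_ge0 ipP).
Qed.

Lemma normHP : seminorm normH.
Proof. exact: ip_seminorm ipHP. Qed.

Lemma normH_ge0 u : 0 <= normH u. Proof. exact: (semi_ge0 normHP). Qed.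
Lemma normH0 : normH 0 = 0. Proof. exact: (semi0 normHP). Qed.
Lemma normHZ a u : normH (a *: u) = `|a| * normH u. Proof. exact: (semiZ normHP). Qed.
Lemma normHBC u v : normH (u - v) = normH (v - u). Proof. exact: (semiBC normHP). Qed.
Lemma normHD u v : normH (u + v) <= normH u + normH v. Proof. exact: (semiD normHP). Qed.
Lemma normHB u v : normH (u - v) <= normH u + normH v. Proof. exact: (semiB normHP). Qed.
Lemma normH_triangle v u w : normH (u - w) <= normH (u - v) + normH (v - w).
Proof. exact: (semi_triangle normHP). Qed.
Lemma normH_dist u v : `|normH u - normH v| <= normH (u - v).
Proof. exact: (semi_dist normHP). Qed.

Lemma sqr_normH u : normH u ^+ 2 = ipH u u.
Proof. exact: (sqr_pnorm ipHP). Qed.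

Lemma sqr_normL2 (f : L2D) : normL2 f ^+ 2 = ipL2 f f.
Proof. exact: (sqr_pnorm (ipL2P _)). Qed.

Lemma normL2_le_normH u i : normL2 (u.1 i) <= normH u /\ normL2 (u.2 i) <= normH u.
Proof.
have ge0 (f : L2D) := ip_ge0 (ipL2P (muD lo hi)) f.
split; apply: ler_wsqrtr; rewrite /Defs.ipH (bigD1 i) //=.
  by rewrite -addrA lerDl addr_ge0 // sumr_ge0.
by rewrite [X in _ <= _ + X](bigD1 i) //= addrCA lerDl !addr_ge0 // sumr_ge0.
Qed.

Lemma normH_le_sum u : normH u <= \sum_i normL2 (u.1 i) + \sum_i normL2 (u.2 i).
Proof.
have n0 (f : L2D) : 0 <= normL2 f by exact: sqrtr_ge0.
have s0 (F : 'I_3 -> L2D) : 0 <= \sum_i normL2 (F i) by exact: sumr_ge0.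
rewrite -(@ler_pXn2r _ 2) ?nnegrE ?addr_ge0 ?sqrtr_ge0 // sqr_normH /Defs.ipH.
have h (F : 'I_3 -> L2D) : \sum_i ipL2 (F i) (F i) <= (\sum_i normL2 (F i)) ^+ 2.
  under eq_bigr do rewrite -sqr_normL2.
  suff [] : (\sum_i normL2 (F i) ^+ 2 <= (\sum_i normL2 (F i)) ^+ 2) /\ 0 <= \sum_i normL2 (F i) by [].
  elim/big_ind2: _ => [|a b a' b' [h1 h2] [h3 h4]|i _].
  - by rewrite expr0n.
  - split; last exact: addr_ge0.
    rewrite sqrrD; apply: le_trans (lerD h1 h3) _.
    by rewrite -addrA [X in _ <= _ + X]addrC addrA lerDl mulrn_wge0 // mulr_ge0.
  - by rewrite lexx.
apply: le_trans (lerD (h _) (h _)) _.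
by rewrite sqrrD -addrA [X in _ <= _ + X]addrC addrA lerDl mulrn_wge0 // mulr_ge0.
Qed.

Lemma normH_eq0 u : normH u = 0 -> u = 0.
Proof.
move=> u0; case: u u0 => u1 u2 u0; congr (_, _); apply/ffunP => i; rewrite ffunE.
  apply: normL2_eq0; apply/eqP; rewrite eq_le sqrtr_ge0 andbT -u0.
  exact: (normL2_le_normH (u1, u2) i).1.
apply: normL2_eq0; apply/eqP; rewrite eq_le sqrtr_ge0 andbT -u0.
exact: (normL2_le_normH (u1, u2) i).2.
Qed.

Lemma ncvg_coords (f : nat -> HH) u :
  (forall i, ncvg (@normL2 _ _ _ (muD lo hi)) (fun n => (f n).1 i) (u.1 i)) ->
  (forall i, ncvg (@normL2 _ _ _ (muD lo hi)) (fun n => (f n).2 i) (u.2 i)) ->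
  ncvg normH f u.
Proof.
move=> f1 f2; apply: (cvg0_le (c := fun n => \sum_i normL2 ((f n).1 i - u.1 i)
    + \sum_i normL2 ((f n).2 i - u.2 i))).
  move=> n; rewrite sqrtr_ge0 /=; apply: le_trans (normH_le_sum _) _.
  by apply: lerD; apply: ler_sum => i _; rewrite -?HH1B -?HH2B.
have c0 (F : nat -> 'I_3 -> R) : (forall i, F ^~ i @ \oo --> (0 : R)) ->
    (fun n => \sum_i F n i) @ \oo --> (0 : R).
  move=> F0; have h : (fun n => \sum_i F n i) @ \oo --> \sum_(i < 3) (0 : R) by apply: cvg_bigsum.
  by rewrite big1_eq in h.
by rewrite -[0 in X in _ --> X]addr0; apply: cvgD; apply: c0.
Qed.

Lemma HH_complete (f : nat -> HH) : ncauchy normH f -> exists u, ncvg normH f u.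
Proof.
move=> fc.
have /choice[u1 hu1] i : exists l, ncvg (@normL2 _ _ _ (muD lo hi)) (fun n => (f n).1 i) l.
  apply: L2_complete => e /fc[N hN]; exists N => m n Nm Nn.
  apply: le_lt_trans (hN m n Nm Nn); have := (normL2_le_normH (f m - f n) i).1.
  by rewrite HH1B.
have /choice[u2 hu2] i : exists l, ncvg (@normL2 _ _ _ (muD lo hi)) (fun n => (f n).2 i) l.
  apply: L2_complete => e /fc[N hN]; exists N => m n Nm Nn.
  apply: le_lt_trans (hN m n Nm Nn); have := (normL2_le_normH (f m - f n) i).2.
  by rewrite HH2B.
exists ([ffun i => u1 i], [ffun i => u2 i]).
by apply: ncvg_coords => i; rewrite /= ffunE.
Qed.

End energy_space_theory.

(** * Borel sets of the energy space and Lipschitz test functions *)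

Section borel_structure.
Context {R : realType} {lo hi : R3 R}.
Local Notation V := (HH lo hi).
Local Notation nrm := (@normH R lo hi).
Local Notation mR := (measurableTypeR R).
Local Notation B := (borelH lo hi).

Definition lipschitz_norm (L : R) (psi : V -> R) : Prop :=
  forall x y, `|psi x - psi y| <= L * nrm (x - y).

Definition seq_continuous (psi : V -> R) : Prop :=
  forall f x, ncvg nrm f x -> psi \o f @ \oo --> psi x.

Lemma lipschitz_seq_continuous L psi : lipschitz_norm L psi -> seq_continuous psi.
Proof.
move=> psiL f x fx; apply: (cvg_dist_le (c := fun n => L * nrm (f n - x))).
  by move=> n; exact: psiL.
by rewrite -[0 in X in _ --> X](mulr0 L); apply: cvgM => //; exact: cvg_cst.
Qed.

Lemma norm_open_measurable (U : set V) : norm_open nrm U -> measurable (U : set B).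
Proof. exact: sub_sigma_algebra. Qed.

Lemma measurable_funR_gt d (T : measurableType d) (f : T -> R) :
  (forall a, measurable [set t | a < f t]) -> measurable_fun [set: T] (f : T -> mR).
Proof.
move=> fa; apply: (measurability (@RGenOInfty.G R)); first exact: RGenOInfty.measurableE.
move=> _ [_ [a ->] <-]; rewrite setTI.
rewrite (_ : _ @^-1` _ = [set t | a < f t]) //.
by apply/funext => t /=; rewrite in_itv /= andbT.
Qed.

Lemma measurable_lipschitz L psi : lipschitz_norm L psi ->
  measurable_fun [set: B] (psi : B -> mR).
Proof.
move=> psiL; apply: measurable_funR_gt => a; apply: norm_open_measurable => x /= ax.
have L1 : 0 < `|L| + 1 by rewrite ltr_wpDl.
exists ((psi x - a) / (`|L| + 1)) => [|y]; first by rewrite divr_gt0 ?subr_gt0.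
rewrite ltr_pdivlMr ?L1 // => yx.
have := psiL y x; rewrite ler_norml => /andP[h _].
have : L * nrm (y - x) <= nrm (y - x) * (`|L| + 1).
  by rewrite mulrC ler_wpM2l ?normH_ge0 // (le_trans (ler_norm _)) // lerDl.
move=> h2; move: yx h h2; set p := nrm _ * _; set q := L * _ => yx h h2; lra.
Qed.

(** The distance to the complement of U. It is meaningful only if that complement is nonempty, which
    is the purpose of the point [y0] below; the whole space is always treated apart. *)
Definition dist_compl (U : set V) (x : V) : R := inf [set nrm (x - y) | y in ~` U].

Section dist_compl_theory.
Variable U : set V.
Hypothesis Uopen : norm_open nrm U.
Variable y0 : V.
Hypothesis y0U : ~ U y0.

Let has x : has_inf [set nrm (x - y) | y in ~` U].
Proof.
split; first by exists (nrm (x - y0)), y0.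
by exists 0 => _ [y _ <-]; exact: normH_ge0.
Qed.

Lemma dist_compl_ge0 x : 0 <= dist_compl U x.
Proof. by apply: lb_le_inf; [exact: (has x).1|move=> _ [y _ <-]; exact: normH_ge0]. Qed.

Lemma dist_compl_lipschitz : lipschitz_norm 1 (dist_compl U).
Proof.
have key x y : dist_compl U x <= dist_compl U y + nrm (x - y).
  rewrite -lerBlDr; apply: lb_le_inf; first exact: (has y).1.
  move=> _ [z Uz <-]; rewrite lerBlDr addrC; apply: le_trans (normH_triangle y _ _).
  by apply: ge_inf; [exact: (has x).2|exists z].
by move=> x y; rewrite mul1r; apply: ler_dist_le => //; rewrite normHBC.
Qed.

Lemma dist_compl_gt0 x : U x <-> 0 < dist_compl U x.
Proof.
split=> [/Uopen[e e0 he]|].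
  apply: lt_le_trans e0 _; apply: lb_le_inf; first exact: (has x).1.
  move=> _ [y Uy <-]; rewrite leNgt; apply/negP => xy; apply/Uy/he.
  by rewrite normHBC.
apply: contraTP => Ux; rewrite -leNgt.
by apply: ge_inf; [exact: (has x).2|exists x => //; rewrite subrr normH0].
Qed.

(** Gives access to open sets through bounded Lipschitz functions: at a point of U the distance to
    the complement is positive, so n times it eventually exceeds 1. *)
Lemma open_indicator_approx (psi := fun n x => Num.min 1 (n%:R * dist_compl U x)) :
  [/\ forall n, lipschitz_norm n%:R (psi n), forall n x, 0 <= psi n x <= 1 &
      forall x, psi ^~ x @ \oo --> (\1_U x : R)].
Proof.
split=> [n x y|n x|x].
- have := dist_compl_lipschitz x y; rewrite mul1r => dxy.
  apply: (@le_trans _ _ `|n%:R * dist_compl U x - n%:R * dist_compl U y|).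
    exact: min1_contraction.
  by rewrite -mulrBr normrM ger0_norm // ler_wpM2l.
- have d0 : 0 <= n%:R * dist_compl U x by rewrite mulr_ge0 // dist_compl_ge0.
  by rewrite /psi ge_min lexx le_min ler01 d0.
have [Ux|Ux] := pselect (U x); last first.
  rewrite indicE memNset // (_ : psi^~ x = cst 0); first exact: cvg_cst.
  apply/funext => n; rewrite /psi (_ : dist_compl U x = 0) ?mulr0 ?min_r ?ler01 //.
  apply/eqP; rewrite eq_le dist_compl_ge0 andbT leNgt; apply/negP.
  by move=> /dist_compl_gt0.
rewrite indicE mem_set //; have d0 := (dist_compl_gt0 x).1 Ux.
apply: cvg_near_cst; exists (Num.truncn (dist_compl U x)^-1).+1 => // n /= nd.
rewrite /psi min_l // -ler_pdivrMr // mul1r.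
by apply: le_trans (ltW (truncnS_gt _)) _; rewrite ler_nat.
Qed.

End dist_compl_theory.

(** An open set other than the whole space is where the 1-Lipschitz distance to its complement is
    positive, so its preimage under f is that of a half-line under a real function. *)
Lemma measurable_borel d (T : measurableType d) (f : T -> V) :
  (forall psi, lipschitz_norm 1 psi -> measurable_fun [set: T] (psi \o f : T -> mR)) ->
  measurable_fun [set: T] (f : T -> B).
Proof.
move=> fpsi; apply: (@measurability _ _ _ B setT f (norm_open nrm)) => // _ [U Uo <-].
rewrite setTI; have [->|] := pselect (U = setT); first by rewrite preimage_setT.
move=> UT; have [y0 Uy0] : exists y, ~ U y.
  by apply: contra_notP UT => /forallNP h; apply/seteqP; split=> // x _; apply: contrapT.
have := fpsi _ (dist_compl_lipschitz Uy0) measurableT _ (measurable_itv `]0, +oo[).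
rewrite setTI; congr (measurable _); apply/seteqP; split=> t /=.
  by rewrite in_itv /= andbT => /(dist_compl_gt0 Uo Uy0).
by move=> /(dist_compl_gt0 Uo Uy0); rewrite in_itv /= andbT.
Qed.

Lemma measurable_ncvg d (T : measurableType d) (f : nat -> T -> V) (g : T -> V) :
  (forall n, measurable_fun [set: T] (f n : T -> B)) ->
  (forall t, ncvg nrm (f ^~ t) (g t)) -> measurable_fun [set: T] (g : T -> B).
Proof.
move=> mf fg; apply: measurable_borel => psi psiL.
apply: (measurable_fun_cvg (h := fun n => psi \o f n)) => [n|t _].
  exact: (measurableT_comp (measurable_lipschitz psiL) (mf n)).
exact: (lipschitz_seq_continuous psiL (fg t)).
Qed.

Section separable.
Variable D : nat -> V.
Hypothesis Ddense : forall x e, 0 < e -> exists k, nrm (x - D k) < e.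

Let hk m x : exists k, nrm (x - D k) < 2^-1 ^+ m.
Proof. by apply: Ddense; rewrite exprn_gt0 // invr_gt0. Qed.

(** The first dense point within 2^-m of x: replacing x by it gives countably valued Borel
    approximations of the identity. *)
Let idx m x : nat := ex_minn (hk m x).

Let measurable_idx m k : measurable ([set x | idx m x = k] : set B).
Proof.
have mb j : measurable ([set x | nrm (x - D j) < 2^-1 ^+ m] : set B).
  apply: norm_open_measurable => x /= xj.
  exists (2^-1 ^+ m - nrm (x - D j)); first by rewrite subr_gt0.
  move=> y yx; apply: le_lt_trans (normH_triangle x _ _) _.
  by rewrite -ltrBrDr.
rewrite (_ : [set x | _] = [set x | nrm (x - D k) < 2^-1 ^+ m] `&`
    \bigcap_(j in [set j | (j < k)%N]) ~` [set x | nrm (x - D j) < 2^-1 ^+ m]).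
  apply: measurableI => //; apply: bigcap_measurableType => j _; exact: measurableC.
apply/seteqP; split=> x /=.
  rewrite /idx; case: ex_minnP => j xj jmin <-; split=> // i /= ij /jmin.
  by rewrite leqNgt ij.
move=> [xk kmin]; rewrite /idx; case: ex_minnP => j xj jmin.
apply/eqP; rewrite eqn_leq jmin // leqNgt; apply/negP => jk.
exact: (kmin j jk).
Qed.

Let cvg_idx x : ncvg nrm (fun m => D (idx m x)) x.
Proof.
apply: (cvg0_le (c := fun m => 2^-1 ^+ m)) => [m|]; last first.
  by apply: cvg_expr0; rewrite invr_ge0 invf_lt1 // ler0n ltr1n.
rewrite normH_ge0 //= normHBC /idx; case: ex_minnP => j xj _; exact: ltW.
Qed.

(** Caratheodory functions: with the countably valued approximations of f only countably many
    sections of Psi occur, and continuity in the second variable passes to the limit. Separability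
    thereby replaces a comparison of the Borel sets of a product with the product sigma-algebra. *)
Lemma measurable_caratheodoryR d (T : measurableType d) (Psi : T -> V -> R) (f : T -> V) :
  (forall v, measurable_fun [set: T] (Psi ^~ v : T -> mR)) ->
  (forall t, seq_continuous (Psi t)) ->
  measurable_fun [set: T] (f : T -> B) ->
  measurable_fun [set: T] (fun t => Psi t (f t) : mR).
Proof.
move=> mPsi cPsi mf.
apply: (measurable_fun_cvg (h := fun m t => Psi t (D (idx m (f t))))); last first.
  by move=> t _; exact: (cPsi t _ _ (cvg_idx (f t))).
move=> m _ Y mY; rewrite setTI.
rewrite (_ : _ @^-1` Y = \bigcup_k ((f @^-1` [set x | idx m x = k]) `&` (Psi ^~ (D k) @^-1` Y))).
  apply: bigcupT_measurable => k; apply: measurableI.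
    by rewrite -[X in measurable X]setTI; apply: mf => //; exact: measurable_idx.
  by rewrite -[X in measurable X]setTI; apply: mPsi.
apply/seteqP; split=> t /=; first by move=> Yt; exists (idx m (f t)).
by move=> [k _ [/= -> ]].
Qed.

Lemma measurable_caratheodory d (T : measurableType d) (Psi : T -> V -> V) (f : T -> V) :
  (forall v, measurable_fun [set: T] (Psi ^~ v : T -> B)) ->
  (forall t g x, ncvg nrm g x -> ncvg nrm (Psi t \o g) (Psi t x)) ->
  measurable_fun [set: T] (f : T -> B) ->
  measurable_fun [set: T] (fun t => Psi t (f t) : B).
Proof.
move=> mPsi cPsi mf; apply: measurable_borel => psi psiL.
apply: (measurable_caratheodoryR (Psi := fun t v => psi (Psi t v))) => //.
  by move=> v; exact: (measurableT_comp (measurable_lipschitz psiL) (mPsi v)).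
by move=> t g x gx; exact: (lipschitz_seq_continuous psiL (cPsi t _ _ gx)).
Qed.

End separable.

Section determination.
Local Open Scope ereal_scope.
Variables mu nu : probability B R.

(** Open sets form a generating class stable under intersection, and the measure of an open set is a
    limit of integrals of Lipschitz functions with values in [0, 1]. *)
Lemma eq_probability_lipschitz :
  (forall L psi, (forall x, 0 <= psi x <= 1)%R -> lipschitz_norm L psi ->
     \int[mu]_x (psi x)%:E = \int[nu]_x (psi x)%:E) ->
  forall A, measurable A -> mu A = nu A.
Proof.
move=> h; apply: (@measure_unique _ _ B (norm_open nrm) (fun=> setT)) => //.
- move=> U W Uo Wo x [Ux Wx]; have [e e0 he] := Uo _ Ux; have [e' e'0 he'] := Wo _ Wx.
  exists (Num.min e e')%R => [|y]; first by rewrite lt_min e0.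
  by rewrite lt_min => /andP[/he ? /he' ?].
- by move=> _ x _; exists 1%R.
- by rewrite bigcup_const //; exists 0%N.
- move=> U Uo; have [->|] := pselect (U = setT); first exact: etrans (probability_setT mu) (esym (probability_setT nu)).
  move=> UT; have [y0 Uy0] : exists y, ~ U y.
    by apply: contra_notP UT => /forallNP k; apply/seteqP; split=> // x _; apply: contrapT.
  have [psiL psi01 psicvg] := open_indicator_approx Uo Uy0.
  pose psi n x := Num.min 1%R (n%:R * dist_compl U x)%R.
  have lim (m : probability B R) : (\int[m]_x (psi n x)%:E @[n --> \oo] --> m U).
    rewrite -(setIT U) -integral_indic //; last exact: norm_open_measurable.
    apply: (dominated_cvg_EFin (g := cst 1%R)).
    + by move=> n; exact: measurable_lipschitz (psiL n).
    + by apply/measurable_indicP; exact: norm_open_measurable.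
    + by apply: nearW => x; exact: psicvg.
    + exact: finite_measure_integrable_cst.
    + move=> n x /=; rewrite ger0_norm; by have /andP[] := psi01 n x.
  have cmu := lim mu; rewrite (_ : (fun n => _) = fun n => \int[nu]_x (psi n x)%:E) in cmu.
    exact: (cvg_unique (@ereal_hausdorff R) cmu (lim nu)).
  by apply/funext => n; apply: h (psi01 n) (psiL n).
- by move=> _; apply: (@le_lt_trans _ _ 1%:E); [exact: probability_le1|exact: ltry].
Qed.

End determination.
End borel_structure.

(** * Slicing three-dimensional integrals by lines *)

Section lebesgue_linear.
Context {R : realType}.
Local Notation mR := (measurableTypeR R).
Local Notation lam := (@lebesgue_measure R).

Lemma measurable_affine (a b : R) :
  measurable_fun [set: mR] (fun t : mR => a * t + b : mR).
Proof. by apply: measurable_funD => //; exact: measurable_funM. Qed.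

(** The pushforward under t |-> a t + b, multiplied by a, gives every half-open interval its length,
    so by uniqueness it is Lebesgue measure. *)
Let pos_preimage (a b : R) (A : set mR) : 0 < a -> measurable A ->
  lam [set t | A (a * t + b)] = ((`|a|^-1)%:E * lam A)%E.
Proof.
move=> a0 mA; pose m := mscale (NngNum (ltW a0)) (push lam (measurable_affine a b)).
have -> : lam A = m A.
  apply: lebesgue_measure_unique => // _ [[x y] _ <-].
  rewrite /= /mscale /= /pushforward.
  have -> : (fun t => a * t + b) @^-1` `]x, y] = `](x - b) / a, (y - b) / a]%classic.
    apply/seteqP; split=> t /=; rewrite !in_itv /= ltr_pdivrMr // ler_pdivlMr //;
      by rewrite ltrBlDr lerBrDr mulrC.
  rewrite !lebesgue_measure_itv /= !lte_fin ltr_pM2r ?invr_gt0 // ltrD2r.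
  case: ifPn => xy; last by rewrite mule0.
  rewrite -!EFinD -EFinM; congr EFin; field; exact: lt0r_neq0.
rewrite /m /mscale /= /pushforward gtr0_norm // muleA -EFinM mulVf ?mul1e //.
exact: lt0r_neq0.
Qed.

Lemma lebesgue_affine_preimage (a b : R) (A : set mR) : a != 0 -> measurable A ->
  lam [set t | A (a * t + b)] = ((`|a|^-1)%:E * lam A)%E.
Proof.
move=> a0 mA; have [a_gt0|a_lt0|aE] := ltgtP 0 a; first exact: pos_preimage.
  rewrite -[a in RHS]opprK normrN -(pos_preimage b) ?oppr_gt0 //.
  rewrite -lebesgue_measureN; last first.
    by rewrite -[X in measurable X]setTI; exact: (measurable_affine a b).
  rewrite /pushforward; congr (lam _); apply/seteqP; split => t /=; by rewrite mulrN mulNr.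
by rewrite -aE eqxx in a0.
Qed.

Lemma leb2_shear (al be ga : R) (A : set (mR * mR)) : be != 0 -> measurable A ->
  leb2 R [set z | A (z.1, al * z.1 + be * z.2 + ga)] = ((`|be|^-1)%:E * leb2 R A)%E.
Proof.
move=> be0 mA; rewrite /leb2 /= /product_measure1 -ge0_integralZl //.
- apply: eq_integral => x _ /=.
  rewrite -(lebesgue_affine_preimage (al * x + ga)) //; last exact: measurable_xsection.
  congr (lam _); apply/seteqP; split => y /=; rewrite /xsection /= !inE /= => h;
    by move: h; congr (A (_, _)); rewrite /=; ring.
- exact: measurable_fun_xsection.
Qed.

Lemma leb2_swap (A : set (mR * mR)) : measurable A ->
  leb2 R [set z | A (z.2, z.1)] = leb2 R A.
Proof.
move=> mA; rewrite /leb2 /=.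
rewrite [RHS](@product_measure_unique _ _ _ _ _ lam lam
  (push (@leb2 R) (@measurable_swap _ _ mR mR))) //.
move=> B C mB mC; rewrite pushE /leb2 /=.
have -> : unstable.swap @^-1` (B `*` C) = C `*` B.
  by apply/seteqP; split => -[x y] [].
by rewrite product_measure1E // muleC.
Qed.

Lemma measurable_affine2 (a b c : R) :
  measurable_fun [set: (mR * mR)%type] (fun z : mR * mR => a * z.1 + b * z.2 + c : mR).
Proof.
apply: measurable_funD => //; apply: measurable_funD => //; apply: measurable_funM => //.
Qed.

Lemma measurable_linear2 (a b c a' b' c' : R) :
  measurable_fun [set: (mR * mR)%type] (fun z : mR * mR =>
    (a * z.1 + b * z.2 + c, a' * z.1 + b' * z.2 + c') : mR * mR).
Proof. by apply: measurable_fun_pair; exact: measurable_affine2. Qed.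

(** Gaussian elimination: for nonzero a the affine map factors into two shears and two coordinate
    swaps. The shears contribute the factors |a| and |D / a|, whose product is the modulus of the
    determinant D. *)
Let leb2_linear_neq0 (a b c a' b' c' : R) (A : set (mR * mR)) :
  a != 0 -> a * b' - b * a' != 0 -> measurable A ->
  leb2 R [set z | A (a * z.1 + b * z.2 + c, a' * z.1 + b' * z.2 + c')]
    = ((`|a * b' - b * a'|^-1)%:E * leb2 R A)%E.
Proof.
move=> a0 D0 mA.
pose B := [set z : mR * mR | A (z.1, (a' / a) * z.1 + ((a * b' - b * a') / a) * z.2 + (c' - a' / a * c))].
have mB : measurable B.
  rewrite -[B]setTI; apply: (measurable_fun_pair measurable_fst) => //.
  exact: measurable_affine2.
have mB' : measurable [set z : mR * mR | B (z.2, z.1)].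
  by rewrite -[X in measurable X]setTI; exact: (@measurable_swap _ _ mR mR).
transitivity (leb2 R [set z : mR * mR | [set z : mR * mR | B (z.2, z.1)]
   (z.1, b * z.1 + a * z.2 + c)]).
  rewrite -[LHS]leb2_swap; last first.
    by rewrite -[X in measurable X]setTI; exact: measurable_linear2.
  congr (leb2 R _); apply/seteqP; split => -[x y]; rewrite /B /= => h.
    by move: h; congr (A (_, _)); field.
  by move: h; congr (A (_, _)); field.
rewrite leb2_shear // leb2_swap // leb2_shear //; last by rewrite mulf_neq0 ?invr_eq0.
by rewrite muleA -EFinM normrM normfV invfM invrK mulrCA mulVf ?mulr1 // normr_eq0.
Qed.

Lemma leb2_linear (a b c a' b' c' : R) (A : set (mR * mR)) :
  a * b' - b * a' != 0 -> measurable A ->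
  leb2 R [set z | A (a * z.1 + b * z.2 + c, a' * z.1 + b' * z.2 + c')]
    = ((`|a * b' - b * a'|^-1)%:E * leb2 R A)%E.
Proof.
move=> D0 mA; have [a0|a0] := eqVneq a 0; last exact: leb2_linear_neq0.
rewrite -[LHS]leb2_swap; last first.
  by rewrite -[X in measurable X]setTI; exact: measurable_linear2.
have b0 : b != 0 by apply: contraNneq D0 => ->; rewrite a0 !mul0r subrr.
have -> : `|a * b' - b * a'| = `|b * a' - a * b'| by rewrite distrC.
rewrite -(@leb2_linear_neq0 b a c b' a' c') //; last by rewrite -opprB oppr_eq0.
congr (leb2 R _); apply/seteqP; split => -[x y] /= h; move: h; congr (A (_, _)); ring.
Qed.

Lemma leb2_linear_null (p q r : R) : ~~ [&& p == 0, q == 0 & r == 0] ->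
  leb2 R [set z : mR * mR | p * z.1 + q * z.2 + r = 0] = 0%E.
Proof.
have mZ (s t u : R) : measurable [set z : mR * mR | s * z.1 + t * z.2 + u = 0].
  by rewrite -[X in measurable X]setTI; exact: (measurable_affine2 s t u measurableT (measurable_set1 0)).
suff H (p' q' r' : R) : q' != 0 ->
    leb2 R [set z : mR * mR | p' * z.1 + q' * z.2 + r' = 0] = 0%E.
  have [q0|q0 _] := eqVneq q 0; last exact: H.
  have [p0|p0 _] := eqVneq p 0.
    rewrite /= => r0; rewrite (_ : [set _ | _] = set0) ?measure0 //.
    by apply/seteqP; split => // z /=; rewrite p0 q0 !mul0r !add0r => rz; rewrite rz eqxx in r0.
  rewrite -[LHS]leb2_swap // -(H q p r) //; congr (leb2 R _).
  by apply/seteqP; split => -[x y] /= <-; ring.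
move=> q0; rewrite /leb2 /= /product_measure1 integral0_eq // => x _ /=.
rewrite (_ : xsection _ _ = [set (- (p' * x + r') / q' : mR)]) ?lebesgue_measure_set1 //.
apply/seteqP; split => y; rewrite /xsection /= !inE /=.
  move=> h; apply: (mulIf q0); rewrite divfK //; apply/eqP; rewrite -subr_eq0.
  by apply/eqP; rewrite -[RHS]h; ring.
by move=> ->; field.
Qed.

End lebesgue_linear.

Section slicing.
Context {R : realType}.
Local Notation mR := (measurableTypeR R).
Local Notation lam := (@lebesgue_measure R).

Lemma ord3P (Q : 'I_3 -> Prop) : Q 0 -> Q 1 -> Q 2%:R -> forall i, Q i.
Proof.
by move=> q0 q1 q2 [[|[|[|//]]] h]; [move: q0|move: q1|move: q2];
  congr Q; apply: val_inj.
Qed.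

Lemma coord3_vec (f : 'I_3 -> R) i : coord3 (vec f) i = f i.
Proof. by elim/ord3P: i. Qed.

Lemma vec_coord3 (x : R3 R) : vec (coord3 x) = x.
Proof. by case: x => -[a b] c. Qed.

Lemma eq_R3 (x y : R3 R) : (forall i, coord3 x i = coord3 y i) -> x = y.
Proof. by move=> xy; rewrite -[x]vec_coord3 -[y]vec_coord3; congr vec; apply/funext. Qed.

(** Started at an arbitrary i, the cyclic order matches the indices i, i + 1, i + 2 of the curl, of
    the cross product and of lines in direction i. *)
Lemma sum3 (V : nmodType) (f : 'I_3 -> V) i :
  \sum_j f j = f i + f (i + 1) + f (i + 2%:R).
Proof.
have s : \sum_j f j = f 0 + f 1 + f 2%:R.
  by rewrite !big_ord_recr big_ord0 /= add0r; congr (f _ + f _ + f _); apply: val_inj.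
elim/ord3P: i; rewrite s.
- by congr (f _ + f _ + f _); apply: val_inj.
- by rewrite -addrA addrC; congr (f _ + f _ + f _); apply: val_inj.
- by rewrite addrC addrA; congr (f _ + f _ + f _); apply: val_inj.
Qed.

Lemma dotE (u v : R3 R) i : dot u v = coord3 u i * coord3 v i
  + coord3 u (i + 1) * coord3 v (i + 1) + coord3 u (i + 2%:R) * coord3 v (i + 2%:R).
Proof. exact: sum3. Qed.

Definition line_pt (i : 'I_3) (y : mR * mR) (t : R) : R3 R :=
  vec (fun j => if j == i then t else if j == i + 1 then y.1 else y.2).

Lemma coord3_line i y t : coord3 (line_pt i y t) i = t.
Proof. by rewrite coord3_vec eqxx. Qed.

Lemma coord3_line1 i y t : coord3 (line_pt i y t) (i + 1) = y.1.
Proof. by rewrite coord3_vec; elim/ord3P: i. Qed.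

Lemma coord3_line2 i y t : coord3 (line_pt i y t) (i + 2%:R) = y.2.
Proof. by rewrite coord3_vec; elim/ord3P: i. Qed.

Lemma line_ptK i (x : R3 R) :
  line_pt i (coord3 x (i + 1), coord3 x (i + 2%:R)) (coord3 x i) = x.
Proof. by apply: eq_R3; elim/ord3P: i; elim/ord3P; rewrite coord3_vec. Qed.

Lemma measurable_coord3 (i : 'I_3) :
  measurable_fun [set: R3 R] (fun x : R3 R => coord3 x i : mR).
Proof.
elim/ord3P: i; rewrite /coord3 /=.
- exact: (measurableT_comp measurable_fst measurable_fst).
- exact: (measurableT_comp measurable_snd measurable_fst).
- exact: measurable_snd.
Qed.

Lemma measurable_fun_R3 d (T : measurableType d) (f : T -> R3 R) :
  (forall i, measurable_fun [set: T] (fun x => coord3 (f x) i : mR)) ->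
  measurable_fun [set: T] f.
Proof.
move=> mf; suff : measurable_fun [set: T]
    (fun x => ((coord3 (f x) 0, coord3 (f x) 1), coord3 (f x) 2%:R) : mR * mR * mR).
  by congr measurable_fun; apply/funext => x; case: (f x) => -[].
apply: measurable_fun_pair => //; exact: measurable_fun_pair.
Qed.

Local Notation T3 := (mR * mR * mR)%type.

Lemma measurable_line_pt i :
  measurable_fun [set: T3] (fun x : T3 => line_pt i x.1 x.2 : T3).
Proof.
suff : measurable_fun [set: T3] (fun x : T3 => line_pt i x.1 x.2 : R3 R) by [].
apply: measurable_fun_R3 => j; under eq_fun do rewrite coord3_vec.
case: (j == i); first exact: measurable_snd.
case: (j == i + 1); first exact: (measurableT_comp measurable_fst measurable_fst).
exact: (measurableT_comp measurable_snd measurable_fst).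
Qed.

(** The planar product measure is declared as a sigma-finite measure in its own right, so that
    Fubini's theorem applies to its product with a further copy of [lam]. *)
Let lam2 : set (mR * mR)%type -> \bar R := (lam \x lam)%E.
HB.instance Definition _ := Measure.on lam2.

Let lam2_sigma_finite : sigma_finite setT lam2.
Proof.
have /sigma_finiteP[F [TF ndF Foo]] := sigma_finiteT lam.
exists (fun n => F n `*` F n) => [|n]; last first.
  have [mF Fy] := Foo n; split; first exact: measurableX.
  by rewrite /lam2 /= product_measure1E // lte_mul_pinfty // ge0_fin_numE.
apply/seteqP; split=> // -[x y] _.
have [k _ Fx] : (\bigcup_k F k) x by rewrite -TF.
have [l _ Fy] : (\bigcup_k F k) y by rewrite -TF.
exists (maxn k l) => //; split.
- by have /subsetPset := ndF _ _ (leq_maxl k l); exact.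
- by have /subsetPset := ndF _ _ (leq_maxr k l); exact.
Qed.

HB.instance Definition _ := Measure_isSigmaFinite.Build _ _ _ lam2 lam2_sigma_finite.

Let rot (x : T3) : T3 := ((x.2, x.1.1), x.1.2).

Let mrot : measurable_fun setT rot.
Proof.
apply: measurable_fun_pair; first apply: measurable_fun_pair => //.
  exact: (measurableT_comp measurable_fst measurable_fst).
exact: (measurableT_comp measurable_snd measurable_fst).
Qed.

Let mrotA (A : set T3) : measurable A -> measurable (rot @^-1` A).
Proof. by move=> mA; rewrite -[X in measurable X]setTI; exact: mrot. Qed.

Let leb3E2 (A : set T3) : measurable A ->
  leb3_prod R A = (\int[lam]_t (leb2 R (ysection A t)))%E.
Proof.
move=> mA; rewrite /leb3_prod.
exact: (product_measure_unique (fun _ _ h h' => product_measure2E lam2 lam h h') mA).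
Qed.

(** Slicing the left side along its last coordinate, and the right side along its first, gives the
    same iterated triple integral. *)
Let leb3_rot (A : set T3) : measurable A -> leb3_prod R (rot @^-1` A) = leb3_prod R A.
Proof.
move=> mA; rewrite leb3E2; last exact: mrotA.
transitivity (\int[(lam \x lam)%E]_x lam (xsection A x))%E; last by [].
rewrite (@fubini_tonelli1 _ _ _ _ R lam lam (fun x => lam (xsection A x))
  (measurable_fun_xsection lam mA)); last by [].
apply: eq_integral => a _; rewrite /fubini_F /leb2 /= /product_measure1.
apply: eq_integral => b _ /=; congr (lam _).
by apply/seteqP; split => c; rewrite /xsection /ysection /= !inE /= ?inE.
Qed.

(** The map that assembles a point from a line and a parameter is the cyclic rotation, its square or
    the identity, according to the direction. *)
Let leb3_line i (A : set T3) : measurable A ->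
  leb3_prod R ((fun x : T3 => line_pt i x.1 x.2 : T3) @^-1` A) = leb3_prod R A.
Proof.
move=> mA; elim/ord3P: i.
- have -> : (fun x : T3 => line_pt 0 x.1 x.2 : T3) = rot by apply/funext.
  exact: leb3_rot.
- have -> : (fun x : T3 => line_pt 1 x.1 x.2 : T3) = rot \o rot by apply/funext.
  by rewrite comp_preimage leb3_rot ?leb3_rot //; exact: mrotA.
- have -> : (fun x : T3 => line_pt 2%:R x.1 x.2 : T3) = id by apply/funext => -[[]].
  by rewrite preimage_id.
Qed.

Let leb3_push i (f : T3 -> \bar R) : measurable_fun [set: T3] f ->
  (\int[leb3_prod R]_x f x = \int[leb3_prod R]_x f (line_pt i x.1 x.2))%E.
Proof.
move=> mf; rewrite -(integral_push (leb3_prod R) (measurable_line_pt i) mf).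
by apply: eq_measure_integral => A mA _; rewrite -[LHS](leb3_line i).
Qed.

Let slice_int i (f : T3 -> \bar R) : (leb3_prod R).-integrable setT f ->
  (\int[leb3_prod R]_x f x = \int[leb2 R]_y \int[lam]_t f (line_pt i y t))%E.
Proof.
move=> intf; have mf := measurable_int _ intf.
rewrite (leb3_push i) // /leb3_prod.
rewrite -(@integral12_prod_meas1 _ _ _ _ R lam2 lam (fun x => f (line_pt i x.1 x.2))) //.
apply/integrableP; split; first exact: (measurableT_comp mf (measurable_line_pt i)).
rewrite -[X in (X < _)%E](@leb3_push i (fun x => `|f x|%E)); last exact: measurableT_comp.
by case/integrableP: intf.
Qed.

Lemma leb3_slice i (f : R3 R -> \bar R) : (leb3 R).-integrable setT f ->
  (\int[leb3 R]_x f x = \int[leb2 R]_y \int[lam]_t f (line_pt i y t))%E.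
Proof. exact: slice_int. Qed.

End slicing.

(** * Telescoping over a tiling of an interval *)

Section interval_chains.
Context {R : realType} {I : finType}.

(* The intervals [al K, be K], K in D, tile [lo, hi], so each upper endpoint
   other than hi is the lower endpoint of exactly one tile. *)
Let tile_next (D : pred I) (al be : I -> R) (lo hi : R) :
  (forall K, D K -> al K < be K) ->
  (forall K, D K -> lo <= al K /\ be K <= hi) ->
  (forall K L t, D K -> D L -> al K < t < be K -> al L < t < be L -> K = L) ->
  (forall t, lo <= t <= hi -> exists2 K, D K & al K <= t <= be K) ->
  forall K (c : R), D K ->
  \sum_(L | D L && (be K == al L)) c + (if be K == hi then c else 0) = c.
Proof.
move=> lt_al_be bnd disj cov K c DK; have [eqhi|nehi] := eqVneq (be K) hi.
  rewrite big1 ?add0r // => L /andP[DL /eqP e].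
  by have := lt_al_be _ DL; rewrite -e eqhi ltNge (bnd _ DL).2.
have K_hi : be K < hi by rewrite lt_neqAle nehi (bnd _ DK).2.
rewrite addr0; have lohi : lo <= hi.
  by apply: le_trans (bnd _ DK).1 (le_trans (ltW (lt_al_be _ DK)) (bnd _ DK).2).
have [L0 DL0 /andP[_ L0hi]] := cov hi (andb_true_intro (conj lohi (lexx hi))).
(* The candidate for the successor of K: among the tiles that reach beyond [be K], the one with the
   smallest lower end. *)
pose S := [pred L | D L && (be K < be L)].
have SL0 : S L0 by rewrite /S /= DL0 (lt_le_trans K_hi).
have [L SL Lmin] := @arg_minP _ R I L0 S al SL0; move: (SL) => /andP[DL KL].
have alL : al L <= be K.
  (* A gap between K and L would contain a point t, and the tile covering t would belong to S with a
     lower end below that of L. *)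
  rewrite leNgt; apply/negP => KaL; pose t := (be K + al L) / 2.
  have [t1 t2] := (midf_lt KaL).
  have [|M DM /andP[Mt tM]] := cov t.
    rewrite (le_trans (bnd _ DK).1) /= ?(le_trans (ltW (lt_al_be _ DK))) ?(ltW t1) //=.
    by rewrite (le_trans (ltW t2)) // (le_trans (ltW (lt_al_be _ DL))) // (bnd _ DL).2.
  have /Lmin : S M by rewrite /S /= DM (lt_le_trans t1).
  by rewrite leNgt (le_lt_trans Mt).
have alLE : be K = al L.
  apply/eqP; rewrite eq_le alL andbT leNgt; apply/negP => LK.
  pose m := Num.max (al K) (al L).
  have mK : m < be K by rewrite gt_max LK lt_al_be.
  have [t1 t2] := midf_lt mK; move: t1; rewrite gt_max => /andP[t1 t1'].
  have := disj K L ((m + be K) / 2) DK DL; rewrite t1 t1' t2 (lt_trans t2 KL) => /(_ erefl erefl) e.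
  by rewrite e ltxx in KL.
rewrite (big_pred1 L) // => M /=; apply/andP/eqP => [[DM /eqP MK]|->]; last by rewrite DL alLE.
have [->//|ML] := eqVneq M L.
pose m := Num.min (be L) (be M).
have mL : al L < m by rewrite lt_min lt_al_be //= -alLE MK lt_al_be.
have [t1 t2] := midf_lt mL; move: t2; rewrite lt_min => /andP[t2 t2'].
by apply: (disj M L ((al L + m) / 2)) => //; rewrite ?t1 ?t2 // -MK alLE t1.
Qed.

(** Every upper value is charged either to the junction with the next tile or to [hi], every lower
    value either to the junction with the previous tile or to [lo]. *)
Lemma tiling_telescope (D : pred I) (al be : I -> R) (lo hi : R) (phi psi : I -> R) :
  (forall K, D K -> al K < be K) ->
  (forall K, D K -> lo <= al K /\ be K <= hi) ->
  (forall K L t, D K -> D L -> al K < t < be K -> al L < t < be L -> K = L) ->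
  (forall t, lo <= t <= hi -> exists2 K, D K & al K <= t <= be K) ->
  \sum_(K | D K) (phi K - psi K)
  = \sum_(K | D K) \sum_(L | D L && (be K == al L)) (phi K - psi L)
  + (\sum_(K | D K) (if be K == hi then phi K else 0)
  - \sum_(K | D K) (if al K == lo then psi K else 0)).
Proof.
move=> lt_al_be bnd disj cov.
have top K : D K -> \sum_(L | D L && (be K == al L)) phi K
    + (if be K == hi then phi K else 0) = phi K.
  by move=> DK; exact: (tile_next lt_al_be bnd disj cov).
have bot L : D L -> \sum_(K | D K && (be K == al L)) psi L
    + (if al L == lo then psi L else 0) = psi L.
  move=> DL.
  (* The reflection t |-> - t turns predecessors into successors, so the same lemma serves the lower
     ends. *)
  rewrite -[RHS](@tile_next D (fun K => - be K) (fun K => - al K) (- hi) (- lo) _ _ _ _ L) => //.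
  - rewrite eqr_opp; congr (_ + _); apply: eq_bigl => K.
    by rewrite eqr_opp [in RHS]eq_sym.
  - by move=> K DK; rewrite ltrN2 lt_al_be.
  - by move=> K DK; rewrite !lerN2; have [] := bnd _ DK.
  - move=> K M t DK DM; rewrite ltrNl ltrNr => /andP[a1 a2].
    rewrite ltrNl ltrNr => /andP[a3 a4].
    by apply: (disj K M (- t)); rewrite // ?a1 ?a2 ?a3 ?a4.
  - move=> t; rewrite lerNl lerNr andbC => /cov[K DK /andP[h1 h2]].
    by exists K => //; rewrite lerNl lerNr h1 h2.
rewrite sumrB -(eq_bigr _ top) -[X in _ - X](eq_bigr _ bot) !big_split /=.
under [X in _ = X + _]eq_bigr do rewrite sumrB.
rewrite sumrB.
have -> : \sum_(L | D L) \sum_(K | D K && (be K == al L)) psi L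
        = \sum_(K | D K) \sum_(L | D L && (be K == al L)) psi L.
  rewrite [RHS](exchange_big_dep D) /=; last by move=> K L _ /andP[].
  by apply: eq_bigr => L DL; apply: eq_bigl => K; rewrite DL.
ring.
Qed.

End interval_chains.

Section box_integrable.
Context {R : realType}.
Local Notation mR := (measurableTypeR R).

Let box (c : R) : set (mR * mR) := `[-c, c]%classic `*` `[-c, c]%classic.

Let mbox c : measurable (box c).
Proof. by apply: measurableX; exact: measurable_itv. Qed.

Let box_fin c : (leb2 R (box c) < +oo)%E.
Proof.
have fin : (@lebesgue_measure R `[(- c)%R, c]%classic < +oo)%E.
  by rewrite lebesgue_measure_itv /=; case: ifP => // _; rewrite -EFinD ltry.
rewrite /leb2 /= product_measure1E; try exact: measurable_itv.
by apply: lte_mul_pinfty => //; rewrite ge0_fin_numE.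
Qed.

Lemma box_integrable (f : mR * mR -> R) (c B : R) :
  measurable_fun [set: (mR * mR)%type] (f : mR * mR -> mR) ->
  (forall y, f y != 0 -> `|f y| <= B /\ (`|y.1| <= c /\ `|y.2| <= c)) ->
  (leb2 R).-integrable setT (EFin \o f).
Proof.
move=> mf bf; have -> : EFin \o f = (EFin \o f) \_ (box c).
  apply/funext => y; rewrite patchE /=; case: ifPn => // ybox.
  have [->//|fy] := eqVneq (f y) 0.
  have [_ [y1 y2]] := bf _ fy; move: ybox; rewrite /box notin_setE => -[].
  by split; rewrite /= in_itv /= -ler_norml.
have [h _] := @integrable_mkcond _ _ _ (leb2 R) (box c) (EFin \o f) (mbox c).
apply: h; apply: measurable_bounded_integrable => //.
  exact: measurable_funTS.
exists (Num.max B 0); split; rewrite ?num_real // => M BM y _ /=.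
have [->|fy] := eqVneq (f y) 0; first by rewrite normr0 ltW // (le_lt_trans _ BM) // le_max lexx orbT.
by apply: le_trans (bf _ fy).1 (ltW (le_lt_trans _ BM)); rewrite le_max lexx.
Qed.

End box_integrable.

(** * Affine functions, barycentric coordinates and orthonormal frames *)

Section affine_functions.
Context {R : realType}.
Local Notation mR := (measurableTypeR R).
Implicit Types (p : P1 (R := R)) (x : R3 R) (y : mR * mR).

Lemma coord3D x (y : R3 R) i : coord3 (x + y) i = coord3 x i + coord3 y i.
Proof. by elim/ord3P: i. Qed.

Lemma coord3N x i : coord3 (- x) i = - coord3 x i.
Proof. by elim/ord3P: i. Qed.

Lemma coord3Z (a : R) x i : coord3 (a *: x) i = a * coord3 x i.
Proof. by elim/ord3P: i. Qed.

Lemma coord3_0 i : coord3 (0 : R3 R) i = 0.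
Proof. by elim/ord3P: i. Qed.

Lemma coord3_sum (J : Type) (r : seq J) (Q : pred J) (F : J -> R3 R) i :
  coord3 (\sum_(j <- r | Q j) F j) i = \sum_(j <- r | Q j) coord3 (F j) i.
Proof.
by apply: (big_morph (fun x => coord3 x i)) => [x y|]; rewrite ?coord3D ?coord3_0.
Qed.

Lemma P1_evalE p x i : P1_eval p x = p.1 + (coord3 p.2 i * coord3 x i
  + coord3 p.2 (i + 1) * coord3 x (i + 1) + coord3 p.2 (i + 2%:R) * coord3 x (i + 2%:R)).
Proof. by rewrite /P1_eval (dotE _ _ i). Qed.

Lemma P1_eval_line p i y t : P1_eval p (line_pt i y t)
  = coord3 p.2 i * t + P1_eval p (line_pt i y 0).
Proof.
by rewrite !(P1_evalE _ _ i) !coord3_line !coord3_line1 !coord3_line2; ring.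
Qed.

Lemma P1_eval_line0 p i y : P1_eval p (line_pt i y 0)
  = coord3 p.2 (i + 1) * y.1 + coord3 p.2 (i + 2%:R) * y.2 + p.1.
Proof. by rewrite !(P1_evalE _ _ i) !coord3_line !coord3_line1 !coord3_line2; ring. Qed.

Lemma P1_eval_comb (J : finType) p (c : J -> R) (v : J -> R3 R) :
  \sum_j c j = 1 -> P1_eval p (\sum_j c j *: v j) = \sum_j c j * P1_eval p (v j).
Proof.
move=> c1; under [RHS]eq_bigr do rewrite mulrDr; rewrite big_split /= -mulr_suml c1 mul1r.
congr (_ + _); rewrite /dot; under [RHS]eq_bigr do rewrite mulr_sumr.
rewrite exchange_big /=; apply: eq_bigr => i _; rewrite coord3_sum mulr_sumr.
by apply: eq_bigr => j _; rewrite coord3Z; ring.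
Qed.

Lemma measurable_P1_eval p :
  measurable_fun [set: R3 R] (fun x : R3 R => P1_eval p x : mR).
Proof.
apply: measurable_funD => //; rewrite /dot.
by apply: measurable_sum => i; apply: measurable_funM => //; exact: measurable_coord3.
Qed.

Lemma measurable_P1_line0 p i :
  measurable_fun [set: (mR * mR)%type] (fun y : mR * mR => P1_eval p (line_pt i y 0) : mR).
Proof. by under eq_fun do rewrite P1_eval_line0; exact: measurable_affine2. Qed.

Lemma P1_bounded p (lo hi : R3 R) :
  exists B, forall x, closed_cuboid lo hi x -> `|P1_eval p x| <= B.
Proof.
exists (`|p.1| + \sum_i `|coord3 p.2 i| * (`|coord3 lo i| + `|coord3 hi i|)) => x bx.
apply: le_trans (ler_normD _ _) _; rewrite lerD2l.
apply: le_trans (ler_norm_sum _ _ _) _; apply: ler_sum => i _; rewrite normrM.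
apply: ler_wpM2l => //; have /andP[h1 h2] := bx i; rewrite ler_norml.
rewrite (le_trans _ h1) ?(le_trans h2) //=.
- by rewrite (le_trans (ler_norm _)) // lerDr.
- by rewrite lerNl (le_trans (ler_norm _)) // normrN lerDl.
Qed.

(** Homogeneous coordinates (1, x), in which affine functions become linear; index 0 is the one
    without a predecessor under [unlift], hence the default 1. *)
Definition homog x : 'rV[R]_4 := \row_k oapp (coord3 x) 1 (unlift ord0 k).

Definition homog_P1 (c : 'I_4 -> R) : P1 (R := R) := (c ord0, vec (fun i => c (lift ord0 i))).

Lemma homog_P1E c x : P1_eval (homog_P1 c) x = \sum_k homog x 0 k * c k.
Proof.
rewrite big_ord_recl !mxE unlift_none /= mul1r; congr (_ + _).
by apply: eq_bigr => i _; rewrite coord3_vec !mxE liftK /= mulrC.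
Qed.

(** Affine independence says that the matrix whose rows are the homogeneous vertices is invertible;
    the columns of the inverse are the coefficients of the barycentric coordinates. *)
Lemma barycentric (v : 'I_4 -> R3 R) : affinely_independent v ->
  exists l : 'I_4 -> P1, [/\ forall j k, P1_eval (l j) (v k) = (j == k)%:R,
    forall x, \sum_j P1_eval (l j) x = 1 &
    forall x, \sum_j P1_eval (l j) x *: v j = x].
Proof.
move=> indep; pose A : 'M[R]_4 := \matrix_j homog (v j).
have homogA (u : 'rV_4) k : (u *m A) 0 k = \sum_j u 0 j * homog (v j) 0 k.
  by rewrite mxE; apply: eq_bigr => j _; rewrite !mxE.
have uA : A \in unitmx.
  rewrite -row_free_unit -kermx_eq0; apply/eqP/row_matrixP => k; rewrite row0.
  have : row k (kermx A) *m A = 0 by rewrite -row_mul mulmx_ker row0.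
  move: (row k _) => u uA0; apply/rowP => j; rewrite mxE.
  apply: (indep (fun j => u 0 j)).
    have := homogA u ord0; rewrite uA0 mxE => e; rewrite [RHS]e; apply: eq_bigr => i _.
    by rewrite mxE unlift_none mulr1.
  apply: eq_R3 => i; rewrite coord3_sum coord3_0.
  have := homogA u (lift ord0 i); rewrite uA0 mxE => e; rewrite [RHS]e; apply: eq_bigr => m _.
  by rewrite coord3Z mxE liftK.
pose B := invmx A; exists (fun j => homog_P1 (fun k => B k j)).
have lE j x : P1_eval (homog_P1 (fun k => B k j)) x = (homog x *m B) 0 j.
  by rewrite homog_P1E mxE.
have BA x : homog x *m B *m A = homog x by rewrite -mulmxA mulVmx // mulmx1.
split=> [j k|x|x].
- by rewrite lE -[homog _](rowK (fun k => homog (v k))) -row_mul mulmxV // rowE mulmx1 mxE /= eq_sym.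
- have := congr1 (fun u : 'rV_4 => u 0 ord0) (BA x).
  rewrite homogA [in RHS]mxE unlift_none /= => <-; apply: eq_bigr => j _.
  have -> : homog (v j) 0 ord0 = 1 by rewrite mxE unlift_none.
  by rewrite lE mulr1.
- apply: eq_R3 => i; have := congr1 (fun u : 'rV_4 => u 0 (lift ord0 i)) (BA x).
  rewrite homogA [in RHS]mxE liftK /= => <-; rewrite coord3_sum; apply: eq_bigr => j _.
  have -> : homog (v j) 0 (lift ord0 i) = coord3 (v j) i by rewrite mxE liftK.
  by rewrite coord3Z lE.
Qed.

End affine_functions.
(** The fundamental theorem in the shape needed for a component of H x E along a coordinate line,
    where each field component is affine. The degenerate interval is treated apart because the
    library theorem asks for s < t. *)
Lemma integral_affine_products (R : realType) (a b c d a' b' c' d' s t : R) : s <= t ->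
  (\int[lebesgue_measure]_(u in `[s, t])
     (a * (c * u + d) + (a * u + b) * c - (a' * (c' * u + d') + (a' * u + b') * c'))%:E
   = ((a * t + b) * (c * t + d) - (a' * t + b') * (c' * t + d')
      - ((a * s + b) * (c * s + d) - (a' * s + b') * (c' * s + d')))%:E)%E.
Proof.
rewrite le_eqVlt => /orP[/eqP ->|st].
  by rewrite subrr set_itv1 integral_set1.
pose F u := (a * u + b) * (c * u + d) - (a' * u + b') * (c' * u + d').
have dF (x : R) : is_derive x 1 F
    (a * (c * x + d) + (a * x + b) * c - (a' * (c' * x + d') + (a' * x + b') * c')).
  apply: is_derive_eq; rewrite /GRing.scale /=; ring.
have cF : continuous F.
  move=> x; apply: differentiable_continuous; apply/derivable1_diffP.
  by have [] := dF x.
rewrite (@continuous_FTC2 _ _ F) ?EFinB //.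
- apply: continuous_subspaceT => x.
  have dG : is_derive x 1 (fun u : R =>
      a * (c * u + d) + (a * u + b) * c - (a' * (c' * u + d') + (a' * u + b') * c'))
      (a * c + a * c - (a' * c' + a' * c')).
    apply: is_derive_eq; rewrite /GRing.scale /=; ring.
  by apply: differentiable_continuous; apply/derivable1_diffP; have [] := dG.
- split=> [x _||]; first by have [] := dF x.
  + by apply: cvg_at_right_filter; exact: cF.
  + by apply: cvg_at_left_filter; exact: cF.
- by move=> x _; rewrite derive1E; have [_ ->] := dF x.
Qed.

Lemma dotC (R : realType) (u v : R3 R) : dot u v = dot v u.
Proof. by apply: eq_bigr => i _; rewrite mulrC. Qed.

(** Unless n is parallel to the third axis, [ft1] is n's projection to the first two coordinates
    turned by a right angle and normalised, and [ft2] is the cross product of n with it. *)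
Lemma orthonormal_completion (R : realType) (p n : R3 R) : dot n n = 1 ->
  exists fr : frame, [/\ orthonormal_frame fr, fpt fr = p & fn fr = n].
Proof.
move=> n1; pose n0 := coord3 n 0; pose n1' := coord3 n 1; pose n2 := coord3 n 2%:R.
have nE : n0 * n0 + n1' * n1' + n2 * n2 = 1 by rewrite -n1 (dotE _ _ 0).
have dE (u v : R3 R) : dot u v = u.1.1 * v.1.1 + u.1.2 * v.1.2 + u.2 * v.2.
  exact: (dotE u v 0).
have nV : n = (n0, n1', n2) by rewrite -[LHS]vec_coord3.
have s2_ge0 : 0 <= n0 ^+ 2 + n1' ^+ 2 by rewrite addr_ge0 // sqr_ge0.
have [s0|s0] := eqVneq (n0 ^+ 2 + n1' ^+ 2) 0.
  have /andP[/eqP a0 /eqP a1] : (n0 == 0) && (n1' == 0).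
    by move/eqP: s0; rewrite paddr_eq0 ?sqr_ge0 // !sqrf_eq0.
  exists (Frame p (1, 0, 0) (0, 1, 0) n); split => //.
  rewrite /orthonormal_frame /= nV a0 a1 !dE /=; move: nE; rewrite a0 a1.
  by rewrite !(mulr0, mul0r, addr0, add0r, mulr1) => ->.
pose s := Num.sqrt (n0 ^+ 2 + n1' ^+ 2).
have ss : s * s = n0 * n0 + n1' * n1' by rewrite -expr2 sqr_sqrtr // !expr2.
have sn0 : s != 0 by rewrite sqrtr_eq0 -ltNge lt_neqAle eq_sym s0.
exists (Frame p (- n1' / s, n0 / s, 0) (- n0 * n2 / s, - n1' * n2 / s, s) n); split => //.
rewrite /orthonormal_frame /= nV !dE /=; split; split.
- have -> : - n1' / s * (- n1' / s) + n0 / s * (n0 / s) + 0 * 0 = (n0 * n0 + n1' * n1') / (s * s).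
    by field.
  by rewrite -ss divff // mulf_neq0.
- have -> : - n0 * n2 / s * (- n0 * n2 / s) + - n1' * n2 / s * (- n1' * n2 / s) + s * s
     = n2 * n2 * ((n0 * n0 + n1' * n1') / (s * s)) + s * s by field.
  by rewrite -ss divff ?mulf_neq0 // mulr1 ss -nE; ring.
- exact: nE.
- by field.
- by field.
- have -> : - n0 * n2 / s * n0 + - n1' * n2 / s * n1' + s * n2
     = n2 / s * (s * s - (n0 * n0 + n1' * n1')) by field.
  by rewrite ss subrr mulr0.
Qed.

(** This minor is the Jacobian of projecting the plane of the frame along direction i. The matrix
    with rows t1, t2, n is orthogonal, so its columns are orthonormal as well, and Lagrange's
    identity expresses the squared minor through their inner products. *)
Lemma orthonormal_minor (R : realType) (fr : frame (R := R)) i : orthonormal_frame fr ->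
  (coord3 (ft1 fr) (i + 1) * coord3 (ft2 fr) (i + 2%:R)
   - coord3 (ft2 fr) (i + 1) * coord3 (ft1 fr) (i + 2%:R)) ^+ 2 = coord3 (fn fr) i ^+ 2.
Proof.
move=> [[d11 d22 dnn] [d12 d1n d2n]].
pose O : 'M[R]_3 := \matrix_(a, j) match val a with 0 => coord3 (ft1 fr) j
  | 1 => coord3 (ft2 fr) j | _ => coord3 (fn fr) j end.
have OOT : O *m O^T = 1%:M.
  apply/matrixP => a b; rewrite !mxE; under eq_bigr do rewrite !mxE.
  elim/ord3P: a; elim/ord3P: b => /=; rewrite ?eqxx //=;
  first [exact: d11|exact: d22|exact: dnn|exact: d12|exact: d1n|exact: d2n
             |exact: (etrans (dotC _ _) d12)
             |exact: (etrans (dotC _ _) d1n)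
             |exact: (etrans (dotC _ _) d2n)].
have OTO : O^T *m O = 1%:M by exact: mulmx1C.
have E a b : coord3 (ft1 fr) a * coord3 (ft1 fr) b + coord3 (ft2 fr) a * coord3 (ft2 fr) b
    + coord3 (fn fr) a * coord3 (fn fr) b = (a == b)%:R.
  have := congr1 (fun M : 'M[R]_3 => M a b) OTO; rewrite !mxE => <-.
  by rewrite (sum3 _ 0); rewrite !mxE.
have e11 := E (i + 1) (i + 1); have e22 := E (i + 2%:R) (i + 2%:R).
have e12 := E (i + 1) (i + 2%:R); rewrite !eqxx in e11 e22.
have ni : coord3 (fn fr) i ^+ 2 = 1 - coord3 (fn fr) (i + 1) ^+ 2 - coord3 (fn fr) (i + 2%:R) ^+ 2.
  by rewrite -dnn (dotE _ _ i); ring.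
have i12 : (i + 1 == i + 2%:R) = false by elim/ord3P: (i).
rewrite i12 /= in e12; rewrite ni.
move: e11 e22 e12; move: (coord3 (ft1 fr) (i + 1)) (coord3 (ft2 fr) (i + 1))
  (coord3 (fn fr) (i + 1)) (coord3 (ft1 fr) (i + 2%:R)) (coord3 (ft2 fr) (i + 2%:R))
  (coord3 (fn fr) (i + 2%:R)) => x1 x2 x3 y1 y2 y3.
move=> e11 e22 e12.
have h1 : x1 * x1 + x2 * x2 = 1 - x3 * x3 by rewrite -[1]e11; ring.
have h2 : y1 * y1 + y2 * y2 = 1 - y3 * y3 by rewrite -[1]e22; ring.
have h3 : x1 * y1 + x2 * y2 = - (x3 * y3) by apply/eqP; rewrite -subr_eq0 opprK e12.
transitivity ((x1 * x1 + x2 * x2) * (y1 * y1 + y2 * y2) - (x1 * y1 + x2 * y2) ^+ 2); first ring.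
by rewrite h1 h2 h3; ring.
Qed.

Section dot_product.
Context {R : realType}.
Implicit Types u v w x : R3 R.

Lemma dotDr u v w : dot u (v + w) = dot u v + dot u w.
Proof. by rewrite /dot -big_split; apply: eq_bigr => m _ /=; rewrite coord3D mulrDr. Qed.

Lemma dotZr u v (c : R) : dot u (c *: v) = c * dot u v.
Proof. by rewrite /dot mulr_sumr; apply: eq_bigr => m _; rewrite coord3Z mulrCA. Qed.

Lemma dotNr u v : dot u (- v) = - dot u v.
Proof. by rewrite /dot -sumrN; apply: eq_bigr => j _; rewrite coord3N mulrN. Qed.

Lemma dot_ge0 u : 0 <= dot u u.
Proof. by rewrite (dotE _ _ 0) -!expr2 !addr_ge0 // sqr_ge0. Qed.

Lemma dot_gt0 u i : coord3 u i != 0 -> 0 < dot u u.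
Proof.
move=> u0; rewrite (dotE _ _ i) -!expr2 -addrA.
by rewrite ltr_pwDl ?exprn_even_gt0 //= addr_ge0 // sqr_ge0.
Qed.

Lemma dot_eq0 u : dot u u = 0 -> u = 0.
Proof.
move=> u0; apply: eq_R3 => m; rewrite coord3_0; apply/eqP; apply: contraTT isT.
by move=> /dot_gt0; rewrite u0 ltxx.
Qed.

Lemma P1_evalD (q : P1 (R := R)) x v : P1_eval q (x + v) = P1_eval q x + dot q.2 v.
Proof. by rewrite /P1_eval dotDr addrA. Qed.

(** Used to move from a boundary point into an open simplex: barycentric coordinates that are
    positive stay so for a short time, those that vanish grow along v. Finiteness of the index set
    gives a common step length. *)
Lemma P1_step (J : finType) (q : J -> P1 (R := R)) p v :
  (forall m, 0 < P1_eval (q m) p \/ (P1_eval (q m) p = 0 /\ 0 < dot (q m).2 v)) ->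
  exists2 e, 0 < e & forall t m, 0 < t -> t <= e -> 0 < P1_eval (q m) (p + t *: v).
Proof.
move=> Hq; have step m : exists e, 0 < e /\ forall t, 0 < t -> t <= e -> 0 < P1_eval (q m) (p + t *: v).
  case: (Hq m) => [q0|[q0 qv]]; last first.
    by exists 1; split=> // t t0 _; rewrite P1_evalD dotZr q0 add0r mulr_gt0.
  have d0 : 0 < `|dot (q m).2 v| + 1 by rewrite ltr_wpDl.
  exists (P1_eval (q m) p / (`|dot (q m).2 v| + 1)); split=> [|t t0].
    by rewrite divr_gt0.
  rewrite ler_pdivlMr // => te; rewrite P1_evalD dotZr.
  have : - (t * `|dot (q m).2 v|) <= t * dot (q m).2 v by rewrite -mulrN; apply: ler_wpM2l; [exact: ltW|exact: (lerNnormlW (lexx _))].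
  by rewrite mulrDr mulr1 in te; lra.
have [f Hf] := choice step.
exists (\big[Num.min/1]_m f m); first by apply/bigmin_gtP; split=> // m _; exact: (Hf m).1.
by move=> t m t0 te; apply: (Hf m).2 => //; apply: le_trans te _; exact: bigmin_le.
Qed.

(* The sum of the two unit gradients is a direction along which both functions
   increase strictly, unless the gradients are opposite. *)
Lemma opposite_gradients u v : dot u u != 0 -> dot v v != 0 ->
  (exists w, 0 < dot u w /\ 0 < dot v w) \/
  v = - (Num.sqrt (dot v v) / Num.sqrt (dot u u)) *: u.
Proof.
move=> u0 v0; pose a := Num.sqrt (dot u u); pose b := Num.sqrt (dot v v).
have a0 : 0 < a by rewrite sqrtr_gt0 lt_neqAle eq_sym u0 dot_ge0.
have b0 : 0 < b by rewrite sqrtr_gt0 lt_neqAle eq_sym v0 dot_ge0.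
have aa : dot u u = a * a by rewrite -expr2 sqr_sqrtr // dot_ge0.
have bb : dot v v = b * b by rewrite -expr2 sqr_sqrtr // dot_ge0.
pose w := a^-1 *: u + b^-1 *: v.
have ww : dot w w = 2 + 2 * dot u v / (a * b).
  rewrite dotDr !dotZr ![dot w _]dotC /w !dotDr !dotZr aa bb [dot v u]dotC.
  by field; rewrite ?gt_eqF.
have uw : dot u w = a * dot w w / 2.
  by rewrite ww /w !dotDr !dotZr aa; field; rewrite ?gt_eqF.
have vw : dot v w = b * dot w w / 2.
  by rewrite ww /w !dotDr !dotZr bb [dot v u]dotC; field; rewrite ?gt_eqF.
have [w0|w0] := eqVneq (dot w w) 0; [right|left].
  have := dot_eq0 w0; rewrite /w => /eqP; rewrite addr_eq0 => /eqP e.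
  rewrite [LHS](_ : v = b *: (b^-1 *: v)); last by rewrite scalerA divff ?scale1r // gt_eqF.
  by rewrite -[b^-1 *: v]opprK -e -/a -/b scalerN scalerA scaleNr.
have wp : 0 < dot w w by rewrite lt_neqAle eq_sym w0 dot_ge0.
by exists w; rewrite uw vw !divr_gt0 ?mulr_gt0.
Qed.

End dot_product.

Section measurable_sets.
Context {R : realType} d (T : measurableType d).
Local Notation mR := (measurableTypeR R).

Lemma measurable_set_le (f g : T -> R) :
  measurable_fun [set: T] (f : T -> mR) -> measurable_fun [set: T] (g : T -> mR) ->
  measurable [set y | f y <= g y].
Proof.
move=> mf mg; have := measurable_fun_ler mf mg measurableT (_ : measurable [set true]).
by rewrite setTI; apply.
Qed.

Lemma measurable_set_eq (f g : T -> R) :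
  measurable_fun [set: T] (f : T -> mR) -> measurable_fun [set: T] (g : T -> mR) ->
  measurable [set y | f y = g y].
Proof.
move=> mf mg; have -> : [set y | f y = g y] = [set y | f y <= g y] `&` [set y | g y <= f y].
  by apply/seteqP; split => y /= => [->|[h1 h2]] //; apply/eqP; rewrite eq_le h1 h2.
by apply: measurableI; exact: measurable_set_le.
Qed.

Lemma measurable_bigmax (I : Type) (r : seq I) (Q : pred I) (m : R) (f : I -> T -> R) :
  (forall j, measurable_fun [set: T] (f j : T -> mR)) ->
  measurable_fun [set: T] (fun y => \big[Num.max/m]_(j <- r | Q j) f j y : mR).
Proof.
move=> mf; elim: r => [|j r IH]; first by under eq_fun do rewrite big_nil; exact: measurable_cst.
under eq_fun do rewrite big_cons; case: (Q j) => //.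
exact: (measurable_maxr (mf j) IH).
Qed.

Lemma measurable_bigmin (I : Type) (r : seq I) (Q : pred I) (m : R) (f : I -> T -> R) :
  (forall j, measurable_fun [set: T] (f j : T -> mR)) ->
  measurable_fun [set: T] (fun y => \big[Num.min/m]_(j <- r | Q j) f j y : mR).
Proof.
move=> mf; elim: r => [|j r IH]; first by under eq_fun do rewrite big_nil; exact: measurable_cst.
under eq_fun do rewrite big_cons; case: (Q j) => //.
exact: (measurable_minr (mf j) IH).
Qed.

End measurable_sets.

Section cuboid_integrable.
Context {R : realType} (lo hi : R3 R).
Local Notation mR := (measurableTypeR R).

Lemma measurable_closed_cuboid : measurable (closed_cuboid lo hi).
Proof.
have -> : closed_cuboid lo hi = \bigcap_(i in [set: 'I_3])
    ([set x | coord3 lo i <= coord3 x i] `&` [set x | coord3 x i <= coord3 hi i]).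
  apply/seteqP; split=> x bx i; first by move=> _; have /andP[] := bx i.
  by have [-> ->] := bx i I.
apply: fin_bigcap_measurable => // i _; apply: measurableI; apply: measurable_set_le => //;
  exact: measurable_coord3.
Qed.

Lemma closed_cuboid_fin : (leb3 R (closed_cuboid lo hi) < +oo)%E.
Proof.
have itv_fin (a b : R) : (@lebesgue_measure R `[a, b]%classic < +oo)%E.
  by rewrite lebesgue_measure_itv /=; case: ifP => // _; rewrite -EFinD ltry.
have mI (a b : R) : measurable (`[a, b]%classic : set mR) by exact: measurable_itv.
have -> : closed_cuboid lo hi = (`[lo.1.1, hi.1.1]%classic `*` `[lo.1.2, hi.1.2]%classic)
    `*` `[lo.2, hi.2]%classic.
  apply/seteqP; split=> x.
    by move=> bx; have := bx 0; have := bx 1; have := bx 2%:R; rewrite /= !in_itv.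
  by rewrite /= !in_itv => -[[h0 h1] h2]; elim/ord3P.
rewrite /leb3 /leb3_prod /= product_measure1E //; last exact: measurableX.
have fin2 : (leb2 R (`[lo.1.1, hi.1.1]%classic `*` `[lo.1.2, hi.1.2]%classic) < +oo)%E.
  rewrite /leb2 /= product_measure1E //.
  by apply: lte_mul_pinfty; [exact: measure_ge0|
    rewrite ge0_fin_numE; [exact: itv_fin|exact: measure_ge0]|exact: itv_fin].
by apply: lte_mul_pinfty; [exact: measure_ge0|
  rewrite ge0_fin_numE; [exact: fin2|exact: measure_ge0]|exact: itv_fin].
Qed.

Lemma cuboid_integrable (f : R3 R -> R) (A : set (R3 R)) (B : R) :
  measurable A -> A `<=` closed_cuboid lo hi ->
  measurable_fun [set: R3 R] (f : R3 R -> mR) ->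
  (forall x, A x -> `|f x| <= B) -> (leb3 R).-integrable A (EFin \o f).
Proof.
move=> mA AD mf bf; apply: measurable_bounded_integrable => //.
- by apply: le_lt_trans closed_cuboid_fin; apply: le_measure => //;
    rewrite inE //; exact: measurable_closed_cuboid.
- exact: measurable_funTS.
- exists B; split; rewrite ?num_real // => M BM y Ay /=.
  exact: le_trans (bf _ Ay) (ltW BM).
Qed.

End cuboid_integrable.

(** * Slicing a simplicial mesh by lines *)

Section mesh_slicing.
Context {R : realType} {lo hi : R3 R} (Th : simplicial_mesh lo hi).
Local Notation mR := (measurableTypeR R).
Local Notation lam := (@lebesgue_measure R).

Lemma mesh_indep (K : elt Th) : affinely_independent (vtx K).
Proof. by case: Th K. Qed.

Lemma mesh_disjoint (K L : elt Th) x :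
  open_simplex (vtx K) x -> open_simplex (vtx L) x -> K = L.
Proof.
case: Th K L => E v indep disj cov /= K L Kx Lx.
apply/eqP; apply: contraT => KL.
by have := disj _ _ KL => /seteqP[] /(_ x (conj Kx Lx)).
Qed.

Lemma mesh_sub (K : elt Th) : simplex (vtx K) `<=` closed_cuboid lo hi.
Proof. by case: Th K => E v indep disj cov /= K x Kx; rewrite -cov; exists K. Qed.

Lemma mesh_cover x : closed_cuboid lo hi x -> exists K : elt Th, simplex (vtx K) x.
Proof. by case: Th => E v indep disj cov /=; rewrite -cov => -[K _ Kx]; exists K. Qed.

Variable l : elt Th -> 'I_4 -> P1 (R := R).
Hypothesis lv : forall K j k, P1_eval (l K j) (vtx K k) = (j == k)%:R.
Hypothesis l1 : forall K x, \sum_j P1_eval (l K j) x = 1.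
Hypothesis lx : forall K x, \sum_j P1_eval (l K j) x *: vtx K j = x.

Let coefE K (c : 'I_4 -> R) j : \sum_k c k = 1 ->
  P1_eval (l K j) (\sum_k c k *: vtx K k) = c j.
Proof.
move=> c1; rewrite P1_eval_comb // (bigD1 j) //= lv eqxx mulr1 big1 ?addr0 // => k kj.
by rewrite lv eq_sym (negbTE kj) mulr0.
Qed.

Lemma simplexE K x : simplex (vtx K) x <-> forall j, 0 <= P1_eval (l K j) x.
Proof.
split=> [[c [c0 _ c1 ->]] j|h]; first by rewrite coefE.
exists (fun j => P1_eval (l K j) x); split => // j; first by rewrite inE.
Qed.

Lemma open_simplexE K x : open_simplex (vtx K) x <-> forall j, 0 < P1_eval (l K j) x.
Proof.
split=> [[c [c0 c1 ->]] j|h]; first by rewrite coefE.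
by exists (fun j => P1_eval (l K j) x).
Qed.

Lemma measurable_simplex (K : elt Th) : measurable (simplex (vtx K)).
Proof.
have -> : simplex (vtx K) = \bigcap_(j in [set: 'I_4]) [set x | 0 <= P1_eval (l K j) x].
  by apply/seteqP; split=> x; rewrite simplexE => h j; [move=> _|]; exact: h.
apply: fin_bigcap_measurable => // j _.
by apply: measurable_set_le => //; exact: measurable_P1_eval.
Qed.

Lemma measurable_open_simplex (K : elt Th) : measurable (open_simplex (vtx K)).
Proof.
have -> : open_simplex (vtx K) = \bigcap_(j in [set: 'I_4]) ~` [set x | P1_eval (l K j) x <= 0].
  apply/seteqP; split=> x; rewrite open_simplexE => h j; first by move=> _; apply/negP; rewrite -ltNge.
  by rewrite ltNge; apply/negP; exact: h.
apply: fin_bigcap_measurable => // j _; apply: measurableC.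
by apply: measurable_set_le => //; exact: measurable_P1_eval.
Qed.

Variable i : 'I_3.
Implicit Types (y : mR * mR) (K L : elt Th) (t : R).

Definition slope K j := coord3 (l K j).2 i.
Definition height K j y := P1_eval (l K j) (line_pt i y 0).

Lemma P1_eval_slope K j y t : P1_eval (l K j) (line_pt i y t) = slope K j * t + height K j y.
Proof. exact: P1_eval_line. Qed.

(* The lower and upper ends of the intersection of an element with the line
   through y in direction i; one unit beyond the cuboid when unconstrained. *)
Definition lower K y := \big[Num.max/coord3 lo i - 1]_(j < 4 | 0 < slope K j)
  (- height K j y / slope K j).
Definition upper K y := \big[Num.min/coord3 hi i + 1]_(j < 4 | slope K j < 0)
  (- height K j y / slope K j).
(** The lines in direction i that meet K. A constraint of slope zero does not restrict the parameter
    t and is therefore imposed on y itself. *)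
Definition shadow K : set (mR * mR) := [set y | lower K y <= upper K y /\
  forall j, slope K j = 0 -> 0 <= height K j y].

(** The line lies in no facet plane parallel to it, and it crosses the other facet planes at
    pairwise different parameters, so that it misses all edges and vertices. *)
Definition generic K y := (forall j, slope K j = 0 -> height K j y != 0) /\
  forall j k, j != k -> slope K j != 0 -> slope K k != 0 ->
    height K j y * slope K k != height K k y * slope K j.

Let m_height K j : measurable_fun [set: (mR * mR)%type] (height K j : _ -> mR).
Proof. exact: measurable_P1_line0. Qed.

Lemma measurable_lower K : measurable_fun [set: (mR * mR)%type] (lower K : _ -> mR).
Proof.
apply: measurable_bigmax => j; apply: measurable_funM => //.
by apply: measurable_funN; exact: m_height.
Qed.

Lemma measurable_upper K : measurable_fun [set: (mR * mR)%type] (upper K : _ -> mR).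
Proof.
apply: measurable_bigmin => j; apply: measurable_funM => //.
by apply: measurable_funN; exact: m_height.
Qed.

Lemma measurable_shadow K : measurable (shadow K).
Proof.
have -> : shadow K = [set y | lower K y <= upper K y] `&`
    \bigcap_(j in [set j | slope K j = 0]) [set y | 0 <= height K j y].
  by apply/seteqP; split=> y [h1 h2]; split.
apply: measurableI; first by apply: measurable_set_le; [exact: measurable_lower|exact: measurable_upper].
apply: fin_bigcap_measurable => [|j _]; first exact: finite_finset.
exact: measurable_set_le.
Qed.

Lemma simplex_line K y t : simplex (vtx K) (line_pt i y t) <->
  shadow K y /\ lower K y <= t <= upper K y.
Proof.
split=> [Kt|[[_ vert] /andP[/bigmax_leP[_ lot] /bigmin_geP[_ tup]]]]; last first.
  apply/simplexE => j; rewrite P1_eval_slope.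
  have [s0|s0|s0] := ltgtP (slope K j) 0.
  - by have := tup _ s0; rewrite ler_ndivlMr // -subr_ge0 opprK mulrC.
  - by have := lot _ s0; rewrite ler_pdivrMr // -subr_ge0 opprK mulrC.
  - by rewrite s0 mul0r add0r vert.
have /(_ i) := mesh_sub Kt; rewrite coord3_line => /andP[t1 t2].
move/simplexE : Kt => Kt.
have lot : lower K y <= t.
  apply/bigmax_leP; split=> [|j s0]; first by rewrite (le_trans _ t1) // gerBl.
  by have := Kt j; rewrite P1_eval_slope ler_pdivrMr // => ?; lra.
have tup : t <= upper K y.
  apply/bigmin_geP; split=> [|j s0]; first by rewrite (le_trans t2) // lerDl.
  by have := Kt j; rewrite P1_eval_slope ler_ndivlMr // => ?; lra.
split; last by rewrite lot tup.
split=> [|j s0]; first exact: le_trans tup.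
by have := Kt j; rewrite P1_eval_slope s0 mul0r add0r.
Qed.

Lemma shadow_lower K y : shadow K y -> simplex (vtx K) (line_pt i y (lower K y)).
Proof. by move=> h; apply/simplex_line; split => //; rewrite lexx h.1. Qed.

Lemma shadow_upper K y : shadow K y -> simplex (vtx K) (line_pt i y (upper K y)).
Proof. by move=> h; apply/simplex_line; split => //; rewrite lexx h.1. Qed.

Lemma shadow_bounds K y : shadow K y -> coord3 lo i <= lower K y /\ upper K y <= coord3 hi i.
Proof.
move=> h; have /(_ i) := mesh_sub (shadow_lower h); have /(_ i) := mesh_sub (shadow_upper h).
by rewrite !coord3_line => /andP[_ ->] /andP[->].
Qed.

(** If no coordinate of positive slope vanished at the lower end, the maximum defining [lower] could
    only be its cut-off value, which lies one unit outside the cuboid, whereas the element lies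
    inside. *)
Lemma lower_attained K y : shadow K y ->
  exists2 j, 0 < slope K j & P1_eval (l K j) (line_pt i y (lower K y)) = 0.
Proof.
move=> h; apply: contrapT => no.
have : lower K y <= coord3 lo i - 1.
  suff H : forall t, t < lower K y -> coord3 lo i - 1 < t -> False.
    by rewrite leNgt; apply/negP => /midf_lt[h1 h2]; exact: (H _ h2 h1).
  have [e e0 He] : exists2 e, 0 < e & forall j, 0 < slope K j -> - height K j y / slope K j <= lower K y - e.
    pose F j := lower K y + height K j y / slope K j.
    have F0 j : 0 < slope K j -> 0 < F j.
      move=> s0; rewrite /F -(opprK (height K j y / _)) subr_gt0 -mulNr lt_neqAle.
      rewrite (le_bigmax_cond _ _ s0) andbT; apply/eqP => e; apply: no; exists j => //.
      by rewrite P1_eval_slope -e; field; rewrite gt_eqF.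
    exists (\big[Num.min/1]_(j < 4 | 0 < slope K j) F j).
      by apply/bigmin_gtP; split.
    by move=> j s0; have := @bigmin_le_cond _ _ _ 1 j (fun j => 0 < slope K j) F s0; rewrite /F mulNr => ?; lra.
  move=> t t1 t2; have : lower K y <= Num.max (coord3 lo i - 1) (lower K y - e).
    by apply/bigmax_leP; split=> [|j s0]; rewrite le_max ?lexx // He ?orbT.
  by rewrite le_max => /orP[|]; lra.
by rewrite leNgt (lt_le_trans _ (shadow_bounds h).1) // gtrBl.
Qed.

Lemma upper_attained K y : shadow K y ->
  exists2 j, slope K j < 0 & P1_eval (l K j) (line_pt i y (upper K y)) = 0.
Proof.
move=> h; apply: contrapT => no.
have [e e0 He] : exists2 e, 0 < e & forall j, slope K j < 0 -> upper K y + e <= - height K j y / slope K j.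
  pose F j := - height K j y / slope K j - upper K y.
  have F0 j : slope K j < 0 -> 0 < F j.
    move=> s0; rewrite subr_gt0 lt_neqAle (bigmin_le_cond _ _ s0) andbT.
    apply/eqP => e; apply: no; exists j => //.
    by rewrite P1_eval_slope e; field; rewrite lt_eqF.
  exists (\big[Num.min/1]_(j < 4 | slope K j < 0) F j).
    by apply/bigmin_gtP; split.
  by move=> j s0; rewrite addrC -lerBrDr; exact: bigmin_le_cond.
have : Num.min (coord3 hi i + 1) (upper K y + e) <= upper K y.
  by rewrite [leRHS]/upper; apply/bigmin_geP; split=> [|j s0]; rewrite ge_min ?lexx // He ?orbT.
have [_ ub] := shadow_bounds h.
by rewrite ge_min => /orP[|]; lra.
Qed.

Lemma generic_lt K y : generic K y -> shadow K y -> lower K y < upper K y.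
Proof.
move=> [_ g2] h; have [j sj ej] := lower_attained h; have [k sk ek] := upper_attained h.
rewrite lt_neqAle h.1 andbT; apply/eqP => e; move: ek; rewrite -e => ek.
have jk : j != k by apply: contraTneq sj => ->; rewrite -leNgt ltW.
have /eqP := g2 j k jk (lt0r_neq0 sj) (ltr0_neq0 sk); apply.
move: ej ek; rewrite !P1_eval_slope => /eqP; rewrite addrC addr_eq0 => /eqP -> /eqP.
by rewrite addrC addr_eq0 => /eqP ->; ring.
Qed.

Lemma open_simplex_line K y t : generic K y -> shadow K y ->
  lower K y < t < upper K y -> open_simplex (vtx K) (line_pt i y t).
Proof.
move=> [g1 _] [_ vert] /andP[/bigmax_ltP[_ lot] /bigmin_gtP[_ tup]].
apply/open_simplexE => j; rewrite P1_eval_slope.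
have [s0|s0|s0] := ltgtP (slope K j) 0.
- by have := tup _ s0; rewrite ltr_ndivlMr // -subr_gt0 opprK mulrC.
- by have := lot _ s0; rewrite ltr_pdivrMr // -subr_gt0 opprK mulrC.
- by rewrite s0 mul0r add0r lt_neqAle eq_sym g1 // vert.
Qed.

(** Each failure of genericity confines y to the zero set of an affine function of two variables,
    which is null unless the function is identically zero; the values of barycentric coordinates at
    the vertices exclude that. *)
Lemma generic_ae : {ae leb2 R, forall y, forall K, generic K y}.
Proof.
have null (p q r : R) : ~~ [&& p == 0, q == 0 & r == 0] ->
    \forall y \ae leb2 R, p * y.1 + q * y.2 + r != 0.
  move=> h; exists [set z : mR * mR | p * z.1 + q * z.2 + r = 0]; split.
  - by apply: measurable_set_eq => //; exact: measurable_affine2.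
  - exact: leb2_linear_null.
  - by move=> y /= /negP; rewrite negbK => /eqP.
apply: filter_forall => K.
have A : \forall y \ae leb2 R, forall j, slope K j = 0 -> height K j y != 0.
  apply: filter_forall => j; have [s0|/eqP s0] := pselect (slope K j = 0); last first.
    by apply: nearW => y /eqP; rewrite (negbTE s0).
  have /null : ~~ [&& coord3 (l K j).2 (i + 1) == 0, coord3 (l K j).2 (i + 2%:R) == 0 & (l K j).1 == 0].
    apply/negP => /and3P[/eqP a1 /eqP a2 /eqP a3].
    have := lv K j j; rewrite (P1_evalE _ _ i) -/(slope K j) s0 a1 a2 a3 eqxx !mul0r !addr0.
    by move/esym/eqP; rewrite oner_eq0.
  move=> H; apply: (@filterS _ (almost_everywhere (leb2 R)) _ _ _ _ H) => y h _.
  by rewrite /height P1_eval_line0.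
have B : \forall y \ae leb2 R, forall j k, j != k -> slope K j != 0 -> slope K k != 0 ->
    height K j y * slope K k != height K k y * slope K j.
  apply: filter_forall => j; apply: filter_forall => k.
  have [jk|jk] := eqVneq j k; first exact: nearW.
  have [sk|sk] := eqVneq (slope K k) 0; first exact: nearW.
  (* The combination of the two coordinates in which the dependence on the line parameter cancels.
     At vertex j it equals [slope K k], so its coefficients cannot all vanish. *)
  pose c n := coord3 (l K j).2 n * slope K k - coord3 (l K k).2 n * slope K j.
  have /null : ~~ [&& c (i + 1) == 0, c (i + 2%:R) == 0 &
      (l K j).1 * slope K k - (l K k).1 * slope K j == 0].
    apply/negP => /and3P[/eqP a1 /eqP a2 /eqP a3].
    have : P1_eval (l K j) (vtx K j) * slope K k - P1_eval (l K k) (vtx K j) * slope K j = 0.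
      transitivity (coord3 (vtx K j) (i + 1) * c (i + 1) + coord3 (vtx K j) (i + 2%:R) * c (i + 2%:R)
        + ((l K j).1 * slope K k - (l K k).1 * slope K j)).
        by rewrite !(P1_evalE _ _ i) /c /slope; ring.
      by rewrite a1 a2 a3 !mulr0 !addr0.
    rewrite !lv eqxx eq_sym (negbTE jk) mul0r mul1r subr0 => /eqP.
    by rewrite (negbTE sk).
  move=> H; apply: (@filterS _ (almost_everywhere (leb2 R)) _ _ _ _ H) => y h _ _ _.
  apply: contraNneq h => e.
  apply/eqP; move/eqP: e; rewrite -subr_eq0 => /eqP e; rewrite -[RHS]e /height !P1_eval_line0 /c.
  ring.
by apply: (@filterS2 _ (almost_everywhere (leb2 R)) _ _ _ _ _ A B) => y hA hB; split.
Qed.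

Lemma measurable_line (f : mR * mR -> R) :
  measurable_fun [set: (mR * mR)%type] (f : _ -> mR) ->
  measurable_fun [set: (mR * mR)%type] (fun y : mR * mR => line_pt i y (f y) : R3 R).
Proof.
move=> mf; apply: measurable_fun_R3 => j; under eq_fun do rewrite coord3_vec.
case: (j == i) => //; case: (j == i + 1); [exact: measurable_fst|exact: measurable_snd].
Qed.

Let c : R := \sum_j (`|coord3 lo j| + `|coord3 hi j|).

Let shadow_box K y : shadow K y -> `|y.1| <= c /\ `|y.2| <= c.
Proof.
move=> /shadow_lower/mesh_sub h.
have H j : `|coord3 (line_pt i y (lower K y)) j| <= c.
  have /andP[h1 h2] := h j; apply: (@le_trans _ _ (`|coord3 lo j| + `|coord3 hi j|)).
    rewrite ler_norml (le_trans _ h1) ?(le_trans h2) //=.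
    - by rewrite (le_trans (ler_norm _)) // lerDr.
    - by rewrite lerNl (le_trans (ler_norm _)) // normrN lerDl.
  by rewrite /c (bigD1 j) //= lerDl sumr_ge0.
by move: (H (i + 1)) (H (i + 2%:R)); rewrite coord3_line1 coord3_line2.
Qed.

Let ind_integrable K (A : set (mR * mR)) (h : mR * mR -> R) (C : R) :
  measurable A -> A `<=` shadow K -> measurable_fun [set: (mR * mR)%type] (h : _ -> mR) ->
  (forall y, A y -> `|h y| <= C) ->
  (leb2 R).-integrable setT (EFin \o (fun y => \1_A y * h y)).
Proof.
move=> mA AK mh hC; apply: (@box_integrable _ _ c C).
  by apply: measurable_funM => //; exact/measurable_indicP.
move=> y; rewrite indicE; have [|_] := boolP (y \in A); last by rewrite mul0r eqxx.
by rewrite inE mul1r => Ay _; split; [exact: hC|exact: (shadow_box (AK _ Ay))].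
Qed.

Section telescope.
Variables (g : elt Th -> R3 R -> R) (B : R).
Hypothesis mg : forall K, measurable_fun [set: R3 R] (g K : R3 R -> mR).
Hypothesis gB : forall K x, closed_cuboid lo hi x -> `|g K x| <= B.

Definition top_value K y := g K (line_pt i y (upper K y)).
Definition bottom_value K y := g K (line_pt i y (lower K y)).
Definition junction K L : set (mR * mR) :=
  [set y | shadow K y /\ shadow L y /\ upper K y = lower L y].
Definition ceiling K : set (mR * mR) := [set y | shadow K y /\ upper K y = coord3 hi i].
Definition floor K : set (mR * mR) := [set y | shadow K y /\ lower K y = coord3 lo i].

Definition crossing K L y := \1_(junction K L) y * (top_value K y - bottom_value L y).

Lemma measurable_top_value K : measurable_fun [set: (mR * mR)%type] (top_value K : _ -> mR).
Proof. exact: (measurableT_comp (mg K) (measurable_line (measurable_upper K))). Qed.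

Lemma measurable_bottom_value K : measurable_fun [set: (mR * mR)%type] (bottom_value K : _ -> mR).
Proof. exact: (measurableT_comp (mg K) (measurable_line (measurable_lower K))). Qed.

Let topB K y : shadow K y -> `|top_value K y| <= B.
Proof. by move=> /shadow_upper/mesh_sub; exact: gB. Qed.

Let bottomB K y : shadow K y -> `|bottom_value K y| <= B.
Proof. by move=> /shadow_lower/mesh_sub; exact: gB. Qed.

Lemma measurable_junction K L : measurable (junction K L).
Proof.
have -> : junction K L = shadow K `&` (shadow L `&` [set y | upper K y = lower L y]) by [].
apply: measurableI; first exact: measurable_shadow.
apply: measurableI; first exact: measurable_shadow.
by apply: measurable_set_eq; [exact: measurable_upper|exact: measurable_lower].
Qed.

Lemma measurable_ceiling K : measurable (ceiling K).
Proof.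
apply: measurableI; first exact: measurable_shadow.
by apply: measurable_set_eq => //; exact: measurable_upper.
Qed.

Lemma measurable_floor K : measurable (floor K).
Proof.
apply: measurableI; first exact: measurable_shadow.
by apply: measurable_set_eq => //; exact: measurable_lower.
Qed.

Let diffB K L y : shadow K y -> shadow L y -> `|top_value K y - bottom_value L y| <= B + B.
Proof. by move=> hK hL; apply: le_trans (ler_normB _ _) _; apply: lerD; [exact: topB|exact: bottomB]. Qed.

Let mdiff K L : measurable_fun [set: (mR * mR)%type] (fun y => top_value K y - bottom_value L y : mR).
Proof. by apply: measurable_funB; [exact: measurable_top_value|exact: measurable_bottom_value]. Qed.

Lemma crossing_integrable K L : (leb2 R).-integrable setT (EFin \o crossing K L).
Proof.
apply: (@ind_integrable K _ _ (B + B)) => //; first exact: measurable_junction.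
  by move=> y [].
by move=> y [hK [hL _]]; exact: diffB.
Qed.

Lemma chord_integrable K : (leb2 R).-integrable setT
  (EFin \o (fun y => \1_(shadow K) y * (top_value K y - bottom_value K y))).
Proof.
apply: (@ind_integrable K _ _ (B + B)) => //; first exact: measurable_shadow.
by move=> y hK; exact: diffB.
Qed.

Lemma ceiling_integrable K : (leb2 R).-integrable setT
  (EFin \o (fun y => \1_(ceiling K) y * top_value K y)).
Proof.
apply: (@ind_integrable K _ _ B) => //; first exact: measurable_ceiling.
- by move=> y [].
- exact: measurable_top_value.
- by move=> y [hK _]; exact: topB.
Qed.

Lemma floor_integrable K : (leb2 R).-integrable setT
  (EFin \o (fun y => \1_(floor K) y * bottom_value K y)).
Proof.
apply: (@ind_integrable K _ _ B) => //; first exact: measurable_floor.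
- by move=> y [].
- exact: measurable_bottom_value.
- by move=> y [hK _]; exact: bottomB.
Qed.

Let indE (A : set (mR * mR)) y (z : R) : \1_A y * z = if `[< A y >] then z else 0.
Proof. by rewrite indicE -[y \in A]/(`[< A y >]); case: ifP; rewrite ?mul1r ?mul0r. Qed.

(** On a generic line the chords of the elements tile the chord of the cuboid: they are
    nondegenerate, their interiors are disjoint because the open simplices are, and they cover
    because the simplices do. If the line meets no element, all terms vanish. *)
Lemma generic_telescope y : (forall K, generic K y) ->
  \sum_K \1_(shadow K) y * (top_value K y - bottom_value K y)
  = \sum_K \sum_L crossing K L y
  + (\sum_K \1_(ceiling K) y * top_value K y - \sum_K \1_(floor K) y * bottom_value K y).
Proof.
move=> gen; have [[K0 hK0]|none] := pselect (exists K, shadow K y); last first.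
  have n0 K (A : set (mR * mR)) (z : R) : A `<=` shadow K -> \1_A y * z = 0.
    by move=> AK; rewrite indE; case: asboolP => // /AK h; case: none; exists K.
  rewrite !big1 ?subrr ?addr0 // => K _; try exact: (n0 K).
  - by apply: (n0 K) => ? [].
  - by apply: (n0 K) => ? [].
  - by rewrite big1 // => L _; apply: (n0 K) => ? [].
have := @tiling_telescope R (elt Th) (fun K => `[< shadow K y >]) (lower^~ y) (upper^~ y)
  (coord3 lo i) (coord3 hi i) (top_value^~ y) (bottom_value^~ y) _ _ _ _.
have -> : \sum_K \1_(shadow K) y * (top_value K y - bottom_value K y)
    = \sum_(K | `[< shadow K y >]) (top_value K y - bottom_value K y).
  by rewrite [RHS]big_mkcond /=; apply: eq_bigr => K _; rewrite indE.
move=> ->.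
- congr (_ + (_ - _)); rewrite [LHS]big_mkcond /=; apply: eq_bigr => K _; last 2 first.
  + rewrite indE; case: asboolP => hK; case: asboolP => [[hK' e]|nK] //; first by rewrite e eqxx.
    by case: eqP => // e; case: nK.
  + rewrite indE; case: asboolP => hK; case: asboolP => [[hK' e]|nK] //; first by rewrite e eqxx.
    by case: eqP => // e; case: nK.
  + case: asboolP => hK; last first.
      rewrite big1 // => L _; rewrite /crossing indE; case: asboolP => // -[hK'] //.
    rewrite [LHS]big_mkcond /=; apply: eq_bigr => L _; rewrite /crossing indE.
    by case: asboolP => /= [hL|nL]; case: asboolP => [[_ [hL' e]]|nJ] //;
      [rewrite e eqxx|case: eqP => // e; case: nJ].
- by move=> K /asboolP hK; exact: generic_lt.
- by move=> K /asboolP hK; exact: shadow_bounds.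
- move=> K L t /asboolP hK /asboolP hL tK tL.
  exact: (mesh_disjoint (open_simplex_line (gen K) hK tK) (open_simplex_line (gen L) hL tL)).
- move=> t /andP[t1 t2].
  (* The coordinates other than i are those of a point of [K0], hence within the bounds of the
     cuboid. *)
  have : closed_cuboid lo hi (line_pt i y t).
    move=> j; have := mesh_sub (shadow_lower hK0) j; rewrite !coord3_vec.
    by case: (j =P i) => // -> _; rewrite t1 t2.
  by move=> /mesh_cover[K /simplex_line[hK tK]]; exists K => //; apply/asboolP.
Qed.

End telescope.

Lemma sum_chords (g : elt Th -> R3 R -> R) (B : R) :
  (forall K, measurable_fun [set: R3 R] (g K : R3 R -> mR)) ->
  (forall K x, closed_cuboid lo hi x -> `|g K x| <= B) ->
  \sum_K (\int[leb2 R]_y (\1_(shadow K) y * (top_value g K y - bottom_value g K y)))%R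
  = \sum_K \sum_L (\int[leb2 R]_y crossing g K L y)%R
  + (\sum_K (\int[leb2 R]_y (\1_(ceiling K) y * top_value g K y))%R
  - \sum_K (\int[leb2 R]_y (\1_(floor K) y * bottom_value g K y))%R).
Proof.
move=> mg gB; have mcr K L := crossing_integrable mg gB K L.
have mch K := chord_integrable mg gB K.
have mce K := ceiling_integrable mg gB K.
have mfl K := floor_integrable mg gB K.
have mKcr K := @integrable_sum_fun _ _ _ (leb2 R) _ (index_enum (elt Th)) setT _ measurableT (mcr K).
rewrite -!Rintegral_sum //.
under [X in _ = X + _]eq_bigr do rewrite -Rintegral_sum //.
rewrite -Rintegral_sum // -RintegralB //; try exact: integrable_sum_fun.
rewrite -RintegralD //; try exact: integrable_sum_fun; last first.
  by apply: integrableB_EFin => //; exact: integrable_sum_fun.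
have int_meas f : (leb2 R).-integrable setT (EFin \o f) ->
    measurable_fun [set: (mR * mR)%type] (f : _ -> mR).
  by move=> /measurable_int /measurable_EFinP.
apply: ae_eq_Rintegral.
- by apply: int_meas; exact: integrable_sum_fun.
- apply: int_meas; apply: integrableD_EFin => //; first exact: integrable_sum_fun.
  by apply: integrableB_EFin => //; exact: integrable_sum_fun.
- apply: (@filterS _ (almost_everywhere (leb2 R)) _ _ _ _ generic_ae) => y gen.
  exact: generic_telescope.
Qed.

(** Fubini in direction i followed by the fundamental theorem on the chord of K; h plays the part of
    an antiderivative of f along these lines. *)
Lemma simplex_slice K (f h : R3 R -> R) (B : R) :
  measurable_fun [set: R3 R] (f : R3 R -> mR) ->
  (forall x, simplex (vtx K) x -> `|f x| <= B) ->
  (forall y s t, s <= t -> (\int[lam]_(u in `[s, t]) (f (line_pt i y u))%:E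
    = (h (line_pt i y t) - h (line_pt i y s))%:E)%E) ->
  (\int[leb3 R]_(x in simplex (vtx K)) f x
   = \int[leb2 R]_y (\1_(shadow K) y * (h (line_pt i y (upper K y)) - h (line_pt i y (lower K y)))))%R.
Proof.
move=> mf fB ftc; have mK := measurable_simplex K.
rewrite /Rintegral integral_mkcond (leb3_slice i); last first.
  have [h' _] := @integrable_mkcond _ _ _ (leb3 R) (simplex (vtx K)) (EFin \o f) mK.
  by apply: h'; apply: (@cuboid_integrable _ lo hi _ _ B) => //; exact: mesh_sub.
congr fine; apply: eq_integral => y _.
transitivity (\int[lam]_(t in [set t | simplex (vtx K) (line_pt i y t)]) (f (line_pt i y t))%:E)%E.
  rewrite [RHS]integral_mkcond; apply: eq_integral => t _; rewrite !patchE.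
  by rewrite -[line_pt i y t \in simplex _]/(`[< simplex (vtx K) (line_pt i y t) >]).
rewrite indicE; have [|/negP nK] := boolP (y \in shadow K).
  rewrite inE mul1r => hK; rewrite -ftc ?hK.1 //; congr (integral _ _ _).
  apply/seteqP; split=> t /=; rewrite in_itv /=.
    by move=> /simplex_line[].
  by move=> h'; apply/simplex_line.
rewrite mul0r (_ : [set t | _] = set0) ?integral_set0 //.
by apply/seteqP; split=> // t /= /simplex_line[hK _]; case: nK; rewrite inE.
Qed.

Lemma junction_face K L y : junction K L y ->
  common_face K L (line_pt i y (upper K y)).
Proof.
move=> [hK [hL e]].
have [j _ ej] := upper_attained hK; have [k _ ek] := lower_attained hL.
split; split.
- exact: shadow_upper.
- by move/open_simplexE => /(_ j); rewrite ej ltxx.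
- by rewrite e; exact: shadow_lower.
- by rewrite e => /open_simplexE => /(_ k); rewrite ek ltxx.
Qed.

Lemma face_framePopp K L fr : face_frame L K fr ->
  face_frame K L (Frame (fpt fr) (ft1 fr) (ft2 fr) (- fn fr)).
Proof.
have dN (u v : R3 R) : dot u (- v) = - dot u v by exact: dotNr.
have dNN (u : R3 R) : dot (- u) (- u) = dot u u by rewrite dN dotC dN opprK.
case=> -[[d11 d22 dnn] [d12 d1n d2n]] h1 h2 h3; split=> /=.
- by split; split => //; rewrite /= ?dNN ?dN ?d1n ?d2n ?oppr0.
- by move=> x [Kx Lx]; rewrite dN h1 ?oppr0 //; split.
- by move=> x Kx; rewrite dN oppr_le0 h3.
- by move=> x Lx; rewrite dN oppr_ge0 h2.
Qed.

(** The geometric core of the slicing. On a generic line the meeting point p lies on exactly one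
    facet of K and one facet of L. Unless their inward gradients are opposite, some direction leads
    from p into both open simplices, which are disjoint; so the two facets lie in a common plane
    that separates the elements. *)
Lemma junction_frame K L y : (forall K, generic K y) -> junction K L y ->
  exists fr, face_frame K L fr.
Proof.
move=> gen Jy; have [hK [hL e]] := Jy.
set p := line_pt i y (upper K y); have Lp : line_pt i y (lower L y) = p by rewrite -e.
have [j sj ej] := upper_attained hK; have [k sk ek] := lower_attained hL.
have pos M m : generic M y -> simplex (vtx M) p -> slope M m != 0 -> P1_eval (l M m) p = 0 ->
    forall m', m' != m -> 0 < P1_eval (l M m') p.
  move=> [g1 g2] /simplexE Mp s0 Mm0 m' mm'; rewrite lt_neqAle Mp andbT eq_sym.
  apply/eqP => Mm'0; move: Mm0 Mm'0; rewrite /p !P1_eval_slope => a1 a2.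
  have [s'0|s'0] := eqVneq (slope M m') 0.
    by move/eqP: a2; rewrite s'0 mul0r add0r (negbTE (g1 _ s'0)).
  have /eqP := g2 m' m mm' s'0 s0; apply.
  have -> : height M m' y = - (slope M m' * upper K y) by apply/eqP; rewrite -addr_eq0 addrC a2.
  have -> : height M m y = - (slope M m * upper K y) by apply/eqP; rewrite -addr_eq0 addrC a1.
  ring.
have posK := pos K j (gen K) (shadow_upper hK) (ltr0_neq0 sj) ej.
have posL : forall m', m' != k -> 0 < P1_eval (l L m') p.
  by apply: pos; rewrite -?Lp //; [exact: shadow_lower|exact: lt0r_neq0].
pose a := (l K j).2; pose b := (l L k).2.
have a2 : 0 < dot a a by apply: (@dot_gt0 _ _ i); exact: ltr0_neq0.
have b2 : 0 < dot b b by apply: (@dot_gt0 _ _ i); exact: lt0r_neq0.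
have evalB (q : P1 (R := R)) (x : R3 R) : P1_eval q p = 0 -> dot q.2 (x - p) = P1_eval q x.
  by move=> q0; rewrite -{2}(subrK p x) [x - p + p]addrC P1_evalD q0 add0r.
have ek' : P1_eval (l L k) p = 0 by rewrite -ek Lp.
(* A direction w entering both elements would produce a common interior point and force K = L, but
   the chord of K cannot start where it ends. *)
case: (opposite_gradients (lt0r_neq0 a2) (lt0r_neq0 b2)) => [[w [aw bw]]|ba].
  have [eK eK0 HK] : exists2 e', 0 < e' & forall t m, 0 < t -> t <= e' ->
      0 < P1_eval (l K m) (p + t *: w).
    by apply: P1_step => m; have [->|mj] := eqVneq m j; [right|left; exact: posK].
  have [eL eL0 HL] : exists2 e', 0 < e' & forall t m, 0 < t -> t <= e' ->
      0 < P1_eval (l L m) (p + t *: w).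
    by apply: P1_step => m; have [->|mk] := eqVneq m k; [right|left; exact: posL].
  have t0 : 0 < Num.min eK eL by rewrite lt_min eK0.
  have tK : Num.min eK eL <= eK by rewrite ge_min lexx.
  have tL : Num.min eK eL <= eL by rewrite ge_min lexx orbT.
  have KL : K = L.
    by apply: (@mesh_disjoint _ _ (p + Num.min eK eL *: w)); apply/open_simplexE => m;
      [exact: HK|exact: HL].
  by have := generic_lt (gen K) hK; rewrite e -KL ltxx.
pose A := Num.sqrt (dot a a).
have A0 : 0 < A by rewrite sqrtr_gt0.
have AA : dot a a = A * A by rewrite -expr2 sqr_sqrtr // ltW.
(* The normalised gradient with reversed sign points out of K, that is, towards L. *)
have n1 : dot (- A^-1 *: a) (- A^-1 *: a) = 1.
  by rewrite dotZr dotC dotZr AA; field; rewrite gt_eqF.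
have [fr [ofr frp frn]] := orthonormal_completion p n1; exists fr.
have down x : simplex (vtx K) x -> dot (x - p) (- A^-1 *: a) <= 0.
  move=> /simplexE /(_ j); rewrite -evalB // => h.
  by rewrite dotZr mulNr oppr_le0 dotC; apply: mulr_ge0 => //; rewrite invr_ge0 ltW.
have up x : simplex (vtx L) x -> 0 <= dot (x - p) (- A^-1 *: a).
  move=> /simplexE /(_ k); rewrite -evalB // -/b ba [dot (_ *: _) _]dotC !dotZr => h.
  rewrite mulNr -(pmulr_rge0 _ (_ : 0 < Num.sqrt (dot b b))) ?sqrtr_gt0 //.
  by move: h; rewrite -/A mulrN mulrA mulNr.
split=> [//|x [[Kx _] [Lx _]]|x Kx|x Lx]; rewrite frp frn.
- by apply/eqP; rewrite eq_le down ?up.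
- exact: down.
- exact: up.
Qed.
Lemma measurable_crossing (g : elt Th -> R3 R -> R) (B : R) :
  (forall K, measurable_fun [set: R3 R] (g K : R3 R -> mR)) ->
  (forall K x, closed_cuboid lo hi x -> `|g K x| <= B) ->
  forall K L, measurable_fun [set: (mR * mR)%type] (crossing g K L : _ -> mR).
Proof. by move=> mg gB K L; have /measurable_int/measurable_EFinP := crossing_integrable mg gB K L. Qed.

Lemma crossing_null (g : elt Th -> R3 R -> R) (B : R) :
  (forall K, measurable_fun [set: R3 R] (g K : R3 R -> mR)) ->
  (forall K x, closed_cuboid lo hi x -> `|g K x| <= B) ->
  forall K L, (\forall y \ae leb2 R, ~ junction K L y) ->
  (\int[leb2 R]_y crossing g K L y)%R = 0.
Proof.
move=> mg gB K L H.
transitivity (\int[leb2 R]_(y in setT) (0 : R))%R; last by rewrite Rintegral_cst // mul0r.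
apply: ae_eq_Rintegral => //; first exact: (measurable_crossing mg gB).
apply: (@filterS _ (almost_everywhere (leb2 R)) _ _ _ _ H) => y nJ.
by rewrite /crossing indicE memNset ?mul0r.
Qed.

Lemma measurable_common_face K L : measurable (common_face K L).
Proof.
by apply: measurableI; apply: measurableD;
  do ?[exact: measurable_simplex|exact: measurable_open_simplex].
Qed.

Section planes.
Variable fr : frame (R := R).
Hypothesis ofr : orthonormal_frame fr.
Let n m := coord3 (fn fr) m.
Let q y := n (i + 1) * y.1 + n (i + 2%:R) * y.2 + (- dot (fpt fr) (fn fr)).
(* Where the line through y in direction i meets the plane of fr. *)
Let pl y := line_pt i y (- q y / n i).

Let dot_line y t : dot (line_pt i y t - fpt fr) (fn fr) = n i * t + q y.
Proof.
rewrite dotC dotDr dotNr [dot (fn fr) (fpt fr)]dotC (dotE _ _ i).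
by rewrite coord3_line coord3_line1 coord3_line2 /q /n; ring.
Qed.

Lemma plane_ptP y t : n i != 0 ->
  dot (line_pt i y t - fpt fr) (fn fr) = 0 -> t = - q y / n i.
Proof.
move=> ni; rewrite dot_line => /eqP; rewrite addr_eq0 => /eqP e.
by rewrite -e mulrC mulKf.
Qed.

Let coord_chart z m : coord3 (chart fr z) m
  = coord3 (ft1 fr) m * z.1 + coord3 (ft2 fr) m * z.2 + coord3 (fpt fr) m.
Proof. by rewrite /chart !coord3D !coord3Z; ring. Qed.

Let shade z : mR * mR := (coord3 (chart fr z) (i + 1), coord3 (chart fr z) (i + 2%:R)).

Let shadeE z : shade z = (coord3 (ft1 fr) (i + 1) * z.1 + coord3 (ft2 fr) (i + 1) * z.2 + coord3 (fpt fr) (i + 1),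
  coord3 (ft1 fr) (i + 2%:R) * z.1 + coord3 (ft2 fr) (i + 2%:R) * z.2 + coord3 (fpt fr) (i + 2%:R)).
Proof. by rewrite /shade !coord_chart. Qed.

Let mshade : measurable_fun [set: (mR * mR)%type] shade.
Proof. by rewrite (funext shadeE); exact: measurable_linear2. Qed.

Let chart_pl z : n i != 0 -> chart fr z = pl (shade z).
Proof.
move=> ni; rewrite -[LHS](line_ptK i); congr line_pt; apply: plane_ptP => //.
rewrite line_ptK /chart; case: ofr => _ [_ d1 d2].
rewrite -[fpt fr + _ + _]addrA [fpt fr + _ - _]addrC addKr dotC dotDr !dotZr.
by rewrite ![dot (fn fr) _]dotC d1 d2 !mulr0 addr0.
Qed.

Let det := coord3 (ft1 fr) (i + 1) * coord3 (ft2 fr) (i + 2%:R)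
  - coord3 (ft2 fr) (i + 1) * coord3 (ft1 fr) (i + 2%:R).

Let normD : `|det| = `|n i|.
Proof.
have := orthonormal_minor i ofr; rewrite -/det -/(n i) => e.
by rewrite -!sqrtr_sqr e.
Qed.

Let mpl : measurable_fun [set: (mR * mR)%type] (pl : mR * mR -> R3 R).
Proof.
apply: measurable_line; apply: measurable_funM => //; apply: measurable_funN.
exact: measurable_affine2.
Qed.

(** Passing from the chart to the projection along direction i divides areas by |n_i|, so of the
    factor n_i in the integrand only the sign remains. *)
Lemma surface_plane (F : set (R3 R)) (h : R3 R -> R) (B : R) : n i != 0 ->
  measurable F -> F `<=` closed_cuboid lo hi ->
  measurable_fun [set: R3 R] (h : R3 R -> mR) -> (forall x, F x -> `|h x| <= B) ->
  (leb2 R).-integrable setT (EFin \o (fun y => \1_F (pl y) * h (pl y))) /\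
  surface_integral fr F (fun x => n i * h x)
   = Num.sg (n i) * (\int[leb2 R]_y (\1_F (pl y) * h (pl y)))%R.
Proof.
move=> ni mF FD mh hB; pose H y := \1_F (pl y) * h (pl y).
have mH : measurable_fun [set: (mR * mR)%type] (H : _ -> mR).
  apply: measurable_funM; last exact: (measurableT_comp mh mpl).
  by apply: (measurableT_comp _ mpl); exact/measurable_indicP.
have iH : (leb2 R).-integrable setT (EFin \o H).
  apply: (@box_integrable _ _ c B) => // y; rewrite /H indicE.
  have [|_] := boolP (pl y \in F); last by rewrite mul0r eqxx.
  rewrite inE mul1r => Fy _; split; first exact: hB.
  have bx j : `|coord3 (pl y) j| <= c.
    have /andP[h1 h2] := FD _ Fy j; apply: (@le_trans _ _ (`|coord3 lo j| + `|coord3 hi j|)).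
      rewrite ler_norml (le_trans _ h1) ?(le_trans h2) //=.
      - by rewrite (le_trans (ler_norm _)) // lerDr.
      - by rewrite lerNl (le_trans (ler_norm _)) // normrN lerDl.
    by rewrite /c (bigD1 j) //= lerDl sumr_ge0.
  by move: (bx (i + 1)) (bx (i + 2%:R)); rewrite coord3_line1 coord3_line2.
split=> //; rewrite /surface_integral.
have D0 : det != 0 by rewrite -normr_gt0 normD normr_gt0.
have pushE' A : measurable A -> push (leb2 R) mshade A = ((`|n i|^-1)%:E * leb2 R A)%E.
  move=> mA; rewrite -normD -(leb2_linear (coord3 (fpt fr) (i + 1)) (coord3 (fpt fr) (i + 2%:R)) D0 mA).
  by congr (leb2 R _); apply/seteqP; split => z /=; rewrite shadeE.
have niV : 0 <= `|n i|^-1 by rewrite invr_ge0.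
have pushG (G : mR * mR -> \bar R) : measurable_fun setT G -> (forall y, 0 <= G y)%E ->
    (\int[leb2 R]_z G (shade z) = (`|n i|^-1)%:E * \int[leb2 R]_y G y)%E.
  move=> mG G0; rewrite -(ge0_integral_push (leb2 R) mshade mG G0).
  rewrite -[X in (X%:E * _)%E]/((NngNum niV)%:num) -(ge0_integral_mscale (leb2 R) measurableT (NngNum niV) mG) //.
  by apply: eq_measure_integral => A mA _; rewrite [LHS]pushE'.
have intH : (\int[leb2 R]_z H (shade z))%R = `|n i|^-1 * (\int[leb2 R]_y H y)%R.
  have mEH : measurable_fun setT (EFin \o H) by exact: measurableT_comp.
  rewrite /Rintegral integralE [X in _ = _ * fine X]integralE.
  have -> : (\int[leb2 R]_x (fun z => (H (shade z))%:E)^\+ x)%E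
      = (\int[leb2 R]_x (EFin \o H)^\+ (shade x))%E.
    by apply: eq_integral => z _; rewrite !funeposE.
  have -> : (\int[leb2 R]_x (fun z => (H (shade z))%:E)^\- x)%E
      = (\int[leb2 R]_x (EFin \o H)^\- (shade x))%E.
    by apply: eq_integral => z _; rewrite !funenegE.
  rewrite pushG //; last exact: measurable_funepos.
  rewrite pushG //; last exact: measurable_funeneg.
  have fp := integrable_pos_fin_num measurableT iH.
  have fq := integrable_neg_fin_num measurableT iH.
  by rewrite -muleBr ?fin_num_adde_defr // fineM // fin_numB fp fq.
rewrite Rintegral_mkcond.
transitivity (\int[leb2 R]_z (n i * H (shade z)))%R.
  apply: eq_Rintegral => z _; rewrite patchE /H -chart_pl // indicE.
  rewrite -[z \in _]/(`[< F (chart fr z) >]) -[chart fr z \in F]/(`[< F (chart fr z) >]).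
  by case: ifP => _; rewrite ?mul1r ?mul0r ?mulr0.
rewrite RintegralZl //; last first.
  apply/integrableP; split; first exact: (measurableT_comp (measurable_int _ iH) mshade).
  rewrite (pushG (fun y => `|(H y)%:E|%E)) //; last by do 2 apply: measurableT_comp => //.
  apply: lte_mul_pinfty => //; rewrite ?lee_fin //.
  by case/integrableP: iH.
by rewrite intH mulrA {1}(numEsg (n i)) mulfK // normr_eq0.
Qed.

(** The sign of n_i decides whether lines in direction i pass from K to L or from L to K, so almost
    surely only one of the crossing terms is nonzero. If n_i = 0, the lines through the face form a
    null set and both sides vanish. *)
Lemma face_crossing K L (g : elt Th -> R3 R -> R) (B : R) : face_frame K L fr ->
  (forall K, measurable_fun [set: R3 R] (g K : R3 R -> mR)) ->
  (forall K x, closed_cuboid lo hi x -> `|g K x| <= B) ->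
  surface_integral fr (common_face K L) (fun x => n i * (g K x - g L x))
  = (\int[leb2 R]_y crossing g K L y)%R + (\int[leb2 R]_y crossing g L K y)%R.
Proof.
case=> _ onF belowK aboveL mg gB.
have mcr := measurable_crossing mg gB.
have cr0 := crossing_null mg gB.
have mFace := measurable_common_face K L.
have onJ K' L' y : (K', L') = (K, L) \/ (K', L') = (L, K) -> junction K' L' y ->
    n i * upper K' y + q y = 0.
  move=> h /junction_face [a b]; rewrite -dot_line; apply: onF.
  by case: h => -[e1 e2]; move: a b; rewrite e1 e2.
have [ni|ni] := eqVneq (n i) 0.
  have noJ K' L' : (K', L') = (K, L) \/ (K', L') = (L, K) -> \forall y \ae leb2 R, ~ junction K' L' y.
    move=> KL; exists [set y : mR * mR | q y = 0]; split.
    - by apply: measurable_set_eq => //; exact: measurable_affine2.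
    - apply: leb2_linear_null; apply/negP => /and3P[/eqP a1 /eqP a2 _].
      case: ofr => -[_ _]; rewrite (dotE _ _ i) -/(n _) -/(n (i + 1)) -/(n (i + 2%:R)) ni a1 a2.
      by rewrite !mul0r !addr0 => /esym/eqP; rewrite oner_eq0.
    - by move=> y /contrapT /(onJ _ _ _ KL); rewrite ni mul0r add0r.
  rewrite !cr0 ?addr0; [|by apply: noJ; right|by apply: noJ; left].
  rewrite /surface_integral; under eq_Rintegral do rewrite ni mul0r.
  rewrite Rintegral_cst ?mul0r //.
  have mch : measurable_fun [set: (mR * mR)%type] (chart fr : mR * mR -> R3 R).
    apply: measurable_fun_R3 => m; under eq_fun do rewrite coord_chart.
    exact: measurable_affine2.
  by rewrite -[X in measurable X]setTI; exact: mch.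
have [| | |iH ->] := @surface_plane (common_face K L) (fun x => g K x - g L x) (B + B) ni mFace.
- by move=> x [[/mesh_sub]].
- by apply: measurable_funB; exact: mg.
- move=> x [[/mesh_sub Dx _] _]; apply: le_trans (ler_normB _ _) _.
  by apply: lerD; exact: gB.
- have mH := measurable_int _ iH; move/measurable_EFinP in mH.
  have atF y : common_face K L (pl y) -> n i * (- q y / n i) + q y = 0.
    by move=> _; field.
  have inK y t : simplex (vtx K) (line_pt i y t) -> n i * t + q y <= 0.
    by move=> /belowK; rewrite dot_line.
  have inL y t : simplex (vtx L) (line_pt i y t) -> 0 <= n i * t + q y.
    by move=> /aboveL; rewrite dot_line.
  have faceK y : common_face K L (pl y) -> [/\ shadow K y, shadow L y,
      lower K y <= - q y / n i <= upper K y & lower L y <= - q y / n i <= upper L y].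
    by move=> [[/simplex_line[h1 h2] _] [/simplex_line[h3 h4] _]].
  have tE t y : n i * t + q y = 0 -> t = - q y / n i.
    by move=> /eqP; rewrite addr_eq0 => /eqP e; rewrite -e mulrC mulKf.
  (* For n_i > 0 a passage from L to K would place the whole chord of K on the wrong side of the
     plane, beyond the point where it touches the plane; for n_i < 0 the same excludes a passage
     from K to L. *)
  have [n0|n0] := ltP 0 (n i).
    rewrite gtr0_sg // mul1r [X in _ = _ + X]cr0 ?addr0; last first.
      apply: (@filterS _ (almost_everywhere (leb2 R)) _ _ _ _ generic_ae) => y gen J.
      have := onJ _ _ _ (or_intror erefl) J; have [hL [hK e]] := J.
      rewrite e => e0; have := inK y _ (shadow_upper hK).
      have := generic_lt (gen K) hK; rewrite -(ltr_pM2l n0); lra.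
    apply: ae_eq_Rintegral => //; apply: nearW => y; rewrite /crossing !indicE.
    have [/set_mem Jy|/negP nJ] := boolP (y \in junction K L).
      have := onJ _ _ _ (or_introl erefl) Jy => /tE e0.
      have eP : pl y = line_pt i y (upper K y) by rewrite /pl e0.
      rewrite mem_set; last by rewrite eP; exact: junction_face.
      by rewrite eP /top_value /bottom_value; have [_ [_ <-]] := Jy.
    have [/set_mem Fy|_] := boolP (pl y \in common_face K L); last by rewrite !mul0r.
    case: nJ; rewrite inE; have [hK hL /andP[k1 k2] /andP[l1' l2]] := faceK _ Fy.
    have uK : upper K y <= - q y / n i.
      by rewrite ler_pdivlMr // mulrC -subr_le0 opprK; exact: inK (shadow_upper hK).
    have lL : - q y / n i <= lower L y.
      by rewrite ler_pdivrMr // mulrC -subr_ge0 opprK; exact: inL (shadow_lower hL).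
    by split=> //; split=> //; apply/eqP; rewrite eq_le (le_trans uK lL) (le_trans l1' k2).
  have n0' : n i < 0 by rewrite lt_neqAle ni.
  rewrite ltr0_sg // mulN1r [X in _ = X + _]cr0 ?add0r; last first.
    apply: (@filterS _ (almost_everywhere (leb2 R)) _ _ _ _ generic_ae) => y gen J.
    have := onJ _ _ _ (or_introl erefl) J; have [hK [hL e]] := J.
    move=> e0; have := inK y _ (shadow_lower hK).
    have := generic_lt (gen K) hK; rewrite -(ltr_nM2l n0'); lra.
  rewrite -mulN1r -RintegralZl //.
  apply: ae_eq_Rintegral => //; first exact: measurable_funM.
  apply: nearW => y; rewrite /crossing !indicE.
  have [/set_mem Jy|/negP nJ] := boolP (y \in junction L K).
    have := onJ _ _ _ (or_intror erefl) Jy => /tE e0.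
    have eP : pl y = line_pt i y (upper L y) by rewrite /pl e0.
    rewrite mem_set; last first.
      by rewrite eP; have [a b] := junction_face Jy; split.
    by rewrite eP /top_value /bottom_value; have [_ [_ <-]] := Jy; ring.
  have [/set_mem Fy|_] := boolP (pl y \in common_face K L); last by rewrite !mul0r mulr0.
  case: nJ; rewrite inE; have [hK hL /andP[k1 k2] /andP[l1' l2]] := faceK _ Fy.
  have lK : - q y / n i <= lower K y.
    by rewrite ler_ndivrMr // mulrC -subr_le0 opprK; exact: inK (shadow_lower hK).
  have uL : upper L y <= - q y / n i.
    by rewrite ler_ndivlMr // mulrC -subr_ge0 opprK; exact: inL (shadow_upper hL).
  by split=> //; split=> //; apply/eqP; rewrite eq_le (le_trans uL lK) (le_trans k1 l2).
Qed.

End planes.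

Section directional_divergence.
Variables (g : elt Th -> R3 R -> R) (B : R).
Hypothesis mg : forall K, measurable_fun [set: R3 R] (g K : R3 R -> mR).
Hypothesis gB : forall K x, closed_cuboid lo hi x -> `|g K x| <= B.

Let flux K L := surface_integral (frame_of K L) (common_face K L)
  (fun x => coord3 (fn (frame_of K L)) i * (g K x - g L x)).

(** The identity also holds for pairs that are not interior faces: either a separating frame exists
    and the common face has area zero, or none exists and then no generic line passes between the
    two elements. *)
Let face_flux K L : (if `[< interior_face K L >] then flux K L else 0)
  = (\int[leb2 R]_y crossing g K L y)%R + (\int[leb2 R]_y crossing g L K y)%R.
Proof.
have mF := measurable_common_face K L.
case: asboolP => [[fr frF _]|nint].
  have FF : face_frame K L (frame_of K L) by rewrite /frame_of; apply: xgetPex; exists fr.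
  by apply: (face_crossing _ FF mg gB); case: FF.
have [[fr FF]|none] := pselect (exists fr, face_frame K L fr).
  have ofr : orthonormal_frame fr by case: FF.
  rewrite -(face_crossing ofr FF mg gB) /surface_integral.
  have mch : measurable_fun [set: (mR * mR)%type] (chart fr : mR * mR -> R3 R).
    by apply: measurable_fun_R3 => m; rewrite /chart; under eq_fun do
      rewrite !coord3D !coord3Z mulrC [_ * coord3 (ft2 fr) m]mulrC -addrA addrC;
      exact: measurable_affine2.
  have mA : measurable (chart fr @^-1` common_face K L).
    by rewrite -[X in measurable X]setTI; exact: mch.
  rewrite /Rintegral null_set_integral //.
    apply: measurable_funTS; apply/measurable_EFinP.
    apply: measurable_funM => //.
    exact: (measurableT_comp (measurable_funB (mg K) (mg L)) mch).
  apply/eqP; rewrite eq_le measure_ge0 andbT leNgt; apply/negP => h.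
  by apply: nint; exists fr.
rewrite !(crossing_null mg gB) ?addr0 //.
- apply: (@filterS _ (almost_everywhere (leb2 R)) _ _ _ _ generic_ae) => y gen J.
  have [fr FF] := junction_frame gen J.
  by apply: none; eexists; exact: face_framePopp FF.
- apply: (@filterS _ (almost_everywhere (leb2 R)) _ _ _ _ generic_ae) => y gen J.
  by apply: none; exact: junction_frame gen J.
Qed.

(** [ori] selects one order of each pair of distinct elements, and the two crossing terms of its
    flux restore the sum over both orders. Diagonal terms vanish, since no generic chord starts
    where it ends. *)
Lemma sum_crossings (ori : rel (elt Th)) : orientation ori ->
  \sum_K \sum_L (\int[leb2 R]_y crossing g K L y)%R
  = \sum_(F : elt Th * elt Th | ori F.1 F.2 && `[< interior_face F.1 F.2 >]) flux F.1 F.2.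
Proof.
move=> oriP; pose cr K L := (\int[leb2 R]_y crossing g K L y)%R.
have crKK K : cr K K = 0.
  apply: (crossing_null mg gB).
  apply: (@filterS _ (almost_everywhere (leb2 R)) _ _ _ _ generic_ae) => y gen [hK [_ e]].
  by have := generic_lt (gen K) hK; rewrite e ltxx.
rewrite big_mkcondr /=; under [RHS]eq_bigr do rewrite face_flux.
rewrite big_split /= pair_big /= (bigID (fun F => ori F.1 F.2)) /=; congr (_ + _).
rewrite (reindex_inj (inv_inj (_ : involutive (fun F : elt Th * elt Th => (F.2, F.1))))) /=; last by case.
rewrite big_mkcond [RHS]big_mkcond /=; apply: eq_bigr => -[K L] _ /=.
have [->|KL] := eqVneq K L; first by rewrite -/(cr L L) crKK; do 2 case: ifP.
by have := oriP _ _ KL; case: (ori K L); case: (ori L K).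
Qed.

Lemma side_ceiling K :
  surface_integral (side_frame lo hi i true) (exterior_face K i true) (g K)
  = (\int[leb2 R]_y (\1_(ceiling K) y * top_value g K y))%R.
Proof.
have chE z : chart (side_frame lo hi i true) z = line_pt i z (coord3 hi i).
  apply: eq_R3 => m; rewrite /chart !coord3D !coord3Z !coord3_vec.
  by case: z => z1 z2 /=; elim/ord3P: (i); elim/ord3P: m; rewrite /= ?(mulr1, mulr0, addr0, add0r).
rewrite /surface_integral Rintegral_mkcond; apply: eq_Rintegral => y _.
rewrite patchE indicE -[y \in _]/(`[< exterior_face K i true (chart (side_frame lo hi i true) y) >]).
rewrite -[y \in ceiling K]/(`[< ceiling K y >]) chE.
case: asboolP => [[/simplex_line[hK /andP[_ h2]] _]|nE].
  rewrite asboolT ?mul1r; last by split=> //; apply/eqP; rewrite eq_le h2 (shadow_bounds hK).2.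
  rewrite /top_value (_ : upper K y = coord3 hi i) //.
  by apply/eqP; rewrite eq_le h2 (shadow_bounds hK).2.
rewrite asboolF ?mul0r // => -[hK e]; apply: nE; split; last by rewrite /= coord3_line.
by rewrite -e; exact: shadow_upper.
Qed.

Lemma side_floor K :
  surface_integral (side_frame lo hi i false) (exterior_face K i false) (g K)
  = (\int[leb2 R]_y (\1_(floor K) y * bottom_value g K y))%R.
Proof.
have chE z : chart (side_frame lo hi i false) z = line_pt i z (coord3 lo i).
  apply: eq_R3 => m; rewrite /chart !coord3D !coord3Z !coord3_vec.
  by case: z => z1 z2 /=; elim/ord3P: (i); elim/ord3P: m; rewrite /= ?(mulr1, mulr0, addr0, add0r).
rewrite /surface_integral Rintegral_mkcond; apply: eq_Rintegral => y _.
rewrite patchE indicE -[y \in _]/(`[< exterior_face K i false (chart (side_frame lo hi i false) y) >]).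
rewrite -[y \in floor K]/(`[< floor K y >]) chE.
case: asboolP => [[/simplex_line[hK /andP[h2 _]] _]|nE].
  rewrite asboolT ?mul1r; last by split=> //; apply/eqP; rewrite eq_le h2 (shadow_bounds hK).1.
  rewrite /bottom_value (_ : lower K y = coord3 lo i) //.
  by apply/eqP; rewrite eq_le h2 (shadow_bounds hK).1.
rewrite asboolF ?mul0r // => -[hK e]; apply: nE; split; last by rewrite /= coord3_line.
by rewrite -e; exact: shadow_lower.
Qed.

(** The divergence theorem for the field with the single component g in direction i, discontinuous
    across elements; f is its derivative, given in integrated form along lines. *)
Lemma directional_divergence (ori : rel (elt Th)) (f : elt Th -> R3 R -> R) (Bf : R) :
  orientation ori ->
  (forall K, measurable_fun [set: R3 R] (f K : R3 R -> mR)) ->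
  (forall K x, closed_cuboid lo hi x -> `|f K x| <= Bf) ->
  (forall K y s t, s <= t -> (\int[lam]_(u in `[s, t]) (f K (line_pt i y u))%:E
    = (g K (line_pt i y t) - g K (line_pt i y s))%:E)%E) ->
  \sum_K (\int[leb3 R]_(x in simplex (vtx K)) f K x)%R
  = \sum_(F : elt Th * elt Th | ori F.1 F.2 && `[< interior_face F.1 F.2 >]) flux F.1 F.2
  + \sum_K (surface_integral (side_frame lo hi i true) (exterior_face K i true) (g K)
          - surface_integral (side_frame lo hi i false) (exterior_face K i false) (g K)).
Proof.
move=> oriP mf fB ftc; rewrite sumrB -(sum_crossings oriP).
under [X in _ = _ + (X - _)]eq_bigr do rewrite side_ceiling.
under [X in _ = _ + (_ - X)]eq_bigr do rewrite side_floor.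
rewrite -(sum_chords mg gB); apply: eq_bigr => K _.
apply: (@simplex_slice K _ (g K) Bf); [exact: mf|move=> x Kx|exact: ftc].
exact: fB (mesh_sub Kx).
Qed.

End directional_divergence.

End mesh_slicing.

(** * Dissipativity of the discrete Maxwell form *)

Section tame_functions.
Context {R : realType} (lo hi : R3 R).
Local Notation mR := (measurableTypeR R).

(** A class of integrands closed under the operations of the Maxwell form, whose members are
    integrable on every element and, through a chart, on every face. *)
Definition tame (F : R3 R -> R) := measurable_fun [set: R3 R] (F : R3 R -> mR) /\
  exists B, forall x, closed_cuboid lo hi x -> `|F x| <= B.

Definition vtame (V : R3 R -> R3 R) := forall i, tame (fun x => coord3 (V x) i).

Lemma tame_cst c : tame (fun=> c).
Proof. by split; [exact: measurable_cst|exists `|c|]. Qed.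

Lemma tameD F G : tame F -> tame G -> tame (fun x => F x + G x).
Proof.
move=> [mF [B hB]] [mG [C hC]]; split; first exact: measurable_funD.
by exists (B + C) => x Dx; apply: le_trans (ler_normD _ _) (lerD (hB _ Dx) (hC _ Dx)).
Qed.

Lemma tameN F : tame F -> tame (fun x => - F x).
Proof.
move=> [mF [B hB]]; split; first exact: measurable_funN.
by exists B => x Dx; rewrite normrN hB.
Qed.

Lemma tameB F G : tame F -> tame G -> tame (fun x => F x - G x).
Proof. by move=> tF tG; apply: tameD => //; exact: tameN. Qed.

Lemma tameM F G : tame F -> tame G -> tame (fun x => F x * G x).
Proof.
move=> [mF [B hB]] [mG [C hC]]; split; first exact: measurable_funM.
exists (`|B| * `|C|) => x Dx; rewrite normrM; apply: ler_pM => //.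
  exact: le_trans (hB _ Dx) (ler_norm _).
exact: le_trans (hC _ Dx) (ler_norm _).
Qed.

Lemma tame_sum (I : Type) (r : seq I) (F : I -> R3 R -> R) :
  (forall i, tame (F i)) -> tame (fun x => \sum_(i <- r) F i x).
Proof.
move=> tF; elim: r => [|i r IH].
  by under eq_fun do rewrite big_nil; exact: tame_cst.
by under eq_fun do rewrite big_cons; exact: tameD.
Qed.

Lemma tame_P1 p : tame (P1_eval p).
Proof. by split; [exact: measurable_P1_eval|exact: P1_bounded]. Qed.

Lemma vtameD V W : vtame V -> vtame W -> vtame (fun x => V x + W x).
Proof. by move=> tV tW i; under eq_fun do rewrite coord3D; exact: tameD. Qed.

Lemma vtameB V W : vtame V -> vtame W -> vtame (fun x => V x - W x).
Proof. by move=> tV tW i; under eq_fun do rewrite coord3D coord3N; exact: tameB. Qed.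

Lemma vtame_cross n V : vtame V -> vtame (fun x => cross n (V x)).
Proof.
move=> tV i; under eq_fun do rewrite coord3_vec.
by apply: tameB; apply: tameM => //; exact: tame_cst.
Qed.

Lemma tame_dot V W : vtame V -> vtame W -> tame (fun x => dot (V x) (W x)).
Proof. by move=> tV tW; apply: tame_sum => i; exact: tameM. Qed.

Lemma tame_uniform (I : finType) (F : I -> R3 R -> R) : (forall i, tame (F i)) ->
  exists B, forall i x, closed_cuboid lo hi x -> `|F i x| <= B.
Proof.
move=> tF; have [B hB] := choice (fun i => (tF i).2).
exists (\sum_i `|B i|) => i x Dx; apply: le_trans (hB i x Dx) _.
by rewrite (bigD1 i) //= (le_trans (ler_norm _)) // lerDl sumr_ge0.
Qed.

Lemma tame_integrable (F : R3 R -> R) (A : set (R3 R)) : tame F ->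
  measurable A -> A `<=` closed_cuboid lo hi -> (leb3 R).-integrable A (EFin \o F).
Proof.
move=> [mF [B hB]] mA AD; apply: (@cuboid_integrable _ lo hi _ _ B) => // x /AD.
exact: hB.
Qed.

Lemma measurable_chart (fr : frame (R := R)) :
  measurable_fun [set: (mR * mR)%type] (chart fr : mR * mR -> R3 R).
Proof.
apply: measurable_fun_R3 => m; rewrite /chart; under eq_fun do
  rewrite !coord3D !coord3Z mulrC [_ * coord3 (ft2 fr) m]mulrC -addrA addrC.
exact: measurable_affine2.
Qed.

Lemma tame_face_integrable (fr : frame (R := R)) (F : R3 R -> R) (A : set (R3 R)) :
  orthonormal_frame fr -> tame F -> measurable A -> A `<=` closed_cuboid lo hi ->
  (leb2 R).-integrable (chart fr @^-1` A) (EFin \o (fun z => F (chart fr z))).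
Proof.
move=> [[d11 d22 dnn] [d12 d1n d2n]] [mF [B hB]] mA AD.
have mch := measurable_chart fr.
have mA' : measurable (chart fr @^-1` A) by rewrite -[X in measurable X]setTI; exact: mch.
apply/integrable_mkcond => //.
(* The two chart coordinates are affine functions of the point, hence bounded on the cuboid; the
   chart preimage of A therefore lies in a square. *)
have [C1 hC1] := P1_bounded (- dot (fpt fr) (ft1 fr), ft1 fr) lo hi.
have [C2 hC2] := P1_bounded (- dot (fpt fr) (ft2 fr), ft2 fr) lo hi.
have -> : (EFin \o (fun z => F (chart fr z))) \_ (chart fr @^-1` A)
    = EFin \o (fun z => \1_A (chart fr z) * F (chart fr z)).
  apply/funext => z; rewrite patchE /= indicE -[z \in _]/(`[< A (chart fr z) >]).
  by rewrite -[chart fr z \in A]/(`[< A (chart fr z) >]); case: ifP; rewrite ?mul1r ?mul0r.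
apply: (@box_integrable _ _ (Num.max C1 C2) B).
  apply: measurable_funM; last exact: (measurableT_comp mF mch).
  by apply: (measurableT_comp _ mch); exact/measurable_indicP.
move=> z; rewrite indicE; have [|_] := boolP (chart fr z \in A); last by rewrite mul0r eqxx.
rewrite inE mul1r => /AD Az _; split; first exact: hB.
have d21 : dot (ft2 fr) (ft1 fr) = 0 by rewrite dotC.
have z1 : z.1 = P1_eval (- dot (fpt fr) (ft1 fr), ft1 fr) (chart fr z).
  by rewrite /P1_eval /= /chart !dotDr !dotZr d11 d12 [dot (ft1 fr) (fpt fr)]dotC; ring.
have z2 : z.2 = P1_eval (- dot (fpt fr) (ft2 fr), ft2 fr) (chart fr z).
  by rewrite /P1_eval /= /chart !dotDr !dotZr d22 d21 [dot (ft2 fr) (fpt fr)]dotC; ring.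
split; rewrite le_max; first by rewrite {1}z1 hC1.
by apply/orP; right; rewrite {1}z2 hC2.
Qed.

Section surface_linear.
Variables (fr : frame (R := R)) (A : set (R3 R)).
Hypotheses (ofr : orthonormal_frame fr) (mA : measurable A) (AD : A `<=` closed_cuboid lo hi).

Let mA' : measurable (chart fr @^-1` A).
Proof. by rewrite -[X in measurable X]setTI; exact: measurable_chart. Qed.

Lemma surface_integralB F G : tame F -> tame G ->
  surface_integral fr A (fun x => F x - G x) = surface_integral fr A F - surface_integral fr A G.
Proof. by move=> tF tG; apply: RintegralB => //; exact: tame_face_integrable. Qed.

Lemma surface_integralD F G : tame F -> tame G ->
  surface_integral fr A (fun x => F x + G x) = surface_integral fr A F + surface_integral fr A G.
Proof. by move=> tF tG; apply: RintegralD => //; exact: tame_face_integrable. Qed.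

Lemma surface_integralZ c F : tame F ->
  surface_integral fr A (fun x => c * F x) = c * surface_integral fr A F.
Proof. by move=> tF; apply: RintegralZl => //; exact: tame_face_integrable. Qed.

Lemma surface_integral_sum (I : Type) (r : seq I) (F : I -> R3 R -> R) :
  (forall i, tame (F i)) -> surface_integral fr A (fun x => \sum_(i <- r) F i x)
  = \sum_(i <- r) surface_integral fr A (F i).
Proof. by move=> tF; apply: Rintegral_sum => // i; exact: tame_face_integrable. Qed.

End surface_linear.

Lemma surface_integral_ge0 (fr : frame (R := R)) A F : (forall x, 0 <= F x) ->
  0 <= surface_integral fr A F.
Proof. by move=> F0; apply: Rintegral_ge0 => z _; exact: F0. Qed.

Lemma eq_surface_integral (fr : frame (R := R)) A F G : F =1 G ->
  surface_integral fr A F = surface_integral fr A G.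
Proof. by move=> FG; apply: eq_Rintegral => z _; rewrite FG. Qed.

End tame_functions.

Lemma partial_P1 (R : realType) (p : P1 (R := R)) k x :
  partial k (P1_eval p) x = coord3 p.2 k.
Proof.
have dk : dot p.2 (evec R k) = coord3 p.2 k.
  rewrite (dotE _ _ k) !coord3_vec eqxx mulr1.
  have -> : (k + 1 == k) = false by elim/ord3P: k.
  have -> : (k + 2%:R == k) = false by elim/ord3P: k.
  by rewrite !mulr0 !addr0.
rewrite /partial /derive; apply: cvg_lim => //.
set F := (fun h : R => _).
have E : {near (0 : R)^', (fun=> coord3 p.2 k) =1 F}.
  near=> h; have h0 : h != 0 by near: h; exact: nbhs_dnbhs_neq.
  rewrite /F /= [h *: _ + x]addrC P1_evalD dotZr dk addrC addKr.
  by rewrite -[RHS]/(h^-1 * (h * _)) mulKf.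
exact: cvg_trans (near_eq_cvg E) (cvg_cst _).
Unshelve. all: by end_near. Qed.

Section on_elements.
Context {R : realType} {lo hi : R3 R} (Th : simplicial_mesh lo hi).
Variables (w : {ffun 'I_3 -> broken Th}) (K : elt Th).

Lemma coord_on_elt i x : coord3 (on_elt w K x) i = P1_eval (w i K) x.
Proof. exact: coord3_vec. Qed.

Lemma vtame_on_elt : vtame lo hi (on_elt w K).
Proof. by move=> i; under eq_fun do rewrite coord_on_elt; exact: tame_P1. Qed.

Lemma curl_on_elt x i : coord3 (curl (on_elt w K) x) i
  = coord3 (w (i + 2%:R) K).2 (i + 1) - coord3 (w (i + 1) K).2 (i + 2%:R).
Proof.
rewrite coord3_vec; under eq_fun do rewrite coord_on_elt.
by under [X in _ - partial _ X _]eq_fun do rewrite coord_on_elt; rewrite !partial_P1.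
Qed.

Lemma vtame_curl : vtame lo hi (fun x => curl (on_elt w K) x).
Proof. by move=> i; under eq_fun do rewrite curl_on_elt; exact: tame_cst. Qed.

Lemma measurable_elt : measurable (simplex (vtx K)).
Proof.
have [l hl] := choice (fun K : elt Th => barycentric (@mesh_indep _ _ _ Th K)).
by apply: (@measurable_simplex _ _ _ Th l); move=> K'; have [] := hl K'.
Qed.

Lemma measurable_face (L : elt Th) : measurable (common_face K L).
Proof.
have [l hl] := choice (fun K : elt Th => barycentric (@mesh_indep _ _ _ Th K)).
by apply: (@measurable_common_face _ _ _ Th l); move=> K'; have [] := hl K'.
Qed.

Lemma measurable_exterior_face i s : measurable (exterior_face K i s).
Proof.
apply: measurableI; first exact: measurable_elt.
by apply: measurable_set_eq => //; exact: measurable_coord3.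
Qed.

Lemma common_face_sub (L : elt Th) : common_face K L `<=` closed_cuboid lo hi.
Proof. by move=> x [[/mesh_sub]]. Qed.

Lemma exterior_face_sub i s : exterior_face K i s `<=` closed_cuboid lo hi.
Proof. by move=> x [/mesh_sub]. Qed.

Lemma interior_face_frame (L : elt Th) : interior_face K L -> orthonormal_frame (frame_of K L).
Proof.
move=> [fr frF _].
by have [] : face_frame K L (frame_of K L) by rewrite /frame_of; apply: xgetPex; exists fr.
Qed.

End on_elements.

Lemma side_orthonormal {R : realType} (lo hi : R3 R) i s : orthonormal_frame (side_frame lo hi i s).
Proof.
have o (j k : 'I_3) : dot (evec R j) (evec R k) = (j == k)%:R.
  rewrite (dotE _ _ 0) !coord3_vec; elim/ord3P: j; elim/ord3P: k;
  by rewrite /= ?(mulr0, mul0r, mulr1, addr0, add0r).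
split; split; rewrite /= ?dotZr ?[dot (_ *: _) _]dotC ?dotZr !o ?eqxx //.
- by rewrite mulr1 -expr2 sqrr_sign.
- by elim/ord3P: i.
- by have -> : (i + 1 == i) = false; [elim/ord3P: i|rewrite mulr0].
- by have -> : (i + 2%:R == i) = false; [elim/ord3P: i|rewrite mulr0].
Qed.

Section maxwell_dissipative.
Context {R : realType} {lo hi : R3 R} (Th : simplicial_mesh lo hi).
Variables (ori : rel (elt Th)) (u : Hh Th).
Hypothesis oriP : orientation ori.
Local Notation mR := (measurableTypeR R).
Local Notation tame := (tame lo hi).
Local Notation vtame := (vtame lo hi).

Let E (K : elt Th) := on_elt u.1 K.
Let H (K : elt Th) := on_elt u.2 K.

Let coordE i K x : coord3 (E K x) i = P1_eval (u.1 i K) x.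
Proof. exact: coord_on_elt. Qed.

Let coordH i K x : coord3 (H K x) i = P1_eval (u.2 i K) x.
Proof. exact: coord_on_elt. Qed.

Let tE K : vtame (E K). Proof. exact: vtame_on_elt. Qed.
Let tH K : vtame (H K). Proof. exact: vtame_on_elt. Qed.

(** The i-th component of H x E, whose divergence is curl H . E - curl E . H. *)
Let g i K x := coord3 (H K x) (i + 1) * coord3 (E K x) (i + 2%:R)
  - coord3 (H K x) (i + 2%:R) * coord3 (E K x) (i + 1).

Let tg i K : tame (g i K).
Proof. by apply: tameB; apply: tameM; do ?[exact: tH|exact: tE]. Qed.

(** The derivative of [g i] in direction i by the product rule. The field values e and h are kept as
    parameters, so that the divergence identity becomes polynomial in them. *)
Let f0 K e h i := coord3 (u.2 (i + 1) K).2 i * coord3 e (i + 2%:R)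
    + coord3 h (i + 1) * coord3 (u.1 (i + 2%:R) K).2 i
  - (coord3 (u.2 (i + 2%:R) K).2 i * coord3 e (i + 1)
    + coord3 h (i + 2%:R) * coord3 (u.1 (i + 1) K).2 i).

Let f i K x := f0 K (E K x) (H K x) i.

Let tf i K : tame (f i K).
Proof.
by apply: tameB; apply: tameD; apply: tameM;
  do ?[exact: tH|exact: tE|exact: tame_cst].
Qed.

Let ord3s (i : 'I_3) : (((i + 1 + 1)%R = (i + 2%:R)%R :> 'I_3) * ((i + 1 + 2%:R)%R = i :> 'I_3)
  * ((i + 2%:R + 1)%R = i :> 'I_3) * ((i + 2%:R + 2%:R)%R = (i + 1)%R :> 'I_3)
  * (((i + 1)%R == i) = false) * (((i + 2%:R)%R == i) = false)
  * (((i + 1)%R == (i + 2%:R)%R :> 'I_3) = false) * (((i + 2%:R)%R == (i + 1)%R :> 'I_3) = false))%type.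
Proof. by do !split; elim/ord3P: i => //=; apply: val_inj. Qed.

Let divergence K x : dot (curl (H K) x) (E K x) - dot (curl (E K) x) (H K x) = \sum_i f i K x.
Proof.
have cE := curl_on_elt u.1 K x; have cH := curl_on_elt u.2 K x.
rewrite /f /E /H; move: (curl (on_elt u.1 K) x) (curl (on_elt u.2 K) x) cE cH => A B cE cH; move: (on_elt u.1 K x) (on_elt u.2 K x) => e h.
suff h' (j : 'I_3) : dot B e - dot A h = \sum_i f0 K e h i by exact: (h' 0).
rewrite (sum3 _ j) (dotE _ _ j) [dot _ h](dotE _ _ j) /f0 !cE !cH !ord3s; ring.
Qed.

Let flux i (F : elt Th * elt Th) := surface_integral (frame_of F.1 F.2) (common_face F.1 F.2)
  (fun x => coord3 (fn (frame_of F.1 F.2)) i * (g i F.1 x - g i F.2 x)).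

Let side i s K := surface_integral (side_frame lo hi i s) (exterior_face K i s) (g i K).

Let interior := [pred F : elt Th * elt Th | ori F.1 F.2 && `[< interior_face F.1 F.2 >]].

Let bary : exists l : elt Th -> 'I_4 -> P1 (R := R),
  [/\ forall K j k, P1_eval (l K j) (vtx K k) = (j == k)%:R,
    forall K x, \sum_j P1_eval (l K j) x = 1 &
    forall K x, \sum_j P1_eval (l K j) x *: vtx K j = x].
Proof.
have [l hl] := choice (fun K : elt Th => barycentric (@mesh_indep _ _ _ Th K)).
by exists l; split=> K; have [] := hl K.
Qed.

Let volume_flux i : \sum_K (\int[leb3 R]_(x in simplex (vtx K)) f i K x)%R
  = \sum_(F | interior F) flux i F + \sum_K (side i true K - side i false K).
Proof.
have [l [lv l1 lx]] := bary.
have [B gB] := tame_uniform (tg i); have [C fC] := tame_uniform (tf i).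
apply: (directional_divergence lv l1 lx (fun K => (tg i K).1) gB oriP (fun K => (tf i K).1) fC).
move=> K y s t st.
have ln p t' : P1_eval p (line_pt i y t') = coord3 p.2 i * t' + P1_eval p (line_pt i y 0).
  exact: P1_eval_line.
rewrite /g !coordE !coordH !(ln _ s) !(ln _ t).
rewrite -integral_affine_products //; apply: eq_integral => t' _.
rewrite /f /f0 !coordE !coordH !(ln _ t'); congr EFin; ring.
Qed.

(** Moving n out of the triple products leaves n . ([H] x (E_K + E_L) - [E] x (H_K + H_L)), with [.]
    the jump from K to L. The mixed products cancel by antisymmetry, and the remaining ones occur
    twice, whence the factor -2. *)
Let interior_flux F : interior F ->
  surface_integral (frame_of F.1 F.2) (common_face F.1 F.2)
    (fun x => dot (cross (fn (frame_of F.1 F.2)) (H F.2 x - H F.1 x)) (E F.1 x + E F.2 x))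
  - surface_integral (frame_of F.1 F.2) (common_face F.1 F.2)
    (fun x => dot (cross (fn (frame_of F.1 F.2)) (E F.2 x - E F.1 x)) (H F.1 x + H F.2 x))
  = - 2 * \sum_i flux i F.
Proof.
case: F => K L /= /andP[_ /asboolP/interior_face_frame ofr].
set n := fn (frame_of K L).
have AD := @common_face_sub _ _ _ Th K L.
rewrite -(surface_integralB ofr (measurable_face K L) AD); last 2 first.
- by apply: tame_dot; [apply: vtame_cross; exact: vtameB|exact: vtameD].
- by apply: tame_dot; [apply: vtame_cross; exact: vtameB|exact: vtameD].
rewrite -(surface_integral_sum ofr (measurable_face K L) AD); last first.
  by move=> i; apply: tameM; [exact: tame_cst|exact: tameB].
rewrite -(surface_integralZ ofr (measurable_face K L) AD); last first.
  by apply: tame_sum => i; apply: tameM; [exact: tame_cst|exact: tameB].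
apply: eq_surface_integral => x.
rewrite (sum3 _ 0) (dotE _ _ 0) [dot _ (H K x + H L x)](dotE _ _ 0).
rewrite !coord3_vec !coord3D !coord3N /g -/n !(ord3s 0); ring.
Qed.

Let exterior_flux K i s :
  surface_integral (side_frame lo hi i s) (exterior_face K i s)
    (fun x => dot (cross (fn (side_frame lo hi i s)) (E K x)) (H K x))
  = (-1) ^+ s * side i s K.
Proof.
have mF := measurable_exterior_face K i s; have AD := @exterior_face_sub _ _ _ Th K i s.
rewrite -(surface_integralZ (side_orthonormal lo hi i s) mF AD) //.
apply: eq_surface_integral => x.
rewrite (dotE _ _ i) /g; set A := E K x; set B := H K x.
rewrite !coord3_vec /side_frame /= !coord3Z !coord3_vec !ord3s !eqxx.
by case: s mF AD => _ _ /=; rewrite ?expr1 ?expr0; ring.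
Qed.

(** The averaged interior terms and the exterior term (n x E) . H cancel exactly the fluxes produced
    by the volume integrals; the penalty terms remain and are minus integrals of squares. *)
Lemma maxwell_form_le0 : maxwell_form ori u u <= 0.
Proof.
have volume : \sum_K ((\int[leb3 R]_(x in simplex (vtx K)) dot (curl (H K) x) (E K x))%R
        - (\int[leb3 R]_(x in simplex (vtx K)) dot (curl (E K) x) (H K x))%R)
   = \sum_i (\sum_(F | interior F) flux i F + \sum_K (side i true K - side i false K)).
  under [RHS]eq_bigr do rewrite -volume_flux.
  rewrite exchange_big /=; apply: eq_bigr => K _.
  have tcH : vtame (fun x => curl (H K) x) by exact: vtame_curl.
  have tcE : vtame (fun x => curl (E K) x) by exact: vtame_curl.
  have msimplex := @measurable_elt _ _ _ Th.
  have KD : simplex (vtx K) `<=` closed_cuboid lo hi := @mesh_sub _ _ _ Th K.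
  rewrite -RintegralB //; last 2 first.
  - exact: (tame_integrable (tame_dot tcH (tE K)) (msimplex K) KD).
  - exact: (tame_integrable (tame_dot tcE (tH K)) (msimplex K) KD).
  rewrite -Rintegral_sum //; last by move=> i; exact: tame_integrable.
  by apply: eq_Rintegral => x _; exact: divergence.
rewrite /maxwell_form -/E -/H volume.
set S1 := \sum_i _; set S2 := (X in _ * X); set S3 := (X in _ + X <= 0).
have h2 : S2 <= \sum_(F | interior F) (- 2 * \sum_i flux i F).
  apply: ler_sum => F iF; rewrite -interior_flux // -addrA gerDl.
  by rewrite -opprD oppr_le0 addr_ge0 // surface_integral_ge0 // => x; exact: dot_ge0.
have h3 : S3 <= \sum_K \sum_i \sum_(s : bool) ((-1) ^+ s * side i s K).
  apply: ler_sum => K _; apply: ler_sum => i _; apply: ler_sum => s _.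
  by rewrite -exterior_flux gerBl surface_integral_ge0 // => x; exact: dot_ge0.
apply: (@le_trans _ _ (S1 + 2^-1 * \sum_(F | interior F) (- 2 * \sum_i flux i F)
  + \sum_K \sum_i \sum_(s : bool) ((-1) ^+ s * side i s K))).
  by apply: lerD => //; rewrite lerD2l ler_pM2l.
(* The weight 1/2 of the averages meets the factor -2 and removes the interior flux; the side fluxes
   cancel by the sign (-1)^s. *)
rewrite -mulr_sumr mulrA mulrN mulVf ?pnatr_eq0 // mulN1r /S1 big_split /=.
rewrite [X in X + _ - _]exchange_big [X in _ + X - _]exchange_big /=.
rewrite [X in X + _]addrAC subrr add0r -big_split /=.
rewrite big1 // => K _; rewrite -big_split big1 // => i _ /=.
by rewrite big_bool /= expr1 expr0 mulN1r mul1r addrACA subrr addNr addr0.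
Qed.

End maxwell_dissipative.

(** * Linear algebra of the finite-dimensional dG space *)

Section finite_dimension.
Context {R : realType} {V : lmodType R} {n : nat}.
Variables (of_row : 'rV[R]_n -> V) (to_row : V -> 'rV[R]_n).
Hypotheses (of_lin : linear of_row) (to_lin : linear to_row).
Hypotheses (of_rowK : cancel of_row to_row) (to_rowK : cancel to_row of_row).

Lemma linear_sum (U W : lmodType R) (f : U -> W) (I : Type) (r : seq I) (c : I -> R) (F : I -> U) :
  linear f -> f (\sum_(i <- r) c i *: F i) = \sum_(i <- r) c i *: f (F i).
Proof.
move=> lf; have f0 : f 0 = 0.
  by have := lf (-1) 0 0; rewrite scaleN1r oppr0 addr0 scaleN1r addNr.
by elim: r => [|i r IH]; [rewrite !big_nil|rewrite !big_cons lf IH].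
Qed.

Lemma linear_injective_surjective (L : V -> V) : linear L ->
  (forall v, L v = 0 -> v = 0) -> forall b, exists v, L v = b.
Proof.
move=> lL iL b.
pose A : 'M[R]_n := \matrix_i to_row (L (of_row (delta_mx 0 i))).
have AE v : v *m A = to_row (L (of_row v)).
  rewrite mulmx_sum_row {2}(row_sum_delta v).
  rewrite linear_sum // linear_sum // linear_sum //.
  by apply: eq_bigr => i _; rewrite rowK.
have to0 : to_row 0 = 0.
  by have := to_lin (-1) 0 0; rewrite scaleN1r oppr0 addr0 scaleN1r addNr.
have of0 : of_row 0 = 0 by rewrite -to0 to_rowK.
have : row_free A.
  apply: inj_row_free => v; rewrite AE => h.
  have /iL : L (of_row v) = 0 by rewrite -(to_rowK (L _)) h of0.
  by move=> h2; rewrite -(of_rowK v) h2 to0.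
rewrite row_free_unit => uA; exists (of_row (to_row b *m invmx A)).
by rewrite -[LHS]to_rowK -AE mulmxKV // to_rowK.
Qed.

(** The map sending w to its products with the coordinate basis is injective by definiteness, hence
    surjective in finite dimension. *)
Lemma riesz_representation (ip : V -> V -> R) (l : V -> R) : inner_product ip ->
  (forall v, ip v v = 0 -> v = 0) -> (forall a u v, l (a *: u + v) = a * l u + l v) ->
  exists w, forall v, ip w v = l v.
Proof.
move=> ipP def ll.
pose T w := of_row (\row_i ip w (of_row (delta_mx 0 i))).
have vE v : v = \sum_i (to_row v) 0 i *: of_row (delta_mx 0 i).
  by rewrite -linear_sum // -row_sum_delta to_rowK.
have [||w Tw] := @linear_injective_surjective T _ _ (of_row (\row_i l (of_row (delta_mx 0 i)))).
- move=> a u v; rewrite /T -of_lin; congr of_row.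
  by apply/rowP => i; rewrite !mxE (ipDl ipP) (ipZl ipP).
- move=> w Tw; apply: def; rewrite {2}(vE w) (ip_sumr ipP) big1 // => i _.
  rewrite (ipZr ipP); suff -> : ip w (of_row (delta_mx 0 i)) = 0 by rewrite mulr0.
  have /rowP/(_ i) : \row_i ip w (of_row (delta_mx 0 i)) = to_row 0 by rewrite -Tw of_rowK.
  rewrite !mxE => ->.
  have -> : to_row 0 = 0.
    by have := to_lin (-1) 0 0; rewrite scaleN1r oppr0 addr0 scaleN1r addNr.
  by rewrite mxE.
exists w => v; rewrite (vE v) (ip_sumr ipP) (@linear_sum _ R^o) //.
apply: eq_bigr => i _; rewrite (ipZr ipP); congr (_ * _).
by have /(can_inj of_rowK)/rowP/(_ i) := Tw; rewrite !mxE.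
Qed.

End finite_dimension.

Section broken_coordinates.
Context {R : realType} {lo hi : R3 R} (Th : simplicial_mesh lo hi).
Local Notation Hh := (Hh Th).

(** One scalar coordinate for each field ([true] for E), component, element and coefficient, where
    [None] is the constant term and [Some k] the k-th slope. *)
Let I : finType := (bool * 'I_3 * elt Th * option 'I_3)%type.

Let coef (p : P1 (R := R)) (k : option 'I_3) : R := if k is Some k then coord3 p.2 k else p.1.

Let coef_lin a p q k : coef (a *: p + q) k = a * coef p k + coef q k.
Proof.
case: p q k => c g [c' g'] [k|] //.
by apply: etrans (coord3D _ _ _) _; rewrite coord3Z.
Qed.

Definition Hh_coord (u : Hh) : 'rV[R]_#|I| :=
  \row_j let: (b, i, K, k) := enum_val j in coef ((if b then u.1 else u.2) i K) k.

Definition Hh_of_coord (c : 'rV[R]_#|I|) : Hh :=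
  let v b i K k := c 0 (enum_rank (b, i, K, k) : 'I_#|I|) in
  let p b := [ffun i => [ffun K => (v b i K None, vec (fun k => v b i K (Some k)))]] in
  (p true, p false).

Lemma Hh_coordK : cancel Hh_coord Hh_of_coord.
Proof.
move=> [u1 u2]; congr (_, _); apply/ffunP => i; apply/ffunP => K; rewrite !ffunE.
  case E : (u1 i K) => [c g]; congr (_, _); first by rewrite mxE enum_rankK /= E.
  by apply: eq_R3 => k; rewrite coord3_vec /Hh_coord mxE enum_rankK /= E.
case E : (u2 i K) => [c g]; congr (_, _); first by rewrite mxE enum_rankK /= E.
by apply: eq_R3 => k; rewrite coord3_vec /Hh_coord mxE enum_rankK /= E.
Qed.

Lemma Hh_of_coordK : cancel Hh_of_coord Hh_coord.
Proof.
move=> c; apply/rowP => j; rewrite !mxE; case E : (enum_val j) => [[[b i] K] k].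
rewrite -[in RHS](enum_valK j) E; case: b E => E /=; rewrite !ffunE /coef; case: k E => [k|] E //=;
  by rewrite coord3_vec.
Qed.

Lemma linear_Hh_coord : linear Hh_coord.
Proof.
move=> a u v; apply/rowP => j; rewrite !mxE; case: (enum_val j) => [[[b i] K] k].
have e1 : (a *: u + v).1 i K = a *: u.1 i K + v.1 i K.
  by rewrite -[LHS]/((a *: u.1 + v.1) i K) !ffunE.
have e2 : (a *: u + v).2 i K = a *: u.2 i K + v.2 i K.
  by rewrite -[LHS]/((a *: u.2 + v.2) i K) !ffunE.
case: b; [exact: (etrans (congr1 (coef^~ k) e1) (coef_lin _ _ _ _))|
  exact: (etrans (congr1 (coef^~ k) e2) (coef_lin _ _ _ _))].
Qed.

Lemma linear_Hh_of_coord : linear Hh_of_coord.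
Proof.
by move=> a u v; apply: (can_inj Hh_coordK); rewrite Hh_of_coordK linear_Hh_coord !Hh_of_coordK.
Qed.

End broken_coordinates.

Section broken_functions.
Context {R : realType} {lo hi : R3 R} (Th : simplicial_mesh lo hi).
Local Notation mR := (measurableTypeR R).
Local Notation muD := (muD lo hi).
Local Notation L2D := (L2 muD).
Local Notation tame := (tame lo hi).
Local Notation Hh := (Hh Th).

Lemma muD_ae_cuboid (Q : R3 R -> Prop) : (forall x, cuboid lo hi x -> Q x) ->
  \forall x \ae muD, Q x.
Proof.
move=> h; exists (~` cuboid lo hi); split; first exact: (measurableC (measurable_cuboid lo hi)).
  by rewrite -[LHS]/(leb3 R ((~` cuboid lo hi) `&` cuboid lo hi)) setICl measure0.
by move=> x; apply: contra_not => Dx; exact: h.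
Qed.

Lemma cuboid_closed x : cuboid lo hi x -> closed_cuboid lo hi x.
Proof.
move=> [[/= h1 h2] h3] i; move: h1 h2 h3; rewrite !in_itv /= => /andP[a b] /andP[a' b'] /andP[a'' b''].
by elim/ord3P: i; rewrite /coord3 /= !ltW.
Qed.

Lemma muD_fin : (muD setT < +oo)%E.
Proof.
rewrite -[X in (X < _)%E]/(leb3 R (setT `&` cuboid lo hi)) setTI; apply: le_lt_trans (closed_cuboid_fin lo hi).
apply: le_measure; rewrite ?inE; [exact: measurable_cuboid|exact: measurable_closed_cuboid|].
exact: cuboid_closed.
Qed.

Definition bounded_ae (f : R3 R -> R) := exists C, \forall x \ae muD, `|f x| <= C.

Lemma bounded_mul_Lfun2 (f g : R3 R -> R) : measurable_fun [set: R3 R] (f : R3 R -> mR) ->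
  bounded_ae f -> g \in Lfun muD 2%:R%:E -> (fun x => f x * g x) \in Lfun muD 2%:R%:E.
Proof.
move=> mf [C fC] g2; have mg : measurable_fun [set: R3 R] (g : R3 R -> mR).
  by move: g2 => /andP[] /[!inE].
have m2 (h : R3 R -> R) : measurable_fun [set: R3 R] (h : R3 R -> mR) ->
    measurable_fun [set: R3 R] (fun x => (h x ^+ 2)%:E).
  by move=> mh; apply/measurable_EFinP; exact: measurable_funX.
have [_ ig] := integrableP _ _ _ (Lfun2_integrable_sqr g2).
apply: Lfun2P; first exact: measurable_funM.
apply: (@le_lt_trans _ _ ((C ^+ 2)%:E * \int[muD]_x (g x ^+ 2)%:E)%E).
  rewrite -ge0_integralZl_EFin ?sqr_ge0 //; [|by move=> x _; rewrite lee_fin sqr_ge0|exact: m2].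
  apply: ae_ge0_le_integral => //.
  - by move=> x _; rewrite lee_fin sqr_ge0.
  - by apply: m2; exact: measurable_funM.
  - by move=> x _; rewrite -EFinM lee_fin mulr_ge0 ?sqr_ge0.
  - by apply: measurable_funeM; exact: m2.
  apply: filterS fC => x fx _; rewrite -EFinM lee_fin exprMn ler_wpM2r ?sqr_ge0 //.
  rewrite -real_normK ?num_real // ler_pXn2r ?nnegrE //.
  exact: le_trans (normr_ge0 _) fx.
rewrite lte_mul_pinfty ?lee_fin ?sqr_ge0 //; apply: le_lt_trans ig.
apply: ge0_le_integral => //; try exact: m2.
- by move=> x _; rewrite lee_fin sqr_ge0.
- by apply: measurableT_comp => //; exact: m2.
- by move=> x _; rewrite /= lee_fin ler_norm.
Qed.

Lemma one_Lfun2 : (fun=> 1 : R) \in Lfun muD 2%:R%:E.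
Proof.
apply: Lfun2P => //; under eq_integral do rewrite expr1n.
by rewrite integral_cst // mul1e muD_fin.
Qed.

Lemma tame_bounded F : tame F -> bounded_ae F.
Proof. by move=> [mF [C hC]]; exists C; apply: muD_ae_cuboid => x /cuboid_closed; exact: hC. Qed.

Lemma tame_Lfun2 F : tame F -> F \in Lfun muD 2%:R%:E.
Proof.
move=> tF; have -> : F = (fun x => F x * 1) by apply/funext => x; rewrite mulr1.
exact: (bounded_mul_Lfun2 tF.1 (tame_bounded tF) one_Lfun2).
Qed.

Let bary : exists l : elt Th -> 'I_4 -> P1 (R := R),
  [/\ forall K j k, P1_eval (l K j) (vtx K k) = (j == k)%:R,
    forall K x, \sum_j P1_eval (l K j) x = 1 &
    forall K x, \sum_j P1_eval (l K j) x *: vtx K j = x].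
Proof.
have [l hl] := choice (fun K : elt Th => barycentric (@mesh_indep _ _ _ Th K)).
by exists l; split=> K; have [] := hl K.
Qed.

Lemma tame_indic (A : set (R3 R)) : measurable A -> tame (\1_A : R3 R -> R).
Proof.
move=> mA; split; first exact/measurable_indicP.
by exists 1 => x _; rewrite indicE; case: (_ \in _); rewrite ?normr1 ?normr0.
Qed.

Lemma measurable_open_elt (K : elt Th) : measurable (open_simplex (vtx K)).
Proof. by have [l [lv l1 lx]] := bary; exact: measurable_open_simplex lv l1 lx K. Qed.

Lemma tame_broken (p : broken Th) : tame (broken_fun p).
Proof.
apply: tame_sum => K; apply: tameM; last exact: tame_P1.
by apply: tame_indic; exact: measurable_open_elt.
Qed.

Lemma P1_evalL a (p q : P1 (R := R)) x : P1_eval (a *: p + q) x = a * P1_eval p x + P1_eval q x.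
Proof.
case: p q => c g [c' g']; rewrite -[LHS]/(a * c + c' + dot (a *: g + g') x) /P1_eval /=.
by rewrite dotC dotDr dotZr ![dot x _]dotC; ring.
Qed.

Lemma broken_funL a (p p' : broken Th) x :
  broken_fun (a *: p + p') x = a * broken_fun p x + broken_fun p' x.
Proof.
rewrite /broken_fun mulr_sumr -big_split; apply: eq_bigr => K _.
rewrite (_ : (a *: p + p') K = a *: p K + p' K); last by rewrite !ffunE.
by rewrite P1_evalL -[RHS]/(_ * (_ * _) + _ * _); ring.
Qed.

Local Notation emb := (fun p : broken Th => toL2 muD (broken_fun p)).

Lemma toL2_brokenL a (p p' : broken Th) : emb (a *: p + p') = a *: emb p + emb p'.
Proof.
apply: eq_L2; apply: (ae_eq_trans (toL2K (tame_Lfun2 (tame_broken _)))).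
apply/ae_eq_sym; apply: (ae_eq_trans (L2_reprD _ _)).
have e1 := toL2K (tame_Lfun2 (tame_broken p)); have e2 := toL2K (tame_Lfun2 (tame_broken p')).
apply: filterS2 (L2_reprZ a (emb p)) (filterI e1 e2) => x /(_ I) h1 [/(_ I) h2 /(_ I) h3] _.
by rewrite h1 h2 h3 broken_funL.
Qed.

Lemma P1_positive_near (s : seq (P1 (R := R))) x0 : (forall p, p \in s -> 0 < P1_eval p x0) ->
  exists2 e, 0 < e & forall x, (forall i, `|coord3 x i - coord3 x0 i| < e) ->
    forall p, p \in s -> 0 < P1_eval p x.
Proof.
elim: s => [_|p s IH h]; first by exists 1.
have [q qs|e e0 he] := IH; first by apply: h; rewrite inE qs orbT.
have p0 : 0 < P1_eval p x0 by apply: h; rewrite mem_head.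
pose c := 1 + \sum_i `|coord3 p.2 i|.
have c0 : 0 < c by rewrite ltr_pwDl // sumr_ge0.
exists (Num.min e (P1_eval p x0 / c)); first by rewrite lt_min e0 divr_gt0.
move=> x hx q; rewrite inE => /predU1P[->|]; last first.
  by apply: he => i; apply: lt_le_trans (hx i) _; rewrite ge_min lexx.
have hx' i : `|coord3 (x - x0) i| <= P1_eval p x0 / c.
  by rewrite coord3D coord3N; apply: le_trans (ltW (hx i)) _; rewrite ge_min lexx orbT.
rewrite -(subrK x0 x) addrC P1_evalD -ltrBlDl sub0r.
have : `|dot p.2 (x - x0)| < P1_eval p x0; last by rewrite ltr_norml => /andP[].
apply: (@le_lt_trans _ _ ((\sum_i `|coord3 p.2 i|) * (P1_eval p x0 / c))).
  rewrite mulr_suml; apply: le_trans (ler_norm_sum _ _ _) _; apply: ler_sum => i _.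
  by rewrite normrM ler_wpM2l.
rewrite mulrA ltr_pdivrMr // mulrC ltr_pM2l // /c ltrDr //.
Qed.

Lemma cuboid_measure_gt0 (a b : R3 R) : (forall i, coord3 a i < coord3 b i) ->
  (0 < leb3 R (cuboid a b))%E.
Proof.
move=> ab; have mI (s t : R) : measurable (`]s, t[%classic : set mR) by exact: measurable_itv.
rewrite /cuboid /leb3 /leb3_prod /= product_measure1E //; last exact: measurableX.
rewrite -[X in (0 < X * _)%E]/(leb2 R (_ `*` _)).
have -> : leb2 R (`]a.1.1, b.1.1[%classic `*` `]a.1.2, b.1.2[%classic)
    = (@lebesgue_measure R `]a.1.1, b.1.1[%classic * @lebesgue_measure R `]a.1.2, b.1.2[%classic)%E.
  by rewrite /leb2 /= product_measure1E.
have := (ab 0, ab 1, ab 2%:R); rewrite /coord3 /= => -[[h0 h1] h2].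
rewrite !lebesgue_measure_itv /= !lte_fin h0 h1 h2.
by rewrite -!EFinD -!EFinM lte_fin !mulr_gt0 // subr_gt0.
Qed.

Lemma open_elt_cuboid (K : elt Th) (p : P1 (R := R)) : p != 0 ->
  exists a b, [/\ forall i, coord3 a i < coord3 b i, cuboid a b `<=` open_simplex (vtx K),
    cuboid a b `<=` cuboid lo hi & forall x, cuboid a b x -> P1_eval p x != 0].
Proof.
move=> p0; have [l [lv l1 lx]] := bary.
have pE q x : P1_eval q x = \sum_j P1_eval (l K j) x * P1_eval q (vtx K j).
  by rewrite -{1}(lx K x) P1_eval_comb.
have [k pk] : exists k, P1_eval p (vtx K k) != 0.
  apply: contrapT => /forallNP h; move/negP: p0; apply.
  have z x : P1_eval p x = 0.
    by rewrite pE big1 // => j _; have /negP/negPn/eqP -> := h j; rewrite mulr0.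
  have := z 0; rewrite /P1_eval dotC; have -> : dot 0 p.2 = 0 by rewrite /dot big1 // => i _; rewrite coord3_0 mul0r.
  rewrite addr0 => c0; have := z p.2; rewrite /P1_eval c0 add0r => /dot_eq0 g0.
  by rewrite (surjective_pairing p) c0 g0.
have h4 : \sum_(j < 4) (4^-1 : R) = 1.
  by rewrite sumr_const card_ord -[LHS]mulr_natl divff // pnatr_eq0.
pose at_ (c : 'I_4 -> R) := \sum_j c j *: vtx K j.
have lat c j : \sum_j c j = 1 -> P1_eval (l K j) (at_ c) = c j.
  move=> c1; rewrite P1_eval_comb // (bigD1 j) //= lv eqxx mulr1 big1 ?addr0 // => m mj.
  by rewrite lv eq_sym (negbTE mj) mulr0.
have [x0 [x0p x0l]] : exists x0, P1_eval p x0 != 0 /\ forall j, 0 < P1_eval (l K j) x0.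
  (* The barycentre serves unless p vanishes there; in that case the midpoint between the barycentre
     and vertex k serves, as p takes half of its nonzero vertex value there. *)
  pose c0 := fun _ : 'I_4 => 4^-1 : R.
  have [z|nz] := eqVneq (P1_eval p (at_ c0)) 0; last first.
    by exists (at_ c0); split=> // j; rewrite lat // invr_gt0.
  pose c1 j : R := 2^-1 * c0 j + 2^-1 * (k == j)%:R.
  have s1 : \sum_j c1 j = 1.
    rewrite big_split -!mulr_sumr h4 /= (bigD1 k) //= eqxx big1; last first.
      by move=> j; rewrite eq_sym => /negbTE ->.
    by rewrite addr0 !mulr1 -[RHS]/(1 : R); field.
  exists (at_ c1); split; last first.
    move=> j; rewrite lat // ltr_pwDl ?mulr_ge0 ?invr_ge0 ?ler0n //.
    by rewrite mulr_gt0 // invr_gt0.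
  rewrite P1_eval_comb //.
  have -> : \sum_j c1 j * P1_eval p (vtx K j) = 2^-1 * P1_eval p (vtx K k).
    transitivity (2^-1 * P1_eval p (at_ c0) + 2^-1 * P1_eval p (vtx K k)); last by rewrite z mulr0 add0r.
    rewrite P1_eval_comb // mulr_sumr.
    have -> : 2^-1 * P1_eval p (vtx K k) = \sum_j 2^-1 * (k == j)%:R * P1_eval p (vtx K j).
      rewrite (bigD1 k) //= eqxx mulr1 big1 ?addr0 // => j.
      by rewrite eq_sym => /negbTE ->; rewrite mulr0 mul0r.
    by rewrite -big_split; apply: eq_bigr => j _; rewrite /c1 mulrDl mulrA.
  by rewrite mulf_neq0 // invr_neq0.
(* Multiplying p by its sign at x0 turns nonvanishing into positivity, which can be handled together
   with the barycentric coordinates. *)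
pose q : P1 (R := R) := Num.sg (P1_eval p x0) *: p.
have qE x : P1_eval q x = Num.sg (P1_eval p x0) * P1_eval p x.
  by rewrite -[q]addr0 P1_evalL [P1_eval 0 _]pE big1 ?addr0 // => j _; rewrite [P1_eval 0 _](_ : _ = 0) ?mulr0 // /P1_eval /dot /= add0r big1 // => i _; rewrite coord3_0 mul0r.
have [|e e0 he] := @P1_positive_near (q :: [seq l K j | j <- enum 'I_4]) x0.
  move=> r; rewrite inE => /predU1P[->|/mapP[j _ ->]]; last exact: x0l.
  by rewrite qE -normrEsg normr_gt0.
have inK x : (forall i, `|coord3 x i - coord3 x0 i| < e) -> open_simplex (vtx K) x.
  move=> hx; exists (fun j => P1_eval (l K j) x); split; [|exact: l1|by rewrite lx].
  by move=> j; apply: he hx _ _; rewrite inE map_f ?orbT // mem_enum.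
have e2 : 0 < e / 2 by rewrite divr_gt0.
exists (vec (fun i => coord3 x0 i - e / 2)), (vec (fun i => coord3 x0 i + e / 2)).
have near x : cuboid (vec (fun i => coord3 x0 i - e / 2)) (vec (fun i => coord3 x0 i + e / 2)) x ->
    forall i, `|coord3 x i - coord3 x0 i| < e / 2.
  move=> [[/= h1 h2] h3].
  move=> i; rewrite ltr_norml; move: h1 h2 h3; rewrite !in_itv /= => h1 h2 h3.
  have {}h1 : coord3 x0 0 - e / 2 < coord3 x 0 < coord3 x0 0 + e / 2 by [].
  have {}h2 : coord3 x0 1 - e / 2 < coord3 x 1 < coord3 x0 1 + e / 2 by [].
  have {}h3 : coord3 x0 2%:R - e / 2 < coord3 x 2%:R < coord3 x0 2%:R + e / 2 by [].
  suff : coord3 x0 i - e / 2 < coord3 x i < coord3 x0 i + e / 2 by move=> /andP[? ?]; apply/andP; split; lra.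
  by elim/ord3P: i.
have half y : y < e / 2 -> y < e by move=> /lt_le_trans; apply; rewrite ler_pdivrMr // ler_peMr ?(ltW e0) // ler1n.
split=> [i|x /near hx|x /near hx|x /near hx].
- by rewrite !coord3_vec; lra.
- by apply: inK => i; exact: half.
- have cub y : (forall i, `|coord3 y i - coord3 x0 i| < e) -> closed_cuboid lo hi y.
    move=> /inK [c [c0 c1 ->]]; apply: (@mesh_sub _ _ _ Th K).
    by exists c; split=> // i; [exact: ltW|rewrite inE].
  have sh t i : `|t| < e -> closed_cuboid lo hi (x0 + t *: evec R i).
    move=> te; apply: cub => j; rewrite coord3D coord3Z coord3_vec addrAC subrr add0r.
    by case: eqP => _; rewrite ?mulr1 // mulr0 normr0.
  (* The point x is within e/2 of x0 in each coordinate, while the points displaced by 3e/4 along an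
     axis still lie in the closed cuboid; this makes the bounds strict. *)
  have b i : coord3 lo i < coord3 x i < coord3 hi i.
    have t1 : `|- (3 / 4 * e)| < e by rewrite normrN ger0_norm; lra.
    have t2 : `|3 / 4 * e| < e by rewrite ger0_norm; lra.
    have := sh _ i t1 i; have := sh _ i t2 i; have := hx i.
    rewrite !coord3D !coord3Z !coord3_vec eqxx !mulr1 ltr_norml => /andP[? ?] /andP[? ?] /andP[? ?].
    by apply/andP; split; lra.
  by split; [split; [exact: b 0|exact: b 1]|exact: b 2%:R].
have := he x (fun i => half _ (hx i)) q (mem_head _ _); rewrite qE.
by apply: contraTneq => ->; rewrite mulr0 ltxx.
Qed.

Lemma toL2_broken_eq0 (p : broken Th) : emb p = 0 -> p = 0.
Proof.
move=> p0; apply/ffunP => K; rewrite ffunE; apply/eqP; apply: contrapT => /negP pK.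
have [a [b [ab abK abD abp]]] := open_elt_cuboid K pK.
have /= [N [mN N0 sN]] : broken_fun p = (fun=> 0) %[ae muD].
  apply: ae_eq_trans (ae_eq_sym (toL2K (tame_Lfun2 (tame_broken p)))) _.
  by rewrite p0; exact: L2_classK.
have muN : muD N = 0 := N0; have : (0 < muD N)%E; last by rewrite muN ltxx.
apply: lt_le_trans (cuboid_measure_gt0 ab) _.
rewrite -[muD N]/(leb3 R (N `&` cuboid lo hi)); apply: le_measure; rewrite ?inE.
- exact: measurable_cuboid.
- exact: (measurableI _ _ mN (measurable_cuboid lo hi)).
move=> x abx; split; last exact: abD.
apply: sN => /= /(_ I); rewrite /broken_fun (bigD1 K) //= indicE mem_set ?mul1r; last exact: abK.
rewrite big1 => [|L LK]; first by rewrite addr0; apply/eqP; exact: abp.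
rewrite indicE memNset ?mul0r // => Lx.
by move/eqP: LK; apply; exact: mesh_disjoint Lx (abK _ abx).
Qed.

End broken_functions.

Section linear_functionals.
Context {R : realType} {lo hi : R3 R} (Th : simplicial_mesh lo hi).
Local Notation Hh := (Hh Th).
Local Notation tame := (tame lo hi).
Implicit Types (f : Hh -> R) (L : Hh -> R3 R).

Definition lin f := forall a v w, f (a *: v + w) = a * f v + f w.
Definition vlin L := forall a v w, L (a *: v + w) = a *: L v + L w.

Lemma linD f g : lin f -> lin g -> lin (fun v => f v + g v).
Proof. by move=> lf lg a v w; rewrite lf lg; ring. Qed.

Lemma linB f g : lin f -> lin g -> lin (fun v => f v - g v).
Proof. by move=> lf lg a v w; rewrite lf lg; ring. Qed.

Lemma linZ c f : lin f -> lin (fun v => c * f v).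
Proof. by move=> lf a v w; rewrite lf; ring. Qed.

Lemma lin_sum (I : finType) (Q : pred I) (F : I -> Hh -> R) :
  (forall i, Q i -> lin (F i)) -> lin (fun v => \sum_(i | Q i) F i v).
Proof.
by move=> lF a v w; rewrite mulr_sumr -big_split; apply: eq_bigr => i Qi; rewrite lF.
Qed.

Lemma vlinD L L' : vlin L -> vlin L' -> vlin (fun v => L v + L' v).
Proof. by move=> lL lL' a v w; rewrite lL lL' scalerDr addrACA. Qed.

Lemma vlinB L L' : vlin L -> vlin L' -> vlin (fun v => L v - L' v).
Proof. by move=> lL lL' a v w; rewrite lL lL' scalerBr opprD addrACA. Qed.

Lemma vlin_cross n L : vlin L -> vlin (fun v => cross n (L v)).
Proof.
move=> lL a v w; apply: eq_R3 => i.
by rewrite lL coord3D coord3Z !coord3_vec !coord3D !coord3Z; ring.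
Qed.

Lemma lin_dotr c L : vlin L -> lin (fun v => dot c (L v)).
Proof. by move=> lL a v w; rewrite lL dotDr dotZr. Qed.

Lemma lin_dotl c L : vlin L -> lin (fun v => dot (L v) c).
Proof. by move=> lL a v w; rewrite lL ![dot _ c]dotC dotDr dotZr. Qed.

Lemma vlin_on_elt1 K x : vlin (fun v => on_elt v.1 K x).
Proof.
move=> a v w; apply: eq_R3 => i; rewrite coord3D coord3Z !coord_on_elt -P1_evalL.
by congr P1_eval; rewrite -[LHS]/((a *: v.1 + w.1) i K) !ffunE.
Qed.

Lemma vlin_on_elt2 K x : vlin (fun v => on_elt v.2 K x).
Proof.
move=> a v w; apply: eq_R3 => i; rewrite coord3D coord3Z !coord_on_elt -P1_evalL.
by congr P1_eval; rewrite -[LHS]/((a *: v.2 + w.2) i K) !ffunE.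
Qed.

Lemma coord_gradientL a (p q : P1 (R := R)) i :
  coord3 (a *: p + q).2 i = a * coord3 p.2 i + coord3 q.2 i.
Proof. by case: p q => c g [c' g']; apply: etrans (coord3D _ _ _) _; rewrite coord3Z. Qed.

Lemma vlin_curl1 K x : vlin (fun v => curl (on_elt v.1 K) x).
Proof.
move=> a v w; apply: eq_R3 => i; rewrite coord3D coord3Z !curl_on_elt.
have e j : (a *: v + w).1 j K = a *: v.1 j K + w.1 j K.
  by rewrite -[LHS]/((a *: v.1 + w.1) j K) !ffunE.
by rewrite (e (i + 2%:R)) (e (i + 1)) !coord_gradientL; ring.
Qed.

Lemma vlin_curl2 K x : vlin (fun v => curl (on_elt v.2 K) x).
Proof.
move=> a v w; apply: eq_R3 => i; rewrite coord3D coord3Z !curl_on_elt.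
have e j : (a *: v + w).2 j K = a *: v.2 j K + w.2 j K.
  by rewrite -[LHS]/((a *: v.2 + w.2) j K) !ffunE.
by rewrite (e (i + 2%:R)) (e (i + 1)) !coord_gradientL; ring.
Qed.

Lemma lin_volume (F : Hh -> R3 R -> R) (K : elt Th) : (forall v, tame (F v)) -> (forall x, lin (F ^~ x)) ->
  lin (fun v => \int[leb3 R]_(x in simplex (vtx K)) F v x)%R.
Proof.
move=> tF lF a v w; have mK := @measurable_elt _ _ _ Th K.
have i u := tame_integrable (tF u) mK (@mesh_sub _ _ _ Th K).
rewrite -RintegralZl // -RintegralD //; last exact: integrableZ_EFin.
by apply: eq_Rintegral => x _; exact: lF.
Qed.

Lemma lin_surface (F : Hh -> R3 R -> R) (fr : frame (R := R)) A : orthonormal_frame fr ->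
  measurable A -> A `<=` closed_cuboid lo hi ->
  (forall v, tame (F v)) -> (forall x, lin (F ^~ x)) -> lin (fun v => surface_integral fr A (F v)).
Proof.
move=> ofr mA AD tF lF a v w.
rewrite -(surface_integralZ ofr mA AD) //.
rewrite -(surface_integralD ofr mA AD) //; last by apply: tameM => //; exact: tame_cst.
by apply: eq_surface_integral => x; exact: lF.
Qed.

End linear_functionals.

Section maxwell_bilinear.
Context {R : realType} {lo hi : R3 R} (Th : simplicial_mesh lo hi) (ori : rel (elt Th)).
Local Notation Hh := (Hh Th).

Ltac tame_tac := lazy beta zeta; lazymatch goal with
  | |- tame _ _ (fun x => dot (@?V x) (@?W x)) => refine (tame_dot (V := V) (W := W) _ _); tame_tac
  | |- vtame _ _ (fun x => cross ?n (@?V x)) => refine (vtame_cross (V := V) n _); tame_tac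
  | |- vtame _ _ (fun x => @?V x - @?W x) => refine (vtameB (V := V) (W := W) _ _); tame_tac
  | |- vtame _ _ (fun x => @?V x + @?W x) => refine (vtameD (V := V) (W := W) _ _); tame_tac
  | |- vtame _ _ (fun x => curl (on_elt ?w ?K) x) => exact (vtame_curl w K)
  | |- vtame _ _ (curl (on_elt ?w ?K)) => exact (vtame_curl w K)
  | |- vtame _ _ (fun x => on_elt ?w ?K x) => exact (vtame_on_elt w K)
  | |- vtame _ _ (on_elt ?w ?K) => exact (vtame_on_elt w K)
  end.

Ltac lin_tac := lazy beta zeta; lazymatch goal with
  | |- vlin (fun v => cross ?n (@?L v)) => refine (vlin_cross (L := L) n _); lin_tac
  | |- vlin (fun v => @?L v - @?M v) => refine (vlinB (L := L) (L' := M) _ _); lin_tac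
  | |- vlin (fun v => @?L v + @?M v) => refine (vlinD (L := L) (L' := M) _ _); lin_tac
  | |- vlin (fun v => curl (on_elt v.1 ?K) ?x) => exact (vlin_curl1 K x)
  | |- vlin (fun v => curl (on_elt v.2 ?K) ?x) => exact (vlin_curl2 K x)
  | |- vlin (fun v => on_elt v.1 ?K ?x) => exact (vlin_on_elt1 K x)
  | |- vlin (fun v => on_elt v.2 ?K ?x) => exact (vlin_on_elt2 K x)
  end.

Lemma maxwell_form_linr (u : Hh) : lin (maxwell_form ori u).
Proof.
apply: linD; first apply: linD.
- apply: lin_sum => K _; apply: linB; apply: lin_volume => [v|x]; solve [tame_tac | apply: lin_dotr; lin_tac].
- apply: linZ; apply: lin_sum => -[K L] /andP[_ /asboolP/interior_face_frame ofr].
  have surf := lin_surface ofr (measurable_face K L) (@common_face_sub _ _ _ _ K L).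
  apply: linB; first apply: linB; first apply: linB; apply: surf => [v|x]; solve [tame_tac | apply: lin_dotr; lin_tac].
- apply: lin_sum => K _; apply: lin_sum => i _; apply: lin_sum => s _.
  have surf := lin_surface (side_orthonormal lo hi i s) (measurable_exterior_face K i s)
    (@exterior_face_sub _ _ _ _ K i s).
  apply: linB; apply: surf => [v|x]; solve [tame_tac | apply: lin_dotr; lin_tac].
Qed.

Lemma maxwell_form_linl (v : Hh) : lin (fun u => maxwell_form ori u v).
Proof.
apply: linD; first apply: linD.
- apply: lin_sum => K _; apply: linB; apply: lin_volume => [u|x]; solve [tame_tac | apply: lin_dotl; lin_tac].
- apply: linZ; apply: lin_sum => -[K L] /andP[_ /asboolP/interior_face_frame ofr].
  have surf := lin_surface ofr (measurable_face K L) (@common_face_sub _ _ _ _ K L).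
  apply: linB; first apply: linB; first apply: linB; apply: surf => [u|x]; solve [tame_tac | apply: lin_dotl; lin_tac].
- apply: lin_sum => K _; apply: lin_sum => i _; apply: lin_sum => s _.
  have surf := lin_surface (side_orthonormal lo hi i s) (measurable_exterior_face K i s)
    (@exterior_face_sub _ _ _ _ K i s).
  apply: linB; apply: surf => [u|x]; solve [tame_tac | apply: lin_dotl; lin_tac].
Qed.

End maxwell_bilinear.

Section dG_operators.
Context {R : realType} {lo hi : R3 R} (Th : simplicial_mesh lo hi) (ori : rel (elt Th)).
Local Notation mR := (measurableTypeR R).
Local Notation Hh := (Hh Th).
Local Notation HH := (HH lo hi).
Local Notation L2D := (L2 (muD lo hi)).
Local Notation emb := (@embH R lo hi Th).
Local Notation Mh := (Mh ori).
Hypothesis oriP : orientation ori.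

Lemma embHL a (u v : Hh) : emb (a *: u + v) = a *: emb u + emb v.
Proof.
congr (_, _); apply/ffunP => i; rewrite !ffunE.
  exact: toL2_brokenL.
exact: toL2_brokenL.
Qed.

Lemma embH0 : emb 0 = 0.
Proof. by have := embHL (-1) 0 0; rewrite scaleN1r oppr0 addr0 scaleN1r addNr. Qed.
Lemma embHZ a u : emb (a *: u) = a *: emb u.
Proof. by rewrite -[a *: u]addr0 embHL embH0 addr0. Qed.
Lemma embHD u v : emb (u + v) = emb u + emb v.
Proof. by rewrite -{1}[u]scale1r embHL scale1r. Qed.
Lemma embHB u v : emb (u - v) = emb u - emb v.
Proof. by rewrite embHD -scaleN1r embHZ scaleN1r. Qed.

Lemma embH_eq0 u : emb u = 0 -> u = 0.
Proof.
case: u => u1 u2 [e1 e2]; congr (_, _); apply/ffunP => i; rewrite ffunE.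
  by apply: toL2_broken_eq0; move/ffunP/(_ i): e1; rewrite !ffunE.
by apply: toL2_broken_eq0; move/ffunP/(_ i): e2; rewrite !ffunE.
Qed.

Let ipHP := ipHP lo hi.
Let ipE (u v : Hh) := ipH (emb u) (emb v).

Lemma ip_embP : inner_product ipE.
Proof.
split=> [u v|u v w|a u v|u]; rewrite /ipE.
- exact: ipC.
- by rewrite embHD (ipDl ipHP).
- by rewrite embHZ (ipZl ipHP).
- exact: ip_ge0.
Qed.

Lemma ip_emb_eq0 u : ipE u u = 0 -> u = 0.
Proof. by move=> h; apply/embH_eq0/normH_eq0; rewrite /normH -/(ipE u u) h sqrtr0. Qed.

Lemma Hh_riesz (l : Hh -> R) : lin l -> exists w, forall v, ipH (emb w) (emb v) = l v.
Proof.
exact: (riesz_representation (@linear_Hh_of_coord _ _ _ Th) (@linear_Hh_coord _ _ _ Th)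
  (@Hh_of_coordK _ _ _ Th) (@Hh_coordK _ _ _ Th) ip_embP ip_emb_eq0).
Qed.

Lemma Hh_surjective (L : Hh -> Hh) : linear L -> (forall v, L v = 0 -> v = 0) ->
  forall b, exists v, L v = b.
Proof.
exact: (linear_injective_surjective (@linear_Hh_of_coord _ _ _ Th) (@linear_Hh_coord _ _ _ Th)
  (@Hh_of_coordK _ _ _ Th) (@Hh_coordK _ _ _ Th)).
Qed.

Lemma Hh_ip_inj (w w' : Hh) : (forall v, ipH (emb w) (emb v) = ipH (emb w') (emb v)) -> w = w'.
Proof.
move=> h; apply/eqP; rewrite -subr_eq0; apply/eqP; apply: ip_emb_eq0.
by rewrite /ipE embHB (ipBl ipHP) -embHB !h subrr.
Qed.

Lemma pihP (f : HH) v : ipH (emb (pih Th f)) (emb v) = ipH f (emb v).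
Proof.
have [w hw] : exists w, forall v, ipH (emb w) (emb v) = ipH f (emb v).
  by apply: Hh_riesz => a u v'; rewrite embHL (ipDr ipHP) (ipZr ipHP).
have /(_ v) : forall v, ipH (f - emb (pih Th f)) (emb v) = 0.
  apply: (@xgetPex _ 0 [set w | forall v, ipH (f - emb w) (emb v) = 0]).
  by exists w => v' /=; rewrite (ipBl ipHP) hw subrr.
by rewrite (ipBl ipHP) => /eqP; rewrite subr_eq0 => /eqP.
Qed.

Lemma pihL a f g : pih Th (a *: f + g) = a *: pih Th f + pih Th g.
Proof.
apply: Hh_ip_inj => v; rewrite pihP; transitivity (a * ipH f (emb v) + ipH g (emb v)).
  exact: (ipL ipHP a f g (emb v)).
rewrite -(pihP f v) -(pihP g v); exact: esym (ipL ip_embP a (pih Th f) (pih Th g) v).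
Qed.

Lemma pihB f g : pih Th (f - g) = pih Th f - pih Th g.
Proof. by rewrite addrC -scaleN1r pihL scaleN1r addrC. Qed.

Lemma pih_embH u : pih Th (emb u) = u.
Proof. by apply: Hh_ip_inj => v; rewrite pihP. Qed.

Lemma normH_pih f : normH (emb (pih Th f)) <= normH f.
Proof.
have [->|p0] := eqVneq (normH (emb (pih Th f))) 0; first exact: normH_ge0.
have pgt : 0 < normH (emb (pih Th f)) by rewrite lt_def p0 normH_ge0.
rewrite -(ler_pM2r pgt) -expr2 sqr_normH pihP.
exact: le_trans (ler_norm _) (cauchy_schwarz ipHP _ _).
Qed.

Lemma MhP u v : ipH (emb (Mh u)) (emb v) = maxwell_form ori u v.
Proof.
have [w hw] := Hh_riesz (maxwell_form_linr ori u).
exact: (@xgetPex _ 0 [set w | forall v, ipH (emb w) (emb v) = maxwell_form ori u v] (ex_intro _ w hw)).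
Qed.

Lemma MhL a u v : Mh (a *: u + v) = a *: Mh u + Mh v.
Proof.
apply: Hh_ip_inj => w; rewrite MhP; apply: etrans (maxwell_form_linl ori w a u v) _.
rewrite -(MhP u w) -(MhP v w); exact: esym (ipL ip_embP a (Mh u) (Mh v) w).
Qed.

Lemma Mh_dissipative u : ipH (emb (Mh u)) (emb u) <= 0.
Proof. by rewrite MhP; exact: maxwell_form_le0. Qed.

End dG_operators.

(** * Multiplication of bounded fields by square-integrable noise *)

Section multiplication.
Context {R : realType} {lo hi : R3 R}.
Local Notation mR := (measurableTypeR R).
Local Notation HH := (HH lo hi).
Local Notation L2D := (L2 (muD lo hi)).

(** Essential boundedness keeps the product with any square-integrable noise in L^2; outside L^2 the
    class [mulL2] has the default value 0 and is no longer linear. *)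
Definition bounded_L2 (f : L2D) := @bounded_ae R lo hi (L2_repr f).

Lemma bounded_L2D f g : bounded_L2 f -> bounded_L2 g -> bounded_L2 (f + g).
Proof.
move=> [C hC] [C' hC']; exists (C + C').
apply: filterS2 (L2_reprD f g) (filterI hC hC') => x /(_ I) -> [h h'].
exact: le_trans (ler_normD _ _) (lerD h h').
Qed.

Lemma bounded_L2Z a f : bounded_L2 f -> bounded_L2 (a *: f).
Proof.
move=> [C hC]; exists (`|a| * C); apply: filterS2 (L2_reprZ a f) hC => x /(_ I) -> h.
by rewrite normrM ler_wpM2l.
Qed.

Lemma mulL2_repr f g : bounded_L2 f ->
  (L2_repr (mulL2 f g) : R3 R -> R) = (fun x => L2_repr f x * L2_repr g x) %[ae muD lo hi].
Proof.
by move=> fC; apply/toL2K/bounded_mul_Lfun2 => //; [exact: measurable_repr|exact: L2_Lfun].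
Qed.

Lemma mulL2Dl a f f' g : bounded_L2 f -> bounded_L2 f' ->
  mulL2 (a *: f + f') g = a *: mulL2 f g + mulL2 f' g.
Proof.
move=> fC fC'; have fC2 := bounded_L2D (bounded_L2Z a fC) fC'.
apply: eq_L2; apply: (ae_eq_trans (mulL2_repr _ fC2)).
apply/ae_eq_sym; apply: (ae_eq_trans (L2_reprD _ _)).
apply: filterS2 (filterI (mulL2_repr g fC) (mulL2_repr g fC'))
  (filterI (L2_reprZ a (mulL2 f g)) (filterI (L2_reprZ a f) (L2_reprD (a *: f) f'))).
by move=> x [/(_ I) h1 /(_ I) h2] [/(_ I) h3 [/(_ I) h4 /(_ I) h5]] _; rewrite h3 h1 h2 h5 h4; ring.
Qed.

Lemma mulL2Br f g g' : bounded_L2 f -> mulL2 f (g - g') = mulL2 f g - mulL2 f g'.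
Proof.
move=> fC; apply: eq_L2; apply: (ae_eq_trans (mulL2_repr _ fC)).
apply/ae_eq_sym; apply: (ae_eq_trans (L2_reprB _ _)).
apply: filterS2 (filterI (mulL2_repr g fC) (mulL2_repr g' fC)) (L2_reprB g g').
by move=> x [/(_ I) h1 /(_ I) h2] /(_ I) h3 _; rewrite h1 h2 h3; ring.
Qed.

Lemma normL2_mulL2 f : bounded_L2 f -> exists2 C, 0 <= C & forall g, normL2 (mulL2 f g) <= C * normL2 g.
Proof.
move=> fb; have [C hC] := fb; exists `|C| => [|g]; first exact: normr_ge0.
rewrite -(@ler_pXn2r _ 2) ?nnegrE ?mulr_ge0 ?sqrtr_ge0 // exprMn -lee_fin.
have mfg : measurable_fun [set: R3 R] (fun x => L2_repr f x * L2_repr g x : mR).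
  by apply: measurable_funM; exact: measurable_repr.
have mg2 : measurable_fun [set: R3 R] (fun x => (L2_repr g x ^+ 2)%:E).
  by apply/measurable_EFinP; apply: measurable_funX; exact: measurable_repr.
rewrite (EFin_sqr_normL2 mfg (mulL2_repr g fb)) [X in (_ <= X)%E]EFinM.
have rr : (L2_repr g : R3 R -> R) = (L2_repr g : R3 R -> R) %[ae muD lo hi] by exact: nearW.
rewrite (EFin_sqr_normL2 (measurable_repr g) rr).
rewrite -ge0_integralZl_EFin ?sqr_ge0 //; last by move=> x _; rewrite lee_fin sqr_ge0.
apply: ae_ge0_le_integral => //.
- by move=> x _; rewrite lee_fin sqr_ge0.
- by apply/measurable_EFinP; exact: measurable_funX.
- by move=> x _; rewrite -EFinM lee_fin mulr_ge0 // sqr_ge0.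
- exact: (measurable_funeM _ mg2).
apply: filterS hC => x fx _; rewrite -EFinM lee_fin exprMn ler_wpM2r ?sqr_ge0 //.
rewrite -[leLHS]real_normK ?num_real // ler_pXn2r ?nnegrE //.
exact: le_trans fx (ler_norm _).
Qed.

(** Both sides are the integral of f g h. This symmetry is what makes the noise operator skew. *)
Lemma ip_mulL2C f g h : bounded_L2 f -> bounded_L2 h -> ipL2 (mulL2 f g) h = ipL2 (mulL2 h g) f.
Proof.
move=> fb hb.
have mr (k : L2D) : measurable_fun [set: R3 R] (L2_repr k : R3 R -> mR) by exact: measurable_repr.
have rr (k : L2D) : (L2_repr k : R3 R -> R) = (L2_repr k : R3 R -> R) %[ae muD lo hi] by exact: nearW.
rewrite (ipL2_ae _ (mr h) (mulL2_repr g fb) (rr h)); last exact: measurable_funM.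
rewrite (ipL2_ae _ (mr f) (mulL2_repr g hb) (rr f)); last exact: measurable_funM.
by apply: eq_Rintegral => x _; ring.
Qed.

End multiplication.

(** * The implicit step is a strict contraction *)

Section dissipative_estimate.
Context {R : realType} {V : lmodType R} (ip : V -> V -> R).
Hypothesis ipP : inner_product ip.
Local Notation nrm := (fun u => Num.sqrt (ip u u)).
Variable A : V -> V.
Hypothesis (A_dissipative : forall u, ip (A u) u <= 0).

(* Testing p - r s = A (p + r s) + e with p + r s gives
   |p|^2 - r^2 |s|^2 <= |e| (|p| + r |s|). *)
Lemma implicit_step_estimate (r : R) (p s e : V) : 0 <= r ->
  p - r *: s = A (p + r *: s) + e -> nrm p <= r * nrm s + nrm e.
Proof.
move=> r0 pse; have nrmP := ip_seminorm ipP.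
have cs := cauchy_schwarz ipP e (p + r *: s); have := A_dissipative (p + r *: s).
have tri := semiD nrmP p (r *: s); rewrite (semiZ nrmP) ger0_norm // in tri.
have : ip (p - r *: s) (p + r *: s) = ip p p - r ^+ 2 * ip s s.
  by rewrite (ipBl ipP) !(ipDr ipP) !(ipZl ipP) !(ipZr ipP) (ipC ipP s p); ring.
rewrite pse (ipDl ipP) => test dis; rewrite -(sqr_pnorm ipP p) -(sqr_pnorm ipP s) in test.
have := semi_ge0 nrmP p; have := semi_ge0 nrmP s; have := semi_ge0 nrmP e => /= e0 s0 p0.
have le1 : ip e (p + r *: s) <= Num.sqrt (ip e e) * (Num.sqrt (ip p p) + r * Num.sqrt (ip s s)).
  by apply: le_trans (ler_norm _) (le_trans cs _); rewrite ler_wpM2l.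
move: (Num.sqrt (ip p p)) (Num.sqrt (ip s s)) (Num.sqrt (ip e e)) p0 s0 e0 test le1 => P S E p0 s0 e0 test le1.
rewrite leNgt; apply/negP => h.
have rs0 : 0 <= r * S by rewrite mulr_ge0.
have : 0 < (P - r * S - E) * (P + r * S) by rewrite mulr_gt0; lra.
by rewrite -subr_ge0 in le1; move: test le1 dis; set x := ip (A _) _; set y := ip e _; nra.
Qed.

End dissipative_estimate.

Section implicit_step.
Context {R : realType} {V G : lmodType R} (ip : V -> V -> R) (nrmG : G -> R).
Variables (t k r c : R) (M : V -> V) (B : G -> V -> V) (g_op : G -> V).
Hypotheses (ipP : inner_product ip) (ip_def : forall u, ip u u = 0 -> u = 0).
Hypothesis nrmGP : seminorm nrmG.
Hypothesis surj : forall L : V -> V, linear L -> (forall v, L v = 0 -> v = 0) ->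
  forall b, exists v, L v = b.
Hypotheses (t0 : 0 <= t) (r0 : 0 <= r) (linM : linear M) (linB : forall a, linear (B a)).
Hypothesis M_dissipative : forall u, ip (M u) u <= 0.
Hypothesis B_skew : forall a u, ip (B a u) u = 0.
Hypothesis BB : forall a a' u, B (a - a') u = B a u - B a' u.
Hypothesis B_bounded : forall u, exists2 C, 0 <= C &
  forall a, Num.sqrt (ip (B a u) (B a u)) <= C * nrmG a.
Hypothesis g_opB : forall g g', g_op (g - g') = g_op g - g_op g'.
Hypothesis g_op_bounded : forall g, Num.sqrt (ip (g_op g) (g_op g)) <= c * nrmG g.
Local Notation nrm := (fun u => Num.sqrt (ip u u)).
Let nrmP := ip_seminorm ipP.

Definition step_op (a : G) (u : V) : V := t *: M u + k *: B a u.

Lemma linear_step_op a : linear (step_op a).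
Proof.
move=> s u v; rewrite /step_op linM linB !scalerDr !scalerA (mulrC t) (mulrC k) -!scalerA.
by rewrite addrACA.
Qed.

Lemma step_op_dissipative a u : ip (step_op a u) u <= 0.
Proof.
rewrite /step_op (ipDl ipP) !(ipZl ipP) B_skew mulr0 addr0.
by rewrite mulr_ge0_le0.
Qed.

Definition step_eq (a g : G) (u u' : V) : Prop :=
  u' - r *: u = step_op a (u' + r *: u) + g_op g.

Definition implicit_step (a g : G) (u : V) : V := xget 0 [set u' | step_eq a g u u'].
Local Notation step := implicit_step.

(** In the unknown w = u' + r u the equation reads w - A w = 2 r u + g with A the step operator.
    Dissipativity gives |w|^2 = <A w, w> <= 0 on the kernel of I - A, so that map is injective and,
    in finite dimension, surjective. *)
Lemma implicit_stepP a g u : step_eq a g u (step a g u).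
Proof.
pose L w := w - step_op a w.
have linL : linear L by move=> s v w; rewrite /L linear_step_op scalerBr opprD addrACA.
have injL v : L v = 0 -> v = 0.
  move=> /eqP; rewrite subr_eq0 => /eqP h; apply: ip_def; apply/eqP.
  rewrite eq_le (ip_ge0 ipP) andbT {1}h; exact: step_op_dissipative.
have [w hw] := surj linL injL (r *: u + r *: u + g_op g).
apply: (@xgetPex _ 0 [set u' | step_eq a g u u']).
exists (w - r *: u); rewrite /= /step_eq subrK.
have -> : w - r *: u - r *: u = step_op a w + (L w - (r *: u + r *: u)).
  by rewrite /L; move: (step_op a w) (r *: u) => x y; rewrite opprD !addrA [x + w]addrC addrK.
by rewrite hw [_ + _ + g_op g]addrC addrK.
Qed.

(** The difference of two steps solves the step equation for the noise a, perturbed by (B a - B a')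
    z with z = q + r v. Only the second solution enters z, so the resulting constant depends on (a',
    g', v) and not on (a, g, u). *)
Lemma step_eq_dist a g u a' g' v p q : step_eq a g u p -> step_eq a' g' v q ->
  nrm (p - q) <= r * nrm (u - v) + nrm (k *: B (a - a') (q + r *: v)) + c * nrmG (g - g').
Proof.
rewrite /step_eq => hp hq; set z := q + r *: v.
have /(implicit_step_estimate ipP (step_op_dissipative a) r0) h : p - q - r *: (u - v)
   = step_op a (p - q + r *: (u - v)) + (k *: B (a - a') z + g_op (g - g')).
  have -> : p - q - r *: (u - v) = (p - r *: u) - (q - r *: v).
    by rewrite scalerBr !opprD opprK addrACA.
  have -> : p - q + r *: (u - v) = (-1) *: z + (p + r *: u).
    by rewrite scalerBr scaleN1r addrACA -opprD addrC.
  have zE : step_op a z - step_op a' z = k *: (B a z - B a' z).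
    by rewrite /step_op opprD addrACA subrr add0r scalerBr.
  rewrite hp hq linear_step_op scaleN1r -/z g_opB BB -zE opprD addrACA.
  move: (step_op a (_ + _)) (step_op a z) (step_op a' z) => s s1 s2.
  by rewrite !addrA [- s1 + s]addrC subrK.
apply: le_trans h _; rewrite -addrA lerD2l; apply: le_trans (semiD nrmP _ _) _.
by rewrite lerD2l.
Qed.

Let step_eq_contraction a g u v p q : step_eq a g u p -> step_eq a g v q ->
  nrm (p - q) <= r * nrm (u - v).
Proof.
move=> hp hq; have := step_eq_dist hp hq; rewrite !subrr (semi0 nrmGP) mulr0 addr0.
have [C C0 hC] := B_bounded (q + r *: v).
rewrite (semiZ nrmP); have -> : nrm (B 0 (q + r *: v)) = 0; last by rewrite mulr0 addr0.
by apply/eqP; rewrite eq_le (semi_ge0 nrmP) andbT; have := hC 0; rewrite (semi0 nrmGP) mulr0.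
Qed.

(** Contraction applied to two solutions with the same initial value and the same noise. *)
Lemma step_eq_unique a g u u' : step_eq a g u u' -> u' = step a g u.
Proof.
move=> h; apply/eqP; rewrite -subr_eq0; apply/eqP/ip_def.
have := step_eq_contraction h (implicit_stepP a g u).
rewrite subrr (semi0 nrmP) mulr0 => h2; rewrite -(sqr_pnorm ipP).
have h3 := semi_ge0 nrmP (u' - step a g u).
by apply/eqP; rewrite expf_eq0 /=; rewrite eq_le h2.
Qed.

Lemma implicit_step_contraction a g u v :
  nrm (step a g u - step a g v) <= r * nrm (u - v).
Proof. exact: step_eq_contraction (implicit_stepP _ _ _) (implicit_stepP _ _ _). Qed.

Lemma implicit_step_continuous a' g' v : exists2 C, 0 <= C & forall a g u,
  nrm (step a g u - step a' g' v) <=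
  r * nrm (u - v) + C * nrmG (a - a') + c * nrmG (g - g').
Proof.
have [C C0 hC] := B_bounded (step a' g' v + r *: v).
exists (`|k| * C) => [|a g u]; first by rewrite mulr_ge0.
apply: le_trans (step_eq_dist (implicit_stepP _ _ _) (implicit_stepP _ _ _)) _.
rewrite lerD2r lerD2l.
by rewrite (semiZ nrmP) -mulrA ler_wpM2l.
Qed.

Lemma implicit_step_growth a g u : nrm (step a g u) <= r * nrm u + c * nrmG g.
Proof.
apply: le_trans (implicit_step_estimate ipP (step_op_dissipative a) r0 (implicit_stepP a g u)) _.
by rewrite lerD2l.
Qed.

End implicit_step.

Section multiplication_by_vectors.
Context {R : realType} {lo hi : R3 R}.
Local Notation HH := (HH lo hi).
Local Notation L2D := (L2 (muD lo hi)).

Lemma HH_ext (f g : HH) : (forall i, f.1 i = g.1 i) -> (forall i, f.2 i = g.2 i) -> f = g.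
Proof. by case: f g => [f1 f2] [g1 g2] /= e1 e2; congr (_, _); apply/ffunP. Qed.

Definition bounded_HH (u : HH) := forall i, bounded_L2 (u.1 i) /\ bounded_L2 (u.2 i).

Lemma mulHL c (u v : HH) a : bounded_HH u -> bounded_HH v ->
  mulH (c *: u + v) a = c *: mulH u a + mulH v a.
Proof.
move=> bu bv; apply: HH_ext => i.
  transitivity (c *: mulL2 (u.1 i) a + mulL2 (v.1 i) a).
    by rewrite ffunE HH1D HH1Z; exact: (mulL2Dl _ _ (bu i).1 (bv i).1).
  by rewrite HH1D HH1Z /= !ffunE.
transitivity (c *: mulL2 (u.2 i) a + mulL2 (v.2 i) a).
  by rewrite ffunE HH2D HH2Z; exact: (mulL2Dl _ _ (bu i).2 (bv i).2).
by rewrite HH2D HH2Z /= !ffunE.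
Qed.

Lemma mulHB (u : HH) a a' : bounded_HH u -> mulH u (a - a') = mulH u a - mulH u a'.
Proof.
move=> bu; apply: HH_ext => i.
  by rewrite ffunE HH1B /= !ffunE; exact: (mulL2Br _ _ (bu i).1).
by rewrite ffunE HH2B /= !ffunE; exact: (mulL2Br _ _ (bu i).2).
Qed.

Lemma JopL c (u v : HH) : Jop (c *: u + v) = c *: Jop u + Jop v.
Proof.
apply: HH_ext => i; last first.
  by rewrite HH2D HH2Z; transitivity ((c *: u + v).1 i); rewrite // HH1D HH1Z.
by rewrite HH1D HH1Z [LHS]ffunE HH2D HH2Z opprD -scalerN !ffunE.
Qed.

Lemma bounded_Jop (u : HH) : bounded_HH u -> bounded_HH (Jop u).
Proof.
move=> bu i; split; last exact: (bu i).1.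
have -> : (Jop u).1 i = (-1) *: u.2 i by rewrite scaleN1r ffunE.
exact: bounded_L2Z (bu i).2.
Qed.

Lemma mulL2N (f a : L2D) : bounded_L2 f -> mulL2 (- f) a = - mulL2 f a.
Proof.
move=> bf; have := mulL2Dl (-1) a bf (bounded_L2Z 0 bf).
have := mulL2Dl (-1) a (bounded_L2Z 0 bf) (bounded_L2Z 0 bf).
by rewrite !scale0r !addr0 !scaleN1r oppr0 addNr => ->; rewrite addr0.
Qed.

(** J sends (E, H) to (- H, E), so componentwise the pairing is the integral of (- H E + E H) a,
    which is zero. *)
Lemma mulH_Jop_skew (u : HH) a : bounded_HH u -> ipH (mulH (Jop u) a) u = 0.
Proof.
move=> bu; rewrite /ipH -big_split big1 //= => i _; have [b1 b2] := bu i.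
have -> : [ffun i0 => mulL2 ((- u.2) i0) a] i = - mulL2 (u.2 i) a.
  by rewrite ffunE [X in mulL2 X]ffunE mulL2N.
have -> : [ffun i0 => mulL2 (u.1 i0) a] i = mulL2 (u.1 i) a by rewrite ffunE.
by rewrite (ip_mulL2C _ b1 b2) (ipNl (ipL2P _)) addNr.
Qed.

Lemma mulH_bounded (u : HH) : bounded_HH u ->
  exists2 C, 0 <= C & forall a, normH (mulH u a) <= C * normL2 a.
Proof.
move=> bu.
have /choice[C1 hC1] i : exists C, 0 <= C /\ forall a, normL2 (mulL2 (u.1 i) a) <= C * normL2 a.
  by have [C C0 h] := normL2_mulL2 (bu i).1; exists C.
have /choice[C2 hC2] i : exists C, 0 <= C /\ forall a, normL2 (mulL2 (u.2 i) a) <= C * normL2 a.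
  by have [C C0 h] := normL2_mulL2 (bu i).2; exists C.
exists (\sum_i C1 i + \sum_i C2 i) => [|a].
  by rewrite addr_ge0 // sumr_ge0 // => i _; [case: (hC1 i)|case: (hC2 i)].
apply: le_trans (normH_le_sum _) _; rewrite mulrDl !mulr_suml.
by apply: lerD; apply: ler_sum => i _; rewrite ffunE; [case: (hC1 i)|case: (hC2 i)].
Qed.

Variable lam2 : R3 R.

Definition tilde_bound := \sum_i `|coord3 lam2 i| + \sum_i `|coord3 lam2 i|.

Lemma tilde_bound_ge0 : 0 <= tilde_bound.
Proof. by rewrite addr_ge0 // sumr_ge0. Qed.

Lemma normH_tildeH (g : L2D) : normH (tildeH lam2 g) <= tilde_bound * normL2 g.
Proof.
apply: le_trans (normH_le_sum _) _; rewrite mulrDl !mulr_suml lerD // ler_sum // => i _;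
by rewrite ffunE (semiZ (normL2P _)).
Qed.

Lemma tildeHB (g g' : L2D) : tildeH lam2 (g - g') = tildeH lam2 g - tildeH lam2 g'.
Proof. by apply: HH_ext => i; rewrite ?HH1B ?HH2B !ffunE scalerBr. Qed.

End multiplication_by_vectors.

Section noise_operator.
Context {R : realType} {lo hi : R3 R} (Th : simplicial_mesh lo hi).
Local Notation Hh := (Hh Th).
Local Notation HH := (HH lo hi).
Local Notation L2D := (L2 (muD lo hi)).
Local Notation emb := (@embH R lo hi Th).
Local Notation pih := (@pih R lo hi Th).

Lemma bounded_embH (u : Hh) : bounded_HH (emb u).
Proof.
have key (p : broken Th) : bounded_L2 (toL2 (muD lo hi) (broken_fun p)).
  have [C hC] := tame_bounded (tame_broken p); exists C.
  by apply: filterS2 (toL2K (tame_Lfun2 (tame_broken p))) hC => x /(_ I) ->.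
by move=> i; rewrite !ffunE; split; exact: key.
Qed.

Definition noise_op (a : L2D) (u : Hh) : Hh := pih (mulH (Jop (emb u)) a).

Let bJ u := bounded_Jop (bounded_embH u).

Lemma linear_noise_op a : linear (noise_op a).
Proof.
move=> c u v; rewrite /noise_op -pihL; congr pih; rewrite embHL JopL.
exact: (mulHL c a (bJ u) (bJ v)).
Qed.

Lemma noise_opB a a' u : noise_op (a - a') u = noise_op a u - noise_op a' u.
Proof. by rewrite /noise_op -pihB; congr pih; exact: mulHB. Qed.

Lemma noise_op_skew a u : ipH (emb (noise_op a u)) (emb u) = 0.
Proof. by rewrite pihP; exact: mulH_Jop_skew (bounded_embH u). Qed.

Lemma noise_op_bounded u : exists2 C, 0 <= C &
  forall a, normH (emb (noise_op a u)) <= C * normL2 a.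
Proof.
have [C C0 hC] := mulH_bounded (bJ u); exists C => // a.
exact: le_trans (normH_pih _ _) (hC a).
Qed.

End noise_operator.

Section scheme_map.
Context {R : realType} {lo hi : R3 R} (Th : simplicial_mesh lo hi) (ori : rel (elt Th)).
Variables (sigma0 lam1 dt : R) (lam2 : R3 R).
Hypotheses (oriP : orientation ori) (dt0 : 0 < dt).
Local Notation Hh := (Hh Th).
Local Notation HH := (HH lo hi).
Local Notation L2D := (L2 (muD lo hi)).
Local Notation emb := (@embH R lo hi Th).
Local Notation pih := (@pih R lo hi Th).
Local Notation r := (expR (- sigma0 * dt)).
Let ipE (u v : Hh) := ipH (emb u) (emb v).
Let g_op (g : L2D) : Hh := pih (tildeH lam2 g).

Definition step : L2D -> L2D -> Hh -> Hh :=
  implicit_step (dt / 2) (lam1 / 2) r (Mh ori) (@noise_op R lo hi Th) g_op.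

Let ipEP := ip_embP Th.
Let ipE_def := @ip_emb_eq0 _ _ _ Th.
Let surj := @Hh_surjective _ _ _ Th.
Let t0 : 0 <= dt / 2. Proof. by rewrite divr_ge0 // ltW. Qed.
Let r0 : 0 <= r. Proof. exact: expR_ge0. Qed.
Let linM : linear (Mh ori). Proof. by move=> c u v; exact: MhL. Qed.
Let linB a : linear (@noise_op R lo hi Th a). Proof. exact: linear_noise_op. Qed.
Let disM u : ipE (Mh ori u) u <= 0. Proof. exact: Mh_dissipative. Qed.
Let skewB a u : ipE (noise_op a u) u = 0. Proof. exact: noise_op_skew. Qed.
Let g_opB g g' : g_op (g - g') = g_op g - g_op g'.
Proof. by rewrite /g_op tildeHB pihB. Qed.
Let g_op_bounded g : Num.sqrt (ipE (g_op g) (g_op g)) <= tilde_bound lam2 * normL2 g.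
Proof. exact: le_trans (normH_pih _ _) (normH_tildeH _ _). Qed.

(** The step is extended to all of [HH] by projecting first: transition functions, laws and
    Wasserstein distances live there, while the equation is solved in the finite-dimensional
    space. *)
Definition scheme_map (a g : L2D) (x : HH) : HH := emb (step a g (pih x)).

Lemma scheme_map_contraction a g x y :
  normH (scheme_map a g x - scheme_map a g y) <= r * normH (x - y).
Proof.
rewrite /scheme_map -embHB.
apply: le_trans (implicit_step_contraction (lam1 / 2) ipEP ipE_def (normL2P _) surj t0 r0 linM linB disM
  skewB (@noise_opB _ _ _ Th) (@noise_op_bounded _ _ _ Th) g_opB g_op_bounded a g (pih x) (pih y)) _.
by apply: ler_wpM2l => //; rewrite -pihB; exact: normH_pih.
Qed.

Lemma scheme_map_continuous a' g' y : exists2 C, 0 <= C & forall a g x,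
  normH (scheme_map a g x - scheme_map a' g' y) <=
  r * normH (x - y) + C * normL2 (a - a') + tilde_bound lam2 * normL2 (g - g').
Proof.
have [C C0 hC] := implicit_step_continuous (lam1 / 2) ipEP ipE_def surj t0 r0 linM linB disM
  skewB (@noise_opB _ _ _ Th) (@noise_op_bounded _ _ _ Th) g_opB g_op_bounded a' g' (pih y).
exists C => // a g x; rewrite /scheme_map -embHB; apply: le_trans (hC a g (pih x)) _.
apply: lerD => //; apply: lerD => //.
by apply: ler_wpM2l => //; rewrite -pihB; exact: normH_pih.
Qed.

Lemma scheme_map_growth a g x :
  normH (scheme_map a g x) <= r * normH x + tilde_bound lam2 * normL2 g.
Proof.
apply: le_trans (implicit_step_growth (lam1 / 2) ipEP ipE_def surj t0 r0 linM linB disM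
  skewB g_op_bounded a g (pih x)) _.
by apply: lerD => //; apply: ler_wpM2l => //; exact: normH_pih.
Qed.

Section solution.
Context {d : measure_display} {Omega : measurableType d} (dW1 dW2 : nat -> Omega -> L2D).
Local Notation scheme x := (dG_scheme ori sigma0 lam1 lam2 dt dW1 dW2 (fun=> x)).
Local Notation sol x := (dG_solution ori sigma0 lam1 lam2 dt dW1 dW2 (fun=> x)).

Lemma dG_schemeE x (u : nat -> Omega -> Hh) : scheme x u <-> (forall w, u 0%N w = pih x) /\
  forall n w, step_eq (dt / 2) (lam1 / 2) r (Mh ori) (@noise_op R lo hi Th) g_op
    (dW1 n w) (dW2 n w) (u n w) (u n.+1 w).
Proof.
have e v w : Mh ori (v + r *: w) = Mh ori v + r *: Mh ori w by rewrite addrC MhL addrC.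
split=> -[u0 uS]; split; [exact: u0| |exact: u0|] => n w.
  by rewrite /step_eq /step_op e; exact: uS.
by have := uS n w; rewrite /step_eq /step_op e; exact.
Qed.

Lemma dG_solutionP x : scheme x (sol x).
Proof.
apply: (@xgetPex _ (fun _ _ => 0) (scheme x)).
pose u := fix u n w := if n is m.+1 then step (dW1 m w) (dW2 m w) (u m w) else pih x.
exists u; apply/dG_schemeE; split=> [//|n w].
exact: (implicit_stepP (lam1 / 2) r g_op ipEP ipE_def surj t0 linM linB disM skewB).
Qed.

Lemma dG_solution0 x w : emb (sol x 0%N w) = emb (pih x).
Proof. by case: (dG_solutionP x) => ->. Qed.

(** Pathwise uniqueness of the implicit step turns the solution, which is only chosen to satisfy the
    scheme, into an iteration of explicit maps. *)
Lemma dG_solutionS x n w :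
  emb (sol x n.+1 w) = scheme_map (dW1 n w) (dW2 n w) (emb (sol x n w)).
Proof.
rewrite /scheme_map pih_embH; congr emb.
apply: (step_eq_unique ipEP ipE_def (normL2P _) surj t0 r0 linM linB disM
  skewB (@noise_opB _ _ _ Th) (@noise_op_bounded _ _ _ Th) g_opB g_op_bounded).
by have /dG_schemeE[_] := dG_solutionP x; exact.
Qed.

End solution.

Lemma scheme_map_pih a g x : scheme_map a g (emb (pih x)) = scheme_map a g x.
Proof. by rewrite /scheme_map pih_embH. Qed.

End scheme_map.

(** * Consequences of contraction for a stationary law *)

Section square_integrals.
Context {d : measure_display} {T : measurableType d} {R : realType}.
Variable mu : {measure set T -> \bar R}.
Local Notation mR := (measurableTypeR R).

Lemma sqr_integral_le (f g h : T -> R) :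
  measurable_fun [set: T] (f : T -> mR) -> measurable_fun [set: T] (g : T -> mR) ->
  measurable_fun [set: T] (h : T -> mR) -> (forall x, `|f x| <= `|g x| + `|h x|) ->
  (\int[mu]_x (f x ^+ 2)%:E <=
   2%:E * (\int[mu]_x (g x ^+ 2)%:E) + 2%:E * (\int[mu]_x (h x ^+ 2)%:E))%E.
Proof.
move=> mf mg mh fgh.
have m2 (k : T -> R) : measurable_fun [set: T] (k : T -> mR) ->
    measurable_fun [set: T] (fun x => (k x ^+ 2)%:E).
  by move=> mk; apply/measurable_EFinP; exact: measurable_funX.
have p2 (k : T -> R) x : setT x -> (0%:E <= (k x ^+ 2)%:E)%E by rewrite lee_fin sqr_ge0.
rewrite -!ge0_integralZl_EFin //; try exact: m2; try exact: p2.
rewrite -ge0_integralD //; last 4 first.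
- by move=> x _; rewrite -EFinM lee_fin mulr_ge0 // sqr_ge0.
- by apply: measurable_funeM; exact: m2.
- by move=> x _; rewrite -EFinM lee_fin mulr_ge0 // sqr_ge0.
- by apply: measurable_funeM; exact: m2.
apply: ge0_le_integral => //; try exact: m2; try exact: p2.
  by apply: emeasurable_funD; apply: measurable_funeM; exact: m2.
move=> x _; rewrite -!EFinM -EFinD lee_fin -(real_normK (num_real (f x))).
apply: (@le_trans _ _ ((`|g x| + `|h x|) ^+ 2)).
  by rewrite ler_pXn2r ?nnegrE ?addr_ge0.
rewrite -(real_normK (num_real (g x))) -(real_normK (num_real (h x))).
by have := sqr_ge0 (`|g x| - `|h x|); nra.
Qed.

End square_integrals.

(** * Density of bounded Lipschitz functions in L^2 of a law *)

Section lipschitz_density.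
Context {R : realType} {lo hi : R3 R}.
Local Notation V := (HH lo hi).
Local Notation nrm := (@normH R lo hi).
Local Notation mR := (measurableTypeR R).
Local Notation B := (borelH lo hi).
Variable pi : probability B R.

Definition lipschitz_bounded (psi : V -> R) : Prop :=
  (exists C, forall x, `|psi x| <= C) /\ (exists L, lipschitz_norm L psi).

Definition approximable (phi : B -> R) : Prop := forall e, 0 < e ->
  exists2 psi, lipschitz_bounded psi & (\int[pi]_x ((phi x - psi x) ^+ 2)%:E < e%:E)%E.

Lemma measurable_lipschitz_bounded psi : lipschitz_bounded psi ->
  measurable_fun [set: B] (psi : B -> mR).
Proof. by move=> [_ [L]]; exact: measurable_lipschitz. Qed.

Lemma approximable_le (phi : B -> R) :
  measurable_fun [set: B] (phi : B -> mR) ->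
  (forall e, 0 < e -> exists psi (g' h' : B -> R),
    [/\ lipschitz_bounded psi, measurable_fun [set: B] (g' : B -> mR),
        measurable_fun [set: B] (h' : B -> mR), (forall x, `|phi x - psi x| <= `|g' x| + `|h' x|) &
        (\int[pi]_x (g' x ^+ 2)%:E < e%:E)%E /\ (\int[pi]_x (h' x ^+ 2)%:E < e%:E)%E]) ->
  approximable phi.
Proof.
move=> mphi H e e0; have e4 : 0 < e / 4 by rewrite divr_gt0.
have [psi [g' [h' [psiL mg' mh' le [ig ih]]]]] := H _ e4; exists psi => //.
apply: le_lt_trans (sqr_integral_le pi _ mg' mh' le) _.
  by apply: measurable_funB => //; exact: measurable_lipschitz_bounded.
have -> : e%:E = (2%:E * (e / 4)%:E + 2%:E * (e / 4)%:E)%E.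
  by rewrite -!EFinM -EFinD; congr EFin; field.
by apply: lteD; rewrite lte_pmul2l.
Qed.

Lemma lipschitz_bounded_cst c : lipschitz_bounded (fun=> c).
Proof.
by split; [exists (`|c|) | exists 0 => x y; rewrite subrr normr0 mul0r].
Qed.

Lemma lipschitz_boundedD f g : lipschitz_bounded f -> lipschitz_bounded g ->
  lipschitz_bounded (fun x => f x + g x).
Proof.
move=> [[C hC] [L hL]] [[C' hC'] [L' hL']]; split.
  by exists (C + C') => x; apply: le_trans (ler_normD _ _) (lerD (hC x) (hC' x)).
exists (L + L') => x y; rewrite opprD addrACA mulrDl.
exact: le_trans (ler_normD _ _) (lerD (hL x y) (hL' x y)).
Qed.

Lemma lipschitz_boundedZ c f : lipschitz_bounded f -> lipschitz_bounded (fun x => c * f x).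
Proof.
move=> [[C hC] [L hL]]; split.
  by exists (`|c| * C) => x; rewrite normrM ler_wpM2l.
by exists (`|c| * L) => x y; rewrite -mulrBr normrM -mulrA ler_wpM2l.
Qed.

Lemma max_dist_le (a b a' b' : R) :
  `|Num.max a b - Num.max a' b'| <= `|a - a'| + `|b - b'|.
Proof.
have h1 := ler_norm (a - a'); have h2 := ler_norm (a' - a).
have h3 := ler_norm (b - b'); have h4 := ler_norm (b' - b).
rewrite [`|a' - a|]distrC in h2; rewrite [`|b' - b|]distrC in h4.
have p1 := normr_ge0 (a - a'); have p2 := normr_ge0 (b - b').
by apply: ler_dist_le; rewrite /Num.max; case: ifPn; case: ifPn; rewrite -?leNgt => ? ?; lra.
Qed.

Lemma lipschitz_bounded_max f g : lipschitz_bounded f -> lipschitz_bounded g ->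
  lipschitz_bounded (fun x => Num.max (f x) (g x)).
Proof.
move=> [[C hC] [L hL]] [[C' hC'] [L' hL']]; split.
  exists (C + C') => x; have := max_dist_le (f x) (g x) 0 0.
  rewrite maxxx !subr0 => /le_trans; apply; exact: lerD.
exists (L + L') => x y; rewrite mulrDl.
exact: le_trans (max_dist_le _ _ _ _) (lerD (hL x y) (hL' x y)).
Qed.

(** Instantiated with addition, and with the maximum to obtain indicators of unions. *)
Lemma approximable_comb (op : R -> R -> R) (f g : B -> R) :
  (forall a b a' b', `|op a b - op a' b'| <= `|a - a'| + `|b - b'|) ->
  (forall h k, lipschitz_bounded h -> lipschitz_bounded k ->
     lipschitz_bounded (fun x => op (h x) (k x))) ->
  measurable_fun [set: B] (f : B -> mR) -> measurable_fun [set: B] (g : B -> mR) ->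
  measurable_fun [set: B] (fun x => op (f x) (g x) : mR) ->
  approximable f -> approximable g -> approximable (fun x => op (f x) (g x)).
Proof.
move=> opL lipop mf mg mop af ag; apply: approximable_le => // e e0.
have [h hL hf] := af _ e0; have [k kL kg] := ag _ e0.
exists (fun x => op (h x) (k x)), (fun x => f x - h x), (fun x => g x - k x).
split=> //; first exact: lipop.
- by apply: measurable_funB => //; exact: measurable_lipschitz_bounded.
- by apply: measurable_funB => //; exact: measurable_lipschitz_bounded.
Qed.

Lemma approximableD (f g : B -> R) :
  measurable_fun [set: B] (f : B -> mR) -> measurable_fun [set: B] (g : B -> mR) ->
  approximable f -> approximable g -> approximable (fun x => f x + g x).
Proof.
move=> mf mg; apply: approximable_comb => //.
- by move=> a b a' b'; rewrite opprD addrACA ler_normD.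
- by move=> h k; exact: lipschitz_boundedD.
- exact: measurable_funD.
Qed.

Lemma approximableZ c (f : B -> R) : measurable_fun [set: B] (f : B -> mR) ->
  approximable f -> approximable (fun x => c * f x).
Proof.
move=> mf af e e0; have c1 : 0 < c ^+ 2 + 1 by rewrite ltr_wpDl ?sqr_ge0.
have [psi psiL hpsi] := af (e / (c ^+ 2 + 1)) (divr_gt0 e0 c1).
exists (fun x => c * psi x); first exact: lipschitz_boundedZ.
under eq_integral do rewrite -mulrBr exprMn EFinM.
have m2 : measurable_fun [set: B] (fun x => ((f x - psi x) ^+ 2)%:E).
  apply/measurable_EFinP; apply: measurable_funX; apply: measurable_funB => //.
  exact: measurable_lipschitz_bounded.
rewrite ge0_integralZl_EFin // ?sqr_ge0 //; last by move=> x _; rewrite lee_fin sqr_ge0.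
have i0 : (0 <= \int[pi]_x ((f x - psi x) ^+ 2)%:E)%E.
  by apply: integral_ge0 => x _; rewrite lee_fin sqr_ge0.
move: i0 hpsi; case: (\int[pi]_x _)%E => [i| |] //; rewrite !lee_fin !lte_fin => i0.
rewrite ltr_pdivlMr // mulrDr mulr1 [i * _]mulrC; apply: le_lt_trans.
by rewrite lerDl.
Qed.

Lemma approximable_lim (f : B -> R) (f_ : nat -> B -> R) :
  measurable_fun [set: B] (f : B -> mR) ->
  (forall n, measurable_fun [set: B] (f_ n : B -> mR)) -> (forall n, approximable (f_ n)) ->
  (fun n => \int[pi]_x ((f x - f_ n x) ^+ 2)%:E)%E @ \oo --> 0%E -> approximable f.
Proof.
move=> mf mf_ af_ lim; apply: approximable_le => // e e0.
have [N _ hN] : \forall n \near \oo, (\int[pi]_x ((f x - f_ n x) ^+ 2)%:E < e%:E)%E.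
  apply: (lim [set y | (y < e%:E)%E]); apply: open_nbhs_nbhs; split; last by rewrite /= lte_fin.
  exact: open_ereal_lt_ereal.
have [psi psiL hpsi] := af_ N _ e0.
exists psi, (fun x => f x - f_ N x), (fun x => f_ N x - psi x); split=> //.
- by apply: measurable_funB; [exact: mf|exact: mf_].
- by apply: measurable_funB; [exact: mf_|exact: measurable_lipschitz_bounded].
- by move=> x; rewrite -(subrKA (f_ N x)) ler_normD.
- by split=> //; exact: hN (leqnn N).
Qed.

(** Indicators of open sets are limits of Lipschitz functions. The measurable sets with approximable
    indicator are stable under complements, under finite unions through the maximum, and then under
    countable unions by dominated convergence; so all Borel sets are among them. *)
Lemma approximable_indic (A : set B) : measurable A -> approximable \1_A.
Proof.
pose G : set (set B) := [set A | measurable A /\ approximable \1_A].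
suff : <<s norm_open nrm >> `<=` G by move=> h mA; have [] := h A mA.
have mi (C : set B) : measurable C -> measurable_fun [set: B] (\1_C : B -> mR).
  by move=> mC; exact/measurable_indicP.
have finite_int : pi.-integrable setT (EFin \o cst 1%R).
  exact: finite_measure_integrable_cst.
have GU C D : G C -> G D -> G (C `|` D).
  move=> [mC aC] [mD aD]; split; first exact: measurableU.
  have -> : \1_(C `|` D) = (fun x : B => Num.max (\1_C x) (\1_D x) : R).
    apply/funext => x; rewrite !indicE in_setU.
    by case: (x \in C); case: (x \in D); rewrite /= /Num.max ?ltxx ?ltr01 ?ltr10.
  apply: approximable_comb => //; [exact: max_dist_le|by move=> h k; exact: lipschitz_bounded_max|].
  by apply: measurable_maxr; exact: mi.
apply: smallest_sub; last first.
  move=> U Uo; split; first exact: norm_open_measurable.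
  have [->|UT] := pselect (U = setT).
    move=> e e0; exists (fun=> 1); first exact: lipschitz_bounded_cst.
    rewrite (eq_integral (cst 0%E)); first by rewrite integral0 lte_fin.
    by move=> x _; rewrite indicE in_setT subrr expr0n.
  have [y0 Uy0] : exists y, ~ U y.
    by apply: contra_notP UT => /forallNP k; apply/seteqP; split=> // x _; apply: contrapT.
  have [psiL psi01 psicvg] := open_indicator_approx Uo Uy0.
  apply: (approximable_lim (f_ := fun n x => Num.min 1 (n%:R * dist_compl U x))).
  - by apply: mi; exact: norm_open_measurable.
  - by move=> n; exact: measurable_lipschitz (psiL n).
  - move=> n e e0; exists (fun x => Num.min 1 (n%:R * dist_compl U x)).
      split; last by exists n%:R; exact: psiL.
      by exists 1 => x; rewrite ger0_norm; have /andP[] := psi01 n x.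
    rewrite (eq_integral (cst 0%E)); first by rewrite integral0 lte_fin.
    by move=> x _; rewrite subrr expr0n.
  rewrite -[X in _ --> X](integral0 pi setT).
  apply: (dominated_cvg_EFin (g := cst 1) (f := cst 0)) => //.
  - move=> n; apply: measurable_funX; apply: measurable_funB.
      by apply: mi; exact: norm_open_measurable.
    exact: measurable_lipschitz (psiL n).
  - apply: nearW => x; have h : (fun n => \1_U x - Num.min 1 (n%:R * dist_compl U x)) @ \oo --> (0 : R).
      rewrite -(subrr (\1_U x)); apply: cvgB; [exact: cvg_cst|exact: psicvg].
    by rewrite -[X in _ --> X](mulr0 0); exact: (cvgM h h).
  - move=> n x /=; rewrite ger0_norm ?sqr_ge0 // -real_normK ?num_real // expr_le1 ?normr_ge0 // indicE.
    exact: indicator_dist_le1.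
split.
- split; first exact: measurable0.
  move=> e e0; exists (fun=> 0); first exact: lipschitz_bounded_cst.
  rewrite (eq_integral (cst 0%E)); first by rewrite integral0 lte_fin.
  by move=> x _; rewrite indicE in_set0 subrr expr0n.
- move=> C [mC aC]; rewrite setTD; split; first exact: measurableC.
  have -> : \1_(~` C) = (fun x : B => 1 + (-1) * \1_C x : R).
    by apply/funext => x; rewrite !indicE in_setC; case: (x \in C) => /=; ring.
  apply: approximableD => //; first by apply: measurable_funM => //; exact: mi.
    by move=> e e0; exists (fun=> 1); [exact: lipschitz_bounded_cst|
      rewrite (eq_integral (cst 0%E)) ?integral0 ?lte_fin // => x _; rewrite subrr expr0n].
  by apply: approximableZ => //; exact: mi.
- suff cup (F : nat -> set B) : (forall k, G (F k)) -> G (\bigcup_k F k) by move=> F; exact: cup.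
  move=> GF; have mF k : measurable (F k) by have [] := GF k.
  split; first exact: bigcup_measurable.
  pose U n := \big[setU/set0]_(i < n) F i.
  have GUn n : G (U n).
    rewrite /U; elim: n => [|n IH]; last by rewrite big_ord_recr; exact: GU.
    rewrite big_ord0; split; first exact: measurable0.
    move=> e e0; exists (fun=> 0); first exact: lipschitz_bounded_cst.
    rewrite (eq_integral (cst 0%E)); first by rewrite integral0 lte_fin.
    by move=> x _; rewrite indicE in_set0 subrr expr0n.
  apply: (approximable_lim (f_ := fun n => \1_(U n))).
  - by apply: mi; exact: bigcup_measurable.
  - by move=> n; apply: mi; have [] := GUn n.
  - by move=> n; have [] := GUn n.
  rewrite -[X in _ --> X](integral0 pi setT).
  apply: (dominated_cvg_EFin (g := cst 1) (f := cst 0)) => //.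
  - move=> n; apply: measurable_funX; apply: measurable_funB; apply: mi; first exact: bigcup_measurable.
    by have [] := GUn n.
  - apply: nearW => x; have [[k _ Fk]|nF] := pselect ((\bigcup_k F k) x).
      apply: cvg_near_cst; exists k.+1 => // n /= kn.
      rewrite !indicE !mem_set ?subrr ?expr0n //; last by exists k.
      by rewrite /U -bigcup_mkord; exists k.
    apply: cvg_near_cst; apply: nearW => n; rewrite !indicE !memNset ?subrr ?expr0n //.
    by rewrite /U -bigcup_mkord => -[k _ Fk]; apply: nF; exists k.
  - move=> n x /=; rewrite ger0_norm ?sqr_ge0 // -real_normK ?num_real // expr_le1 ?normr_ge0 // !indicE.
Qed.

(** The positive and negative parts are approximated separately, each from below by simple
    functions; its own square dominates the squared errors. *)
Lemma approximable_square_integrable (phi : B -> R) :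
  measurable_fun [set: B] (phi : B -> mR) ->
  (\int[pi]_x (phi x ^+ 2)%:E < +oo)%E -> approximable phi.
Proof.
wlog p0 : phi / forall x, 0 <= phi x => [hw|] mphi i2.
  have -> : phi = (fun x => Num.max (phi x) 0 + (-1) * Num.max (- phi x) 0).
    apply/funext => x; rewrite /Num.max oppr_lt0.
    by case: ltgtP => // h; rewrite ?h; ring.
  have part (f : B -> R) : measurable_fun [set: B] (f : B -> mR) -> (forall x, `|f x| = `|phi x|) ->
      approximable (fun x => Num.max (f x) 0).
    move=> mf fphi; apply: hw => [x||].
    - by rewrite le_max lexx orbT.
    - exact: measurable_maxr.
    apply: le_lt_trans i2; apply: ge0_le_integral => //.
    - by move=> x _; rewrite lee_fin sqr_ge0.
    - by apply/measurable_EFinP; apply: measurable_funX; exact: measurable_maxr.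
    - by apply/measurable_EFinP; exact: measurable_funX.
    move=> x _; rewrite lee_fin -(real_normK (num_real (phi x))) -fphi real_normK ?num_real //.
    by rewrite /Num.max; case: ifPn => // _; rewrite expr0n sqr_ge0.
  apply: approximableD; [exact: measurable_maxr| |exact: part|].
    by apply: measurable_funM => //; apply: measurable_maxr => //; exact: measurable_funN.
  apply: approximableZ; first by apply: measurable_maxr => //; exact: measurable_funN.
  by apply: part => [|x]; [exact: measurable_funN|rewrite normrN].
have mE : measurable_fun [set: B] (EFin \o phi) by exact/measurable_EFinP.
pose f_ n (x : B) : R := nnsfun_approx measurableT mE n x.
have f_cvg x : f_ ^~ x @ \oo --> phi x.
  have := @cvg_nnsfun_approx _ _ _ setT measurableT _ mE (fun x _ => p0 x) x I.
  by move=> /fine_cvg.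
have f_le n x : 0 <= f_ n x <= phi x.
  rewrite fun_ge0 /= -(cvg_lim _ (f_cvg x)) //.
  apply: nondecreasing_cvgn_le; last by apply/cvg_ex; exists (phi x).
  by move=> m k mk; have /lefP := nd_nnsfun_approx measurableT mE mk; apply.
apply: (approximable_lim (f_ := f_)) => //.
- by move=> n; exact: (@measurable_funPT _ _ _ _ (nnsfun_approx measurableT mE n)).
- move=> n; have [r fE] : exists r : seq R, f_ n = fun x => \sum_(y <- r) y * \1_(f_ n @^-1` [set y]) x.
    eexists; apply/funext => x; rewrite {1}/f_ fimfunE fsbig_finite //=; reflexivity.
  have mpre y : measurable (f_ n @^-1` [set y] : set B).
    rewrite -[X in measurable X]setTI.
    exact: (@measurable_funPT _ _ _ _ (nnsfun_approx measurableT mE n)).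
  have mi y : measurable_fun [set: B] (fun x => y * \1_(f_ n @^-1` [set y]) x : mR).
    by apply: measurable_funM => //; exact/measurable_indicP.
  rewrite fE; elim: r {fE} => [|y r IH].
    under eq_fun do rewrite big_nil.
    move=> e e0; exists (fun=> 0); first exact: lipschitz_bounded_cst.
    rewrite (eq_integral (cst 0%E)); first by rewrite integral0 lte_fin.
    by move=> x _; rewrite subrr expr0n.
  under eq_fun do rewrite big_cons; apply: approximableD => //.
    by apply: measurable_sum => z; exact: mi.
  by apply: approximableZ; [exact/measurable_indicP|exact: approximable_indic].
- rewrite -[X in _ --> X](integral0 pi setT).
  apply: (dominated_cvg_EFin (g := fun x => phi x ^+ 2) (f := cst 0)) => //.
  + by move=> n; apply: measurable_funX; apply: measurable_funB.
  + apply: nearW => x; have h : (fun n => phi x - f_ n x) @ \oo --> (0 : R).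
      rewrite -(subrr (phi x)); apply: cvgB; [exact: cvg_cst|exact: f_cvg].
    by rewrite -[X in _ --> X](mulr0 0); exact: (cvgM h h).
  + apply/integrableP; split; first by apply/measurable_EFinP; exact: measurable_funX.
    by under eq_integral do rewrite gee0_abs ?lee_fin ?sqr_ge0 //.
  + move=> n x; rewrite ger0_norm ?sqr_ge0 //; have /andP[h1 h2] := f_le n x.
    by rewrite ler_pXn2r ?nnegrE ?subr_ge0 ?p0 // gerBl.
Qed.

End lipschitz_density.

Section probability_integrals.
Context {d : measure_display} {T : measurableType d} {R : realType}.
Variable P : probability T R.
Local Notation mR := (measurableTypeR R).

Lemma bounded_integrable (f : T -> R) C : measurable_fun [set: T] (f : T -> mR) ->
  (forall x, `|f x| <= C) -> P.-integrable setT (EFin \o f).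
Proof.
move=> mf fC; apply: (le_integrable measurableT _ _ (finite_measure_integrable_cst P C measurableT)).
- exact/measurable_EFinP.
- by move=> x _ /=; rewrite lee_fin; apply: le_trans (fC x) (ler_norm _).
Qed.

Lemma Rintegral_cst1 (c : R) : (\int[P]_x c = c)%R.
Proof.
rewrite Rintegral_cst //; transitivity (c * fine (1%E : \bar R)); last by rewrite mulr1.
by congr (_ * fine _); exact: probability_setT.
Qed.

Lemma EFin_Rintegral (f : T -> R) : P.-integrable setT (EFin \o f) ->
  ((\int[P]_x f x)%R%:E = \int[P]_x (f x)%:E)%E.
Proof. by move=> fi; rewrite /Rintegral fineK //; exact: integrable_fin_num. Qed.

Lemma integral_cst1 (c : R) : (\int[P]_x c%:E = c%:E)%E.
Proof. by rewrite -EFin_Rintegral ?Rintegral_cst1 //; exact: finite_measure_integrable_cst. Qed.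

Lemma Rintegral_dist_le (f g h : T -> R) : P.-integrable setT (EFin \o f) ->
  P.-integrable setT (EFin \o g) -> P.-integrable setT (EFin \o h) ->
  (forall x, `|f x - g x| <= h x) ->
  `|(\int[P]_x f x)%R - (\int[P]_x g x)%R| <= (\int[P]_x h x)%R.
Proof.
move=> fi gi hi fgh; rewrite -RintegralB //.
have fgi := integrableB_EFin measurableT fi gi.
apply: le_trans (le_normr_Rintegral measurableT fgi) _.
apply: le_Rintegral => //.
by have := integrable_norm fgi; apply: eq_integrable => // x _.
Qed.

Lemma Rintegral_dist_cst (f g : T -> R) c : P.-integrable setT (EFin \o f) ->
  P.-integrable setT (EFin \o g) -> (forall x, `|f x - g x| <= c) ->
  `|(\int[P]_x f x)%R - (\int[P]_x g x)%R| <= c.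
Proof.
move=> fi gi fgc; apply: le_trans (Rintegral_dist_le fi gi _ fgc) _.
  exact: finite_measure_integrable_cst.
by rewrite Rintegral_cst1.
Qed.

Lemma square_integrable (g : T -> R) : measurable_fun [set: T] (g : T -> mR) ->
  (\int[P]_x (g x ^+ 2)%:E < +oo)%E -> P.-integrable setT (EFin \o g).
Proof.
move=> mg g2; have gL := Lfun2P mg g2.
have := integrable_mul2 gL (Lfun_cst P 1 2).
by apply: eq_integrable => // x _ /=; rewrite mulr1.
Qed.

Lemma jensen_sqr (g : T -> R) : measurable_fun [set: T] (g : T -> mR) ->
  (((\int[P]_x g x)%R ^+ 2)%:E <= \int[P]_x (g x ^+ 2)%:E)%E.
Proof.
move=> mg; have [g2|] := ltP (\int[P]_x (g x ^+ 2)%:E)%E +oo%E; last first.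
  by move=> h; apply: le_trans h; rewrite leey.
have gL := Lfun2P mg g2; have oL := Lfun_cst P 1 2.
have := cauchy_schwarz (ipL2P P) (toL2 P g) (toL2 P (cst 1)).
rewrite !ipL2_toL2 //.
rewrite (_ : (\int[P]_x (g x * cst 1 x))%R = (\int[P]_x g x)%R); last first.
  by apply: eq_Rintegral => x _; rewrite mulr1.
rewrite (_ : (\int[P]_x (cst 1 x * cst 1 x))%R = 1); last first.
  by rewrite -[RHS](Rintegral_cst1 1); apply: eq_Rintegral => x _; rewrite mulr1.
rewrite sqrtr1 mulr1 => h.
have -> : (\int[P]_x (g x ^+ 2)%:E = (\int[P]_x (g x * g x))%R%:E)%E.
  rewrite EFin_Rintegral; last exact: integrable_mul2.
  by apply: eq_integral => x _; rewrite expr2.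
have i0 : 0 <= (\int[P]_x (g x * g x))%R by apply: Rintegral_ge0 => x _; rewrite -expr2 sqr_ge0.
rewrite lee_fin -real_normK ?num_real // -[leRHS]sqr_sqrtr //.
by rewrite ler_pXn2r ?nnegrE ?sqrtr_ge0.
Qed.

End probability_integrals.

Definition to_probability d (T : measurableType d) (R : realType)
  (m : {measure set T -> \bar R}) (m1 : m setT = 1%E) : set T -> \bar R := m.
HB.instance Definition _ d (T : measurableType d) (R : realType)
  (m : {measure set T -> \bar R}) (m1 : m setT = 1%E) := Measure.copy (to_probability m1) m.
HB.instance Definition _ d (T : measurableType d) (R : realType)
  (m : {measure set T -> \bar R}) (m1 : m setT = 1%E) :=
  Measure_isProbability.Build d T R (to_probability m1) m1.

(** Jensen's inequality for the uniform average: expanding around the mean m, the cross term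
    vanishes and a nonnegative variance is left over. *)
Lemma sqr_mean_le (R : realType) N (a : nat -> R) c :
  (N.+1%:R^-1 * \sum_(n < N.+1) a n - c) ^+ 2 <= N.+1%:R^-1 * \sum_(n < N.+1) (a n - c) ^+ 2.
Proof.
have N0 : 0 < N.+1%:R :> R by [].
set m := _ * _; have mE : \sum_(n < N.+1) (a n - m) = 0.
  rewrite sumrB sumr_const card_ord -[X in _ - X]mulr_natl /m mulrA divff ?mul1r ?subrr //.
have -> : \sum_(n < N.+1) (a n - c) ^+ 2
    = \sum_(n < N.+1) (a n - m) ^+ 2 + N.+1%:R * (m - c) ^+ 2.
  transitivity (\sum_(n < N.+1) ((a n - m) ^+ 2 + 2 * (m - c) * (a n - m) + (m - c) ^+ 2)).
    by apply: eq_bigr => n _; ring.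
  by rewrite !big_split /= -mulr_sumr mE mulr0 addr0 sumr_const card_ord mulr_natl.
rewrite mulrDr mulKf ?gt_eqF // lerDr mulr_ge0 ?invr_ge0 //.
by apply: sumr_ge0 => n _; exact: sqr_ge0.
Qed.

(** The constants of [Ph_cvg_L2], where (a + b)^2 <= 2 a^2 + 2 b^2 is applied twice to three errors
    of size e/10. *)
Lemma tenths (R : realType) (e : R) : 0 < e ->
  2 * (e / 10) + 2 * (e / 10) <= 4 * (e / 10) /\ 2 * (e / 10) + 2 * (4 * (e / 10)) <= e.
Proof. by move=> e0; split; lra. Qed.

(** * Uniqueness, mixing, ergodicity and Wasserstein contraction *)

Section ergodic_package.
Context {R : realType} {lo hi : R3 R}.
Context {d : measure_display} {Omega : measurableType d} (P : probability Omega R).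
Local Notation V := (HH lo hi).
Local Notation B := (borelH lo hi).
Local Notation mR := (measurableTypeR R).
Variables (D : nat -> V) (Phi : nat -> Omega -> V -> V) (r : R) (pi : probability B R).
Hypothesis Ddense : forall x e, 0 < e -> exists k, normH (x - D k) < e.
Hypothesis r01 : 0 < r < 1.
Hypothesis mPhi : forall n, measurable_fun [set: Omega * B] (fun z => Phi n z.1 z.2 : B).
Hypothesis Phi_contr : forall n w x y,
  normH (Phi n w x - Phi n w y) <= r ^+ n * normH (x - y).
Hypothesis pi_stationary : forall n L (psi : B -> R), (forall x, 0 <= psi x <= 1) ->
  lipschitz_norm L psi ->
  (\int[pi]_x \int[P]_w (psi (Phi n w x))%:E = \int[pi]_x (psi x)%:E)%E.

Let Ph n (phi : B -> R) (x : V) : R := (\int[P]_w phi (Phi n w x))%R.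

Let mPhi1 n x : measurable_fun [set: Omega] (fun w => Phi n w x : B).
Proof. exact: (measurableT_comp (mPhi n) (measurable_pair2 (x : B))). Qed.

(** The left side is an integral against the law of the n-step map under P x pi. By hypothesis this
    law and pi agree on Lipschitz functions with values in [0, 1], hence on all Borel sets. *)
Lemma ge0_stationary n (g : B -> \bar R) : measurable_fun [set: B] g ->
  (forall x, 0 <= g x)%E ->
  (\int[pi]_x \int[P]_w g (Phi n w x) = \int[pi]_x g x)%E.
Proof.
pose m := push (P \x pi)%E (mPhi n).
have m1 : m setT = 1%E.
  transitivity ((P \x pi)%E (setT `*` setT)); first by rewrite setXTT.
  rewrite product_measure1E // -[RHS]mule1.
  by congr (_ * _)%E; exact: probability_setT.
have swap (f : B -> \bar R) : measurable_fun [set: B] f -> (forall x, 0 <= f x)%E ->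
    (\int[pi]_x \int[P]_w f (Phi n w x) = \int[m]_x f x)%E.
  move=> mf f0; rewrite ge0_integral_push // fubini_tonelli2 //=.
  exact: (measurableT_comp mf (mPhi n)).
move=> mg g0; rewrite swap //; apply: eq_measure_integral => A mA _.
apply: (eq_probability_lipschitz (mu := to_probability m1) (nu := pi)) => // L psi psi01 psiL.
rewrite -(pi_stationary n psi01 psiL); symmetry; apply: (swap (fun x => (psi x)%:E)) => [|x].
  by apply/measurable_EFinP; exact: measurable_lipschitz psiL.
by rewrite lee_fin; have /andP[] := psi01 x.
Qed.

Section bounded_functions.
Variables (phi : B -> R) (C : R).
Hypothesis mphi : measurable_fun [set: B] (phi : B -> mR).
Hypothesis phiC : forall x, `|phi x| <= C.

Let phi_int n x : P.-integrable setT (EFin \o (fun w => phi (Phi n w x))).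
Proof. by apply: (@bounded_integrable _ _ _ P _ C) => //; exact: (measurableT_comp mphi (mPhi1 n x)). Qed.

(** Adding the bound C makes the integrand nonnegative, so that the measurability and invariance
    results for nonnegative functions apply; C is subtracted afterwards. *)
Let Ph_shift n x : (\int[P]_w (phi (Phi n w x) + C)%:E = (Ph n phi x + C)%:E)%E.
Proof.
have ci := finite_measure_integrable_cst P C measurableT.
rewrite -EFin_Rintegral; last exact: (integrableD_EFin measurableT (phi_int n x) ci).
by rewrite RintegralD // Rintegral_cst1.
Qed.

Let phi_shift_ge0 x : 0 <= phi x + C.
Proof. by have := phiC x; rewrite ler_norml => /andP[]; lra. Qed.

Lemma measurable_Ph n : measurable_fun [set: B] (Ph n phi : B -> mR).
Proof.
have mG : measurable_fun [set: B]
    (fubini_G P (fun z : Omega * B => (phi (Phi n z.1 z.2) + C)%:E)).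
  apply: measurable_fun_fubini_tonelli_G => [|z]; last by rewrite lee_fin.
  apply/measurable_EFinP; apply: measurable_funD => //.
  exact: (measurableT_comp mphi (mPhi n)).
have GE : fubini_G P (fun z : Omega * B => (phi (Phi n z.1 z.2) + C)%:E)
    = EFin \o (fun x => Ph n phi x + C).
  by apply/funext => x; exact: Ph_shift.
move: mG; rewrite GE => /measurable_EFinP mC.
have -> : Ph n phi = (fun x => Ph n phi x + C - C) by apply/funext => x; rewrite addrK.
by apply: measurable_funB.
Qed.

Lemma Ph_bounded n x : `|Ph n phi x| <= C.
Proof.
have ci := finite_measure_integrable_cst P 0 measurableT.
have := @Rintegral_dist_cst _ _ _ P _ _ C (phi_int n x) ci.
by rewrite Rintegral_cst1 subr0; apply => w; rewrite subr0.
Qed.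

Lemma bounded_stationary n : (\int[pi]_x Ph n phi x = \int[pi]_x phi x)%R.
Proof.
have := @ge0_stationary n (fun x => (phi x + C)%:E).
rewrite (_ : (fun x => \int[P]_w (phi (Phi n w x) + C)%:E)%E = fun x => (Ph n phi x + C)%:E); last first.
  by apply/funext => x; exact: Ph_shift.
have ci := finite_measure_integrable_cst pi C measurableT.
have i1 := bounded_integrable pi (measurable_Ph n) (Ph_bounded n).
have i2 := bounded_integrable pi mphi phiC.
rewrite -!EFin_Rintegral; [|exact: integrableD_EFin|exact: integrableD_EFin].
rewrite !RintegralD // => h; apply: (addIr (\int[pi]_x cst C x)%R).
apply: EFin_inj; apply: h => [|x]; last by rewrite lee_fin.
by apply/measurable_EFinP; exact: measurable_funD.
Qed.

Lemma Ph_lipschitz n L : lipschitz_norm L phi -> forall x y,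
  `|Ph n phi x - Ph n phi y| <= `|L| * r ^+ n * normH (x - y).
Proof.
move=> phiL x y; apply: (Rintegral_dist_cst (phi_int n x) (phi_int n y)) => w.
apply: le_trans (phiL _ _) _; rewrite -mulrA.
apply: (@le_trans _ _ (`|L| * normH (Phi n w x - Phi n w y))).
  by rewrite ler_wpM2r ?normH_ge0 // ler_norm.
by rewrite ler_wpM2l.
Qed.

End bounded_functions.
Lemma invariant_stationary : invariant_measure Ph pi.
Proof. by move=> n phi mphi [C phiC]; exact: (bounded_stationary mphi phiC). Qed.

Lemma cvg_expr_mul c : (fun n => c * r ^+ n) @ \oo --> (0 : R).
Proof.
rewrite -[0 in X in _ --> X](mulr0 c); apply: cvgM; first exact: cvg_cst.
by apply: cvg_expr0; have /andP[/ltW -> ->] := r01.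
Qed.

Lemma Ph_forget (psi : B -> R) L C : (forall x, `|psi x| <= C) -> lipschitz_norm L psi ->
  forall x, (fun n => Ph n psi x - Ph n psi 0) @ \oo --> (0 : R).
Proof.
move=> psiC psiL x.
apply: (cvg_dist_le (c := fun n => `|L| * normH x * r ^+ n)); last exact: cvg_expr_mul.
move=> n; rewrite subr0 mulrAC -[x in normH x]subr0.
exact: (Ph_lipschitz (measurable_lipschitz psiL) psiC).
Qed.

(** The initial point is forgotten, so [Ph n psi 0] differs from the m-average of [Ph n psi] by a
    vanishing amount, and that average is constant by hypothesis. The law m is left arbitrary: in
    [invariant_unique] any two invariant laws then have as integrals the limit of one and the same
    sequence. *)
Lemma lipschitz_mixing (m : probability B R) (psi : B -> R) L C :
  (forall x, `|psi x| <= C) -> lipschitz_norm L psi ->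
  (forall n, \int[m]_x Ph n psi x = \int[m]_x psi x)%R ->
  (fun n => Ph n psi 0) @ \oo --> (\int[m]_x psi x)%R.
Proof.
move=> psiC psiL inv.
have mpsi := measurable_lipschitz psiL.
have mP n := measurable_Ph mpsi psiC n.
have ci c := finite_measure_integrable_cst m c measurableT.
have iP n := bounded_integrable m (mP n) (Ph_bounded mpsi psiC n).
have h : (fun n => \int[m]_x (Ph n psi x - Ph n psi 0))%R @ \oo --> (\int[m]_x 0)%R.
  apply: (dominated_cvg_Rintegral (g := cst (C + C))) => //.
  - by move=> n; apply: measurable_funB => //; exact: mP.
  - by apply: nearW => x; exact: Ph_forget psiC psiL x.
  - move=> n x /=; apply: le_trans (ler_normB _ _) _.
    by apply: lerD; exact: (Ph_bounded mpsi psiC).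
rewrite Rintegral_cst1 in h.
have -> : (fun n => Ph n psi 0)
    = fun n => (\int[m]_x psi x)%R - (\int[m]_x (Ph n psi x - Ph n psi 0))%R.
  apply/funext => n; have := RintegralB measurableT (iP n) (ci (Ph n psi 0)).
  by rewrite Rintegral_cst1 inv => ->; rewrite opprB addrC subrK.
by rewrite -[X in _ --> X]subr0; apply: cvgB => //; exact: cvg_cst.
Qed.

Lemma invariant_unique (nu : probability B R) : invariant_measure Ph nu ->
  forall A, measurable A -> nu A = pi A.
Proof.
move=> inu; apply: eq_probability_lipschitz => L psi psi01 psiL.
have mpsi := measurable_lipschitz psiL.
have psi1 x : `|psi x| <= 1 by rewrite ger0_norm; have /andP[] := psi01 x.
have ex1 : exists C, forall x, `|psi x| <= C by exists 1.
rewrite -!EFin_Rintegral; [|exact: (bounded_integrable _ mpsi psi1)|exact: (bounded_integrable _ mpsi psi1)].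
congr EFin; apply: (@cvg_unique _ (@Rhausdorff R) ((fun n => Ph n psi 0) @ \oo)).
  by apply: lipschitz_mixing psi1 psiL _ => n; exact: inu.
by apply: lipschitz_mixing psi1 psiL _ => n; exact: invariant_stationary.
Qed.

Lemma sqrt_integrable (m : probability B R) : finite_second_moment m ->
  m.-integrable setT (EFin \o @normH R lo hi).
Proof.
move=> m2; have mn : measurable_fun [set: B] (@normH R lo hi : B -> mR).
  by apply: (@measurable_lipschitz _ _ _ 1) => x y; rewrite mul1r normH_dist.
have mn2 : measurable_fun [set: B] (fun x : B => normH x ^+ 2 + 1 : mR).
  by apply: measurable_funD => //; exact: measurable_funX.
apply: (@le_integrable _ _ _ m setT measurableT _ (EFin \o (fun x => normH x ^+ 2 + 1))).
- exact/measurable_EFinP.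
- move=> x _ /=; rewrite lee_fin !ger0_norm ?normH_ge0 ?addr_ge0 ?sqr_ge0 //.
  by have := sqr_ge0 (normH x - 1); have := normH_ge0 x; move: (normH x) => t; nra.
- apply: integrableD_EFin => //; last exact: finite_measure_integrable_cst.
  apply/integrableP; split; first by apply/measurable_EFinP; exact: measurable_funX.
  by under eq_integral do rewrite gee0_abs ?lee_fin ?sqr_ge0 //.
Qed.

Lemma stationary_mixing rho dt (v : V) : 0 < rho -> r = expR (- rho * dt) ->
  0 < normH v -> finite_second_moment pi -> exponentially_mixing Ph dt pi.
Proof.
move=> rho0 rE v0 pi2; exists rho => //.
have ni := sqrt_integrable pi2.
have m0 : 0 <= (\int[pi]_x normH x)%R by apply: Rintegral_ge0 => x _; exact: normH_ge0.
exists (fun x => normH x + (\int[pi]_x normH x)%R + 1) => [x|phi L [C phiC] phiL n x].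
  by rewrite ltr_wpDl // addr_ge0 // normH_ge0.
have mphi := measurable_lipschitz phiL.
(* The Lipschitz bound at the pair v, 0 has positive distance, which rules out a negative L; a
   nonzero vector is required for this. *)
have L0 : 0 <= L.
  have := le_trans (normr_ge0 _) (phiL v 0); rewrite subr0.
  by rewrite pmulr_lge0.
have -> : expR (- rho * (n%:R * dt)) = r ^+ n.
  by rewrite rE -expRM_natl; congr expR; rewrite mulrCA.
have ci c := finite_measure_integrable_cst pi c measurableT.
(* Invariance rewrites the limit as the pi-average of [Ph n phi y], which is compared with
   [Ph n phi x] by contraction; |x - y| <= |x| + |y| then gives the first two terms of C(x), and the
   added 1 makes C(x) positive. *)
rewrite -(bounded_stationary mphi phiC n) -{1}(Rintegral_cst1 pi (Ph n phi x)).
have bi : pi.-integrable setT (EFin \o (fun y => L * r ^+ n * (normH x + normH y))).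
  exact: (integrableZ_EFin _ measurableT (integrableD_EFin measurableT (ci _) ni)).
apply: le_trans (Rintegral_dist_le (ci _) _ bi _) _.
- exact: bounded_integrable (measurable_Ph mphi phiC n) (Ph_bounded mphi phiC n).
- move=> y; have := Ph_lipschitz mphi phiC n phiL x y; rewrite (ger0_norm L0).
  move=> /le_trans; apply; rewrite ler_wpM2l ?normHB //.
  by rewrite mulr_ge0 // exprn_ge0 //; have /andP[/ltW] := r01.
rewrite RintegralZl //; last exact: (integrableD_EFin measurableT (ci _) ni).
have sumE := RintegralD measurableT (ci (normH x)) ni; rewrite Rintegral_cst1 in sumE.
rewrite sumE -[leRHS]mulrA [leRHS]mulrC ler_wpM2l //.
  by rewrite mulr_ge0 // exprn_ge0 //; have /andP[/ltW] := r01.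
by rewrite lerDl.
Qed.

(** For unbounded phi the integral may fail to exist at some x. The integrals of the positive and
    the negative part are measurable separately, and the real value of their difference is then
    measurable for every x. *)
Lemma measurable_Ph_all n (phi : B -> R) : measurable_fun [set: B] (phi : B -> mR) ->
  measurable_fun [set: B] (Ph n phi : B -> mR).
Proof.
move=> mphi; have mF : measurable_fun [set: Omega * B] (fun z => (phi (Phi n z.1 z.2))%:E).
  by apply/measurable_EFinP; exact: (measurableT_comp mphi (mPhi n)).
have mp := measurable_fun_fubini_tonelli_G _ (measurable_funepos mF) (fun z => funepos_ge0 _ z) (m1 := P).
have mn := measurable_fun_fubini_tonelli_G _ (measurable_funeneg mF) (fun z => funeneg_ge0 _ z) (m1 := P).
have -> : Ph n phi = fine \o (fun x => fubini_G P (fun z : Omega * B => (phi (Phi n z.1 z.2))%:E)^\+%E x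
    - fubini_G P (fun z : Omega * B => (phi (Phi n z.1 z.2))%:E)^\-%E x)%E.
  apply/funext => x; rewrite /Ph /Rintegral /= integralE.
  by congr (fine (_ - _)%E); apply: eq_integral => w _; rewrite ?funeposE ?funenegE.
by apply: measurableT_comp => //; exact: emeasurable_funB.
Qed.

(** If the right side is infinite there is nothing to show. Otherwise phi - psi is square integrable
    along the noise and psi is bounded, so the integrals are additive and Jensen's inequality
    applies. *)
Lemma Ph_dist_sqr n (phi psi : B -> R) C : measurable_fun [set: B] (phi : B -> mR) ->
  measurable_fun [set: B] (psi : B -> mR) -> (forall x, `|psi x| <= C) -> forall x,
  (((Ph n phi x - Ph n psi x) ^+ 2)%:E
    <= \int[P]_w ((phi (Phi n w x) - psi (Phi n w x)) ^+ 2)%:E)%E.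
Proof.
move=> mphi mpsi psiC x.
have mp : measurable_fun [set: Omega] (fun w => phi (Phi n w x) - psi (Phi n w x) : mR).
  by apply: measurable_funB;
    [exact: (measurableT_comp mphi (mPhi1 n x))|exact: (measurableT_comp mpsi (mPhi1 n x))].
have [g2|] := ltP (\int[P]_w ((phi (Phi n w x) - psi (Phi n w x)) ^+ 2)%:E)%E +oo%E; last first.
  by move=> h; apply: le_trans h; rewrite leey.
apply: le_trans (jensen_sqr P mp).
have gi := square_integrable mp g2.
have pi' : P.-integrable setT (EFin \o (fun w => psi (Phi n w x))).
  apply: (bounded_integrable P (C := C)) => //; exact: (measurableT_comp mpsi (mPhi1 n x)).
rewrite (_ : Ph n phi x = (\int[P]_w (phi (Phi n w x) - psi (Phi n w x)))%R + Ph n psi x) ?addrK //.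
rewrite -RintegralD //; apply: eq_Rintegral => w _; rewrite subrK //.
Qed.

Lemma Ph_dist_sqr_integral n (phi psi : B -> R) C : measurable_fun [set: B] (phi : B -> mR) ->
  measurable_fun [set: B] (psi : B -> mR) -> (forall x, `|psi x| <= C) ->
  (\int[pi]_x ((Ph n phi x - Ph n psi x) ^+ 2)%:E <= \int[pi]_x ((phi x - psi x) ^+ 2)%:E)%E.
Proof.
move=> mphi mpsi psiC.
have mg : measurable_fun [set: B] (fun x => ((phi x - psi x) ^+ 2)%:E).
  by apply/measurable_EFinP; apply: measurable_funX; exact: measurable_funB.
have g0 x : (0 <= ((phi x - psi x) ^+ 2)%:E)%E by rewrite lee_fin sqr_ge0.
rewrite -(ge0_stationary n mg g0); apply: ge0_le_integral => //.
- by move=> x _; rewrite lee_fin sqr_ge0.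
- apply/measurable_EFinP; apply: measurable_funX.
  by apply: measurable_funB; exact: measurable_Ph_all.
- apply: (measurable_fun_fubini_tonelli_G (m1 := P)
    (fun z : Omega * B => ((phi (Phi n z.1 z.2) - psi (Phi n z.1 z.2)) ^+ 2)%:E)) => //.
  exact: (measurableT_comp mg (mPhi n)).
- by move=> x _; exact: Ph_dist_sqr psiC x.
Qed.

(** Bounded Lipschitz psi converges pointwise and boundedly, hence in L^2(pi). A general phi is
    replaced by such a psi; by stationarity the transition operators do not increase the L^2(pi)
    error, which therefore stays small uniformly in n. *)
Lemma Ph_cvg_L2 (phi : B -> R) : measurable_fun [set: B] (phi : B -> mR) ->
  (\int[pi]_x (phi x ^+ 2)%:E < +oo)%E -> forall e, 0 < e ->
  \forall n \near \oo, (\int[pi]_x ((Ph n phi x - (\int[pi]_y phi y)%R) ^+ 2)%:E <= e%:E)%E.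
Proof.
move=> mphi phi2 e e0; have e10 : 0 < e / 10 by rewrite divr_gt0.
have [e4 ee] := tenths e0.
have [psi psiL hpsi] := approximable_square_integrable mphi phi2 e10.
have mpsi := measurable_lipschitz_bounded psiL; have [[C psiC] [L psi_lip]] := psiL.
have psii := bounded_integrable pi mpsi psiC.
have hmean : (((\int[pi]_y phi y)%R - (\int[pi]_y psi y)%R) ^+ 2)%:E%E
    = (((\int[pi]_y (phi y - psi y))%R) ^+ 2)%:E%E.
  by rewrite RintegralB //; exact: square_integrable.
have mean : ((((\int[pi]_y phi y)%R - (\int[pi]_y psi y)%R) ^+ 2)%:E < (e / 10)%:E)%E.
  by rewrite hmean; apply: le_lt_trans (jensen_sqr pi _) hpsi; exact: measurable_funB.
have lim : (fun n => \int[pi]_x ((Ph n psi x - (\int[pi]_y psi y)%R) ^+ 2)%:E)%E @ \oo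
    --> (\int[pi]_x (0 : R)%:E)%E.
  apply: (dominated_cvg_EFin (g := cst ((C + C) ^+ 2)) (f := cst 0)) => //.
  - move=> n; apply: measurable_funX; apply: measurable_funB => //.
    exact: measurable_Ph_all.
  - apply: nearW => x; have h : (fun n => Ph n psi x - (\int[pi]_y psi y)%R) @ \oo --> (0 : R).
      have h1 := Ph_forget psiC psi_lip x.
      have h2 := lipschitz_mixing psiC psi_lip (fun n => bounded_stationary mpsi psiC n) (m := pi).
      have -> : (fun n => Ph n psi x - (\int[pi]_y psi y)%R)
         = fun n => (Ph n psi x - Ph n psi 0) + (Ph n psi 0 - (\int[pi]_y psi y)%R).
        by apply/funext => n; rewrite addrA subrK.
      rewrite -[0 in X in _ --> X]addr0; apply: cvgD => //.
      by rewrite -[0 in X in _ --> X](subrr (\int[pi]_y psi y)%R); apply: cvgB => //; exact: cvg_cst.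
    by rewrite -[X in _ --> X](mulr0 0); exact: (cvgM h h).
  - exact: finite_measure_integrable_cst.
  - move=> n x /=; rewrite ger0_norm ?sqr_ge0 // -real_normK ?num_real //.
    have C0 : 0 <= C by apply: le_trans (psiC 0); exact: normr_ge0.
    rewrite ler_pXn2r ?nnegrE ?addr_ge0 //; apply: le_trans (ler_normB _ _) _.
    apply: lerD; first exact: Ph_bounded mpsi psiC n x.
    rewrite -[(\int[pi]_y psi y)%R]subr0 -{1}(Rintegral_cst1 pi 0); apply: Rintegral_dist_cst => //.
      exact: finite_measure_integrable_cst.
    by move=> y; rewrite subr0.
rewrite integral0 in lim.
have near1 : \forall n \near \oo,
    (\int[pi]_x ((Ph n psi x - (\int[pi]_y psi y)%R) ^+ 2)%:E < (e / 10)%:E)%E.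
  apply: (lim [set y | (y < (e / 10)%:E)%E]); apply: open_nbhs_nbhs; split.
    exact: open_ereal_lt_ereal.
  by rewrite /= lte_fin.
apply: filterS near1 => n hn.
have mP (f : B -> R) : measurable_fun [set: B] (f : B -> mR) ->
    measurable_fun [set: B] (Ph n f : B -> mR) by exact: measurable_Ph_all.
have i1 : (\int[pi]_x ((Ph n phi x - Ph n psi x) ^+ 2)%:E <= (e / 10)%:E)%E.
  exact: le_trans (Ph_dist_sqr_integral n mphi mpsi psiC) (ltW hpsi).
have i2 : (\int[pi]_x ((Ph n psi x - (\int[pi]_y phi y)%R) ^+ 2)%:E <= (4 * (e / 10))%:E)%E.
  apply: le_trans (@sqr_integral_le _ _ _ pi _
    (fun x => Ph n psi x - (\int[pi]_y psi y)%R)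
    (fun=> (\int[pi]_y psi y)%R - (\int[pi]_y phi y)%R) _ _ _ _) _ => //.
  - by apply: measurable_funB => //; exact: mP.
  - by apply: measurable_funB => //; exact: mP.
  - by move=> x; rewrite -[X in `|X| <= _](subrKA (\int[pi]_y psi y)%R) ler_normD.
  rewrite integral_cst1 -[X in (_ + _ * X%:E)%E]sqrrN opprB.
  apply: le_trans (leeD (lee_wpmul2l _ (ltW hn)) (lee_wpmul2l _ (ltW mean))) _; rewrite ?lee_fin //.
apply: le_trans (@sqr_integral_le _ _ _ pi _ (fun x => Ph n phi x - Ph n psi x)
    (fun x => Ph n psi x - (\int[pi]_y phi y)%R) _ _ _ _) _ => //.
- by apply: measurable_funB => //; exact: mP.
- by apply: measurable_funB; exact: mP.
- by apply: measurable_funB => //; exact: mP.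
- by move=> x; rewrite -[X in `|X| <= _](subrKA (Ph n psi x)) ler_normD.
apply: le_trans (leeD (lee_wpmul2l _ i1) (lee_wpmul2l _ i2)) _; rewrite ?lee_fin //.
Qed.

(** The functions [Ph n phi] themselves converge in L^2(pi), so the squared errors converge to 0 in
    Cesaro mean, and convexity of the square bounds the error of the time average by that mean. *)
Lemma stationary_ergodic : ergodic_measure Ph pi.
Proof.
move=> phi mphi phi2; set c := (\int[pi]_y phi y)%R.
pose a n := (\int[pi]_x ((Ph n phi x - c) ^+ 2)%:E)%E.
have a0 n : (0 <= a n)%E by apply: integral_ge0 => x _; rewrite lee_fin sqr_ge0.
have mP n : measurable_fun [set: B] (fun x => Ph n phi x - c : mR).
  by apply: measurable_funB => //; exact: measurable_Ph_all.
have afin n : a n \is a fin_num.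
  rewrite ge0_fin_numE //; apply: le_lt_trans (@sqr_integral_le _ _ _ pi _
    (fun x => Ph n phi x - Ph n (cst 0) x) (fun=> c) _ _ _ _) _ => //.
  - by apply: measurable_funB; exact: measurable_Ph_all.
  - by move=> x; rewrite [Ph n (cst 0) x]Rintegral_cst1 subr0 ler_normB.
  rewrite lte_add_pinfty // lte_mul_pinfty ?lee_fin //.
    apply: le_lt_trans (@Ph_dist_sqr_integral n phi (cst 0) 0 mphi _ _) _ => //.
      by move=> x; rewrite normr0.
    by under eq_integral do rewrite subr0.
  by rewrite integral_cst1 ltry.
have fa : (fine \o a) @ \oo --> (0 : R).
  apply/cvgrPdist_le => e e0; apply: filterS (Ph_cvg_L2 mphi phi2 e0) => n.
  rewrite sub0r normrN /= ger0_norm ?fine_ge0 //.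
  by rewrite -[X in (X <= _)%E](fineK (afin n)) lee_fin.
(* [arithmetic_mean] at N averages N + 1 terms, so the sequence in the goal is shifted by one. *)
have := cesaro fa; rewrite -[in X in _ -> X]cvg_shiftS => mean.
have mean' : (fun N => (arithmetic_mean (fine \o a) N)%:E) @ \oo --> 0%E.
  by apply/fine_cvgP; split; [exact: nearW|exact: mean].
apply: (squeeze_cvge _ (cvg_cst 0%E) mean'); apply: nearW => N /=; apply/andP; split.
  by apply: integral_ge0 => x _; rewrite lee_fin sqr_ge0.
have N0 : 0 < N.+1%:R :> R by [].
have -> : ((arithmetic_mean (fine \o a) N)%:E
    = \int[pi]_x (N.+1%:R^-1 * \sum_(n < N.+1) (Ph n phi x - c) ^+ 2)%:E)%E.
  under eq_integral do rewrite EFinM -sumEFin.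
  rewrite ge0_integralZl_EFin ?invr_ge0 //; last 2 first.
  - by move=> x _; apply: sume_ge0 => n _; rewrite lee_fin sqr_ge0.
  - by apply: emeasurable_sum => n; apply/measurable_EFinP; apply: measurable_funX; exact: mP.
  rewrite ge0_integral_sum //; last 2 first.
  - by move=> n; apply/measurable_EFinP; apply: measurable_funX; exact: mP.
  - by move=> n x _; rewrite lee_fin sqr_ge0.
  rewrite /arithmetic_mean /= EFinM /series /= big_mkord -sumEFin.
  by congr (_ * _)%E; apply: eq_bigr => n _; rewrite fineK.
apply: ge0_le_integral => //.
- by move=> x _; rewrite lee_fin sqr_ge0.
- apply/measurable_EFinP; apply: measurable_funX; apply: measurable_funB => //.
  apply: measurable_funM => //; apply: measurable_sum => n; exact: measurable_Ph_all.
- apply/measurable_EFinP; apply: measurable_funM => //; apply: measurable_sum => n.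
  by apply: measurable_funX; exact: mP.
move=> x _; rewrite lee_fin.
exact: (sqr_mean_le N (fun n => Ph n phi x) c).
Qed.

Section wasserstein_contraction.
Variables (n : nat) (mu : probability B R).

Let g (A : set B) (x : B) : \bar R := (\int[P]_w (\1_A (Phi n w x) : R)%:E)%E.

Let gE A x : measurable A -> g A x = (Ph n \1_A x)%:E.
Proof.
move=> mA; symmetry; apply: EFin_Rintegral.
apply: (bounded_integrable P (C := 1)) => [|w].
  by apply: (measurableT_comp _ (mPhi1 n x)); exact/measurable_indicP.
by rewrite indicE; case: (_ \in _); rewrite /= ?normr1 ?normr0 ?ler01.
Qed.

Let measurable_g A : measurable A -> measurable_fun [set: B] (g A).
Proof.
move=> mA; apply: (measurable_fun_fubini_tonelli_G (m1 := P)
    (fun z : Omega * B => (\1_A (Phi n z.1 z.2) : R)%:E)) => [|z].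
  apply/measurable_EFinP; apply: (measurableT_comp _ (mPhi n)); exact/measurable_indicP.
by rewrite lee_fin.
Qed.

Let g_ge0 A x : (0 <= g A x)%E.
Proof. by apply: integral_ge0 => w _; rewrite lee_fin. Qed.

Let transposeE (nu : probability B R) A : measurable A ->
  transpose Ph n nu A = (\int[nu]_x g A x)%E.
Proof. by move=> mA; apply: eq_integral => x _; rewrite gE. Qed.

Lemma transpose_stationary A : measurable A -> transpose Ph n pi A = pi A.
Proof.
move=> mA; rewrite transposeE //.
rewrite (ge0_stationary n (g := fun x => (\1_A x)%:E)); last 2 first.
- by apply/measurable_EFinP; exact/measurable_indicP.
- by move=> x; rewrite lee_fin.
by rewrite integral_indic // setIT.
Qed.

Section pushed_coupling.
Variable gam : probability (B * B)%type R.

(** The synchronous coupling: both initial points are driven by the same noise, so contraction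
    applies sample by sample. *)
Let F (z : Omega * (B * B)) : B * B := (Phi n z.1 z.2.1, Phi n z.1 z.2.2).

Let mF1 : measurable_fun [set: Omega * (B * B)] (fun z => Phi n z.1 z.2.1 : B).
Proof.
have h : measurable_fun [set: Omega * (B * B)] (fun z : Omega * (B * B) => (z.1, z.2.1)).
  apply: measurable_fun_pair; first exact: measurable_fst.
  exact: (measurableT_comp measurable_fst measurable_snd).
exact: (measurableT_comp (mPhi n) h).
Qed.

Let mF2 : measurable_fun [set: Omega * (B * B)] (fun z => Phi n z.1 z.2.2 : B).
Proof.
have h : measurable_fun [set: Omega * (B * B)] (fun z : Omega * (B * B) => (z.1, z.2.2)).
  apply: measurable_fun_pair; first exact: measurable_fst.
  exact: (measurableT_comp measurable_snd measurable_snd).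
exact: (measurableT_comp (mPhi n) h).
Qed.

Let mF : measurable_fun [set: Omega * (B * B)] F.
Proof. exact: measurable_fun_pair. Qed.

Let m := push (P \x gam)%E mF.

Let m1 : m setT = 1%E.
Proof.
transitivity ((P \x gam)%E (setT `*` setT)); first by rewrite setXTT.
rewrite product_measure1E // -[RHS]mule1.
by congr (_ * _)%E; exact: probability_setT.
Qed.

Lemma pushed_coupling : coupling mu pi gam ->
  coupling (transpose Ph n mu) pi (to_probability m1).
Proof.
move=> mupi A mA.
have marg (h : B * B -> B) (nu : probability B R) : measurable_fun [set: B * B] h ->
    (forall C, measurable C -> gam (h @^-1` C) = nu C) ->
    (\int[P \x gam]_z (\1_A (Phi n z.1 (h z.2)) : R)%:E)%E = (\int[nu]_x g A x)%E.
  move=> mh hnu.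
  have mz : measurable_fun [set: Omega * (B * B)] (fun z => Phi n z.1 (h z.2) : B).
    have k : measurable_fun [set: Omega * (B * B)] (fun z : Omega * (B * B) => (z.1, h z.2)).
      apply: measurable_fun_pair; first exact: measurable_fst.
      exact: (measurableT_comp mh measurable_snd).
    exact: (measurableT_comp (mPhi n) k).
  rewrite fubini_tonelli2 /=; last 2 first.
  - by apply/measurable_EFinP; apply: (measurableT_comp _ mz); exact/measurable_indicP.
  - by move=> z; rewrite lee_fin.
  rewrite -[LHS](ge0_integral_push gam mh (measurable_g mA) (g_ge0 A)).
  by apply: eq_measure_integral => C mC _; exact: hnu.
have ind (X : set (Omega * (B * B))) : measurable X ->
    ((P \x gam) X = \int[P \x gam]_z (\1_X z : R)%:E)%E.
  by move=> mX; rewrite integral_indic // setIT.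
split.
- rewrite transposeE //.
  rewrite -(marg fst mu measurable_fst); last first.
    by move=> C mC; rewrite -(mupi C mC).1; congr (gam _); apply/seteqP; split=> [z|z []].
  transitivity ((P \x gam)%E ((fun z => Phi n z.1 z.2.1) @^-1` A)).
    by congr ((P \x gam)%E _); apply/seteqP; split=> [z []|z].
  by rewrite ind // -[X in measurable X]setTI; exact: mF1.
(* The second marginal is the transpose applied to pi, which is pi again by stationarity. *)
- rewrite -(transpose_stationary mA) transposeE //.
  rewrite -(marg snd pi measurable_snd); last first.
    by move=> C mC; rewrite -(mupi C mC).2; congr (gam _); apply/seteqP; split=> [z|z []].
  transitivity ((P \x gam)%E ((fun z => Phi n z.1 z.2.2) @^-1` A)).
    by congr ((P \x gam)%E _); apply/seteqP; split=> [z []|z].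
  by rewrite ind // -[X in measurable X]setTI; exact: mF2.
Qed.

(** The distance is Lipschitz in each variable; joint measurability for the product sigma-algebra
    then follows from separability. *)
Let mN : measurable_fun [set: B * B] (fun z => (normH (z.1 - z.2) ^+ 2)%:E).
Proof.
apply/measurable_EFinP; apply: measurable_funX.
apply: (measurable_caratheodoryR Ddense (Psi := fun (z : B * B) v => normH (z.1 - v))
  (f := snd)) => [v|z|]; last exact: measurable_snd.
- have h : measurable_fun [set: B] (fun x : B => normH (x - v) : mR).
    apply: (@measurable_lipschitz _ _ _ 1) => x y; rewrite mul1r.
    by apply: le_trans (normH_dist _ _) _; rewrite opprB addrA subrK.
  exact: (measurableT_comp h measurable_fst).
- apply: (@lipschitz_seq_continuous _ _ _ 1) => x y; rewrite mul1r.
  apply: le_trans (normH_dist _ _) _.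
  by rewrite opprB addrC addrA subrK normHBC.
Qed.

Lemma pushed_cost :
  (\int[to_probability m1]_z (normH (z.1 - z.2) ^+ 2)%:E
   <= ((r ^+ n) ^+ 2)%:E * \int[gam]_z (normH (z.1 - z.2) ^+ 2)%:E)%E.
Proof.
have N0 (z : B * B) : (0 <= (normH (z.1 - z.2) ^+ 2)%:E)%E by rewrite lee_fin sqr_ge0.
have rn0 : 0 <= (r ^+ n) ^+ 2 by exact: sqr_ge0.
rewrite -ge0_integralZl_EFin //.
rewrite -[leLHS]/(\int[m]_z (normH (z.1 - z.2) ^+ 2)%:E)%E.
rewrite (ge0_integral_push (P \x gam)%E mF mN N0) fubini_tonelli2 //; last exact: (measurableT_comp mN mF).
apply: ge0_le_integral => //.
- by move=> z _; apply: integral_ge0.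
- by apply: measurable_fun_fubini_tonelli_G => //; exact: (measurableT_comp mN mF).
- exact: (measurable_funeM _ mN).
move=> z _; rewrite -EFinM -(integral_cst1 P (_ * _)).
apply: ge0_le_integral => //.
- by apply: (measurableT_comp (measurableT_comp mN mF)); exact: measurable_pair2.
move=> w _; rewrite lee_fin -exprMn ler_pXn2r ?nnegrE ?normH_ge0 //.
  exact: Phi_contr.
by rewrite mulr_ge0 ?normH_ge0 // exprn_ge0 //; have /andP[/ltW] := r01.
Qed.

Lemma pushed_coupling_cost : coupling mu pi gam ->
  exists2 gam' : probability (B * B)%type R, coupling (transpose Ph n mu) pi gam' &
    (\int[gam']_z (normH (z.1 - z.2) ^+ 2)%:E
     <= ((r ^+ n) ^+ 2)%:E * \int[gam]_z (normH (z.1 - z.2) ^+ 2)%:E)%E.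
Proof.
by move=> cgam; exists (to_probability m1); [exact: pushed_coupling|exact: pushed_cost].
Qed.

End pushed_coupling.

Lemma wasserstein_contraction :
  (wasserstein2 (transpose Ph n mu) pi <= (r ^+ n)%:E * wasserstein2 mu pi)%E.
Proof.
have r0 : 0 < r by have /andP[] := r01.
have rn0 : 0 < (r ^+ n) ^+ 2 by rewrite !exprn_gt0.
rewrite /wasserstein2; set S' := [set c | _]; set S := [set c | _].
have S0 c : S c -> (0 <= c)%E.
  by move=> [gam _ ->]; apply: integral_ge0 => z _; rewrite lee_fin sqr_ge0.
have S'0 c : S' c -> (0 <= c)%E.
  by move=> [gam _ ->]; apply: integral_ge0 => z _; rewrite lee_fin sqr_ge0.
have i0 : (0 <= ereal_inf S)%E by exact: le_ereal_inf_tmp.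
have i'0 : (0 <= ereal_inf S')%E by exact: le_ereal_inf_tmp.
have le : (ereal_inf S' <= ((r ^+ n) ^+ 2)%:E * ereal_inf S)%E.
  rewrite -lee_pdivrMl //; apply: le_ereal_inf_tmp => c [gam cgam ->].
  rewrite lee_pdivrMl //; have [gam' cgam' le'] := pushed_coupling_cost cgam.
  by apply: le_trans le'; apply: ereal_inf_lbound; exists gam'.
have -> : ((r ^+ n)%:E = ((r ^+ n) ^+ 2)%:E `^ 2^-1)%E.
  rewrite /= powR12_sqrt ?sqrtr_sqr ?ger0_norm ?exprn_ge0 // ?ltW //.
rewrite -poweRM ?lee_fin ?(ltW rn0) //.
by apply: gt0_ler_poweR => //; rewrite in_itv /= leey andbT // mule_ge0 // lee_fin ltW.
Qed.

End wasserstein_contraction.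
End ergodic_package.
Import HBSimple.
(** * Reversing the order of the noise increments *)

Section equality_in_law.
Context {R : realType} (J : finType).
Local Notation mR := (measurableTypeR R).

Definition coord_continuous (phi : (J -> R) -> R) : Prop :=
  forall (x : nat -> J -> R) l, (forall i, x ^~ i @ \oo --> l i) ->
    phi \o x @ \oo --> phi l.

Variable phi : (J -> R) -> R.
Hypothesis phiC : coord_continuous phi.

Section quantisation.
Variable s : seq R.
Hypothesis us : uniq s.

(** When each coordinate takes finitely many values, the expectation is a finite sum over value
    patterns and depends only on the probabilities of rectangles. *)
Lemma quantised_expectation d (T : measurableType d) (P : probability T R) (Z : J -> T -> R)
    (h : R -> R) :
  (forall x, h x \in s) -> measurable_fun [set: mR] (h : mR -> mR) ->
  (forall i, measurable_fun [set: T] (Z i : T -> mR)) ->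
  measurable_fun [set: T] (fun w => phi (fun i => h (Z i w)) : mR) /\
  (\int[P]_w phi (fun i => h (Z i w)))%R =
  \sum_(v : {ffun J -> 'I_(size s)}) phi (fun i => nth 0 s (v i)) *
    fine (P [set w | forall i, h (Z i w) = nth 0 s (v i)]).
Proof.
move=> hs mh mZ.
pose A (v : {ffun J -> 'I_(size s)}) := [set w | forall i, h (Z i w) = nth 0 s (v i)].
have mA v : measurable (A v).
  have -> : A v = \bigcap_(i in [set: J]) (h \o Z i) @^-1` [set nth 0 s (v i)].
    by apply/seteqP; split=> w /= Aw i; [move=> _; exact: Aw|exact: (Aw i I)].
  apply: fin_bigcap_measurable => [|i _]; first exact: finite_finset.
  rewrite -[_ @^-1` _]setTI; exact: (measurableT_comp mh (mZ i)).
have phiE w : phi (fun i => h (Z i w)) =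
    \sum_(v : {ffun J -> 'I_(size s)}) phi (fun i => nth 0 s (v i)) * \1_(A v) w.
  have ix i : (index (h (Z i w)) s < size s)%N by rewrite index_mem.
  rewrite (bigD1 [ffun i => Ordinal (ix i)]) //= big1 => [|v vw]; last first.
    rewrite indicE memNset ?mulr0 // => /= Aw; move/negP: vw; apply; apply/eqP/ffunP => i.
    by rewrite ffunE; apply: val_inj; rewrite /= Aw index_uniq.
  rewrite indicE mem_set ?mulr1 ?addr0; last by move=> i; rewrite ffunE /= nth_index.
  by congr phi; apply/funext => i; rewrite ffunE /= nth_index.
have mt (v : {ffun J -> 'I_(size s)}) : measurable_fun [set: T] (fun w => phi (fun i => nth 0 s (v i)) * \1_(A v) w : mR).
  by apply: measurable_funM => //; exact/measurable_indicP.
have it (v : {ffun J -> 'I_(size s)}) : P.-integrable setT (EFin \o (fun w => phi (fun i => nth 0 s (v i)) * \1_(A v) w)).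
  apply: (bounded_integrable P (mt v) (C := `|phi (fun i => nth 0 s (v i))|)) => w.
  by rewrite normrM ler_piMr // indicE; case: (_ \in _); rewrite ?normr1 ?normr0.
split.
  rewrite (_ : (fun w => _) = fun w => \sum_(v : {ffun J -> 'I_(size s)})
    phi (fun i => nth 0 s (v i)) * \1_(A v) w); last by apply/funext.
  by apply: measurable_sum => v; exact: mt.
under eq_Rintegral do rewrite phiE.
rewrite Rintegral_sum //; apply: eq_bigr => v _.
rewrite RintegralZl //; last first.
  apply: (bounded_integrable P (C := 1)) => [|w]; first exact/measurable_indicP.
  by rewrite indicE; case: (_ \in _); rewrite ?normr1 ?normr0.
by congr (_ * _); rewrite /Rintegral integral_indic // setIT.
Qed.

End quantisation.

Variable C : R.
Hypothesis phi_bounded : forall x, `|phi x| <= C.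

(** Finitely valued measurable functions h n, with values listed in s n, that approximate the
    identity of the real line pointwise. *)
Definition quantiser (h : nat -> R -> R) (s : nat -> seq R) : Prop :=
  [/\ forall n, uniq (s n), forall n x, h n x \in s n,
      forall n, measurable_fun [set: mR] (h n : mR -> mR) &
      forall x, h ^~ x @ \oo --> x].

Lemma quantiser_exists : exists h s, quantiser h s.
Proof.
have [g hg] := @approximation_sfun _ mR R (EFin : mR -> \bar R) setT measurableT
  (@EFin_measurable R setT).
have /choice[s hs] n : exists s : seq R, range (g n) = [set` s].
  by apply/finite_seqP; exact: fimfunP.
exists (fun n => g n : mR -> R), (fun n => undup (s n)); split=> [n|n x|n|x].
- exact: undup_uniq.
- rewrite mem_undup; have : range (g n) (g n x) by exists x.
  by rewrite hs.
- by have := @measurable_funPT _ _ _ _ (g n).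
by have /fine_cvgP[] := hg x I.
Qed.

Lemma measurable_coord_continuous d (T : measurableType d) (P : probability T R) (Z : J -> T -> R) :
  (forall i, measurable_fun [set: T] (Z i : T -> mR)) ->
  measurable_fun [set: T] (fun w => phi (Z ^~ w) : mR).
Proof.
move=> mZ; have [h [s [us hs mh hx]]] := quantiser_exists.
apply: (measurable_fun_cvg (h := fun n w => phi (fun i => h n (Z i w)))) => [n|w _].
  exact: (quantised_expectation (us n) P (hs n) (mh n) mZ).1.
by apply: phiC => i; exact: hx.
Qed.

Lemma expectation_quantised_cvg d (T : measurableType d) (P : probability T R) (Z : J -> T -> R)
    h s : quantiser h s ->
  (forall i, measurable_fun [set: T] (Z i : T -> mR)) ->
  (fun n => \int[P]_w phi (fun i => h n (Z i w)))%R @ \oo --> (\int[P]_w phi (Z ^~ w))%R.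
Proof.
move=> [us hs mh hx] mZ.
apply: (dominated_cvg_Rintegral (g := fun=> C)).
- by move=> n; exact: (quantised_expectation (us n) P (hs n) (mh n) mZ).1.
- exact: (measurable_coord_continuous P).
- by apply: nearW => w; apply: phiC => i; exact: hx.
- exact: finite_measure_integrable_cst.
- by move=> n w; exact: phi_bounded.
Qed.

(** Laws that agree on rectangles give equal expectations of the quantised coordinates, and
    dominated convergence removes the quantisation. *)
Lemma expectation_eq_law d1 (T1 : measurableType d1) (P1 : probability T1 R) (Z1 : J -> T1 -> R)
    d2 (T2 : measurableType d2) (P2 : probability T2 R) (Z2 : J -> T2 -> R) :
  (forall i, measurable_fun [set: T1] (Z1 i : T1 -> mR)) ->
  (forall i, measurable_fun [set: T2] (Z2 i : T2 -> mR)) ->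
  (forall B : J -> set mR, (forall i, measurable (B i)) ->
    P1 [set w | forall i, B i (Z1 i w)] = P2 [set w | forall i, B i (Z2 i w)]) ->
  (\int[P1]_w phi (Z1 ^~ w) = \int[P2]_w phi (Z2 ^~ w))%R.
Proof.
move=> mZ1 mZ2 eqP12; have [h [s q]] := quantiser_exists; have [us hs mh hx] := q.
have c1 := expectation_quantised_cvg (P := P1) q mZ1.
have c2 := expectation_quantised_cvg (P := P2) q mZ2.
suff E : (fun n => \int[P1]_w phi (fun i => h n (Z1 i w)))%R = (fun n => \int[P2]_w phi (fun i => h n (Z2 i w)))%R.
  by rewrite E in c1; exact: (cvg_unique _ c1 c2).
apply/funext => n.
rewrite (quantised_expectation (us n) P1 (hs n) (mh n) mZ1).2.
rewrite (quantised_expectation (us n) P2 (hs n) (mh n) mZ2).2.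
apply: eq_bigr => v _; congr (_ * fine _).
apply: (eqP12 (fun i => h n @^-1` [set nth 0 (s n) (v i)])) => i.
by rewrite -[_ @^-1` _]setTI; apply: (mh n) => //; exact: measurable_set1.
Qed.

End equality_in_law.

Section rectangles.
Context {R : realType}.
Local Notation mR := (measurableTypeR R).

Definition rectangle (T : Type) (Z : nat -> T -> R) (B : nat -> set R) (K : nat) : set T :=
  [set w | forall k, (k < K)%N -> B k (Z k w)].

Lemma rectangleS (T : Type) (Z : nat -> T -> R) B K :
  rectangle Z B K.+1 = rectangle Z B K `&` Z K @^-1` B K.
Proof.
apply/seteqP; split=> w /=.
  by move=> h; split=> [k kK|]; apply: h => //; exact: ltnW.
by move=> [h hK] k; rewrite ltnS leq_eqVlt => /predU1P[->|/h].
Qed.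

Lemma measurable_rectangle d (T : measurableType d) (Z : nat -> T -> R) (B : nat -> set mR) K :
  (forall k, (k < K)%N -> measurable_fun [set: T] (Z k : T -> mR)) ->
  (forall k, measurable (B k)) -> measurable (rectangle Z B K).
Proof.
move=> mZ mB; elim: K mZ => [|K IH] mZ.
  by rewrite (_ : rectangle _ _ _ = setT) //; apply/seteqP; split.
rewrite rectangleS; apply: measurableI; first by apply: IH => k kK; apply: mZ; exact: ltnW.
by rewrite -[_ @^-1` _]setTI; exact: mZ.
Qed.

End rectangles.

Section brownian_increments.
Context {d : measure_display} {Omega : measurableType d} {R : realType}.
Variables (P : probability Omega R) (Ft : R -> set (set Omega)).
Variables (X : nat + nat -> R -> Omega -> R) (dt : R).
Local Notation mR := (measurableTypeR R).
Hypothesis Ft_filtration : filtration Ft.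
Hypothesis X_BM : forall j, brownian_motion P Ft (X j).
Hypothesis X_indep : independent_processes P X.
Hypothesis dt0 : 0 < dt.

Definition bm_increment j k (w : Omega) : R := X j (k.+1%:R * dt) w - X j (k%:R * dt) w.
Local Notation Z := bm_increment.
Local Notation gam := (normal_prob 0 (Num.sqrt dt) : probability mR R).

Let time_ge0 k : 0 <= k%:R * dt. Proof. by rewrite mulr_ge0 // ltW. Qed.
Let time_lt k : k%:R * dt < k.+1%:R * dt. Proof. by rewrite ltr_pM2r // ltr_nat. Qed.
Let time_le k l : (k <= l)%N -> k%:R * dt <= l%:R * dt.
Proof. by move=> kl; rewrite ler_pM2r // ler_nat. Qed.
Let time_step k : k.+1%:R * dt - k%:R * dt = dt.
Proof. by rewrite -mulrBl -natrB // subSnn mul1r. Qed.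

Lemma measurable_brownian j t : 0 <= t -> measurable_fun [set: Omega] (X j t : Omega -> mR).
Proof.
move=> t0 _ B mB; rewrite setTI; have [ad _ _ _ _] := X_BM j.
by apply: ((Ft_filtration.1 t t0).2); exact: ad.
Qed.

Lemma measurable_bm_increment j k : measurable_fun [set: Omega] (Z j k : Omega -> mR).
Proof. by apply: measurable_funB; exact: measurable_brownian. Qed.

Let measurable_adapted K j k : (k < K)%N ->
  measurable_fun [set: g_sigma_algebraType (Ft (K%:R * dt))] (Z j k : _ -> mR).
Proof.
move=> kK; have mX l : (l <= K)%N ->
    measurable_fun [set: g_sigma_algebraType (Ft (K%:R * dt))] (X j (l%:R * dt) : _ -> mR).
  move=> lK _ B mB; rewrite setTI; apply: sub_sigma_algebra.
  have [ad _ _ _ _] := X_BM j; apply: (Ft_filtration.2 (l%:R * dt)); last exact: ad.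
  by rewrite time_ge0 time_le.
by apply: measurable_funB; apply: mX => //; exact: ltnW.
Qed.

Lemma bm_increment_law j k (E : set mR) : measurable E -> P (Z j k @^-1` E) = gam E.
Proof.
move=> mE; have [_ _ _ law _] := X_BM j.
by have := law _ _ (time_ge0 k) (time_lt k) _ mE; rewrite time_step.
Qed.

(** By induction on K: the event about the first K increments belongs to the filtration at time K
    dt, of which the next increment is independent. *)
Lemma bm_increment_rectangle j (B : nat -> set mR) K : (forall k, measurable (B k)) ->
  P (rectangle (Z j) B K) = (\prod_(k < K) fine (gam (B k)))%:E.
Proof.
move=> mB; have [_ _ _ law ind] := X_BM j; elim: K => [|K IH].
  rewrite big_ord0 (_ : rectangle _ _ _ = setT); first exact: probability_setT.
  by apply/seteqP; split.
rewrite rectangleS big_ord_recr /= EFinM -IH.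
have FK : Ft (K%:R * dt) (rectangle (Z j) B K).
  have := @measurable_rectangle R _ (g_sigma_algebraType (Ft (K%:R * dt))) (Z j) B K
    (fun k => @measurable_adapted K j k) mB.
  by rewrite /measurable /= sigma_algebra_id //; exact: (Ft_filtration.1 _ (time_ge0 K)).1.
have := law _ _ (time_ge0 K) (time_lt K) _ (mB K); rewrite time_step => lawK.
rewrite (ind _ _ (time_ge0 K) (time_lt K) _ _ FK (mB K)) lawK fineK //.
exact: (fin_num_measure gam).
Qed.

Let sigma_rectangle j (B : nat -> set mR) K : (forall k, measurable (B k)) ->
  sigma_process (X j) (rectangle (Z j) B K).
Proof.
move=> mB; pose G := [set A | exists t (B : set R), [/\ 0 <= t, measurable (B : set mR) & A = X j t @^-1` B]].
have mX t : 0 <= t -> measurable_fun [set: g_sigma_algebraType G] (X j t : _ -> mR).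
  by move=> t0 _ A mA; rewrite setTI; apply: sub_sigma_algebra; exists t, A.
apply: (@measurable_rectangle R _ (g_sigma_algebraType G)) => // k _.
by apply: measurable_funB; exact: mX.
Qed.

Lemma bm_increments_rectangle (s : seq (nat + nat)) (B : nat + nat -> nat -> set mR) K :
  uniq s -> (forall j k, measurable (B j k)) ->
  P [set w | forall j, j \in s -> rectangle (Z j) (B j) K w] =
  (\prod_(j <- s) \prod_(k < K) fine (gam (B j k)))%:E.
Proof.
move=> us mB.
have -> : [set w | forall j, j \in s -> rectangle (Z j) (B j) K w] =
    \big[setI/setT]_(j <- s) rectangle (Z j) (B j) K.
  elim: s {us} => [|j s IH]; first by rewrite big_nil; apply/seteqP; split.
  rewrite big_cons -IH; apply/seteqP; split=> w /=.
    by move=> h; split=> [|i si]; apply: h; rewrite inE ?eqxx // si orbT.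
  by move=> [hj h] i; rewrite inE => /predU1P[->//|/h].
have mr j : measurable (rectangle (Z j) (B j) K).
  by apply: measurable_rectangle => // k _; exact: measurable_bm_increment.
rewrite -[LHS]fineK; last by rewrite fin_num_measure //; exact: bigsetI_measurable.
rewrite (X_indep us) => [|j _]; last exact: sigma_rectangle.
by congr EFin; apply: eq_bigr => j _; rewrite bm_increment_rectangle.
Qed.

Section finite_family.
Variables (J : finType) (idx : J -> nat + nat).
Hypothesis idx_inj : injective idx.

Lemma finite_family_rectangle K (B : J -> nat -> set mR) : (forall a k, measurable (B a k)) ->
  P [set w | forall a, rectangle (Z (idx a)) (B a) K w] =
  (\prod_a \prod_(k < K) fine (gam (B a k)))%:E.
Proof.
move=> mB; pose B' j k := if [pick a | idx a == j] is Some a then B a k else setT.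
have B'E a k : B' (idx a) k = B a k.
  by rewrite /B'; case: pickP => [b /eqP/idx_inj ->//|/(_ a)]; rewrite eqxx.
have mB' j k : measurable (B' j k) by rewrite /B'; case: pickP.
have us : uniq [seq idx a | a <- index_enum J] by rewrite map_inj_uniq // index_enum_uniq.
have := bm_increments_rectangle K us mB'; rewrite big_map.
under eq_bigr do under eq_bigr do rewrite B'E.
move=> <-; congr (P _); apply/seteqP; split=> w /= h.
  by move=> _ /mapP[a _ ->] k kK; rewrite B'E; exact: h.
move=> a k kK; rewrite -B'E; apply: h => //.
by apply/mapP; exists a => //; rewrite mem_index_enum.
Qed.

(* Backward iteration over n + M steps: the first n noises come from the second
   sample point, in reversed order, the remaining ones from the first. *)
Definition splice (T : Type) (n : nat) (f g : nat -> T) (k : nat) : T :=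
  if (k < n)%N then g (n - k.+1)%N else f (k - n)%N.

(** Both sides are the product of the Gaussian masses of all B a k. The two sample points are
    independent, and reversing the first n times only permutes identically distributed factors. *)
Lemma splice_rectangle n M (B : J -> nat -> set mR) : (forall a k, measurable (B a k)) ->
  (P \x P)%E [set z | forall a, rectangle (fun k z =>
     splice n (Z (idx a) ^~ z.1) (Z (idx a) ^~ z.2) k) (B a) (n + M) z] =
  P [set w | forall a, rectangle (Z (idx a)) (B a) (n + M) w].
Proof.
move=> mB; pose B1 a k := B a (n + k)%N; pose B2 a k := B a (n - k.+1)%N.
have mr K (B' : J -> nat -> set mR) : (forall a k, measurable (B' a k)) ->
    measurable [set w | forall a, rectangle (Z (idx a)) (B' a) K w].
  move=> mB'; rewrite (_ : [set w | _] = \bigcap_a rectangle (Z (idx a)) (B' a) K).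
    apply: fin_bigcap_measurable => [|a _]; first exact: finite_finset.
    by apply: measurable_rectangle => // k _; exact: measurable_bm_increment.
  by apply/seteqP; split=> w /= h a; [move=> _; exact: h|exact: h a I].
rewrite (_ : [set z | _] = [set w | forall a, rectangle (Z (idx a)) (B1 a) M w] `*`
    [set w | forall a, rectangle (Z (idx a)) (B2 a) n w]); last first.
  apply/seteqP; split=> [[w w'] /= h|[w w'] /= [h1 h2] a k].
    split=> a k kK.
      have := h a (n + k)%N; rewrite ltn_add2l kK /splice ltnNge leq_addr /= addKn; exact.
    have nk : (n - k.+1 < n)%N by rewrite ltn_subrL (leq_ltn_trans _ kK).
    have := h a (n - k.+1)%N; rewrite (leq_trans nk) ?leq_addr // /splice nk.
    by rewrite subnSK // subKn ?(ltnW kK) //; exact.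
  rewrite /splice; case: (ltnP k n) => [kn _|nk knM].
    by have := h2 a (n - k.+1)%N; rewrite /B2 ltn_subrL (leq_ltn_trans _ kn) // subnSK // subKn ?(ltnW kn) //; exact.
  by have := h1 a (k - n)%N; rewrite /B1 ltn_subLR // subnKC //; exact.
rewrite (product_measure1E _ _ (mr M B1 (fun a k => mB a _)) (mr n B2 (fun a k => mB a _))).
have e1 := finite_family_rectangle M (fun a k => mB a (n + k)%N).
have e2 := finite_family_rectangle n (fun a k => mB a (n - k.+1)%N).
rewrite [X in (X * _)%E = _]e1 [X in (_ * X)%E = _]e2 finite_family_rectangle // -EFinM.
rewrite -big_split /=; congr EFin.
apply: eq_bigr => a _; rewrite big_split_ord /= mulrC; congr (_ * _).
by rewrite [RHS](reindex_inj rev_ord_inj); apply: eq_bigr.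
Qed.

End finite_family.
End brownian_increments.

(** * Finite second moment of Gaussian increments *)

Section gaussian_second_moment.
Context {R : realType}.
Local Notation mR := (measurableTypeR R).
Variable s : R.
Hypothesis s0 : 0 < s.
Let s' := Num.sqrt 2 * s.
Let s'0 : 0 < s'. Proof. by rewrite mulr_gt0 // sqrtr_gt0. Qed.
(** The constant of a comparison with the normal density of doubled variance, whose total mass is 1;
    8 s^2 + 2 bounds (2 x^2 + 2) e^(-y) at y = x^2 / (4 s^2). *)
Let K := (8 * s ^+ 2 + 2) * normal_peak s / normal_peak s'.

Let K0 : 0 <= K.
Proof.
rewrite divr_ge0 ?normal_peak_ge0 // mulr_ge0 ?normal_peak_ge0 // addr_ge0 //.
by rewrite mulr_ge0 // sqr_ge0.
Qed.

(* y e^{-y} <= 1 at y = x^2 / (4 s^2) absorbs the polynomial factor. *)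
Let pdf_comparison x : (2 * x ^+ 2 + 2) * normal_pdf 0 s x <= K * normal_pdf 0 s' x.
Proof.
rewrite /normal_pdf !gt_eqF // /normal_fun subr0.
set y := x ^+ 2 / (4 * s ^+ 2); have s20 : 0 < s ^+ 2 by rewrite exprn_gt0.
have y0 : 0 <= y by rewrite divr_ge0 ?sqr_ge0 // mulr_ge0 // ltW.
have e1 : - x ^+ 2 / (s ^+ 2 *+ 2) = - y + - y.
  by rewrite /y; field; exact: lt0r_neq0.
have e2 : - x ^+ 2 / (s' ^+ 2 *+ 2) = - y.
  by rewrite /s' exprMn sqr_sqrtr // /y; field; exact: lt0r_neq0.
rewrite e1 e2 expRD.
have ye : y * expR (- y) <= 1.
  rewrite expRN ler_pdivrMr ?expR_gt0 // mul1r.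
  by apply: le_trans (expR_ge1Dx y); rewrite lerDr.
have e01 : expR (- y) <= 1 by rewrite -[leRHS]expR0 ler_expR oppr_le0.
have xE : x ^+ 2 = 4 * s ^+ 2 * y by rewrite /y; field; exact: lt0r_neq0.
have pk : 0 < normal_peak s' by rewrite normal_peak_gt0 // gt_eqF.
have h : (2 * x ^+ 2 + 2) * expR (- y) <= 8 * s ^+ 2 + 2.
  rewrite mulrDl lerD //; last by rewrite ler_piMr.
  rewrite xE; have -> : 2 * (4 * s ^+ 2 * y) * expR (- y) = 8 * s ^+ 2 * (y * expR (- y)) by ring.
  by rewrite ler_piMr // mulr_ge0 // ltW.
rewrite /K; set c := 8 * s ^+ 2 + 2 in h *; set p := normal_peak s; set p' := normal_peak s'.
have -> : c * p / p' * (p' * expR (- y)) = c * (p * expR (- y)).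
  by field; exact: lt0r_neq0.
have -> : (2 * x ^+ 2 + 2) * (p * (expR (- y) * expR (- y)))
  = (2 * x ^+ 2 + 2) * expR (- y) * (p * expR (- y)) by ring.
by rewrite ler_wpM2r // mulr_ge0 ?expR_ge0 // normal_peak_ge0.
Qed.

Let shell n : set mR := [set x | n%:R <= `|x| < n.+1%:R].

Let measurable_shell n : measurable (shell n).
Proof.
have -> : shell n = (fun x : mR => `|x|) @^-1` [set` `[n%:R, n.+1%:R[%R].
  by apply/seteqP; split=> x; rewrite /= in_itv.
rewrite -[_ @^-1` _]setTI; exact: (@normr_measurable R setT measurableT _ (measurable_itv _)).
Qed.

Let shell_comparison n :
  ((n.+1%:R ^+ 2)%:E * normal_prob 0 s (shell n) <= K%:E * normal_prob 0 s' (shell n))%E.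
Proof.
have mp t : measurable_fun (shell n) (fun x : mR => (normal_pdf 0 t x)%:E).
  by apply/measurable_EFinP; apply: measurable_funTS; exact: measurable_normal_pdf.
have p0 t x : (0 <= (normal_pdf 0 t x)%:E)%E by rewrite lee_fin normal_pdf_ge0.
rewrite /normal_prob -!ge0_integralZl_EFin ?sqr_ge0 //.
apply: ge0_le_integral; first exact: measurable_shell.
- by move=> x _; rewrite -EFinM lee_fin mulr_ge0 ?sqr_ge0 ?normal_pdf_ge0.
- exact: (measurable_funeM _ (mp s)).
- exact: (measurable_funeM _ (mp s')).
move=> x /andP[nx _]; rewrite -!EFinM lee_fin; apply: le_trans (pdf_comparison x).
apply: ler_wpM2r; first exact: normal_pdf_ge0.
rewrite -[x ^+ 2]real_normK ?num_real //.
(* For n <= |x| one has (n + 1)^2 <= (|x| + 1)^2 <= 2 |x|^2 + 2. *)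
move: (`|x|) nx => a na; rewrite -natr1; have n0 : 0 <= n%:R :> R by [].
have := sqr_ge0 (a - 1); move: (n%:R) n0 na => m m0 ma h.
have : 0 <= (a - m) * (a + m + 2) by apply: mulr_ge0; lra.
by move: h; rewrite !expr2; lra.
Qed.

(** The law of Z is given as a set function, so Z^2 is bounded by (n + 1)^2 on the shell n <= |Z| <
    n + 1, and the resulting series is compared with the total mass of the wider Gaussian. *)
Lemma gaussian_second_moment d (T : measurableType d) (P : probability T R) (Z : T -> R) :
  measurable_fun [set: T] (Z : T -> mR) ->
  (forall B : set mR, measurable B -> P (Z @^-1` B) = normal_prob 0 s B) ->
  (\int[P]_w (Z w ^+ 2)%:E <= K%:E)%E.
Proof.
move=> mZ law; pose f n w : \bar R := ((n.+1%:R ^+ 2)%:E * (\1_(shell n) (Z w))%:E)%E.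
have f0 n w : (0 <= f n w)%E by rewrite /f -EFinM lee_fin mulr_ge0 ?sqr_ge0.
have mi n : measurable_fun [set: T] (fun w => (\1_(shell n) (Z w) : R)%:E).
  apply/measurable_EFinP; apply: (measurableT_comp _ mZ).
  exact/measurable_indicP.
have mf n : measurable_fun [set: T] (f n) by exact: (measurable_funeM _ (mi n)).
have intf n : (\int[P]_w f n w = (n.+1%:R ^+ 2)%:E * normal_prob 0 s (shell n))%E.
  rewrite ge0_integralZl_EFin ?sqr_ge0 //.
  congr (_ * _)%E; rewrite -(law _ (measurable_shell n)).
  transitivity (\int[P]_w (\1_(Z @^-1` shell n) w : R)%:E)%E; first by [].
  rewrite integral_indic ?setIT // -[_ @^-1` _]setTI; apply: mZ => //; exact: measurable_shell.
apply: (@le_trans _ _ (\int[P]_w \sum_(0 <= n <oo) f n w)%E).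
  apply: ge0_le_integral => //.
  - by move=> w _; rewrite lee_fin sqr_ge0.
  - by apply/measurable_EFinP; exact: measurable_funX.
  - exact: ge0_emeasurable_sum.
  move=> w _; pose n := Num.truncn `|Z w|.
  have /andP[n1 n2] := truncn_itv (normr_ge0 (Z w)).
  apply: le_trans (nneseries_ge_term n (fun k => f0 k w)).
  rewrite /f -EFinM lee_fin indicE mem_set ?mulr1 /= /shell /= ?n1 //.
  by rewrite -[leLHS]real_normK ?num_real // ler_pXn2r ?nnegrE // ltW.
rewrite integral_nneseries //.
apply: (@le_trans _ _ (\sum_(0 <= n <oo) (K%:E * normal_prob 0 s' (shell n)))%E).
  apply: lee_nneseries => [n _|n _]; first by rewrite intf mule_ge0 // lee_fin sqr_ge0.
  by rewrite intf; exact: shell_comparison.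
rewrite nneseriesZl //.
rewrite -[leRHS]mule1; apply: lee_wpmul2l; first by rewrite lee_fin.
have tS : trivIset setT shell.
  apply: ltn_trivIset => m n mn; apply/seteqP; split=> // x [/= /andP[_ xm] /andP[nx _]].
  by have := le_lt_trans nx xm; rewrite ltr_nat ltnS leqNgt mn.
have := @measure_bigcup _ _ _ (normal_prob 0 s') setT shell (fun n _ => measurable_shell n) tS.
have -> : (\sum_(0 <= n <oo | n \in [set: nat]) normal_prob 0 s' (shell n)
   = \sum_(0 <= n <oo) normal_prob 0 s' (shell n))%E.
  by apply: eq_eseriesl => n; rewrite in_setT.
move=> <-; apply: (probability_le1 (normal_prob 0 s' : probability mR R)).
by apply: bigcup_measurable => n _; exact: measurable_shell.
Qed.

End gaussian_second_moment.
Lemma sum_ord_split (W : nmodType) (F : nat -> W) N M : (N <= M)%N ->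
  \sum_(i < M) F i = \sum_(i < N) F i + \sum_(N <= i < M) F i.
Proof. by move=> NM; rewrite -!(big_mkord xpredT F) (@big_cat_nat _ _ _ N 0 M). Qed.

(** * Orthogonal series, measurable sums and elementary bounds *)

Section orthogonal_series.
Context {R : realType} {V : lmodType R} (ip : V -> V -> R).
Hypothesis ipP : inner_product ip.
Local Notation nrm := (fun u => Num.sqrt (ip u u)).
Variables (v : nat -> V) (e : nat -> R).
Hypothesis v_orth : forall i j, ip (v i) (v j) = (i == j)%:R * e i.

Lemma sqr_norm_orthogonal_sum (c : nat -> R) N :
  ip (\sum_(i < N) c i *: v i) (\sum_(i < N) c i *: v i) = \sum_(i < N) c i ^+ 2 * e i.
Proof.
rewrite (ip_suml ipP); apply: eq_bigr => i _; rewrite (ip_sumr ipP) (bigD1 i) //= big1 => [|j ji].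
  by rewrite (ipZl ipP) (ipZr ipP) v_orth eqxx mul1r addr0 mulrA.
by rewrite (ipZl ipP) (ipZr ipP) v_orth (inj_eq val_inj) eq_sym (negbTE ji) mul0r !mulr0.
Qed.

Lemma sqr_norm_orthogonal_tail (c : nat -> R) N M : (N <= M)%N ->
  ip (\sum_(i < M) c i *: v i - \sum_(i < N) c i *: v i)
     (\sum_(i < M) c i *: v i - \sum_(i < N) c i *: v i)
  = \sum_(N <= i < M) c i ^+ 2 * e i.
Proof.
move=> NM; pose c' i := if (i < N)%N then 0 else c i.
have -> : \sum_(i < M) c i *: v i - \sum_(i < N) c i *: v i = \sum_(i < M) c' i *: v i.
  rewrite (sum_ord_split (fun i => c i *: v i) NM) (sum_ord_split (fun i => c' i *: v i) NM).
  rewrite addrAC subrr add0r [X in _ = X + _]big1 ?add0r => [|i _]; last first.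
    by rewrite /c' ltn_ord scale0r.
  by apply: eq_big_nat => i /andP[Ni _]; rewrite /c' ltnNge Ni.
rewrite sqr_norm_orthogonal_sum (sum_ord_split (fun i => c' i ^+ 2 * e i) NM).
rewrite big1 ?add0r => [|i _]; last by rewrite /c' ltn_ord expr0n mul0r.
by apply: eq_big_nat => i /andP[Ni _]; rewrite /c' ltnNge Ni.
Qed.

Variables (Ce : R).
Hypothesis e_ge0 : forall i, 0 <= e i.
Hypothesis e_sum : forall N, \sum_(i < N) e i <= Ce.

Lemma orthogonal_series_bound (c : nat -> R) A N : (forall i, `|c i| <= A) ->
  ip (\sum_(i < N) c i *: v i) (\sum_(i < N) c i *: v i) <= A ^+ 2 * Ce.
Proof.
move=> cA; rewrite sqr_norm_orthogonal_sum.
apply: (@le_trans _ _ (A ^+ 2 * \sum_(i < N) e i)); last by rewrite ler_wpM2l ?sqr_ge0.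
rewrite mulr_sumr ler_sum // => i _; rewrite ler_wpM2r //.
rewrite -[leLHS]real_normK ?num_real // ler_pXn2r ?nnegrE //.
exact: le_trans (normr_ge0 _) (cA i).
Qed.

(** Bounded coefficients and summable squared lengths suffice, with no randomness involved: this is
    where truncation of the Gaussian increments yields convergence of the noise series for every
    sample. *)
Lemma orthogonal_series_cauchy (c : nat -> R) A : (forall i, `|c i| <= A) ->
  ncauchy nrm (fun N => \sum_(i < N) c i *: v i).
Proof.
move=> cA eps eps0; have nrmP := ip_seminorm ipP.
pose E N := \sum_(i < N) e i.
have ndE : nondecreasing_seq E.
  by apply/nondecreasing_seqP => N; rewrite /E big_ord_recr /= lerDl.
have cE : cvgn E.
  by apply: nondecreasing_is_cvgn => //; exists Ce => _ [N _ <-]; exact: e_sum.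
have A10 : 0 < A ^+ 2 + 1 by rewrite ltr_wpDl ?sqr_ge0.
have d0 : 0 < eps ^+ 2 / (A ^+ 2 + 1) by rewrite divr_gt0 // exprn_gt0.
(* The added 1 in the denominator avoids dividing by zero when the bound A is zero. *)
have [N0 _ hN0] : \forall N \near \oo, limn E - E N < eps ^+ 2 / (A ^+ 2 + 1).
  by move/cvgrPdist_lt: cE => /(_ _ d0); apply: filterS => N; exact: le_lt_trans (ler_norm _).
have key M N : (N0 <= N)%N -> (N <= M)%N ->
    nrm (\sum_(i < M) c i *: v i - \sum_(i < N) c i *: v i) < eps.
  move=> N0N NM /=; rewrite -[eps]ger0_norm ?ltW // -sqrtr_sqr ltr_sqrt ?exprn_gt0 //.
  rewrite sqr_norm_orthogonal_tail //.
  apply: (@le_lt_trans _ _ (A ^+ 2 * (E M - E N))).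
    rewrite /E (sum_ord_split e NM) addrAC subrr add0r mulr_sumr.
    apply: ler_sum => i _; rewrite ler_wpM2r //.
    rewrite -[leLHS]real_normK ?num_real // ler_pXn2r ?nnegrE //.
    exact: le_trans (normr_ge0 _) (cA i).
  have h1 : E M - E N <= limn E - E N by rewrite lerD2r; exact: nondecreasing_cvgn_le.
  have h2 : 0 <= E M - E N by rewrite subr_ge0; exact: ndE.
  have := hN0 N N0N; rewrite ltr_pdivlMr // => h3.
  by apply: le_lt_trans h3; rewrite mulrC ler_pM ?sqr_ge0 // lerDl.
exists N0 => m n N0m N0n; have [nm|/ltnW mn] := leqP n m; first exact: key.
by rewrite (semiBC nrmP); exact: key.
Qed.

End orthogonal_series.

Section measurable_HH.
Context {R : realType} {lo hi : R3 R}.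
Local Notation V := (HH lo hi).
Local Notation B := (borelH lo hi).
Local Notation L2D := (L2 (muD lo hi)).
Local Notation mR := (measurableTypeR R).
Variable D : nat -> V.
Hypothesis Ddense : forall x e, 0 < e -> exists k, normH (x - D k) < e.
Context {d : measure_display} {T : measurableType d}.

Lemma measurable_lipschitz_comp L (G : V -> V) (f : T -> V) :
  (forall x y, normH (G x - G y) <= L * normH (x - y)) ->
  measurable_fun [set: T] (f : T -> B) -> measurable_fun [set: T] (G \o f : T -> B).
Proof.
move=> GL mf; apply: measurable_borel => psi psiL.
have mG : measurable_fun [set: B] (psi \o G : B -> mR).
  apply: (@measurable_lipschitz _ _ _ L) => x y.
  by apply: le_trans (psiL _ _) _; rewrite mul1r; exact: GL.
exact: (measurableT_comp mG mf).
Qed.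

Lemma measurable_HHD (f g : T -> V) : measurable_fun [set: T] (f : T -> B) ->
  measurable_fun [set: T] (g : T -> B) -> measurable_fun [set: T] (fun t => f t + g t : B).
Proof.
move=> mf mg; apply: (measurable_caratheodory Ddense (Psi := fun t v => f t + v) (f := g)) => [v|t h x hx|]; last exact: mg.
  apply: (@measurable_lipschitz_comp 1 (fun x => x + v)) => [x y|]; last exact: mf.
  by rewrite mul1r opprD addrACA subrr addr0.
exact: (ncvgD (normHP lo hi) (ncvg_cst (normHP lo hi) (f t)) hx).
Qed.

Lemma measurable_HHZ (z : T -> R) (v : V) : measurable_fun [set: T] (z : T -> mR) ->
  measurable_fun [set: T] (fun t => z t *: v : B).
Proof.
move=> mz; apply: measurable_borel => psi psiL.
apply: (measurableT_comp (f := fun a : mR => psi (a *: v)) _ mz).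
apply: continuous_measurable_fun => a.
have v0 : 0 < normH v + 1 by rewrite ltr_wpDl // normH_ge0.
apply/cvgrPdist_lt => eps eps0; exists (eps / (normH v + 1)); first by rewrite /= divr_gt0.
move=> b /= ab; apply: le_lt_trans (psiL _ _) _; rewrite mul1r -scalerBl normHZ.
apply: (@le_lt_trans _ _ (`|a - b| * (normH v + 1))); first by rewrite ler_wpM2l // lerDl.
by rewrite -ltr_pdivlMr.
Qed.

Lemma measurable_HH_sum N (f : nat -> T -> V) :
  (forall i, measurable_fun [set: T] (f i : T -> B)) ->
  measurable_fun [set: T] (fun t => \sum_(i < N) f i t : B).
Proof.
move=> mf; elim: N => [|N IH].
  rewrite (_ : (fun t => _) = cst 0); first exact: measurable_cst.
  by apply/funext => t; rewrite big_ord0.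
rewrite (_ : (fun t => _) = (fun t => \sum_(i < N) f i t + f N t)); first exact: measurable_HHD.
by apply/funext => t; rewrite big_ord_recr.
Qed.

(** An isometric copy of L^2 inside [HH]. The two noises of a step are stored as components 0 and 1
    of one vector, so that the Borel theory of [HH] covers them jointly. *)
Definition injH (j : 'I_3) (f : L2D) : V := ([ffun i => if i == j then f else 0], 0).

Lemma injHL j c f g : injH j (c *: f + g) = c *: injH j f + injH j g.
Proof.
apply: HH_ext => i; last by rewrite HH2D HH2Z !ffunE scaler0 addr0.
by rewrite HH1D HH1Z !ffunE; case: (i == j); rewrite // scaler0 addr0.
Qed.

Lemma injH0 j : injH j 0 = 0.
Proof. by have := injHL j (-1) 0 0; rewrite scaleN1r oppr0 addr0 scaleN1r addNr. Qed.
Lemma injHZ j c f : injH j (c *: f) = c *: injH j f.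
Proof. by rewrite -[c *: f]addr0 injHL injH0 addr0. Qed.
Lemma injHB j f g : injH j (f - g) = injH j f - injH j g.
Proof. by rewrite addrC -scaleN1r injHL scaleN1r addrC. Qed.
Lemma injH_sum j (I : Type) (r : seq I) (c : I -> R) (f : I -> L2D) :
  injH j (\sum_(i <- r) c i *: f i) = \sum_(i <- r) c i *: injH j (f i).
Proof.
elim: r => [|i r IH]; first by rewrite !big_nil injH0.
by rewrite !big_cons injHL IH.
Qed.

Lemma normH_injH j f : normH (injH j f) = normL2 f.
Proof.
rewrite /normH /normL2 /ipH /= [X in _ + X]big1 ?addr0; last first.
  by move=> i _; rewrite ffunE (ip0l (ipL2P _)).
rewrite (bigD1 j) //= big1 ?addr0 => [|i ij]; rewrite ffunE ?eqxx //.
by rewrite (negbTE ij) (ip0l (ipL2P _)).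
Qed.

Lemma measurable_injH j (f : T -> L2D) : measurable_fun [set: T] (f : T -> borelL2 (muD lo hi)) ->
  measurable_fun [set: T] (fun t => injH j (f t) : B).
Proof.
move=> mf; apply: (@measurability _ _ _ B setT (fun t => injH j (f t)) (norm_open (@normH R lo hi))) => // _ [U Uo <-].
rewrite setTI -[_ @^-1` U]/(f @^-1` (injH j @^-1` U)) -[X in measurable X]setTI; apply: mf => //.
apply: sub_sigma_algebra => g /Uo[eps eps0 h]; exists eps => // g' gg'.
by apply: h; rewrite -injHB normH_injH.
Qed.

End measurable_HH.
Lemma sqr_le_sum_sqr (R : realFieldType) (a x y : R) : 0 <= x -> 0 <= y -> 0 <= a -> a <= y + x ->
  a ^+ 2 <= 2 * y ^+ 2 + 2 * x ^+ 2.
Proof.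
move=> x0 y0 a0 h; have := sqr_ge0 (y - x).
have : 0 <= (y + x - a) * (y + x + a) by apply: mulr_ge0; lra.
by rewrite !expr2; lra.
Qed.

Lemma noise_bound (R : realFieldType) (n a e p : R) : 0 <= a -> 0 <= n -> 0 <= e -> 0 <= p ->
  n <= a + (e + p) -> n ^+ 2 <= 2 * a ^+ 2 + (4 * e ^+ 2 + 4 * p ^+ 2).
Proof.
move=> a0 n0 e0 p0 h; have := sqr_le_sum_sqr (addr_ge0 e0 p0) a0 n0 h.
have := sqr_le_sum_sqr e0 p0 (addr_ge0 p0 e0) (lexx _).
by rewrite [p + e]addrC; lra.
Qed.

(** Convexity of the square with weights r and 1 - r, applied to x and c e / (1 - r); it keeps the
    factor r < 1 in front of x^2. *)
Lemma convex_sqr_bound (R : realFieldType) (r c n x e : R) : 0 < r < 1 -> 0 <= n -> 0 <= x -> 0 <= c ->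
  0 <= e -> n <= r * x + c * e -> n ^+ 2 <= r * x ^+ 2 + c ^+ 2 / (1 - r) * e ^+ 2.
Proof.
move=> /andP[r0 r1] n0 x0 c0 e0 h; have r1' : 0 < 1 - r by rewrite subr_gt0.
apply: (@le_trans _ _ ((r * x + c * e) ^+ 2)).
  by rewrite ler_pXn2r ?nnegrE // addr_ge0 // mulr_ge0 // ltW.
rewrite -subr_ge0.
have -> : r * x ^+ 2 + c ^+ 2 / (1 - r) * e ^+ 2 - (r * x + c * e) ^+ 2
  = r / (1 - r) * ((1 - r) * x - c * e) ^+ 2 by field; rewrite gt_eqF.
by rewrite mulr_ge0 ?sqr_ge0 // divr_ge0 // ltW.
Qed.

Lemma cvg0Z (R : realType) (s : R) (a : nat -> R) : a @ \oo --> (0 : R) ->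
  (fun k => s * a k) @ \oo --> (0 : R).
Proof. by move=> a0; rewrite -[0 in X in _ --> X](mulr0 s); apply: cvgM => //; exact: cvg_cst. Qed.

Lemma cvg0D (R : realType) (a a' : nat -> R) : a @ \oo --> (0 : R) -> a' @ \oo --> (0 : R) ->
  (fun k => a k + a' k) @ \oo --> (0 : R).
Proof. by move=> a0 a'0; rewrite -[0 in X in _ --> X](addr0 0); exact: cvgD. Qed.

Lemma cvg0_sub (R : realType) (a : nat -> R) (s : nat -> nat) : (forall l, (l <= s l)%N) ->
  a @ \oo --> (0 : R) -> (fun l => a (s l)) @ \oo --> (0 : R).
Proof.
by move=> ls a0 E /a0[N _ h]; exists N => // l /= Nl; apply: h; exact: leq_trans Nl (ls l).
Qed.

Section normed_limits.
Context {R : realType} {V : lmodType R} (nrm : V -> R).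
Hypothesis nrmP : seminorm nrm.

Lemma ncvg_scale (x : nat -> R) (l : R) (v : V) : x @ \oo --> l ->
  ncvg nrm (fun i => x i *: v) (l *: v).
Proof.
move=> xl; rewrite /ncvg (_ : (fun i => _) = fun i => nrm v * `|x i - l|); last first.
  by apply/funext => i; rewrite -scalerBl (semiZ nrmP) mulrC.
have xl0 : (fun i => x i - l) @ \oo --> (0 : R).
  by rewrite -(subrr l); apply: cvgB => //; exact: cvg_cst.
suff : (fun i => `|x i - l|) @ \oo --> `|0 : R| by rewrite normr0; exact: cvg0Z.
exact: (cvg_norm xl0).
Qed.

Lemma ncvg_sum N (f : nat -> nat -> V) g : (forall i, ncvg nrm (f ^~ i) (g i)) ->
  ncvg nrm (fun n => \sum_(i < N) f n i) (\sum_(i < N) g i).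
Proof.
move=> fg; elim: N => [|N IH].
  by rewrite (_ : (fun n => _) = fun=> \sum_(i < 0) g i);
    [exact: (ncvg_cst nrmP)|apply/funext => n; rewrite !big_ord0].
rewrite (_ : (fun n => _) = fun n => \sum_(i < N) f n i + f n N).
  by rewrite big_ord_recr; apply: (ncvgD nrmP).
by apply/funext => n; rewrite big_ord_recr.
Qed.

End normed_limits.

Lemma six_sevenths (R : realFieldType) (e : R) : 0 < e ->
  \sum_(i < 3) e / 7 + \sum_(i < 3) e / 7 < e.
Proof. by move=> e0; rewrite !big_ord_recl !big_ord0; lra. Qed.

Section mode_index.
Variable N : nat.

Definition mode_index (a : 'I_N + 'I_N) : nat + nat :=
  match a with inl i => inl (val i) | inr i => inr (val i) end.

Lemma mode_index_inj : injective mode_index.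
Proof. by move=> [i|i] [j|j] //= [] /val_inj ->. Qed.

End mode_index.

(** * Law of the noise under splicing, from finitely many modes to the limit *)

Section noise_exchange.
Context {R : realType} {lo hi : R3 R} {d : measure_display} {Omega : measurableType d}.
Local Notation V := (HH lo hi).
Local Notation B := (borelH lo hi).
Local Notation mR := (measurableTypeR R).
Local Notation ncvgH := (ncvg (@normH R lo hi)).
Variable P : probability Omega R.

Lemma product_setT : (P \x P)%E [set: Omega * Omega] = 1%E.
Proof.
rewrite -setXTT product_measure1E // -[RHS]mule1.
by congr (_ * _)%E; exact: probability_setT.
Qed.

Definition square_probability : probability (Omega * Omega)%type R := to_probability product_setT.
Local Notation PP := square_probability.

Lemma ae_fst (Q : Omega -> Prop) : (\forall w \ae P, Q w) -> \forall z \ae PP, Q z.1.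
Proof.
move=> [N [mN N0 QN]]; exists (N `*` setT); split; first exact: measurableX.
  apply: etrans (product_measure1E P P mN measurableT) _.
  exact: etrans (congr1 (fun t => t * _)%E N0) (mul0e _).
by move=> [w w'] /= h; split=> //; exact: QN.
Qed.

Lemma ae_snd (Q : Omega -> Prop) : (\forall w \ae P, Q w) -> \forall z \ae PP, Q z.2.
Proof.
move=> [N [mN N0 QN]]; exists (setT `*` N); split; first exact: measurableX.
  apply: etrans (product_measure1E P P measurableT mN) _.
  exact: etrans (congr1 (fun t => _ * t)%E N0) (mule0 _).
by move=> [w w'] /= h; split=> //; exact: QN.
Qed.

Variables (K n M : nat) (phi : (nat -> V) -> R) (C : R).
Hypothesis KE : K = (n + M)%N.
Hypothesis phiC : forall f, `|phi f| <= C.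
Hypothesis phi_continuous : forall (f : nat -> nat -> V) g,
  (forall k, (k < K)%N -> ncvgH (f ^~ k) (g k)) -> phi \o f @ \oo --> phi g.

(** Continuity along a constant sequence: the hypothesis only looks at the first K entries, so phi
    cannot depend on the others. *)
Lemma phi_ext f g : (forall k, (k < K)%N -> f k = g k) -> phi f = phi g.
Proof.
move=> fg; have : (fun _ : nat => phi f) @ \oo --> phi g.
  by apply: (@phi_continuous (fun=> f) g) => k kK; rewrite -fg //; exact: (ncvg_cst (normHP lo hi)).
by move=> h; exact: (cvg_unique _ (cvg_cst _) h).
Qed.

Variables (Ft : R -> set (set Omega)) (X : nat + nat -> R -> Omega -> R) (dt : R).
Hypothesis Ft_filtration : filtration Ft.
Hypothesis X_BM : forall j, brownian_motion P Ft (X j).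
Hypothesis X_indep : independent_processes P X.
Hypothesis dt0 : 0 < dt.
Local Notation Z := (bm_increment X dt).

Section fixed_modes.
Variables (N : nat) (modes : (nat + nat -> R) -> V).

Let J : finType := ('I_N + 'I_N)%type.
Hypothesis modes_ext : forall z z', (forall a : 'I_N + 'I_N, z (mode_index a) = z' (mode_index a)) ->
  modes z = modes z'.
Hypothesis modes_continuous : forall (z : nat -> nat + nat -> R) l,
  (forall j, z ^~ j @ \oo --> l j) -> ncvgH (fun i => modes (z i)) (modes l).

Let ext (z : J -> R) (j : nat + nat) : R :=
  if [pick a | mode_index a == j] is Some a then z a else 0.

Let extE z a : ext z (mode_index a) = z a.
Proof.
by rewrite /ext; case: pickP => [c /eqP/mode_index_inj ->//|/(_ a)]; rewrite eqxx.
Qed.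

(** The observable as a function of finitely many real increments, one for each mode and time step,
    to which equality of laws on rectangles applies. *)
Let Phi (z : J * 'I_K -> R) : R :=
  phi (fun k => if insub k is Some k' then modes (ext (fun a => z (a, k'))) else 0).

Let Phi_continuous : coord_continuous Phi.
Proof.
move=> z l zl; apply: phi_continuous => k kK; rewrite insubT.
apply: modes_continuous => j; rewrite /ext; case: pickP => [a _|_]; [exact: zl|exact: cvg_cst].
Qed.

Let PhiE (f : J -> nat -> R) : Phi (fun ak => f ak.1 (val ak.2)) =
  phi (fun k => modes (ext (f ^~ k))).
Proof. by apply: phi_ext => k kK; rewrite insubT. Qed.

Let mZ j k : measurable_fun [set: Omega] (Z j k : Omega -> mR).
Proof. exact: (measurable_bm_increment Ft_filtration X_BM dt0). Qed.

Let Z1 (ak : J * 'I_K) w := Z (mode_index ak.1) ak.2 w.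
Let Z2 (ak : J * 'I_K) (z : Omega * Omega) :=
  splice n (Z (mode_index ak.1) ^~ z.1) (Z (mode_index ak.1) ^~ z.2) ak.2.

Let mZ2 ak : measurable_fun [set: Omega * Omega] (Z2 ak : _ -> mR).
Proof.
rewrite /Z2 /splice; case: (ltnP ak.2 n) => _.
  exact: (measurableT_comp (mZ _ _) measurable_snd).
exact: (measurableT_comp (mZ _ _) measurable_fst).
Qed.

Let modesE1 w : Phi (Z1 ^~ w) = phi (fun k => modes (fun j => Z j k w)).
Proof.
rewrite (PhiE (fun a k => Z (mode_index a) k w)); congr phi; apply/funext => k.
by apply: modes_ext => a; rewrite extE.
Qed.

Let modesE2 z : Phi (Z2 ^~ z) = phi (splice n (fun k => modes (fun j => Z j k z.1))
  (fun k => modes (fun j => Z j k z.2))).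
Proof.
rewrite (PhiE (fun a k => splice n (Z (mode_index a) ^~ z.1) (Z (mode_index a) ^~ z.2) k)).
congr phi; apply/funext => k; rewrite /splice; case: ifP => kn;
  by apply: modes_ext => a; rewrite extE.
Qed.

(** The version with N modes per noise, where the joint law of finitely many Brownian increments
    decides. *)
Lemma modes_exchange :
  [/\ measurable_fun [set: Omega] (fun w => phi (fun k => modes (fun j => Z j k w)) : mR),
      measurable_fun [set: Omega * Omega] (fun z =>
        phi (splice n (fun k => modes (fun j => Z j k z.1)) (fun k => modes (fun j => Z j k z.2))) : mR) &
      (\int[P]_w phi (fun k => modes (fun j => Z j k w)) =
       \int[PP]_z phi (splice n (fun k => modes (fun j => Z j k z.1)) (fun k => modes (fun j => Z j k z.2))))%R].
Proof.
split.
- rewrite (_ : (fun w => _) = fun w => Phi (Z1 ^~ w)); last by apply/funext => w; rewrite modesE1.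
  by apply: (measurable_coord_continuous Phi_continuous P) => ak; exact: mZ.
- rewrite (_ : (fun z => _) = fun z => Phi (Z2 ^~ z)); last by apply/funext => z; rewrite modesE2.
  by apply: (measurable_coord_continuous Phi_continuous PP) => ak; exact: mZ2.
under eq_Rintegral do rewrite -modesE1.
under [RHS]eq_Rintegral do rewrite -modesE2.
apply: (expectation_eq_law Phi_continuous (C := C)) => [z|ak|ak|E mE]; [exact: phiC|exact: mZ|exact: mZ2|].
pose E' a k : set mR := if insub k is Some k' then E (a, k') else setT.
have mE' a k : measurable (E' a k) by rewrite /E'; case: insubP.
have E'E a (k : 'I_K) : E' a (val k) = E (a, k) by rewrite /E' valK.
have rectE (T : Type) (f : J -> nat -> T -> R) :
    [set w | forall ak, E ak (f ak.1 (val ak.2) w)] =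
    [set w | forall a, rectangle (f a) (E' a) (n + M) w].
  rewrite -KE; apply/seteqP; split=> w /= h.
    by move=> a k kK; rewrite /E' insubT; exact: (h (a, Sub k kK)).
  by move=> [a k] /=; rewrite -E'E; exact: (h a k (ltn_ord k)).
rewrite (rectE _ (fun a k w => Z (mode_index a) k w)).
rewrite (rectE _ (fun a k z => splice n (Z (mode_index a) ^~ z.1) (Z (mode_index a) ^~ z.2) k)).
symmetry; exact: (splice_rectangle Ft_filtration X_BM X_indep dt0 (@mode_index_inj N)).
Qed.

End fixed_modes.

Variables (modes : nat -> (nat + nat -> R) -> V) (Gam : nat -> Omega -> V) (sub : nat -> nat).
Hypothesis modes_ext : forall N z z', (forall a : 'I_N + 'I_N, z (mode_index a) = z' (mode_index a)) ->
  modes N z = modes N z'.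
Hypothesis modes_continuous : forall N (z : nat -> nat + nat -> R) l,
  (forall j, z ^~ j @ \oo --> l j) -> ncvgH (fun i => modes N (z i)) (modes N l).
Hypothesis modes_cvg : \forall w \ae P, forall k, (k < K)%N ->
  ncvgH (fun l => modes (sub l) (fun j => Z j k w)) (Gam k w).
Hypothesis mGam1 : measurable_fun [set: Omega] (fun w => phi (Gam ^~ w) : mR).
Hypothesis mGam2 : measurable_fun [set: Omega * Omega]
  (fun z => phi (splice n (Gam ^~ z.1) (Gam ^~ z.2)) : mR).

(** The identity holds for each number of modes; along the subsequence [sub] the modes converge
    almost surely at all K times, and phi is bounded and continuous, so both expectations
    converge. *)
Lemma noise_exchange :
  (\int[P]_w phi (Gam ^~ w) = \int[PP]_z phi (splice n (Gam ^~ z.1) (Gam ^~ z.2)))%R.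
Proof.
have ex l := modes_exchange (@modes_ext (sub l)) (@modes_continuous (sub l)).
have c1 : (fun l => \int[P]_w phi (fun k => modes (sub l) (fun j => Z j k w)))%R @ \oo
    --> (\int[P]_w phi (Gam ^~ w))%R.
  apply: (dominated_cvg_Rintegral (g := fun=> C)) => //.
  - by move=> l; case: (ex l).
  - by apply: filterS modes_cvg => w h; exact: phi_continuous.
  - exact: finite_measure_integrable_cst.
have c2 : (fun l => \int[PP]_z phi (splice n (fun k => modes (sub l) (fun j => Z j k z.1))
    (fun k => modes (sub l) (fun j => Z j k z.2))))%R @ \oo
    --> (\int[PP]_z phi (splice n (Gam ^~ z.1) (Gam ^~ z.2)))%R.
  apply: (dominated_cvg_Rintegral (g := fun=> C)) => //.
  - by move=> l; case: (ex l).
  - apply: filterS2 (ae_fst modes_cvg) (ae_snd modes_cvg) => z h1 h2.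
    apply: (phi_continuous (f := fun l => splice n (fun k => modes (sub l) (fun j => Z j k z.1))
      (fun k => modes (sub l) (fun j => Z j k z.2)))) => k kK.
    rewrite /splice; case: ifPn => [kn|]; [apply: h2|rewrite -leqNgt => nk; apply: h1].
      by rewrite KE; apply: leq_trans (leq_addr M n); rewrite ltn_subrL (leq_ltn_trans _ kn).
    exact: leq_ltn_trans (leq_subr _ _) kK.
  - exact: finite_measure_integrable_cst.
suff E : (fun l => \int[P]_w phi (fun k => modes (sub l) (fun j => Z j k w)))%R =
    (fun l => \int[PP]_z phi (splice n (fun k => modes (sub l) (fun j => Z j k z.1))
    (fun k => modes (sub l) (fun j => Z j k z.2))))%R.
  by rewrite E in c1; exact: (cvg_unique _ c1 c2).
by apply/funext => l; case: (ex l).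
Qed.

End noise_exchange.

Section noise.
Context {R : realType} {lo hi : R3 R}.
Context {d : measure_display} {Omega : measurableType d}.
Local Notation V := (HH lo hi).
Local Notation B := (borelH lo hi).
Local Notation L2D := (L2 (muD lo hi)).
Local Notation mR := (measurableTypeR R).
Local Notation ncvgH := (ncvg (@normH R lo hi)).
Variables (P : probability Omega R) (Ft : R -> set (set Omega)).
Variables (D : nat -> V) (dt b : R) (q : nat -> L2D) (S : L2D -> L2D) (eta1 eta2 : nat -> R).
Variables (beta1 beta2 : nat -> R -> Omega -> R) (W2 : R -> Omega -> L2D) (C1 C2 : R).
Hypothesis Ddense : forall x e, 0 < e -> exists k, normH (x - D k) < e.
Hypothesis dt0 : 0 < dt.
Hypothesis q_orth : forall i j, ipL2 (q i) (q j) = (i == j)%:R.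
Hypothesis Sq_orth : forall i j, ipL2 (S (q i)) (S (q j)) = (i == j)%:R * eta1 i.
Hypothesis eta1_ge0 : forall i, 0 <= eta1 i.
Hypothesis eta2_ge0 : forall i, 0 <= eta2 i.
Hypothesis eta1_sum : forall N, \sum_(i < N) eta1 i <= C1.
Hypothesis eta2_sum : forall N, \sum_(i < N) eta2 i <= C2.
Hypothesis Ft_filtration : filtration Ft.
Local Notation X := (noise_family beta1 beta2).
Hypothesis X_BM : forall j, brownian_motion P Ft (X j).
Hypothesis X_indep : independent_processes P X.
Hypothesis W2_wiener : Q_wiener P eta2 q beta2 W2.
Local Notation Z := (bm_increment X dt).
Local Notation dW1 := (truncated_increment b dt q S beta1).
Local Notation dW2 := (increment dt W2).

Let ipP := ipL2P (muD lo hi).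
Let nP := normL2P (muD lo hi).
Let nHP := normHP lo hi.
Let A := Num.sqrt (2 * b * `|ln dt|).
Let clip (x : R) := Num.max (- A) (Num.min (x / Num.sqrt dt) A).

Let A0 : 0 <= A. Proof. exact: sqrtr_ge0. Qed.

Let clip_bound x : `|clip x| <= A.
Proof.
rewrite ler_norml /clip le_max lexx /= ge_max ge_min lexx orbT andbT.
by apply: le_trans A0; rewrite oppr_le0.
Qed.

Let clip_continuous : continuous clip.
Proof.
move=> x; apply: (@continuous_max R R (fun=> - A) ((fun y => y / Num.sqrt dt) \min (fun=> A)) x).
  exact: cvg_cst.
apply: continuous_min; last exact: cvg_cst.
by apply: cvgM; [exact: cvg_id|exact: cvg_cst].
Qed.

(** Existence of the limit, so that [sumL2] does not take its default value. It holds for every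
    sample point. *)
Lemma dW1_series k w :
  ncvg (@normL2 _ _ _ (muD lo hi)) (fun N => Num.sqrt dt *: \sum_(i < N) clip (Z (inl (val i)) k w) *: S (q i)) (dW1 k w).
Proof.
apply: (ncvgZ nP); have [l hl] := L2_complete (orthogonal_series_cauchy ipP Sq_orth eta1_ge0 eta1_sum
  (fun i => clip_bound (Z (inl i) k w))).
exact: (@xgetPex _ 0 [set l | (fun N => normL2 (\sum_(i < N) clip (Z (inl (val i)) k w) *: S (q i) - l)) @ \oo
  --> (0 : R)] (ex_intro _ l hl)).
Qed.

Lemma dW1_bound k w : normL2 (dW1 k w) <= Num.sqrt dt * Num.sqrt (A ^+ 2 * C1).
Proof.
apply: (ler_cvg_to (ncvg_nrm nP (dW1_series k w)) (cvg_cst _)); apply: nearW => N.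
rewrite (semiZ nP) ger0_norm ?sqrtr_ge0 // ler_wpM2l ?sqrtr_ge0 //; apply: ler_wsqrtr.
exact: (orthogonal_series_bound ipP Sq_orth eta1_ge0 eta1_sum _ (fun i => clip_bound (Z (inl i) k w))).
Qed.

Definition noise k w : V := injH 0 (dW1 k w) + injH 1 (dW2 k w).

(** The truncated noise as a deterministic function of the scalar increments, which separates the
    randomness from the space dependence. *)
Definition noise_modes N (z : nat + nat -> R) : V :=
  \sum_(i < N) (Num.sqrt dt * clip (z (inl (val i)))) *: injH 0 (S (q i))
  + \sum_(i < N) (Num.sqrt (eta2 i) * z (inr (val i))) *: injH 1 (q i).

Let partial2 N t w : L2D := \sum_(i < N) (Num.sqrt (eta2 i) * beta2 i t w) *: q i.
(** The error of the truncated series of W2 at time t; the error of an increment is a difference of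
    two of these. *)
Let U N t w : V := injH 1 (partial2 N t w - W2 t w).

Let measurable_U N t : 0 <= t -> measurable_fun [set: Omega] (U N t : Omega -> B).
Proof.
move=> t0; have [mW _] := W2_wiener t0.
rewrite (_ : U N t = fun w => \sum_(i < N) (Num.sqrt (eta2 i) * beta2 i t w) *: injH 1 (q i)
   + (-1) *: injH 1 (W2 t w)).
  apply: (measurable_HHD Ddense).
    apply: (@measurable_HH_sum _ _ _ _ Ddense _ _ N (fun i w => (Num.sqrt (eta2 i) * beta2 i t w) *: injH 1 (q i))) => i.
    apply: measurable_HHZ; apply: measurable_funM => //.
    exact: (measurable_brownian Ft_filtration X_BM (inr i)).
  apply: (measurable_lipschitz_comp (L := 1) (G := fun x => (-1) *: x)); last exact: measurable_injH.
  by move=> x y; rewrite mul1r -scalerBr normHZ normrN1 mul1r.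
by apply/funext => w; rewrite /U /partial2 injHB injH_sum scaleN1r.
Qed.

Let time_ge0 k : 0 <= k%:R * dt. Proof. by rewrite mulr_ge0 // ltW. Qed.

Let err N k w : V := U N (k.+1%:R * dt) w - U N (k%:R * dt) w.

Let measurable_err N k : measurable_fun [set: Omega] (err N k : Omega -> B).
Proof.
rewrite (_ : err N k = fun w => U N (k.+1%:R * dt) w + (-1) *: U N (k%:R * dt) w); last first.
  by apply/funext => w; rewrite scaleN1r.
apply: (measurable_HHD Ddense); first exact: measurable_U.
apply: (measurable_lipschitz_comp (L := 1) (G := fun x => (-1) *: x)); last exact: measurable_U.
by move=> x y; rewrite mul1r -scalerBr normHZ normrN1 mul1r.
Qed.

Let measurable_sqr_norm (f : Omega -> V) : measurable_fun [set: Omega] (f : Omega -> B) ->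
  measurable_fun [set: Omega] (fun w => normH (f w) ^+ 2 : mR).
Proof.
move=> mf; apply: measurable_funX; apply: (measurableT_comp (f := @normH R lo hi : B -> mR) _ mf).
by apply: (@measurable_lipschitz _ _ _ 1) => x y; rewrite mul1r normH_dist.
Qed.

Let sqr_err N k w : normH (err N k w) ^+ 2 <=
  2 * normH (U N (k.+1%:R * dt) w) ^+ 2 + 2 * normH (U N (k%:R * dt) w) ^+ 2.
Proof.
have := normHB (U N (k.+1%:R * dt) w) (U N (k%:R * dt) w).
have := normH_ge0 (err N k w); rewrite -/(err N k w).
have := normH_ge0 (U N (k.+1%:R * dt) w); have := normH_ge0 (U N (k%:R * dt) w).
exact: sqr_le_sum_sqr.
Qed.

(** [Q_wiener] gives mean-square convergence at each time separately, here at the two end points of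
    step k. *)
Let err_small k (e : R) : 0 < e -> exists N0, forall N, (N0 <= N)%N ->
  (\int[P]_w (normH (err N k w) ^+ 2)%:E <= e%:E)%E.
Proof.
move=> e0; have small t : 0 <= t -> exists N0, forall N, (N0 <= N)%N ->
    (\int[P]_w (normH (U N t w) ^+ 2)%:E <= (e / 4)%:E)%E.
  move=> t0; have [_ cW] := W2_wiener t0.
  have e4 : (0 < (e / 4)%:E)%E by rewrite lte_fin divr_gt0.
  have [N0 _ h] : \forall N \near \oo,
      (\int[P]_w (normL2 (partial2 N t w - W2 t w) ^+ 2)%:E < (e / 4)%:E)%E.
    exact: (cW _ (open_ereal_lt' e4)).
  exists N0 => N NN; apply: ltW.
  have -> : (\int[P]_w (normH (U N t w) ^+ 2)%:E
     = \int[P]_w (normL2 (partial2 N t w - W2 t w) ^+ 2)%:E)%E.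
    by apply: eq_integral => w _; rewrite normH_injH.
  exact: h.
have [N1 h1] := small _ (time_ge0 k.+1); have [N2 h2] := small _ (time_ge0 k).
exists (maxn N1 N2) => N; rewrite geq_max => /andP[/h1 {}h1 /h2 {}h2].
have m1 t : 0 <= t -> measurable_fun [set: Omega] (fun w => (normH (U N t w) ^+ 2)%:E).
  by move=> t0; apply/measurable_EFinP/measurable_sqr_norm; exact: measurable_U.
have p1 t w : (0 <= (normH (U N t w) ^+ 2)%:E)%E by rewrite lee_fin sqr_ge0.
apply: (@le_trans _ _ (\int[P]_w (2%:E * (normH (U N (k.+1%:R * dt) w) ^+ 2)%:E
   + 2%:E * (normH (U N (k%:R * dt) w) ^+ 2)%:E))%E).
  apply: ge0_le_integral => //.
  - by move=> w _; rewrite lee_fin sqr_ge0.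
  - by apply/measurable_EFinP/measurable_sqr_norm; exact: measurable_err.
  - by apply: emeasurable_funD; apply: measurable_funeM; exact: m1.
  by move=> w _; rewrite -!EFinM -EFinD lee_fin; exact: sqr_err.
rewrite ge0_integralD //; last 4 first.
- by move=> w _; rewrite mule_ge0.
- by apply: measurable_funeM; exact: m1.
- by move=> w _; rewrite mule_ge0.
- by apply: measurable_funeM; exact: m1.
rewrite !ge0_integralZl_EFin //; [|exact: m1|exact: m1].
have -> : (e%:E = 2%:E * (e / 4)%:E + 2%:E * (e / 4)%:E)%E.
  by rewrite -!EFinM -EFinD; congr EFin; field.
have two0 : (0 <= 2%:E :> \bar R)%E by rewrite lee_fin.
exact: (leeD (lee_wpmul2l two0 h1) (lee_wpmul2l two0 h2)).
Qed.

Let mode1_err N k w :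
  \sum_(i < N) (Num.sqrt dt * clip (Z (inl (val i)) k w)) *: injH 0 (S (q i)) - injH 0 (dW1 k w)
  = injH 0 (Num.sqrt dt *: (\sum_(i < N) clip (Z (inl (val i)) k w) *: S (q i)) - dW1 k w).
Proof.
rewrite [RHS]injHB [X in _ = X - _]injHZ injH_sum scaler_sumr; congr (_ - _).
by apply: eq_bigr => i _; rewrite scalerA.
Qed.

Let mode2_err N k w :
  \sum_(i < N) (Num.sqrt (eta2 i) * Z (inr (val i)) k w) *: injH 1 (q i) - injH 1 (dW2 k w)
  = err N k w.
Proof.
transitivity (injH 1 ((partial2 N (k.+1%:R * dt) w - partial2 N (k%:R * dt) w) - dW2 k w)).
  rewrite [RHS]injHB; congr (_ - _); rewrite -injH_sum; congr injH.
  by rewrite -sumrB; apply: eq_bigr => i _; rewrite -scalerBl -mulrBr.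
by rewrite /err /U -injHB; congr injH; rewrite !opprD !opprK addrACA.
Qed.

Let measurable_dW2 k : measurable_fun [set: Omega] (fun w => injH 1 (dW2 k w) : B).
Proof.
have mW k' : measurable_fun [set: Omega] (fun w => injH 1 (W2 (k'%:R * dt) w) : B).
  by apply: measurable_injH; case: (W2_wiener (time_ge0 k')).
rewrite (_ : (fun w => _) = fun w => injH 1 (W2 (k.+1%:R * dt) w) + (-1) *: injH 1 (W2 (k%:R * dt) w)).
  apply: (measurable_HHD Ddense) => //.
  apply: (measurable_lipschitz_comp (L := 1) (G := fun x => (-1) *: x)); last exact: mW.
  by move=> x y; rewrite mul1r -scalerBr normHZ normrN1 mul1r.
by apply/funext => w; rewrite /increment injHB scaleN1r.
Qed.

Let measurable_mode N (c : nat -> R) (f : nat -> R -> R) (v : nat -> V) (j : nat -> nat + nat) k :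
  (forall i, continuous (f i)) ->
  measurable_fun [set: Omega] (fun w => \sum_(i < N) (c i * f i (Z (j i) k w)) *: v i : B).
Proof.
move=> cf; apply: (@measurable_HH_sum _ _ _ _ Ddense _ _ N (fun i w => (c i * f i (Z (j i) k w)) *: v i)) => i.
apply: measurable_HHZ; apply: measurable_funM => //.
apply: (measurableT_comp (f := f i : mR -> mR)); first exact: continuous_measurable_fun.
exact: (measurable_bm_increment Ft_filtration X_BM dt0).
Qed.

Let measurable_dW1 k : measurable_fun [set: Omega] (fun w => injH 0 (dW1 k w) : B).
Proof.
apply: (measurable_ncvg (f := fun N w => \sum_(i < N) (Num.sqrt dt * clip (Z (inl (val i)) k w)) *: injH 0 (S (q i)))).
  move=> N; exact: (@measurable_mode N (fun=> Num.sqrt dt) (fun=> clip) (fun i => injH 0 (S (q i))) inl k (fun=> clip_continuous)).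
move=> w; suff E : (fun N => normH (\sum_(i < N) (Num.sqrt dt * clip (Z (inl (val i)) k w)) *: injH 0 (S (q i)) - injH 0 (dW1 k w)))
   = (fun N => normL2 (Num.sqrt dt *: (\sum_(i < N) clip (Z (inl (val i)) k w) *: S (q i)) - dW1 k w)).
  by rewrite /ncvg E; exact: dW1_series.
by apply/funext => N; rewrite mode1_err normH_injH.
Qed.

Lemma measurable_noise k : measurable_fun [set: Omega] (noise k : Omega -> B).
Proof. exact: (measurable_HHD Ddense (measurable_dW1 k) (measurable_dW2 k)). Qed.

(** The first noise is bounded outright by [a]. The second is a finite sum p minus an error whose
    second moment is at most 1 for suitable N; orthogonality bounds the second moment of p by C2
    times that of one Gaussian increment, for every k and N alike. *)
Lemma noise_second_moment : exists M, forall k,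
  (\int[P]_w (normH (noise k w) ^+ 2)%:E <= M%:E)%E.
Proof.
have sq0 : 0 < Num.sqrt dt by rewrite sqrtr_gt0.
have [G hG] : exists G, forall j k, (\int[P]_w (Z j k w ^+ 2)%:E <= G%:E)%E.
  eexists => j k; apply: (gaussian_second_moment sq0); last exact: (bm_increment_law X_BM dt0).
  exact: (measurable_bm_increment Ft_filtration X_BM dt0).
pose a := Num.sqrt dt * Num.sqrt (A ^+ 2 * C1).
have a0 : 0 <= a by rewrite mulr_ge0 ?sqrtr_ge0.
exists (2 * a ^+ 2 + (4 * 1 + 4 * (C2 * G))) => k; have [N hN] := err_small k ltr01.
have {hN}errN := hN N (leqnn N).
pose p w : V := injH 1 (\sum_(i < N) (Num.sqrt (eta2 i) * Z (inr (val i)) k w) *: q i).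
have G0 : 0 <= G.
  by rewrite -lee_fin; apply: le_trans (hG (inl 0%N) 0%N); apply: integral_ge0 => w _; rewrite lee_fin sqr_ge0.
have mZ2 i : measurable_fun [set: Omega] (fun w => (Z (inr i) k w ^+ 2)%:E).
  apply/measurable_EFinP; apply: measurable_funX.
  exact: (measurable_bm_increment Ft_filtration X_BM dt0).
have pE w : (normH (p w) ^+ 2)%:E = (\sum_(i < N) (eta2 i)%:E * (Z (inr (val i)) k w ^+ 2)%:E)%E.
  rewrite normH_injH sqr_normL2.
  have qo i j : ipL2 (q i) (q j) = (i == j)%:R * 1 by rewrite mulr1.
  rewrite (sqr_norm_orthogonal_sum ipP qo (fun i => Num.sqrt (eta2 i) * Z (inr i) k w)).
  rewrite -sumEFin; apply: eq_bigr => i _.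
  by rewrite mulr1 exprMn sqr_sqrtr // EFinM.
have pG : (\int[P]_w (normH (p w) ^+ 2)%:E <= (C2 * G)%:E)%E.
  under eq_integral do rewrite pE.
  rewrite ge0_integral_sum //; last 2 first.
  - by move=> i; exact: (measurable_funeM _ (mZ2 i)).
  - by move=> i w _; rewrite -EFinM lee_fin mulr_ge0 ?sqr_ge0.
  apply: (@le_trans _ _ (\sum_(i < N) (eta2 i)%:E * G%:E)%E).
    apply: lee_sum => i _; rewrite ge0_integralZl_EFin //; last by move=> w _; rewrite lee_fin sqr_ge0.
    by apply: lee_wpmul2l; rewrite ?lee_fin.
  under eq_bigr do rewrite -EFinM.
  by rewrite sumEFin -mulr_suml lee_fin ler_wpM2r.
have mp : measurable_fun [set: Omega] (p : Omega -> B).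
  rewrite (_ : p = fun w => \sum_(i < N) (Num.sqrt (eta2 i) * Z (inr (val i)) k w) *: injH 1 (q i)); last first.
    by apply/funext => w; rewrite /p injH_sum.
  exact: (@measurable_mode N (fun i => Num.sqrt (eta2 i)) (fun=> id) (fun i => injH 1 (q i)) inr k (fun _ x => cvg_id)).
have noise_le w : normH (noise k w) ^+ 2 <=
    2 * a ^+ 2 + (4 * normH (err N k w) ^+ 2 + 4 * normH (p w) ^+ 2).
  have e : injH 1 (dW2 k w) = p w - err N k w.
    by rewrite -mode2_err -injH_sum opprB addrC subrK.
  apply: noise_bound a0 (normH_ge0 _) (normH_ge0 _) (normH_ge0 _) _.
  apply: le_trans (normHD _ _) _; rewrite lerD //.
    by rewrite normH_injH; exact: dW1_bound.
  by rewrite e [leRHS]addrC; exact: normHB.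
have m2 (f : Omega -> V) : measurable_fun [set: Omega] (f : Omega -> B) ->
    measurable_fun [set: Omega] (fun w => (normH (f w) ^+ 2)%:E).
  by move=> mf; apply/measurable_EFinP; exact: measurable_sqr_norm.
apply: (@le_trans _ _ (\int[P]_w ((2 * a ^+ 2)%:E + (4%:E * (normH (err N k w) ^+ 2)%:E
    + 4%:E * (normH (p w) ^+ 2)%:E)))%E).
  apply: ge0_le_integral => //.
  - by move=> w _; rewrite lee_fin sqr_ge0.
  - by apply: m2; exact: measurable_noise.
  - apply: emeasurable_funD => //; apply: emeasurable_funD; apply: measurable_funeM; exact: m2.
  by move=> w _; rewrite -!EFinM -!EFinD lee_fin; exact: noise_le.
have q0 (f : Omega -> V) w : (0 <= 4%:E * (normH (f w) ^+ 2)%:E)%E.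
  by rewrite -EFinM lee_fin mulr_ge0 ?sqr_ge0.
have m4 (f : Omega -> V) : measurable_fun [set: Omega] (f : Omega -> B) ->
    measurable_fun [set: Omega] (fun w => (4%:E * (normH (f w) ^+ 2)%:E)%E).
  by move=> mf; apply: measurable_funeM; exact: m2.
rewrite ge0_integralD //; last 3 first.
- by move=> w _; rewrite lee_fin mulr_ge0 ?sqr_ge0.
- by move=> w _; rewrite adde_ge0.
- by apply: emeasurable_funD; exact: m4.
rewrite integral_cst1 ge0_integralD //; [|exact: m4|exact: m4].
rewrite !ge0_integralZl_EFin //; try exact: m2; try (by move=> w _; rewrite lee_fin sqr_ge0).
have four0 : (0 <= 4%:E :> \bar R)%E by rewrite lee_fin.
rewrite !EFinD (EFinM 4 1) (EFinM 4 (C2 * G)); apply: leeD => //.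
exact: (leeD (lee_wpmul2l four0 errN) (lee_wpmul2l four0 pG)).
Qed.

(** Mean-square convergence of the second noise yields almost sure convergence only along a
    subsequence. It is chosen so that the second moments of the errors decay geometrically for all
    of the first K steps at once; [l <= phi l] preserves the convergence of the first noise. *)
Lemma noise_modes_cvg K : exists phi : nat -> nat, (forall l, (l <= phi l)%N) /\
  \forall w \ae P, forall k, (k < K)%N ->
    ncvgH (fun l => noise_modes (phi l) (fun j => Z j k w)) (noise k w).
Proof.
have small l : exists N0, forall N, (N0 <= N)%N -> forall k, (k < K)%N ->
    (\int[P]_w (normH (err N k w) ^+ 2)%:E <= (1 * 2^-1 ^+ l * 2^-1 ^+ l)%:E)%E.
  have e0 : 0 < 1 * 2^-1 ^+ l * 2^-1 ^+ l :> R by rewrite mul1r mulr_gt0 // exprn_gt0.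
  elim: K => [|K [N1 h1]]; first by exists 0%N.
  have [N2 h2] := err_small K e0; exists (maxn N1 N2) => N; rewrite geq_max => /andP[N1N N2N] k.
  by rewrite ltnS leq_eqVlt => /predU1P[->|]; [exact: h2|exact: h1].
have [phi0 hphi0] := choice small; pose phi l := maxn l (phi0 l).
have hphi l k : (k < K)%N -> (\int[P]_w (normH (err (phi l) k w) ^+ 2)%:E
    <= (1 * 2^-1 ^+ l * 2^-1 ^+ l)%:E)%E.
  by move=> kK; apply: hphi0 => //; exact: leq_maxr.
have lphi l : (l <= phi l)%N by exact: leq_maxl.
exists phi; split=> //; move: phi lphi hphi => phi lphi hphi.
have key k : (k < K)%N -> \forall w \ae P,
    ncvgH (fun l => noise_modes (phi l) (fun j => Z j k w)) (noise k w).
  move=> kK; have h01 : 0 <= (2^-1 : R) < 1 by rewrite invr_ge0 ler0n invf_lt1 // ltr1n.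
  have half0 : 0 < (2^-1 : R) by rewrite invr_gt0.
  apply: filterS (@ae_geometric_bound _ _ _ P (fun l w => normH (err (phi l) k w) ^+ 2) 1 (2^-1) (2^-1)
    (fun l => measurable_sqr_norm (measurable_err (phi l) k)) (fun l w => sqr_ge0 _) half0 h01
    (fun l => hphi l k kK)).
  move=> w [C hC].
  have err0 : (fun l => normH (err (phi l) k w)) @ \oo --> (0 : R).
    have sq0 : (fun l => normH (err (phi l) k w) ^+ 2) @ \oo --> (0 : R).
      apply: (cvg0_le (c := fun l => C * 2^-1 ^+ l)) => [l|]; first by rewrite sqr_ge0 hC.
      by rewrite -[0 in X in _ --> X](mulr0 C); apply: cvgM; [exact: cvg_cst|exact: cvg_expr0].
    have -> : (fun l => normH (err (phi l) k w)) = (fun l => Num.sqrt (normH (err (phi l) k w) ^+ 2)).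
      by apply/funext => l; rewrite sqrtr_sqr ger0_norm // normH_ge0.
    by rewrite -[0 in X in _ --> X]sqrtr0; apply: continuous_cvg => //; exact: sqrt_continuous.
  apply: (cvg0_le (c := fun l => normL2 (Num.sqrt dt *: (\sum_(i < phi l) clip (Z (inl (val i)) k w) *: S (q i))
     - dW1 k w) + normH (err (phi l) k w))) => [l|].
    rewrite normH_ge0 /= /noise_modes /noise opprD addrACA mode1_err mode2_err.
    by apply: le_trans (normHD _ _) _; rewrite normH_injH.
  rewrite -[0 in X in _ --> X](addr0 0); apply: cvgD => //.
  by move=> E /(dW1_series k w)[N _ h]; exists N => // l /= Nl; apply: h; exact: leq_trans Nl (lphi l).
elim: K key {small hphi hphi0} => [_|K IH key]; first exact: nearW.
have := IH (fun k kK => key k (ltnW kK)).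
apply: filterS2 (key K (ltnSn K)) => w h1 h2 k.
by rewrite ltnS leq_eqVlt => /predU1P[->|/h2].
Qed.

Lemma noise_modes_ext N z z' : (forall a : 'I_N + 'I_N, z (mode_index a) = z' (mode_index a)) ->
  noise_modes N z = noise_modes N z'.
Proof.
move=> zz; have h1 (i : 'I_N) : z (inl (val i)) = z' (inl (val i)) by exact: (zz (inl i)).
have h2 (i : 'I_N) : z (inr (val i)) = z' (inr (val i)) by exact: (zz (inr i)).
rewrite /noise_modes (eq_bigr (fun i : 'I_N => (Num.sqrt dt * clip (z' (inl (val i)))) *: injH 0 (S (q i)))).
  rewrite [X in _ + X = _](eq_bigr (fun i : 'I_N => (Num.sqrt (eta2 i) * z' (inr (val i))) *: injH 1 (q i))) // => i _.
  by rewrite h2.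
by move=> i _; rewrite h1.
Qed.

Lemma noise_modes_continuous N (z : nat -> nat + nat -> R) l :
  (forall j, z ^~ j @ \oo --> l j) -> ncvgH (fun i => noise_modes N (z i)) (noise_modes N l).
Proof.
move=> zl; apply: (ncvgD nHP).
  apply: (@ncvg_sum _ _ _ nHP N (fun n i => (Num.sqrt dt * clip (z n (inl i))) *: injH 0 (S (q i)))
    (fun i => (Num.sqrt dt * clip (l (inl i))) *: injH 0 (S (q i)))) => i.
  apply: (ncvg_scale nHP); apply: cvgM; first exact: cvg_cst.
  by apply: continuous_cvg; [exact: clip_continuous|exact: zl].
apply: (@ncvg_sum _ _ _ nHP N (fun n i => (Num.sqrt (eta2 i) * z n (inr i)) *: injH 1 (q i))
  (fun i => (Num.sqrt (eta2 i) * l (inr i)) *: injH 1 (q i))) => i.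
by apply: (ncvg_scale nHP); apply: cvgM; [exact: cvg_cst|exact: zl].
Qed.

Lemma noise_law_exchange n M (phi : (nat -> V) -> R) C :
  (forall f, `|phi f| <= C) ->
  (forall (f : nat -> nat -> V) g,
    (forall k, (k < n + M)%N -> ncvgH (f ^~ k) (g k)) -> phi \o f @ \oo --> phi g) ->
  measurable_fun [set: Omega] (fun w => phi (noise ^~ w) : mR) ->
  measurable_fun [set: Omega * Omega] (fun z => phi (splice n (noise ^~ z.1) (noise ^~ z.2)) : mR) ->
  (\int[P]_w phi (noise ^~ w) =
   \int[square_probability P]_z phi (splice n (noise ^~ z.1) (noise ^~ z.2)))%R.
Proof.
move=> phiC phi_cont m1 m2; have [sub [_ subP]] := noise_modes_cvg (n + M).
exact: (noise_exchange (erefl (n + M)%N) phiC phi_cont Ft_filtration X_BM X_indep dt0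
  noise_modes_ext noise_modes_continuous subP m1 m2).
Qed.

End noise.

(** * The stationary law as the limit of backward iteration *)

Section random_iteration.
Context {R : realType} {lo hi : R3 R} {d : measure_display} {Omega : measurableType d}.
Local Notation V := (HH lo hi).
Local Notation B := (borelH lo hi).
Local Notation mR := (measurableTypeR R).
Local Notation ncvgH := (ncvg (@normH R lo hi)).
Variables (P : probability Omega R) (D : nat -> V) (F : V -> V -> V) (Pr : V -> V).
Variables (r c M2 : R) (Gam : nat -> Omega -> V).
Hypothesis Ddense : forall x e, 0 < e -> exists k, normH (x - D k) < e.
Hypothesis r01 : 0 < r < 1.
Hypothesis c0 : 0 <= c.
Hypothesis F_contr : forall e x y, normH (F e x - F e y) <= r * normH (x - y).
Hypothesis F_cont : forall e' y, exists2 C, 0 <= C & forall e x,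
  normH (F e x - F e' y) <= r * normH (x - y) + C * normH (e - e').
Hypothesis F_growth : forall e x, normH (F e x) <= r * normH x + c * normH e.
Hypothesis F_Pr : forall e x, F e (Pr x) = F e x.
Hypothesis Pr_F : forall e x, Pr (F e x) = F e x.
Hypothesis Pr_Pr : forall x, Pr (Pr x) = Pr x.
Hypothesis Pr_contr : forall x y, normH (Pr x - Pr y) <= normH (x - y).
Hypothesis Pr0 : Pr 0 = 0.
Hypothesis mGam : forall k, measurable_fun [set: Omega] (Gam k : Omega -> B).
Hypothesis Gam_moment : forall k, (\int[P]_w (normH (Gam k w) ^+ 2)%:E <= M2%:E)%E.
Hypothesis Gam_exchange : forall (n M : nat) (phi : (nat -> V) -> R) (C : R),
  (forall f, `|phi f| <= C) ->
  (forall (f : nat -> nat -> V) g,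
    (forall k, (k < n + M)%N -> ncvgH (f ^~ k) (g k)) -> phi \o f @ \oo --> phi g) ->
  measurable_fun [set: Omega] (fun w => phi (Gam ^~ w) : mR) ->
  measurable_fun [set: Omega * Omega] (fun z => phi (splice n (Gam ^~ z.1) (Gam ^~ z.2)) : mR) ->
  (\int[P]_w phi (Gam ^~ w) = \int[square_probability P]_z phi (splice n (Gam ^~ z.1) (Gam ^~ z.2)))%R.
Local Notation PP := (square_probability P).

Let r0 : 0 <= r. Proof. by have /andP[/ltW] := r01. Qed.

Fixpoint forward (f : nat -> V) (n : nat) (x : V) : V :=
  if n is m.+1 then F (f m) (forward f m x) else Pr x.

Fixpoint backward (f : nat -> V) (n : nat) (x : V) : V :=
  if n is m.+1 then F (f 0%N) (backward (fun k => f k.+1) m x) else Pr x.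

(** One more backward step acts innermost, so consecutive iterates are images of two nearby points
    under the same n-fold contraction. *)
Lemma backward_rcons f n x : backward f n.+1 x = backward f n (F (f n) x).
Proof. by elim: n f => [|n IH] f /=; [rewrite F_Pr Pr_F|rewrite -IH]. Qed.

Lemma Pr_backward f n x : Pr (backward f n x) = backward f n x.
Proof. by case: n => [|n] /=; rewrite ?Pr_Pr ?Pr_F. Qed.

(** The latest forward noise is applied outermost and thus becomes entry 0 of a backward iteration;
    the other forward noises follow in reversed order, then those of f. *)
Lemma forward_backward f g n M x :
  forward g n (backward f M x) = backward (splice n f g) (n + M) x.
Proof.
elim: n => [|n IH] /=.
  rewrite Pr_backward; congr (backward _ M x).
  by apply/funext => k; rewrite /splice ltn0 subn0.
by rewrite IH /splice /= subSS subn0; congr F; congr (backward _ (n + M) x); apply/funext => k; rewrite ltnS subSS.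
Qed.

Lemma backward_contraction f n x y :
  normH (backward f n x - backward f n y) <= r ^+ n * normH (x - y).
Proof.
elim: n f => [|n IH] f /=; first by rewrite expr0 mul1r.
by apply: le_trans (F_contr _ _ _) _; rewrite exprS -mulrA ler_wpM2l.
Qed.

Lemma forward_contraction f n x y :
  normH (forward f n x - forward f n y) <= r ^+ n * normH (x - y).
Proof.
elim: n => [|n IH] /=; first by rewrite expr0 mul1r.
by apply: le_trans (F_contr _ _ _) _; rewrite exprS -mulrA ler_wpM2l.
Qed.

Let F_ncvg e x (e_ x_ : nat -> V) : ncvgH e_ e -> ncvgH x_ x ->
  ncvgH (fun k => F (e_ k) (x_ k)) (F e x).
Proof.
move=> ee xx; have [C C0 hC] := F_cont e x.
apply: (cvg0_le (c := fun k => r * normH (x_ k - x) + C * normH (e_ k - e))) => [k|].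
  by rewrite normH_ge0 hC.
exact: (cvg0D (cvg0Z r xx) (cvg0Z C ee)).
Qed.

Lemma backward_ncvg n x (f : nat -> nat -> V) g : (forall k, (k < n)%N -> ncvgH (f ^~ k) (g k)) ->
  ncvgH (fun i => backward (f i) n x) (backward g n x).
Proof.
elim: n f g => [|n IH] f g fg /=; first exact: (ncvg_cst (normHP lo hi)).
apply: F_ncvg; first exact: fg.
by apply: (IH (fun i k => f i k.+1)) => k kn; exact: fg.
Qed.

Section measurability.
Context {d' : measure_display} {T : measurableType d'}.

Lemma measurable_F (f g : T -> V) : measurable_fun [set: T] (f : T -> B) ->
  measurable_fun [set: T] (g : T -> B) -> measurable_fun [set: T] (fun t => F (f t) (g t) : B).
Proof.
have cst (x : V) : ncvgH (fun=> x) x by exact: (ncvg_cst (normHP lo hi)).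
move=> mf mg; apply: (measurable_caratheodory Ddense (Psi := fun t v => F (f t) v)) => [v|t h x hx|//].
  apply: (measurable_caratheodory Ddense (Psi := fun _ e => F e v)) => [e|t h x hx|//].
    exact: measurable_cst.
  exact: (F_ncvg hx (cst v)).
exact: (F_ncvg (cst (f t)) hx).
Qed.

Lemma measurable_Pr (f : T -> V) : measurable_fun [set: T] (f : T -> B) ->
  measurable_fun [set: T] (fun t => Pr (f t) : B).
Proof. by apply: (measurable_lipschitz_comp (L := 1)) => x y; rewrite mul1r. Qed.

Lemma measurable_backward (f : nat -> T -> V) n (g : T -> V) :
  (forall k, measurable_fun [set: T] (f k : T -> B)) -> measurable_fun [set: T] (g : T -> B) ->
  measurable_fun [set: T] (fun t => backward (f ^~ t) n (g t) : B).
Proof.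
move=> mf mg; elim: n f mf => [|n IH] f mf /=; first exact: measurable_Pr.
by apply: measurable_F => //; exact: (IH (fun k => f k.+1)).
Qed.

Lemma measurable_forward_comp (f : nat -> T -> V) n (g : T -> V) :
  (forall k, measurable_fun [set: T] (f k : T -> B)) -> measurable_fun [set: T] (g : T -> B) ->
  measurable_fun [set: T] (fun t => forward (f ^~ t) n (g t) : B).
Proof.
move=> mf mg; elim: n => [|n IH] /=; first exact: measurable_Pr.
exact: measurable_F.
Qed.

End measurability.

Lemma measurable_forward n :
  measurable_fun [set: Omega * B] (fun z => forward (Gam ^~ z.1) n z.2 : B).
Proof.
apply: (measurable_forward_comp (f := fun k (z : Omega * B) => Gam k z.1)) => [k|].
  exact: (measurableT_comp (mGam k) measurable_fst).
exact: measurable_snd.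
Qed.

Let X M w := backward (Gam ^~ w) M 0.

Let mX M : measurable_fun [set: Omega] (X M : Omega -> B).
Proof. by apply: measurable_backward => //; exact: measurable_cst. Qed.

Let mnorm2 d' (T : measurableType d') (f : T -> V) : measurable_fun [set: T] (f : T -> B) ->
  measurable_fun [set: T] (fun t => normH (f t) ^+ 2 : mR).
Proof.
move=> mf; apply: measurable_funX; apply: (measurableT_comp (f := @normH R lo hi : B -> mR) _ mf).
by apply: (@measurable_lipschitz _ _ _ 1) => x y; rewrite mul1r normH_dist.
Qed.

Let X_increment M w : normH (X M.+1 w - X M w) <= r ^+ M * (c * normH (Gam M w)).
Proof.
rewrite /X backward_rcons; apply: le_trans (backward_contraction _ _ _ _) _.
rewrite subr0 ler_wpM2l ?exprn_ge0 //.
by apply: le_trans (F_growth _ _) _; rewrite normH0 mulr0 add0r.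
Qed.

(** Contraction bounds the second moment of the M-th increment by c^2 M2 r^M r^M. One factor r^M
    ensures summability, the other leaves increments of size sqrt(r)^M, so the iterates are
    Cauchy. *)
Let X_ncvg : \forall w \ae P, exists x, ncvgH (X ^~ w) x.
Proof.
have [rgt r1] := andP r01.
have := @ae_geometric_bound _ _ _ P (fun M w => normH (X M.+1 w - X M w) ^+ 2) (c ^+ 2 * M2) r r.
have mincr k : measurable_fun [set: Omega] (fun w => X k.+1 w - X k w : B).
  rewrite (_ : (fun w => _) = fun w => X k.+1 w + (-1) *: X k w); last first.
    by apply/funext => w; rewrite scaleN1r.
  apply: (measurable_HHD Ddense); first exact: mX.
  apply: (measurable_lipschitz_comp (L := 1) (G := fun x => (-1) *: x)); last exact: mX.
  by move=> x y; rewrite mul1r -scalerBr normHZ normrN1 mul1r.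
have incr_moment k : (\int[P]_w (normH (X k.+1 w - X k w) ^+ 2)%:E
    <= (c ^+ 2 * M2 * r ^+ k * r ^+ k)%:E)%E.
  pose a := (r ^+ k * c) ^+ 2; have a0 : 0 <= a by rewrite sqr_ge0.
  apply: (@le_trans _ _ (\int[P]_w (a%:E * (normH (Gam k w) ^+ 2)%:E))%E).
    apply: ge0_le_integral => //.
    - by move=> w _; rewrite lee_fin sqr_ge0.
    - by apply/measurable_EFinP; exact: mnorm2.
    - by apply: measurable_funeM; apply/measurable_EFinP; exact: mnorm2.
    move=> w _; have rc0 : 0 <= r ^+ k * c * normH (Gam k w).
      by rewrite mulr_ge0 ?normH_ge0 // mulr_ge0 // exprn_ge0.
    rewrite -EFinM lee_fin /a -exprMn ler_pXn2r ?nnegrE ?normH_ge0 //.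
    by rewrite -mulrA; exact: X_increment.
  rewrite ge0_integralZl_EFin //; last 2 first.
  - by move=> w _; rewrite lee_fin sqr_ge0.
  - by apply/measurable_EFinP; exact: mnorm2.
  have -> : c ^+ 2 * M2 * r ^+ k * r ^+ k = a * M2 by rewrite /a; ring.
  rewrite (EFinM a M2); have ae0 : (0 <= a%:E :> \bar R)%E by rewrite lee_fin.
  exact: (lee_wpmul2l ae0 (Gam_moment k)).
have r01' : 0 <= r < 1 by rewrite r0.
move=> /(_ (fun k => mnorm2 (mincr k)) (fun k w => sqr_ge0 _) rgt r01' incr_moment).
apply: filterS => w [C hC]; apply: HH_complete.
have s01 : 0 <= Num.sqrt r < 1 by rewrite sqrtr_ge0 -sqrtr1 ltr_sqrt.
apply: (geometric_cauchy (normHP lo hi) (C := Num.sqrt C) s01) => k.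
have C0 : 0 <= C by have := hC 0%N; rewrite expr0 mulr1; apply: le_trans; exact: sqr_ge0.
rewrite -[leLHS]ger0_norm ?normH_ge0 // -sqrtr_sqr.
have -> : Num.sqrt C * Num.sqrt r ^+ k = Num.sqrt (C * r ^+ k).
  rewrite sqrtrM //; congr (_ * _); elim: k => [|k IH]; first by rewrite !expr0 sqrtr1.
  by rewrite !exprS sqrtrM // IH.
by apply: ler_wsqrtr; exact: hC.
Qed.

(* The indicator removes the null set where the backward iterates diverge, so that
   the limit is a measurable function on all of Omega. *)
Let Y : exists N, [/\ measurable N, P N = 0%E &
  exists Xoo : Omega -> V, forall w, ncvgH (fun M => \1_(~` N) w *: X M w) (Xoo w)].
Proof.
have [N [mN N0 hN]] := X_ncvg; exists N; split=> //.
suff /choice[Xoo h] w : exists x, ncvgH (fun M => \1_(~` N) w *: X M w) x by exists Xoo.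
have [Nw|Nw] := pselect (N w).
  have E : (fun M => \1_(~` N) w *: X M w) = (fun=> 0).
    by apply/funext => M; rewrite indicE memNset ?scale0r //; apply.
  by exists 0; rewrite E; exact: (ncvg_cst (normHP lo hi)).
have [x hx] : exists x, ncvgH (X ^~ w) x by apply: contrapT => h; exact/Nw/hN.
have E : (fun M => \1_(~` N) w *: X M w) = X ^~ w.
  by apply/funext => M; rewrite indicE mem_set // scale1r.
by exists x; rewrite E.
Qed.

(** The bound is the fixed point of m = r m + c^2 M2 / (1 - r), the recursion obtained from the
    growth estimate by convexity. The noise f is arbitrary because the induction passes to the
    shifted sequence. *)
Let moment_recursion (f : nat -> Omega -> V) n : (forall k, measurable_fun [set: Omega] (f k : Omega -> B)) ->
  (forall k, (\int[P]_w (normH (f k w) ^+ 2)%:E <= M2%:E)%E) ->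
  (\int[P]_w (normH (backward (f ^~ w) n 0) ^+ 2)%:E <= (c ^+ 2 * M2 / (1 - r) ^+ 2)%:E)%E.
Proof.
have [rgt r1] := andP r01; have r1' : 0 < 1 - r by rewrite subr_gt0.
have M20 : 0 <= M2.
  by rewrite -lee_fin; apply: le_trans (Gam_moment 0%N); apply: integral_ge0 => w _; rewrite lee_fin sqr_ge0.
elim: n f => [|n IH] f mf fM /=.
  rewrite Pr0 normH0 expr0n /= integral_cst1 lee_fin.
  by rewrite divr_ge0 ?sqr_ge0 // mulr_ge0 ?sqr_ge0.
pose b w := backward (fun k => f k.+1 w) n 0.
have mb : measurable_fun [set: Omega] (b : Omega -> B).
  by apply: (measurable_backward (f := fun k => f k.+1)) => //; exact: measurable_cst.
have {}IH : (\int[P]_w (normH (b w) ^+ 2)%:E <= (c ^+ 2 * M2 / (1 - r) ^+ 2)%:E)%E.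
  exact: (IH (fun k => f k.+1) (fun k => mf k.+1) (fun k => fM k.+1)).
pose a := c ^+ 2 / (1 - r); have a0 : 0 <= a by rewrite divr_ge0 ?sqr_ge0 // ltW.
have mE (g : Omega -> V) s : measurable_fun [set: Omega] (g : Omega -> B) ->
    measurable_fun [set: Omega] (fun w => s%:E * (normH (g w) ^+ 2)%:E)%E.
  by move=> mg; apply: measurable_funeM; apply/measurable_EFinP; exact: mnorm2.
have pE (g : Omega -> V) s w : 0 <= s -> (0 <= s%:E * (normH (g w) ^+ 2)%:E)%E.
  by move=> s0; rewrite -EFinM lee_fin mulr_ge0 // sqr_ge0.
apply: (@le_trans _ _ (\int[P]_w (r%:E * (normH (b w) ^+ 2)%:E + a%:E * (normH (f 0%N w) ^+ 2)%:E))%E).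
  apply: ge0_le_integral => //.
  - by move=> w _; rewrite lee_fin sqr_ge0.
  - apply/measurable_EFinP; apply: (mnorm2 (f := fun w => F (f 0%N w) (b w))).
    exact: measurable_F.
  - by apply: emeasurable_funD; exact: mE.
  move=> w _; rewrite -!EFinM -EFinD lee_fin.
  exact: (convex_sqr_bound r01 (normH_ge0 _) (normH_ge0 _) c0 (normH_ge0 _) (F_growth _ _)).
rewrite ge0_integralD //; last 4 first.
- by move=> w _; exact: pE.
- exact: mE.
- by move=> w _; exact: pE.
- exact: mE.
rewrite !ge0_integralZl_EFin //; last 4 first.
- by move=> w _; rewrite lee_fin sqr_ge0.
- by apply/measurable_EFinP; exact: mnorm2.
- by move=> w _; rewrite lee_fin sqr_ge0.
- by apply/measurable_EFinP; exact: mnorm2.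
have -> : c ^+ 2 * M2 / (1 - r) ^+ 2 = r * (c ^+ 2 * M2 / (1 - r) ^+ 2) + a * M2.
  by rewrite /a; field; rewrite gt_eqF.
rewrite EFinD (EFinM r) (EFinM a).
have re0 : (0 <= r%:E :> \bar R)%E by rewrite lee_fin.
have ae0 : (0 <= a%:E :> \bar R)%E by rewrite lee_fin.
exact: (leeD (lee_wpmul2l re0 IH) (lee_wpmul2l ae0 (fM 0%N))).
Qed.

(** The law of the backward limit. Applying n forward steps with fresh noise to the M-th backward
    iterate gives a variable with the law of the iterate n + M; letting M grow on both sides yields
    stationarity. *)
Lemma stationary_exists : exists2 pi : probability B R, finite_second_moment pi &
  forall n L (psi : B -> R), (forall x, 0 <= psi x <= 1) -> lipschitz_norm L psi ->
    (\int[pi]_x \int[P]_w (psi (forward (Gam ^~ w) n x))%:E = \int[pi]_x (psi x)%:E)%E.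
Proof.
have [N [mN N0 [Xoo hX]]] := Y.
have mYM M : measurable_fun [set: Omega] (fun w => \1_(~` N) w *: X M w : B).
  apply: (measurable_caratheodory Ddense (Psi := fun w v => \1_(~` N) w *: v)) => [v|w h x hx|].
  - by apply: measurable_HHZ; apply/measurable_indicP; exact: measurableC.
  - exact: (ncvgZ (normHP lo hi)).
  - exact: mX.
have mXoo : measurable_fun [set: Omega] (Xoo : Omega -> B).
  exact: (measurable_ncvg mYM hX).
have Xcvg : \forall w \ae P, ncvgH (X ^~ w) (Xoo w).
  exists N; split=> // w /= h; apply: contrapT => Nw; apply: h.
  have E : (fun M => \1_(~` N) w *: X M w) = X ^~ w.
    by apply/funext => M; rewrite indicE mem_set // scale1r.
  by have := hX w; rewrite E.
have pi1 : push P mXoo setT = 1%E by rewrite pushE preimage_setT; exact: probability_setT.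
exists (to_probability pi1) => [|n L psi psi01 psiL].
  rewrite /finite_second_moment.
  have -> : (\int[to_probability pi1]_x (normH x ^+ 2)%:E = \int[P]_w (normH (Xoo w) ^+ 2)%:E)%E.
    apply: (ge0_integral_push P mXoo (g := fun x => (normH x ^+ 2)%:E)) => [|x].
      by apply/measurable_EFinP; exact: (@mnorm2 _ B (fun x : B => x) (@measurable_id _ B setT)).
    by rewrite lee_fin sqr_ge0.
  apply: le_lt_trans (ltry (c ^+ 2 * M2 / (1 - r) ^+ 2)).
  apply: (fatou_le (g_ := fun M w => normH (\1_(~` N) w *: X M w) ^+ 2)).
  - by move=> M; exact: mnorm2.
  - by move=> M w; exact: sqr_ge0.
  - move=> w; have nX := ncvg_nrm (normHP lo hi) (hX w).
    by under eq_fun do rewrite expr2; rewrite expr2; exact: cvgM.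
  apply: nearW => M; apply: le_trans (moment_recursion M mGam Gam_moment).
  apply: ge0_le_integral => //.
  - by move=> w _; rewrite lee_fin sqr_ge0.
  - by apply/measurable_EFinP; exact: mnorm2.
  - by apply/measurable_EFinP; exact: (mnorm2 (mX M)).
  move=> w _; rewrite lee_fin ler_pXn2r ?nnegrE ?normH_ge0 // normHZ ler_piMl ?normH_ge0 //.
  by rewrite indicE; case: (_ \in _); rewrite ?normr1 ?normr0.
have mpsi := measurable_lipschitz psiL.
have psi1 x : `|psi x| <= 1 by rewrite ger0_norm; have /andP[] := psi01 x.
have mF2 : measurable_fun [set: Omega * Omega] (fun z => forward (Gam ^~ z.2) n (Xoo z.1) : B).
  apply: (measurable_forward_comp (f := fun k z => Gam k z.2)) => [k|].
    exact: (measurableT_comp (mGam k) measurable_snd).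
  exact: (measurableT_comp mXoo measurable_fst).
have mFM M : measurable_fun [set: Omega * Omega] (fun z => forward (Gam ^~ z.2) n (X M z.1) : B).
  apply: (measurable_forward_comp (f := fun k z => Gam k z.2)) => [k|].
    exact: (measurableT_comp (mGam k) measurable_snd).
  exact: (measurableT_comp (mX M) measurable_fst).
(* Tonelli's theorem rewrites the left side on pairs of samples: the first carries the stationary
   start, the second the fresh noise. *)
transitivity (\int[PP]_z psi (forward (Gam ^~ z.2) n (Xoo z.1)))%R%:E.
  rewrite EFin_Rintegral; last by apply: (bounded_integrable _ (C := 1)) => [|z]; [exact: (measurableT_comp mpsi mF2)|exact: psi1].
  transitivity (\int[P]_w \int[P]_w' (psi (forward (Gam ^~ w') n (Xoo w)))%:E)%E; last first.
    symmetry; apply: (@fubini_tonelli1 _ _ _ _ _ P P (fun z => (psi (forward (Gam ^~ z.2) n (Xoo z.1)))%:E)) => [|z].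
      by apply/measurable_EFinP; exact: (measurableT_comp mpsi mF2).
    by rewrite lee_fin; have /andP[] := psi01 (forward (Gam ^~ z.2) n (Xoo z.1)).
  apply: (ge0_integral_push P mXoo (g := fun x => \int[P]_w' (psi (forward (Gam ^~ w') n x))%:E)%E) => [|x].
    have mz : measurable_fun [set: B * Omega] (fun z => (psi (forward (Gam ^~ z.2) n z.1))%:E).
      apply/measurable_EFinP; apply: (measurableT_comp mpsi).
      apply: (measurable_forward_comp (f := fun k (z : B * Omega) => Gam k z.2)) => [k|].
        exact: (measurableT_comp (mGam k) measurable_snd).
      exact: measurable_fst.
    apply: (measurable_fun_fubini_tonelli_F _ mz) => z.
    by rewrite lee_fin; have /andP[] := psi01 (forward (Gam ^~ z.2) n z.1).
  by apply: integral_ge0 => w _; rewrite lee_fin; have /andP[] := psi01 (forward (Gam ^~ w) n x).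
transitivity (\int[P]_w psi (Xoo w))%R%:E; last first.
  rewrite EFin_Rintegral; last by apply: (bounded_integrable _ (C := 1)) => [|z]; [exact: (measurableT_comp mpsi mXoo)|exact: psi1].
  symmetry; apply: (ge0_integral_push P mXoo (g := fun x => (psi x)%:E)) => [|x].
    exact/measurable_EFinP.
  by rewrite lee_fin; have /andP[] := psi01 x.
congr EFin.
(* The two limits in M; for each finite M the integrals coincide by the exchange property. *)
have c1 : (fun M => \int[PP]_z psi (forward (Gam ^~ z.2) n (X M z.1)))%R @ \oo
    --> (\int[PP]_z psi (forward (Gam ^~ z.2) n (Xoo z.1)))%R.
  apply: (dominated_cvg_Rintegral (g := fun=> 1)).
  - by move=> M; exact: (measurableT_comp mpsi (mFM M)).
  - exact: (measurableT_comp mpsi mF2).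
  - apply: filterS (ae_fst Xcvg) => z hz; apply: (lipschitz_seq_continuous psiL).
    apply: (cvg0_le (c := fun M => r ^+ n * normH (X M z.1 - Xoo z.1))) => [M|].
      by rewrite normH_ge0 forward_contraction.
    by rewrite -[0 in X in _ --> X](mulr0 (r ^+ n)); apply: cvgM => //; exact: cvg_cst.
  - exact: finite_measure_integrable_cst.
  - by move=> M z; exact: psi1.
have c2 : (fun M => \int[P]_w psi (X (n + M)%N w))%R @ \oo --> (\int[P]_w psi (Xoo w))%R.
  apply: (dominated_cvg_Rintegral (g := fun=> 1)).
  - by move=> M; exact: (measurableT_comp mpsi (mX (n + M))).
  - exact: (measurableT_comp mpsi mXoo).
  - apply: filterS Xcvg => w hw; apply: (lipschitz_seq_continuous psiL (f := fun M => X (n + M)%N w)).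
    exact: (cvg0_sub (fun M => leq_addl n M) hw).
  - exact: finite_measure_integrable_cst.
  - by move=> M z; exact: psi1.
suff E : (fun M => \int[PP]_z psi (forward (Gam ^~ z.2) n (X M z.1)))%R =
    (fun M => \int[P]_w psi (X (n + M)%N w))%R.
  by rewrite E in c1; exact: (cvg_unique _ c1 c2).
apply/funext => M; symmetry.
have fbE z : psi (forward (Gam ^~ z.2) n (X M z.1)) =
    psi (backward (splice n (Gam ^~ z.1) (Gam ^~ z.2)) (n + M) 0) by rewrite /X forward_backward.
under [RHS]eq_Rintegral do rewrite fbE.
apply: (@Gam_exchange n M (fun f => psi (backward f (n + M) 0)) 1) => [f|f g fg||].
- exact: psi1.
- by apply: (lipschitz_seq_continuous psiL); exact: backward_ncvg.
- exact: (measurableT_comp mpsi (mX (n + M))).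
rewrite (_ : (fun z => _) = fun z => psi (forward (Gam ^~ z.2) n (X M z.1))); last by apply/funext => z; rewrite fbE.
exact: (measurableT_comp mpsi (mFM M)).
Qed.

End random_iteration.

(** * Trace-class covariances and separability *)

Section eigenvalue_sums.
Context {R : realType} {lo hi : R3 R}.
Local Notation L2D := (L2 (muD lo hi)).
Local Notation HH := (HH lo hi).

(** The multi-index 0 contributes exactly [ipL2 f f], and all other contributions are
    nonnegative. *)
Lemma ipL2_le_sobolev_sq (s : R) (f : L2D) : ((ipL2 f f)%:E <= sobolev_sq s f)%E.
Proof.
apply: le_ereal_inf_tmp => _ [df [df0 _ ->]].
have ip0 (g : L2D) : (0 <= (ipL2 g g)%:E)%E by rewrite lee_fin (ip_ge0 (ipL2P _)).
apply: (@le_trans _ _ (\sum_(a : {ffun 'I_3 -> 'I_(Num.truncn s).+1} | (\sum_i a i <= Num.truncn s)%N)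
  (ipL2 (df a) (df a))%:E)%E).
  rewrite (bigD1 [ffun=> ord0]) /=; last by rewrite big1 // => i _; rewrite ffunE.
  by rewrite df0 leeDl // sume_ge0.
rewrite leeDl //; case: ifP => // _; apply: sume_ge0 => a _.
apply: integral_ge0 => x _; apply: integral_ge0 => y _.
by rewrite lee_fin divr_ge0 ?sqr_ge0 ?powR_ge0.
Qed.

Variables (q : nat -> L2D) (eta : nat -> R) (Q S : L2D -> L2D).
Hypothesis q_orth : forall i j, ipL2 (q i) (q j) = (i == j)%:R.
Hypothesis Q_eigen : forall k, Q (q k) = eta k *: q k.
Hypothesis S_sqrt : nonneg_sqrt Q S.

Lemma sqrt_orthogonal i j : ipL2 (S (q i)) (S (q j)) = (i == j)%:R * eta i.
Proof.
have ipP := ipL2P (muD lo hi); have [_ sym _ SS] := S_sqrt.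
rewrite sym SS Q_eigen (ipZr ipP) q_orth mulrC.
by case: eqVneq => [->//|_]; rewrite !mul0r.
Qed.

(** The eigenvalue [eta i] is the squared L^2 norm of [S (q i)], so the Hilbert-Schmidt series
    dominates the trace. *)
Lemma eigenvalue_sum (V : set L2D) (gamma : R) : hilbert_schmidt q V (sobolev_sq gamma) S ->
  exists C, forall N, \sum_(i < N) eta i <= C.
Proof.
move=> [_ _ _ hs]; exists (fine (\sum_(0 <= k <oo) sobolev_sq gamma (S (q k)))%E) => N.
have nsq0 k : (0 <= sobolev_sq gamma (S (q k)))%E.
  by apply: le_trans (ipL2_le_sobolev_sq _ _); rewrite lee_fin (ip_ge0 (ipL2P _)).
rewrite -lee_fin fineK; last by rewrite ge0_fin_numE // nneseries_ge0.
apply: (@le_trans _ _ (\sum_(0 <= k < N) sobolev_sq gamma (S (q k)))%E); last exact: nneseries_lim_ge.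
rewrite big_mkord -sumEFin; apply: lee_sum => i _.
by apply: le_trans (ipL2_le_sobolev_sq _ _); rewrite sqrt_orthogonal eqxx mul1r.
Qed.

End eigenvalue_sums.

Section separability.
Context {R : realType} {lo hi : R3 R}.
Local Notation L2D := (L2 (muD lo hi)).
Local Notation HH := (HH lo hi).
Variable q : nat -> L2D.
Hypothesis q_basis : orthonormal_basis q.

Let nP := normL2P (muD lo hi).

(** Finite rational combinations of the basis, coded by a countable type. *)
Let comb (s : seq rat) : L2D := \sum_(k < size s) ratr (nth 0 s k) *: q k.

Let comb_dense (f : L2D) e : 0 < e -> exists s, normL2 (f - comb s) <= e.
Proof.
move=> e0; have [q_orth q_dense] := q_basis; have e2 : 0 < e / 2 by rewrite divr_gt0.
have [N hN] := cvg0_ex (q_dense f) e2.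
(* The tolerance per coefficient; N + 1 in the denominator keeps it well defined when N = 0. *)
have eN : 0 < e / 2 / N.+1%:R by rewrite divr_gt0.
have /choice[c hc] k : exists c : rat, `|ipL2 f (q k) - ratr c| < e / 2 / N.+1%:R.
  have lt : ipL2 f (q k) - e / 2 / N.+1%:R < ipL2 f (q k) + e / 2 / N.+1%:R.
    by rewrite ltrBlDr -addrA ltrDl addr_gt0.
  have [c] := rat_in_itvoo lt.
  by rewrite in_itv /= => /andP[h1 h2]; exists c; rewrite distrC ltr_distl h1 h2.
exists (mkseq c N); apply: le_trans (semi_triangle nP (\sum_(k < N) ipL2 f (q k) *: q k) _ _) _.
rewrite [leRHS]splitr; apply: lerD; first by rewrite (semiBC nP); apply: ltW; exact: hN.
rewrite /comb size_mkseq -sumrB; apply: le_trans (semi_sum nP _ _ _) _.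
apply: (@le_trans _ _ (\sum_(k < N) e / 2 / N.+1%:R)).
  apply: ler_sum => k _; rewrite nth_mkseq // -scalerBl (semiZ nP).
  by rewrite /normL2 q_orth eqxx sqrtr1 mulr1 ltW.
rewrite sumr_const card_ord -[leLHS]mulr_natr -mulrA; apply: ler_piMr; first exact: ltW.
by rewrite mulrC ler_pdivrMr // mul1r ler_nat.
Qed.

Lemma HH_separable : exists D : nat -> HH, forall x e, 0 < e -> exists k, normH (x - D k) < e.
Proof.
pose T : Type := ({ffun 'I_3 -> seq rat} * {ffun 'I_3 -> seq rat})%type.
pose dec (t : T) : HH := ([ffun i => comb (t.1 i)], [ffun i => comb (t.2 i)]).
exists (fun n => if unpickle n is Some t then dec t else 0) => x e e0.
have e7 : 0 < e / 7 by rewrite divr_gt0.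
have /choice[s1 h1] i := comb_dense (x.1 i) e7.
have /choice[s2 h2] i := comb_dense (x.2 i) e7.
exists (pickle (([ffun i => s1 i], [ffun i => s2 i]) : T)); rewrite pickleK.
apply: le_lt_trans (normH_le_sum _) _.
apply: (@le_lt_trans _ _ (\sum_(i < 3) e / 7 + \sum_(i < 3) e / 7)).
  by apply: lerD; apply: ler_sum => i _; rewrite ?HH1B ?HH2B !ffunE.
exact: six_sevenths.
Qed.

Lemma HH_nonzero : exists v : HH, 0 < normH v.
Proof.
have [q_orth _] := q_basis; exists (injH 0 (q 0%N)).
by rewrite normH_injH /normL2 q_orth eqxx sqrtr1.
Qed.

End separability.

(** * The scheme as an iteration of random contractions *)

Section scheme_iteration.
Context {R : realType} {lo hi : R3 R} (Th : simplicial_mesh lo hi) (ori : rel (elt Th)).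
Variables (sigma0 lam1 dt : R) (lam2 : R3 R).
Hypotheses (oriP : orientation ori) (dt0 : 0 < dt).
Local Notation V := (HH lo hi).
Local Notation L2D := (L2 (muD lo hi)).
Local Notation emb := (@embH R lo hi Th).
Local Notation pih := (@pih R lo hi Th).
Local Notation r := (expR (- sigma0 * dt)).
Local Notation S := (scheme_map ori sigma0 lam1 dt lam2).

(** Component 0 of the noise vector is the multiplicative increment, component 1 the additive one,
    as stored by [injH]. *)
Definition scheme_step (e x : V) : V := S (e.1 0) (e.1 1) x.

Definition mesh_projection (x : V) : V := emb (pih x).

Lemma scheme_step_contraction e x y :
  normH (scheme_step e x - scheme_step e y) <= r * normH (x - y).
Proof. exact: scheme_map_contraction. Qed.

Lemma scheme_step_continuous e' y : exists2 C, 0 <= C & forall e x,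
  normH (scheme_step e x - scheme_step e' y) <= r * normH (x - y) + C * normH (e - e').
Proof.
have [C C0 hC] := scheme_map_continuous sigma0 lam1 lam2 oriP dt0 (e'.1 0) (e'.1 1) y.
exists (C + tilde_bound lam2) => [|e x]; first by rewrite addr_ge0 // tilde_bound_ge0.
apply: le_trans (hC _ _ _) _; rewrite -addrA lerD2l [leRHS]mulrDl.
have [h1 _] := normL2_le_normH (e - e') 0; have [h2 _] := normL2_le_normH (e - e') 1.
rewrite HH1B in h1; rewrite HH1B in h2.
by apply: lerD; apply: ler_wpM2l => //; exact: tilde_bound_ge0.
Qed.

Lemma scheme_step_growth e x : normH (scheme_step e x) <= r * normH x + tilde_bound lam2 * normH e.
Proof.
apply: le_trans (scheme_map_growth _ _ _ oriP dt0 _ _ _) _; rewrite lerD2l.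
by apply: ler_wpM2l; [exact: tilde_bound_ge0|exact: (normL2_le_normH e 1).1].
Qed.

Lemma scheme_step_projection e x : scheme_step e (mesh_projection x) = scheme_step e x.
Proof. exact: scheme_map_pih. Qed.

Lemma projection_scheme_step e x : mesh_projection (scheme_step e x) = scheme_step e x.
Proof. by rewrite /mesh_projection /scheme_step /scheme_map pih_embH. Qed.

Lemma mesh_projectionK x : mesh_projection (mesh_projection x) = mesh_projection x.
Proof. by rewrite /mesh_projection pih_embH. Qed.

Lemma mesh_projection_contraction x y :
  normH (mesh_projection x - mesh_projection y) <= normH (x - y).
Proof. by rewrite /mesh_projection -embHB -pihB; exact: normH_pih. Qed.

Lemma mesh_projection0 : mesh_projection 0 = 0.
Proof.
apply: normH_eq0; apply/eqP; rewrite eq_le normH_ge0 andbT -(normH0 lo hi).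
exact: normH_pih.
Qed.

Lemma injH01 (a g : L2D) : (injH 0 a + injH 1 g).1 0 = a /\ (injH 0 a + injH 1 g).1 1 = g.
Proof. by rewrite !HH1D !ffunE /= addr0 add0r. Qed.

Lemma dG_solution_forward d (Omega : measurableType d) (dW1 dW2 : nat -> Omega -> L2D) n w x :
  emb (dG_solution ori sigma0 lam1 lam2 dt dW1 dW2 (fun=> x) n w) =
  forward scheme_step mesh_projection (fun k => injH 0 (dW1 k w) + injH 1 (dW2 k w)) n x.
Proof.
elim: n => [|n IH]; first exact: dG_solution0.
apply: etrans (dG_solutionS sigma0 lam1 lam2 oriP dt0 dW1 dW2 x n w) _.
have [a1 a2] := injH01 (dW1 n w) (dW2 n w).
rewrite IH; set y := forward _ _ _ _ _.
change (S (dW1 n w) (dW2 n w) y = scheme_step (injH 0 (dW1 n w) + injH 1 (dW2 n w)) y).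
exact: (congr2 (fun a g => S a g y) (esym a1) (esym a2)).
Qed.

End scheme_iteration.

Theorem theorem4p3 (R : realType)
  (d : measure_display) (Omega : measurableType d) (P : probability Omega R)
  (Ft : R -> set (set Omega))
  (lo hi : R3 R)
  (sigma0 lam1 : R) (lam2 : R3 R) (gamma1 gamma2 b r1 r2 : R)
  (q : nat -> L2 (muD lo hi)) (eta1 eta2 : nat -> R)
  (Q1 Q2 Q1h Q2h : L2 (muD lo hi) -> L2 (muD lo hi))
  (beta1 beta2 : nat -> R -> Omega -> R)
  (W1 W2 : R -> Omega -> L2 (muD lo hi))
  (u0 : Omega -> HH lo hi)
  (lo_lt_hi : forall i, coord3 lo i < coord3 hi i)
  (sigma0_gt0 : 0 < sigma0)
  (gamma1_ge1 : 1 <= gamma1) (gamma2_ge1 : 1 <= gamma2)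
  (b_ge4 : 4 <= b)
  (r1_gt0 : 0 < r1) (r2_gt0 : 0 < r2)
  (Ft_filtration : filtration Ft)
  (q_basis : orthonormal_basis q)
  (Q1_eigen : forall k, 0 <= eta1 k /\ Q1 (q k) = eta1 k *: q k)
  (Q2_eigen : forall k, 0 <= eta2 k /\ Q2 (q k) = eta2 k *: q k)
  (Q1h_sqrt : nonneg_sqrt Q1 Q1h) (Q2h_sqrt : nonneg_sqrt Q2 Q2h)
  (Q1h_HS : hilbert_schmidt q
     (sobolev gamma1) (sobolev_sq gamma1) Q1h)
  (Q2h_HS : hilbert_schmidt q
     (sobolev0 gamma2) (sobolev_sq gamma2) Q2h)
  (beta1_BM : forall k, brownian_motion P Ft (beta1 k))
  (beta2_BM : forall k, brownian_motion P Ft (beta2 k))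
  (beta_indep : independent_processes P (noise_family beta1 beta2))
  (W1_wiener : Q_wiener P eta1 q beta1 W1)
  (W2_wiener : Q_wiener P eta2 q beta2 W2)
  (u0_measurable : measurable_fun setT (u0 : Omega -> borelH lo hi))
  (u0_L2 : (\int[P]_w (normH (u0 w) ^+ 2)%:E < +oo)%E) :
  exists2 dt0 : R, 0 < dt0 &
  forall (Th : simplicial_mesh lo hi) (ori : rel (elt Th)) (dt : R),
    regular_mesh r1 r2 Th -> orientation ori -> 0 < dt < dt0 ->
    let Ph := transition ori sigma0 lam1 lam2 dt
                (truncated_increment b dt q Q1h beta1) (increment dt W2) P in
    exists pi : probability (borelH lo hi) R,
      [/\
          [/\ finite_second_moment pi,
              invariant_measure Ph pi,
              (forall nu : probability (borelH lo hi) R,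
                 invariant_measure Ph nu ->
                 forall A, measurable A -> nu A = pi A),
              ergodic_measure Ph pi
            & exponentially_mixing Ph dt pi]
        &
          forall mu : probability (borelH lo hi) R, finite_second_moment mu ->
            forall n : nat,
              (wasserstein2 (transpose Ph n mu) pi <=
               (expR (- sigma0 * (n%:R * dt)))%:E * wasserstein2 mu pi)%E].
Proof.
(* The estimates below hold for every dt > 0, so any positive bound serves. *)
exists 1 => // Th ori dt _ oriP /andP[dt0 _] Ph.
have [q_orth _] := q_basis; have [D Ddense] := HH_separable q_basis.
have [v v0] := HH_nonzero q_basis.
have [C1 hC1] := eigenvalue_sum q_orth (fun k => (Q1_eigen k).2) Q1h_sqrt Q1h_HS.
have [C2 hC2] := eigenvalue_sum q_orth (fun k => (Q2_eigen k).2) Q2h_sqrt Q2h_HS.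
have S_orth := sqrt_orthogonal q_orth (fun k => (Q1_eigen k).2) Q1h_sqrt.
have e1 k := (Q1_eigen k).1; have e2 k := (Q2_eigen k).1.
have X_BM j : brownian_motion P Ft (noise_family beta1 beta2 j) by case: j.
pose Gam := noise dt b q Q1h beta1 W2.
have mGam : forall k, measurable_fun setT (Gam k : Omega -> borelH lo hi) :=
  measurable_noise b Ddense dt0 S_orth e1 hC1 Ft_filtration X_BM W2_wiener.
have [M2 GamM] := noise_second_moment b Ddense dt0 q_orth S_orth e1 e2 hC1 hC2 Ft_filtration X_BM W2_wiener.
pose r := expR (- sigma0 * dt).
(* Positivity of [sigma0] makes the contraction strict; the same number is the mixing rate below. *)
have r01 : 0 < r < 1 by rewrite expR_gt0 expR_lt1 mulNr oppr_lt0 mulr_gt0.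
pose F := scheme_step ori sigma0 lam1 dt lam2; pose Pr := @mesh_projection R lo hi Th.
have Fcontr : forall e x y, normH (F e x - F e y) <= r * normH (x - y) :=
  scheme_step_contraction sigma0 lam1 lam2 oriP dt0.
have Fcont := scheme_step_continuous sigma0 lam1 lam2 oriP dt0.
have Prcontr : forall x y, normH (Pr x - Pr y) <= normH (x - y) := @mesh_projection_contraction R lo hi Th.
have [pi pi2 pi_stat] := stationary_exists Ddense r01 (tilde_bound_ge0 lam2) Fcontr Fcont
  (scheme_step_growth sigma0 lam1 lam2 oriP dt0) (scheme_step_projection ori sigma0 lam1 dt lam2)
  (projection_scheme_step ori sigma0 lam1 dt lam2) (@mesh_projectionK R lo hi Th) Prcontr
  (mesh_projection0 Th) mGam GamM
  (fun n M phi C h1 h2 h3 h4 => noise_law_exchange Ddense dt0 S_orth e1 hC1 Ft_filtration X_BM beta_indep W2_wiener h1 h2 h3 h4).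
pose Phi n w x := forward F Pr (Gam ^~ w) n x.
have mPhi n : measurable_fun [set: Omega * borelH lo hi] (fun z => Phi n z.1 z.2 : borelH lo hi).
  exact: (measurable_forward Ddense Fcont Prcontr mGam).
have Phi_contr n w x y : normH (Phi n w x - Phi n w y) <= r ^+ n * normH (x - y).
  exact: (forward_contraction r01 Fcontr Prcontr).
(* The transition functions are rewritten through the iterated maps, to which the abstract results
   apply. For n = 0 the map is the mesh projection, not the identity. *)
have -> : Ph = fun n phi x => (\int[P]_w phi (Phi n w x))%R.
  apply/funext => n; apply/funext => phi; apply/funext => x.
  by apply: eq_Rintegral => w _; rewrite dG_solution_forward.
exists pi; split.
  split=> //.
  - exact: (invariant_stationary mPhi pi_stat).
  - by move=> nu; exact: (invariant_unique r01 mPhi Phi_contr pi_stat).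
  - exact: (stationary_ergodic r01 mPhi Phi_contr pi_stat).
  - exact: (stationary_mixing r01 mPhi Phi_contr pi_stat sigma0_gt0 (erefl r) v0 pi2).
move=> mu _ n; have -> : expR (- sigma0 * (n%:R * dt)) = r ^+ n.
  by rewrite /r -expRM_natl mulrCA.
exact: (wasserstein_contraction Ddense r01 mPhi Phi_contr pi_stat).
Qed.
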